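(* Let $d\ge1$, $\mathbf k\in\mathbb N^d$, $R>0$, and let $M$ be a wide-sense stationary $L^2$ random measure on $\mathbb R^d$ with spectral density $s$. Assume that either (a) $s$ is isotropic (that is, $s(u)$ depends only on $\|u\|$) and $A=B(0,R)$; or (b) $s$ is separable (that is, $s(u)=s_1(u_1)\cdots s_d(u_d)$, $u\in\mathbb R^d$, for some even functions $s_i:\mathbb R\to\mathbb R_+$) and $A=[-R,R]^d$. Assume that $M$ is not linearly maximally rigid on $A$, and that it is not true that $\int_{B(0,\varepsilon)}u^{2\mathbf k}s(u)^{-1}\,du=\infty$ for all $\varepsilon>0$. Then for every $\eta>0$, $M$ is not linearly $\mathbf k$-rigid on $A^{+\eta}=\bigcup_{t\in A}B(t,\eta)$.
   Context: $\mathbb N=\{0,1,2,\dots\}$; for $\mathbf k\in\mathbb N^d$, $t^{\mathbf k}=\prod_{i}t_i^{k_i}$. $\mathcal C_c^b(\mathbb R^d)$ is the space of bounded measurable compactly supported functions on $\mathbb R^d$, $\mathcal C_c^b(A^c)$ the subspace of those vanishing on $A$, and $\hat f(u)=\int e^{-i\langle u,x\rangle}f(x)\,dx$. Wide-sense stationary (WSS) $L^2$ random (signed) measure $M$: a linear family of real $L^2$ random variables $I_M(f)$, $f\in\mathcal C_c^b(\mathbb R^d)$ real (extended linearly to complex $f$), such that $\mathrm{Var}(I_M(f))$ is invariant under translations of $f$ and $\mathrm{Var}(I_M(f))=(2\pi)^{-d}\int|\hat f|^2\,d\mathsf S$ for a non-negative symmetric measure $\mathsf S$ on $\mathbb R^d$,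 the spectral measure. The spectral density $s$ is the density (with respect to Lebesgue measure) of the absolutely continuous part of $\mathsf S$. Convention: $1/0=\infty$. Linear rigidity: for $\gamma$ bounded measurable with bounded support, $M$ is linearly $\gamma$-rigid on a bounded set $A$ if $\inf_{h\in\mathcal C_c^b(A^c)}\mathrm{Var}(I_M(\gamma)-I_M(h))=0$. $M$ is linearly $\mathbf k$-rigid on $A$ if this holds for $\gamma(t)=t^{\mathbf k}1_A(t)$, and linearly maximally rigid on $A$ if it holds for every bounded measurable $\gamma$ supported in $A$. *)

(* Defs.v *)
From HB Require Import structures.
From mathcomp Require Import all_boot all_order all_algebra.
From mathcomp Require Import all_classical all_reals all_analysis.
From mathcomp Require Import complex.

Set Implicit Arguments.
Unset Strict Implicit.
Unset Printing Implicit Defensive.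
Import Order.TTheory GRing.Theory Num.Theory.
Import numFieldNormedType.Exports.
Local Open Scope classical_set_scope.
Local Open Scope ring_scope.
Local Open Scope complex_scope.

Local Notation normc := ComplexField.Normc.normc.

(* R^d is [d.-tuple R] with the product sigma-algebra, which is its Borel
   sigma-algebra; the library has no Lebesgue measure on it. *)
Section lebesgue_tuple.
Context {R : realType}.
Local Open Scope ereal_scope.

Definition cons_pair n (x : measurableTypeR R * n.-tuple R) : n.+1.-tuple R :=
  [tuple of (x.1 : R) :: x.2].

Lemma measurable_cons_pair n : measurable_fun setT (@cons_pair n).
Proof.
by apply: (measurable_cons (f := fst)); [exact: measurable_fst|
                                         exact: measurable_snd].
Qed.

Section lebesgue_cons.
Variables (n : nat) (m : {sigma_finite_measure set (n.-tuple R) -> \bar R}).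

Definition lebesgue_cons : set (n.+1.-tuple R) -> \bar R :=
  pushforward (@lebesgue_measure R \x m) (@cons_pair n).

Let lebesgue_cons0 : lebesgue_cons set0 = 0.
Proof. by rewrite /lebesgue_cons /pushforward preimage_set0 measure0. Qed.

Let lebesgue_cons_ge0 A : 0 <= lebesgue_cons A.
Proof. exact: integral_ge0. Qed.

Let measurable_preimage_cons A :
  measurable A -> measurable (@cons_pair n @^-1` A).
Proof. by rewrite -[X in _ -> measurable X]setTI; exact: measurable_cons_pair. Qed.

Let lebesgue_cons_additive : semi_sigma_additive lebesgue_cons.
Proof.
move=> F mF tF mUF; rewrite /lebesgue_cons /pushforward preimage_bigcup.
apply: measure_semi_sigma_additive.
- by move=> i; exact: measurable_preimage_cons.
- apply/trivIsetP => /= i j _ _ ij; rewrite -preimage_setI.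
  by move/trivIsetP : tF => /(_ _ _ _ _ ij) ->//; rewrite preimage_set0.
- by rewrite -preimage_bigcup; exact: measurable_preimage_cons.
Qed.

HB.instance Definition _ := isMeasure.Build _ _ _ lebesgue_cons
  lebesgue_cons0 lebesgue_cons_ge0 lebesgue_cons_additive.

Let lebesgue_cons_sigma_finite : sigma_finite setT lebesgue_cons.
Proof.
have /sigma_finiteP[F [TF ndF Foo]] := sigma_finiteT (@lebesgue_measure R).
have /sigma_finiteP[G [TG ndG Goo]] := sigma_finiteT m.
pose uncons (x : n.+1.-tuple R) : measurableTypeR R * n.-tuple R :=
  (thead x, [tuple of behead x]).
have unconsK : cancel (@cons_pair n) uncons.
  by move=> [a x]; congr pair; exact/val_inj.
have consK : cancel uncons (@cons_pair n).
  by move=> x; rewrite [RHS]tuple_eta.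
have mu : measurable_fun setT uncons.
  apply: measurable_fun_pair; last exact: measurable_behead.
  exact: (@measurable_tnth _ R n.+1 ord0).
exists (fun i => uncons @^-1` (F i `*` G i)).
  rewrite -preimage_bigcup (_ : \bigcup_i _ = setT) ?preimage_setT// -subTset.
  move=> [x y] _.
  have [i _ Fix] : (\bigcup_i F i) x by rewrite -TF.
  have [j _ Gjy] : (\bigcup_i G i) y by rewrite -TG.
  exists (maxn i j) => //; split => /=.
    by move: x Fix; exact/subsetPset/ndF/leq_maxl.
  by move: y Gjy; exact/subsetPset/ndG/leq_maxr.
move=> i; have [mFi Fioo] := Foo i; have [mGi Gioo] := Goo i; split.
  by rewrite -[X in measurable X]setTI; apply: mu => //; exact: measurableX.
rewrite /lebesgue_cons /pushforward -comp_preimage.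
rewrite (_ : _ \o _ = id); last by apply/funext => x; exact: unconsK.
by rewrite /= product_measure1E// lte_mul_pinfty// ge0_fin_numE.
Qed.

HB.instance Definition _ := Measure_isSigmaFinite.Build _ _ _ lebesgue_cons
  lebesgue_cons_sigma_finite.
End lebesgue_cons.

Fixpoint lebesgue_tuple n : {sigma_finite_measure set (n.-tuple R) -> \bar R} :=
  if n is n'.+1 then lebesgue_cons (lebesgue_tuple n') else \d_[tuple].

End lebesgue_tuple.

Arguments lebesgue_tuple {R} n.

Section euclidean_space.
Context {R : realType} {d : nat}.
Implicit Types (x y t : d.-tuple R) (A : set (d.-tuple R)).

Definition origin : d.-tuple R := [tuple 0 | i < d].

Definition vopp x : d.-tuple R := [tuple - tnth x i | i < d].

Definition vsub x y : d.-tuple R := [tuple tnth x i - tnth y i | i < d].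

Definition dotprod x y : R := \sum_(i < d) tnth x i * tnth y i.

Definition enorm x : R := Num.sqrt (dotprod x x).

(* Balls are open and Euclidean. *)
Definition eball x (r : R) : set (d.-tuple R) := [set y | enorm (vsub y x) < r].

Definition cube (r : R) : set (d.-tuple R) :=
  [set x | forall i, - r <= tnth x i <= r].

Definition enlarge A (eta : R) : set (d.-tuple R) := \bigcup_(t in A) eball t eta.

Definition monomial (k : 'I_d -> nat) x : R := \prod_(i < d) tnth x i ^+ k i.

Definition isotropic (s : d.-tuple R -> R) : Prop :=
  forall u v, enorm u = enorm v -> s u = s v.

Definition separable (s : d.-tuple R -> R) : Prop :=
  exists s_ : 'I_d -> R -> R,
    [/\ forall i a, 0 <= s_ i a,
        forall i a, s_ i (- a) = s_ i a
      & forall u, s u = \prod_(i < d) s_ i (tnth u i)].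

End euclidean_space.

Section complex_functions.
Context {R : realType}.

Definition Cintegral disp (T : measurableType disp)
    (mu : {measure set T -> \bar R}) (f : T -> R[i]) : R[i] :=
  (\int[mu]_x complex.Re (f x))%R +i* (\int[mu]_x complex.Im (f x))%R.

Definition expi (a : R) : R[i] := cos a +i* sin a.

Definition Cexpectation disp (T : measurableType disp) (P : probability T R)
    (X : T -> R[i]) : R[i] :=
  fine ('E_P[fun w => complex.Re (X w)])%E +i*
  fine ('E_P[fun w => complex.Im (X w)])%E.

Definition Cvariance disp (T : measurableType disp) (P : probability T R)
    (X : T -> R[i]) : \bar R :=
  ('E_P[fun w => (normc (X w - Cexpectation P X) ^+ 2)%R])%E.

Context {d : nat}.
Implicit Types (f : d.-tuple R -> R[i]) (A : set (d.-tuple R)).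

(* Bounded measurable functions; compact support is expressed by vanishing
   outside some centered ball. *)
Definition Ccb : set (d.-tuple R -> R[i]) :=
  [set f : d.-tuple R -> R[i] |
    [/\ measurable_fun setT (fun x => complex.Re (f x)),
        measurable_fun setT (fun x => complex.Im (f x)),
        exists C : R, forall x, normc (f x) <= C
      & exists r : R, forall x, r < enorm x -> f x = 0]].

(* [Ccb_on B] is C_c^b(B), the members of C_c^b(R^d) vanishing outside B. *)
Definition Ccb_on (B : set (d.-tuple R)) : set (d.-tuple R -> R[i]) :=
  [set f : d.-tuple R -> R[i] | Ccb f /\ forall x, ~ B x -> f x = 0].

Definition fourier f (u : d.-tuple R) : R[i] :=
  Cintegral (lebesgue_tuple d) (fun x => expi (- dotprod u x) * f x).

End complex_functions.

Definition Cextend {R : realType} {d : nat} {T : Type}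
    (I : (d.-tuple R -> R) -> T -> R) (f : d.-tuple R -> R[i]) (w : T) : R[i] :=
  I (fun x => complex.Re (f x)) w +i* I (fun x => complex.Im (f x)) w.

(* [wss_int] is constrained only on C_c^b(R^d); elements of L^2 being classes
   modulo a.s. equality, its linearity is an a.s. identity. *)
Record wss_measure {R : realType} (d : nat) {disp} {T : measurableType disp}
    (P : probability T R) := WSSMeasure {
  wss_int : (d.-tuple R -> R) -> {RV P >-> R} ;
  spectral_measure : {measure set (d.-tuple R) -> \bar R} ;
  wss_int_L2 : forall f : d.-tuple R -> R, Ccb (fun x => (f x)%:C) ->
    (wss_int f : T -> R) \in Lfun P 2%:E ;
  wss_int_linear : forall (a : R) (f g : d.-tuple R -> R),
    Ccb (fun x => (f x)%:C) -> Ccb (fun x => (g x)%:C) ->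
    {ae P, forall w,
      wss_int (fun x => a * f x + g x) w = a * wss_int f w + wss_int g w} ;
  wss_var_translation : forall f (t : d.-tuple R), Ccb f ->
    Cvariance P (Cextend wss_int (fun x => f (vsub x t))) =
    Cvariance P (Cextend wss_int f) ;
  spectral_measure_sym : forall E, measurable E ->
    spectral_measure (vopp @^-1` E) = spectral_measure E ;
  wss_var_spectral : forall f, Ccb f ->
    Cvariance P (Cextend wss_int f) =
    (((2 * pi) ^- d)%:E *
     \int[spectral_measure]_u ((normc (fourier f u)) ^+ 2)%:E)%E
}.

Section rigidity.
Context {R : realType} {d : nat} {disp} {T : measurableType disp}.
Context {P : probability T R} (M : wss_measure d P).
Implicit Types (A : set (d.-tuple R)) (s : d.-tuple R -> R).

Definition IM : (d.-tuple R -> R[i]) -> T -> R[i] := Cextend (wss_int M).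

(* The a.c. part is given by the Lebesgue decomposition: [nu] is the singular
   part of the spectral measure.  [s] is determined almost everywhere. *)
Definition spectral_density s : Prop :=
  [/\ measurable_fun setT s, forall u, 0 <= s u &
    exists (nu : {measure set (d.-tuple R) -> \bar R}) (N : set (d.-tuple R)),
      [/\ measurable N, lebesgue_tuple d N = 0%E, nu (~` N) = 0%E &
        forall E, measurable E ->
          spectral_measure M E =
          (\int[lebesgue_tuple d]_(u in E) (s u)%:E + nu E)%E]].

Definition linearly_rigid (gamma : d.-tuple R -> R[i]) A : Prop :=
  ereal_inf [set Cvariance P (fun w => IM gamma w - IM h w)
            | h in Ccb_on (~` A)] = 0%E.

Definition linearly_k_rigid (k : 'I_d -> nat) A : Prop :=
  linearly_rigid (fun t => (monomial k t * \1_A t)%:C) A.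

Definition linearly_maximally_rigid A : Prop :=
  forall gamma, Ccb_on A gamma -> linearly_rigid gamma A.

End rigidity.

(* Main.v *)
From HB Require Import structures.
Require Import Defs.
From mathcomp Require Import all_boot all_order all_algebra.
From mathcomp Require Import all_classical all_reals all_analysis.
From mathcomp Require Import measurable_realfun ring lra complex.

Set Implicit Arguments.
Unset Strict Implicit.
Unset Printing Implicit Defensive.
Import Order.TTheory GRing.Theory Num.Theory.
Import numFieldNormedType.Exports.
Local Open Scope classical_set_scope.
Local Open Scope ring_scope.

(** Let [psi] be the Hartley transform, a real form of the Fourier transform, of a
    bounded function [m] with compact support. If [M] is not maximally rigid on [A],
    some test function on [A] has a transform at positive distance, in the space of
    square integrable functions for the spectral measure, from the transforms of the
    test functions off [A]. The orthogonal component [phi] of that transform has, after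
    a mollification, a transform [m] supported close to [A], and the absolutely
    continuous part of the spectral measure is identified by [psi = phi s] almost
    everywhere, up to a constant. Hence [psi] is not zero and [psi ^ 2 / s] is integrable
    ([spectral_function]).

    Conversely, to refute rigidity of order [k] on a larger set [A'] it suffices to find
    a function [Psi] with [Psi ^ 2 / s] integrable that is orthogonal to the transforms of
    the test functions off [A'] but not to that of the monomial on [A']. The
    candidate is [G] times a Fejer kernel times [\prod sin (delta u_i) ^ k_i], where [G] is
    band-limited and does not vanish at the origin: the sines are finite differences,
    which lower the degrees, and Cauchy-Schwarz bounds the pairing of [Psi] with the
    transforms of test functions ([not_linearly_k_rigid]). Near the origin the sines are
    dominated by the monomial, and there the integral of [u ^ (2 k) / s] is finite by
    assumption; away from it [G] has to be controlled by [psi]. So the task is to build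
    [G] from [psi] by removing the zeros of [psi] at the origin, without enlarging the
    spectrum by more than [eta] allows ([rigidity_reduction]).

    In one variable this is a division. A superposition of waves of frequency at
    most [B] is analytic, so it either vanishes or has a finite order at 0, and Taylor's
    formula with integral remainder exhibits the quotient by the corresponding power
    as a superposition of the same kind ([wave_division]). In the separable case [psi]
    is restricted to a line parallel to each axis on which it is square integrable for
    the inverse of the corresponding factor of [s], the restriction is divided, and [G]
    is the product of the quotients ([separable_multiplier]).

    In the isotropic case [psi] is restricted to a line through the origin on which it
    is square integrable for the radial weight; let [q] be the even part of the quotient
    of this restriction. Then [q (|u|)] has the right size, and it is band-limited because
    [cos (tau |u|)] is the transform of a distribution carried by the ball of radius [tau].
    Explicitly, repeated integration by parts writes a cosine as an average, with the
    weight [(1 - t^2)^E], of functions [x ^ i cos^(i) x] at [x = w t] ([cos_euler_wave]);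
    by rotation invariance this becomes an average over the ball of plane waves with
    polynomial factors ([ball_euler_wave]). A product of cardinal sines with small
    spectrum absorbs the polynomials ([band_limited_poly_wave]), and it does not have to
    be radial ([isotropic_multiplier]). *)

(** * Integrals of real functions *)

Notation L1 mu f := (integrable mu setT (fun x => (f x)%:E)).

Section real_integrals.
Context d (T : measurableType d) (R : realType) (mu : {measure set T -> \bar R}).
Implicit Types f g : T -> R.

Lemma L1_measurable f : L1 mu f -> measurable_fun setT f.
Proof. by move=> /integrableP[/measurable_EFinP]. Qed.

Lemma L1_le f g : measurable_fun setT f -> L1 mu g ->
  (forall x, `|f x| <= g x) -> L1 mu f.
Proof.
move=> mf ig fg; apply: (le_integrable _ _ _ ig) => //.
  exact/measurable_EFinP.
by move=> x _ /=; rewrite lee_fin (le_trans (fg x))// ler_norm.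
Qed.

Lemma L1D f g : L1 mu f -> L1 mu g -> L1 mu (fun x => f x + g x).
Proof. by move=> fi gi; exact: (integrableD _ fi gi). Qed.

Lemma L1Zl c f : L1 mu f -> L1 mu (fun x => c * f x).
Proof. by move=> fi; exact: (integrableZl _ _ fi). Qed.

Lemma L1_norm f : L1 mu f -> L1 mu (fun x => `|f x|).
Proof. by move=> fi; exact: (integrable_norm fi). Qed.

Lemma L1_bounded_mul f g C : L1 mu f -> measurable_fun setT g ->
  (forall x, `|g x| <= C) -> L1 mu (fun x => g x * f x).
Proof.
move=> fi mg gC; apply: (L1_le _ (L1Zl C (L1_norm fi))).
  by apply: measurable_funM => //; exact: L1_measurable.
by move=> x; rewrite normrM ler_wpM2r.
Qed.

Lemma EFin_Rintegral f : L1 mu f ->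
  (\int[mu]_x f x)%:E = (\int[mu]_x (f x)%:E)%E.
Proof.
by move=> fi; rewrite /Rintegral fineK//; exact: integrable_fin_num.
Qed.

Lemma ge0_L1 f : measurable_fun setT f -> (forall x, 0 <= f x) ->
  (\int[mu]_x (f x)%:E < +oo)%E -> L1 mu f.
Proof.
move=> mf f0 fi; apply/integrableP; split; first exact/measurable_EFinP.
by under eq_integral do rewrite gee0_abs ?lee_fin//.
Qed.

Lemma L1_lty f : L1 mu f -> (forall x, 0 <= f x) ->
  (\int[mu]_x (f x)%:E < +oo)%E.
Proof.
by move=> fi f0; rewrite -EFin_Rintegral// ltry.
Qed.

Lemma le_Rint f g : L1 mu f -> L1 mu g -> (forall x, f x <= g x) ->
  \int[mu]_x f x <= \int[mu]_x g x.
Proof. by move=> fi gi fg; apply: le_Rintegral. Qed.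

Lemma Rint_norm_le f g : L1 mu f -> L1 mu g -> (forall x, `|f x| <= g x) ->
  `|\int[mu]_x f x| <= \int[mu]_x g x.
Proof.
move=> fi gi fg; apply: (le_trans (le_normr_Rintegral _ _)) => //.
by apply: le_Rint => //; exact: L1_norm.
Qed.

Lemma RintD f g : L1 mu f -> L1 mu g ->
  \int[mu]_x (f x + g x) = \int[mu]_x f x + \int[mu]_x g x.
Proof. by move=> fi gi; rewrite RintegralD. Qed.

Lemma RintB f g : L1 mu f -> L1 mu g ->
  \int[mu]_x (f x - g x) = \int[mu]_x f x - \int[mu]_x g x.
Proof. by move=> fi gi; rewrite RintegralB. Qed.

Lemma RintZl c f : L1 mu f -> \int[mu]_x (c * f x) = c * \int[mu]_x f x.
Proof. by move=> fi; rewrite RintegralZl. Qed.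

Lemma eq_Rint f g : f =1 g -> \int[mu]_x f x = \int[mu]_x g x.
Proof. by move=> fg; apply: eq_Rintegral => x _; exact: fg. Qed.

Lemma eq_Rint_in (D : set T) f g : (forall x, D x -> f x = g x) ->
  \int[mu]_(x in D) f x = \int[mu]_(x in D) g x.
Proof. by move=> fg; apply: eq_Rintegral => x; rewrite inE; exact: fg. Qed.

Lemma Rint0 : \int[mu]_x 0 = 0 :> R.
Proof. by rewrite /Rintegral integral0. Qed.

Lemma L1_0 : L1 mu (fun=> 0 : R).
Proof. exact: integrable0. Qed.

Lemma measurable_indicM f (A : set T) : measurable A -> measurable_fun setT f ->
  measurable_fun setT (fun x => \1_A x * f x).
Proof. by move=> mA mf; apply: measurable_funM => //; exact: measurable_indic. Qed.

Lemma dominated_Rint (f_ : nat -> T -> R) f g :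
  (forall n, measurable_fun setT (f_ n)) -> L1 mu g ->
  (forall n x, `|f_ n x| <= g x) ->
  (forall x, f_ ^~ x @ \oo --> f x) ->
  L1 mu f /\ (fun n => \int[mu]_x f_ n x) @ \oo --> \int[mu]_x f x.
Proof.
move=> mf gi fg ff.
have mlim : measurable_fun setT f.
  by apply: (measurable_fun_cvg (h := f_)) => // x _; exact: ff.
have /= := @dominated_convergence _ T R mu setT measurableT
  (fun n x => (f_ n x)%:E) (fun x => (f x)%:E) (fun x => (g x)%:E).
case.
- by move=> n; exact/measurable_EFinP.
- exact/measurable_EFinP.
- by apply: aeW => x _; apply/fine_cvgP; split; [exact: nearW|exact: ff].
- exact: gi.
- by apply: aeW => x n _; rewrite lee_fin.
move=> fi _ cf; split => //.
rewrite /Rintegral; apply: fine_cvg; rewrite fineK//.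
exact: integrable_fin_num.
Qed.

Lemma ge0_integrable (F : T -> \bar R) : measurable_fun setT F ->
  (forall x, 0 <= F x)%E -> (\int[mu]_x F x < +oo)%E -> mu.-integrable setT F.
Proof.
move=> mF F0 Foo; apply/integrableP; split => //.
by under eq_integral do rewrite gee0_abs//.
Qed.

(** The values are finite almost everywhere, so that if none were both positive
    and finite the function would vanish almost everywhere. *)
Lemma exists_pos_fin (F : T -> \bar R) : measurable_fun setT F ->
  (forall x, 0 <= F x)%E -> (0 < \int[mu]_x F x < +oo)%E ->
  exists x, (0 < F x < +oo)%E.
Proof.
move=> mF F0 /andP[I0 Ioo]; apply: contrapT => noex.
have FI := ge0_integrable mF F0 Ioo.
have aeF := integrable_ae measurableT FI.
suff H : (\int[mu]_x F x = \int[mu]_x 0)%E by rewrite H integral0 ltxx in I0.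
apply: ge0_ae_eq_integral => //.
apply: filterS aeF => x /(_ I) Fx _.
apply/eqP; apply: contrapT => /negP Fx0; apply: noex; exists x.
by rewrite lt0e Fx0 F0/= -ge0_fin_numE.
Qed.

End real_integrals.

(** Changes of variables are established for nonnegative functions first; [phiE]
    is such a formula, and the signed case follows by splitting into positive
    and negative parts. *)
Section change_of_variables.
Context d1 d2 (T1 : measurableType d1) (T2 : measurableType d2) (R : realType).
Variables (m1 : {measure set T1 -> \bar R}) (m2 : {measure set T2 -> \bar R}).
Variables (phi : T1 -> T2) (c : R).
Hypothesis mphi : measurable_fun setT phi.
Hypothesis c0 : 0 <= c.
Hypothesis phiE : forall F : T2 -> \bar R, measurable_fun setT F ->
  (forall x, 0 <= F x)%E ->
  (\int[m1]_x F (phi x) = c%:E * \int[m2]_x F x)%E.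

Lemma change_L1 f : L1 m2 f -> L1 m1 (fun x => f (phi x)).
Proof.
move=> fi; have mf := L1_measurable fi.
apply/integrableP; split; first by apply/measurable_EFinP; exact: measurableT_comp.
rewrite (phiE (F := fun x => `|(f x)%:E|%E))//.
  case/integrableP: fi => _ /= fi.
  by rewrite lte_mul_pinfty// lee_fin.
by apply: measurableT_comp => //; exact/measurable_EFinP.
Qed.

Lemma change_Rint f : L1 m2 f ->
  \int[m1]_x f (phi x) = c * \int[m2]_x f x.
Proof.
move=> fi; have mf : measurable_fun setT (fun x => (f x)%:E).
  by apply/measurable_EFinP; exact: L1_measurable fi.
apply: EFin_inj; rewrite EFinM !EFin_Rintegral//; last exact: change_L1.
rewrite integralE [in RHS]integralE.
rewrite muleBr//; last first.
  have [] := (integrable_pos_fin_num measurableT fi, integrable_neg_fin_num measurableT fi).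
  by move=> fp fn; rewrite fin_num_adde_defl// fin_numN.
rewrite -(phiE (F := (fun x => (f x)%:E)^\+%E))//; last exact: measurable_funepos.
rewrite -(phiE (F := (fun x => (f x)%:E)^\-%E))//; last exact: measurable_funeneg.
congr (_ - _)%E; apply: eq_integral => x _; [exact: (congr1 (@^~ x) (funepos_comp (EFin \o f) phi))|exact: (congr1 (@^~ x) (funeneg_comp (EFin \o f) phi))].
Qed.

End change_of_variables.

(** A bound by a product of integrable functions is what the kernels below
    satisfy, and it makes every section and partial integral integrable. *)
Section fubini_real.
Context d1 d2 (T1 : measurableType d1) (T2 : measurableType d2) (R : realType).
Variables (m1 : {sigma_finite_measure set T1 -> \bar R}).
Variables (m2 : {sigma_finite_measure set T2 -> \bar R}).
Variables (f : T1 -> T2 -> R) (a : T1 -> R) (b : T2 -> R).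
Hypothesis mf : measurable_fun setT (fun z : T1 * T2 => f z.1 z.2).
Hypotheses (ia : L1 m1 a) (ib : L1 m2 b).
Hypothesis fab : forall x y, `|f x y| <= a x * b y.

Let F (z : T1 * T2) : \bar R := (f z.1 z.2)%:E.

Lemma L1_prod : (m1 \x m2)%E.-integrable setT F.
Proof.
have mF : measurable_fun setT F by exact/measurable_EFinP.
have ma := L1_measurable ia; have mb := L1_measurable ib.
apply/(integrable12ltyP _ _ mF).
apply: (@le_lt_trans _ _ (\int[m1]_x \int[m2]_y (`|a x| * `|b y|)%:E)%E).
  apply: ge0_le_integral => //.
  - by move=> *; exact: integral_ge0.
  - apply: (measurable_fun_fubini_tonelli_F (abse \o F)) => //.
      exact: measurableT_comp.
    by move=> z; exact: abse_ge0.
  - apply: (measurable_fun_fubini_tonelli_F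
      (fun z : T1 * T2 => (`|a z.1| * `|b z.2|)%:E)) => //.
      by apply/measurable_EFinP; apply: measurable_funM;
        apply: measurableT_comp => //; exact: measurableT_comp.
  - move=> x _; apply: ge0_le_integral => //.
    + apply: measurableT_comp => //; apply/measurable_EFinP.
      exact: (measurableT_comp mf (pair1_measurable x)).
    + apply/measurable_EFinP; apply: measurable_funM => //.
      exact: measurableT_comp.
    + move=> y _ /=; rewrite lee_fin -normrM (le_trans (fab x y))// ler_norm//.
under eq_integral => x _.
  under eq_integral do rewrite EFinM.
  rewrite ge0_integralZl//; last by apply/measurable_EFinP; exact: measurableT_comp.
  rewrite -EFin_Rintegral; last exact: L1_norm.
  over.
rewrite /= ge0_integralZr//.
- by rewrite -EFin_Rintegral ?ltry//; exact: L1_norm.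
- by apply/measurable_EFinP; exact: measurableT_comp.
- by rewrite lee_fin Rintegral_ge0.
Qed.

Lemma L1_section1 x : L1 m2 (f x).
Proof.
apply: (L1_le _ (L1Zl (a x) ib)) => //.
exact: (measurableT_comp mf (pair1_measurable x)).
Qed.

Lemma L1_section2 y : L1 m1 (f ^~ y).
Proof.
apply: (L1_le _ (L1Zl (b y) ia)) => //.
  exact: (measurableT_comp mf (pair2_measurable y)).
by move=> x; rewrite mulrC.
Qed.

Let fubini_FE : fubini_F m2 F = fun x => (\int[m2]_y f x y)%:E.
Proof.
by apply/funext => x; rewrite EFin_Rintegral//; exact: L1_section1.
Qed.

Let fubini_GE : fubini_G m1 F = fun y => (\int[m1]_x f x y)%:E.
Proof.
by apply/funext => x; rewrite EFin_Rintegral//; exact: L1_section2.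
Qed.

Lemma measurable_Rint1 : measurable_fun setT (fun x => \int[m2]_y f x y).
Proof.
by apply/measurable_EFinP; have := measurable_fubini_F L1_prod; rewrite fubini_FE.
Qed.

Lemma measurable_Rint2 : measurable_fun setT (fun y => \int[m1]_x f x y).
Proof.
by apply/measurable_EFinP; have := measurable_fubini_G L1_prod; rewrite fubini_GE.
Qed.

Lemma L1_Rint1 : L1 m1 (fun x => \int[m2]_y f x y).
Proof. by have := integrable_fubini_F L1_prod; rewrite fubini_FE. Qed.

Lemma L1_Rint2 : L1 m2 (fun y => \int[m1]_x f x y).
Proof.
apply: (L1_le measurable_Rint2 (L1Zl (\int[m1]_x a x) ib)) => y.
rewrite mulrC -RintZl//; apply: Rint_norm_le; [exact: L1_section2|exact: L1Zl|].
by move=> x; rewrite mulrC.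
Qed.

Lemma Rint_swap :
  \int[m1]_x \int[m2]_y f x y = \int[m2]_y \int[m1]_x f x y.
Proof.
apply: EFin_inj; rewrite !EFin_Rintegral; [|exact: L1_Rint2|exact: L1_Rint1].
have := Fubini L1_prod; rewrite -[X in X = _]/(\int[m1]_x fubini_F m2 F x)%E.
by rewrite -[X in _ = X]/(\int[m2]_x fubini_G m1 F x)%E fubini_FE fubini_GE.
Qed.

End fubini_real.

(** * Square integrable functions and densities *)

Lemma quad_discr (R : realType) (a b c : R) : 0 <= c ->
  (forall t, 0 <= a - 2 * b * t + c * t ^+ 2) -> b ^+ 2 <= a * c.
Proof.
move=> c0 H; have [c_eq|c_neq] := eqVneq c 0.
  rewrite c_eq mulr0; have [->|b0] := eqVneq b 0; first by rewrite expr0n.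
  have := H ((a + 1) / (2 * b)); rewrite c_eq mul0r addr0.
  have -> : a - 2 * b * ((a + 1) / (2 * b)) = -1 by field.
  by rewrite ler0N1.
have cp : 0 < c by rewrite lt0r c_neq.
have := H (b / c).
have -> : a - 2 * b * (b / c) + c * (b / c) ^+ 2 = (a * c - b ^+ 2) / c by field.
by rewrite pmulr_lge0 ?invr_gt0// subr_ge0.
Qed.

Section square_integrable.
Context d (T : measurableType d) (R : realType) (mu : {measure set T -> \bar R}).
Implicit Types f g : T -> R.

Definition L2 f := measurable_fun setT f /\ L1 mu (fun x => f x ^+ 2).

Lemma L2_mul f g : L2 f -> L2 g -> L1 mu (fun x => f x * g x).
Proof.
move=> [mf if2] [mg ig2]; apply: (L1_le _ (L1D if2 ig2)).
  exact: measurable_funM.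
move=> x; rewrite normrM -(real_normK (num_real (f x))) -(real_normK (num_real (g x))).
have := sqr_ge0 (`|f x| - `|g x|); have := normr_ge0 (f x); have := normr_ge0 (g x).
by nra.
Qed.

Lemma L2_lin a f g : L2 f -> L2 g -> L2 (fun x => a * f x + g x).
Proof.
move=> Lf Lg; have [mf if2] := Lf; have [mg ig2] := Lg; split.
  by apply: measurable_funD => //; exact: measurable_funM.
have -> : (fun x => ((a * f x + g x) ^+ 2)%:E) =
  (fun x => (a ^+ 2 * (f x ^+ 2) + (2 * a * (f x * g x) + g x ^+ 2))%:E).
  by apply/funext => x; congr EFin; ring.
by apply: L1D; [exact: L1Zl|apply: L1D => //; apply: L1Zl; exact: L2_mul].
Qed.

Lemma L2Z a f : L2 f -> L2 (fun x => a * f x).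
Proof.
move=> [mf if2]; split; first exact: measurable_funM.
have -> : (fun x => ((a * f x) ^+ 2)%:E) = (fun x => (a ^+ 2 * (f x ^+ 2))%:E).
  by apply/funext => x; congr EFin; ring.
exact: L1Zl.
Qed.

Lemma L2B f g : L2 f -> L2 g -> L2 (fun x => f x - g x).
Proof.
move=> Lf Lg; have -> : (fun x => f x - g x) = (fun x => -1 * g x + f x).
  by apply/funext => x; ring.
exact: L2_lin.
Qed.

Lemma Rint_sqr_lin a f g : L2 f -> L2 g ->
  \int[mu]_x ((f x - a * g x) ^+ 2) =
  \int[mu]_x (f x ^+ 2) - 2 * (\int[mu]_x (f x * g x)) * a
    + (\int[mu]_x (g x ^+ 2)) * a ^+ 2.
Proof.
move=> Lf Lg; have [mf if2] := Lf; have [mg ig2] := Lg.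
have fg := L2_mul Lf Lg.
rewrite (eq_Rint mu (g := fun x => f x ^+ 2 +
  (- (2 * a) * (f x * g x) + a ^+ 2 * (g x ^+ 2)))); last by move=> x; ring.
rewrite RintD//; last by apply: L1D; apply: L1Zl.
rewrite RintD; [|exact: L1Zl..].
by rewrite !RintZl//; ring.
Qed.

Lemma Cauchy_Schwarz f g : L2 f -> L2 g ->
  (\int[mu]_x (f x * g x)) ^+ 2 <= \int[mu]_x (f x ^+ 2) * \int[mu]_x (g x ^+ 2).
Proof.
move=> Lf Lg; apply: quad_discr.
  by apply: Rintegral_ge0 => x _; exact: sqr_ge0.
move=> t; rewrite -Rint_sqr_lin//.
by apply: Rintegral_ge0 => x _; exact: sqr_ge0.
Qed.

End square_integrable.

Section density.
Local Open Scope ereal_scope.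
Context d (T : measurableType d) (R : realType).
Variables (S lam nu : {measure set T -> \bar R}) (s : T -> R).
Hypotheses (ms : measurable_fun setT s) (s0 : forall x, (0 <= s x)%R).
Hypothesis SE : forall E, measurable E ->
  S E = \int[lam]_(x in E) (s x)%:E + nu E.

Import HBNNSimple.

(** The formula passes from sets to simple functions by linearity, and to their
    increasing limits by monotone convergence. *)
Lemma ge0_integral_density (F : T -> \bar R) : measurable_fun setT F ->
  (forall x, 0 <= F x) ->
  \int[S]_x F x = \int[lam]_x (F x * (s x)%:E) + \int[nu]_x F x.
Proof.
move=> mF F0; pose h := nnsfun_approx measurableT mF.
have hF x : (h n x)%:E @[n --> \oo] --> F x.
  by apply: cvg_nnsfun_approx.
have hnd x m n : (m <= n)%N -> (h m x <= h n x)%R.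
  by move=> mn; exact/lefP/nd_nnsfun_approx.
have mh n : measurable_fun setT (fun x => (h n x)%:E) by exact/measurable_EFinP.
have c1 (mu : {measure set T -> \bar R}) :
    \int[mu]_x (h n x)%:E @[n --> \oo] --> \int[mu]_x F x.
  rewrite (eq_integral (fun x => limn (fun n => (h n x)%:E))); last first.
    by move=> x _; apply/esym/cvg_lim.
  apply: cvg_monotone_convergence => //.
  - by move=> n x _; rewrite lee_fin.
  - by move=> x _ m n mn; rewrite lee_fin hnd.
have ms' : measurable_fun setT (fun x => (s x)%:E) by exact/measurable_EFinP.
have c2 : \int[lam]_x ((h n x)%:E * (s x)%:E) @[n --> \oo]
    --> \int[lam]_x (F x * (s x)%:E).
  rewrite (eq_integral (fun x => limn (fun n => (h n x)%:E * (s x)%:E))); last first.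
    by move=> x _; apply/esym/cvg_lim => //; apply: cvgeZr.
  apply: cvg_monotone_convergence => //.
  - by move=> n; exact: emeasurable_funM.
  - by move=> n x _; rewrite mule_ge0// lee_fin.
  - by move=> x _ m n mn; rewrite lee_wpmul2r ?lee_fin// hnd.
suff hE n : \int[S]_x (h n x)%:E =
    \int[lam]_x ((h n x)%:E * (s x)%:E) + \int[nu]_x (h n x)%:E.
  have c3 : \int[S]_x (h n x)%:E @[n --> \oo] -->
      \int[lam]_x (F x * (s x)%:E) + \int[nu]_x F x; last first.
    exact: (cvg_unique _ (c1 S) c3).
  rewrite (funext hE); apply: cvgeD => //; apply: ge0_adde_def; rewrite inE; apply: integral_ge0 => // x _.
  by rewrite mule_ge0// lee_fin.
have hn x : (h n x)%:E = (\sum_(y \in range (h n)) (y * \1_(h n @^-1` [set y]) x)%:E)%E.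
  by rewrite fsumEFin// -fimfunE.
have mi y : measurable_fun setT (fun x => (y * \1_(h n @^-1` [set y]) x)%:E).
  by apply/measurable_EFinP; exact: measurable_funM.
have i0 y x : 0 <= (y * \1_(h n @^-1` [set y]) x)%:E by exact: nnfun_muleindic_ge0.
have key (mu : {measure set T -> \bar R}) : \int[mu]_x (h n x)%:E =
    (\sum_(y \in range (h n)) (y%:E * mu (h n @^-1` [set y])))%E.
  under eq_integral do rewrite hn.
  rewrite ge0_integral_fsum//; apply: eq_fsbigr => y _.
  by rewrite integralZl_indic_nnsfun// integral_indic// setIT.
rewrite (key S) (key nu).
have -> : \int[lam]_x ((h n x)%:E * (s x)%:E) =
    (\sum_(y \in range (h n)) (y%:E * \int[lam]_(x in h n @^-1` [set y]) (s x)%:E))%E.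
  under eq_integral => x _.
    rewrite hn ge0_mule_fsuml; last by move=> y; exact: i0.
    over.
  rewrite ge0_integral_fsum//=; last 2 first.
  - by move=> y; exact: emeasurable_funM.
  - by move=> y x _; rewrite mule_ge0 ?lee_fin ?i0//; exact: i0.
  apply: eq_fsbigr => y; rewrite inE => -[z _ <-].
  under eq_integral do rewrite EFinM -muleA.
  rewrite ge0_integralZl//; last 3 first.
  - by apply: emeasurable_funM => //; exact/measurable_EFinP.
  - by move=> x _; rewrite mule_ge0 ?lee_fin.
  - by rewrite lee_fin.
  congr (_ * _); rewrite [RHS]integral_mkcond; apply: eq_integral => x _.
  by rewrite epatch_indic muleC.
rewrite -fsbig_split//=; apply: eq_fsbigr => y; rewrite inE => -[z _ <-].
by rewrite SE// ge0_muleDr// integral_ge0// => x _; rewrite lee_fin.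
Qed.

End density.

(** * Orthogonal vectors *)

Lemma sum_half (R : realType) n :
  \sum_(0 <= k < n) (2^-1 : R) ^+ k = 2 - 2 * 2^-1 ^+ n.
Proof.
elim: n => [|n IH]; first by rewrite big_geq// expr0; ring.
by rewrite big_nat_recr//= IH exprS; field.
Qed.

Lemma sum_half_le (R : realType) n : \sum_(0 <= k < n) (2^-1 : R) ^+ k <= 2.
Proof. by rewrite sum_half gerBl mulr_ge0// exprn_ge0// invr_ge0. Qed.

Section orthogonal_vector.
Context d (T : measurableType d) (R : realType) (mu : {measure set T -> \bar R}).
Variables (W : (T -> R) -> Prop) (g : T -> R) (eps : R).
Hypothesis W0 : W (fun=> 0).
Hypothesis Wlin : forall a f h, W f -> W h -> W (fun x => a * f x + h x).
Hypothesis WL2 : forall w, W w -> L2 mu w.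
Hypothesis gL2 : L2 mu g.
Hypothesis eps_gt0 : 0 < eps.
Hypothesis g_far : forall w, W w -> eps <= \int[mu]_x ((g x - w x) ^+ 2).

Let D := inf [set \int[mu]_x ((g x - w x) ^+ 2) | w in W].

Let has_infD : has_inf [set \int[mu]_x ((g x - w x) ^+ 2) | w in W].
Proof.
split; first by exists (\int[mu]_x ((g x - 0) ^+ 2)); exists (fun=> 0).
by exists eps => _ [w Ww <-]; exact: g_far.
Qed.

Let D_ge : eps <= D.
Proof.
by apply: lb_le_inf; [case: has_infD|move=> _ [w Ww <-]; exact: g_far].
Qed.

Let D_le w : W w -> D <= \int[mu]_x ((g x - w x) ^+ 2).
Proof. by move=> Ww; apply: ge_inf; [case: has_infD|exists w]. Qed.

(* At this rate the squared norms of the differences [v_ n], even multiplied by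
   [4 ^+ n], are summable. *)
Let delta n : R := 8^-1 ^+ n.

Let delta_gt0 n : 0 < delta n. Proof. by rewrite exprn_gt0// invr_gt0. Qed.

Let minimizing : {w_ : nat -> T -> R | forall n,
  W (w_ n) /\ \int[mu]_x ((g x - w_ n x) ^+ 2) <= D + delta n}.
Proof.
apply: cid.
suff /choice[w_ Hw] : forall n : nat, exists w,
    W w /\ \int[mu]_x ((g x - w x) ^+ 2) <= D + delta n by exists w_.
move=> n; have [_ [w Ww <-] wD] := inf_adherent (delta_gt0 n) has_infD.
by exists w; split => //; exact: ltW.
Qed.

Let w_ := sval minimizing.
Let f_ n x := g x - w_ n x.

Let Ww n : W (w_ n). Proof. exact: (svalP minimizing n).1. Qed.

Let fL2 n : L2 mu (f_ n). Proof. by apply: L2B => //; exact: WL2. Qed.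

(** The excess of the squared distance at [w_ n + t w] over its infimum is a
    nonnegative quadratic polynomial in [t]; its discriminant bounds the inner
    product. *)
Let near_orth n w : W w ->
  (\int[mu]_x (f_ n x * w x)) ^+ 2 <= delta n * \int[mu]_x (w x ^+ 2).
Proof.
move=> wW; apply: quad_discr.
  by apply: Rintegral_ge0 => x _; exact: sqr_ge0.
move=> t; have := (svalP minimizing n).2; rewrite -/w_ => wn.
have := D_le (Wlin t wW (Ww n)).
rewrite (eq_Rint mu (g := fun x => (f_ n x - t * w x) ^+ 2)); last first.
  by move=> x; rewrite /f_; congr (_ ^+ 2); ring.
rewrite Rint_sqr_lin//; last exact: WL2.
rewrite -/(f_ n) in wn *.
by lra.
Qed.

Let v_ n x := f_ n.+1 x - f_ n x.

Let Wv n : W (v_ n).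
Proof.
have -> : v_ n = fun x => -1 * w_ n.+1 x + w_ n x.
  by apply/funext => x; rewrite /v_ /f_; ring.
exact: Wlin.
Qed.

(** The difference lies in [W], so that [near_orth] applies to it twice. *)
Let v_small n : \int[mu]_x (v_ n x ^+ 2) <= 4 * delta n.
Proof.
set X := \int[mu]_x (v_ n x ^+ 2).
have X0 : 0 <= X by apply: Rintegral_ge0 => x _; exact: sqr_ge0.
have XE : X = \int[mu]_x (f_ n.+1 x * v_ n x) - \int[mu]_x (f_ n x * v_ n x).
  rewrite -RintB; [|exact/L2_mul/WL2|exact/L2_mul/WL2].
  by apply: eq_Rint => x; rewrite /v_; ring.
have p := near_orth n.+1 (Wv n); have q := near_orth n (Wv n).
rewrite -/X in p q.
have dn : delta n.+1 <= delta n.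
  by rewrite /delta exprS ler_piMl// ?(ltW (delta_gt0 n))// invf_le1//; lra.
have {}p : (\int[mu]_x (f_ n.+1 x * v_ n x)) ^+ 2 <= delta n * X.
  by apply: (le_trans p); rewrite ler_wpM2r.
move: p q XE; set P := \int[mu]_x (f_ n.+1 x * v_ n x).
set Q := \int[mu]_x (f_ n x * v_ n x) => p q XE.
have := delta_gt0 n => d0.
have [->|Xn0] := eqVneq X 0; first by rewrite mulr_ge0// ltW.
have Xp : 0 < X by rewrite lt0r Xn0.
rewrite -(ler_pM2r Xp).
have := sqr_ge0 (P + Q); rewrite {1}XE.
have -> : X = P - Q by []. 
nra.
Qed.

(* Where [G] is finite the differences decrease geometrically; [Z] is the
   exceptional set. *)
Let Gn n x : \bar R := (4 ^+ n * v_ n x ^+ 2)%:E.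
Let G x : \bar R := (\sum_(n <oo) Gn n x)%E.

Let Gn0 n x : (0 <= Gn n x)%E.
Proof. by rewrite lee_fin mulr_ge0 ?sqr_ge0// exprn_ge0. Qed.

Let mv n : measurable_fun setT (v_ n).
Proof. by have [] := WL2 (Wv n). Qed.

Let mGn n : measurable_fun setT (Gn n).
Proof.
by apply/measurable_EFinP; apply: measurable_funM => //; exact: measurable_funX.
Qed.

Let mG : measurable_fun setT G.
Proof. by apply: ge0_emeasurable_sum => // n x _ _; exact: Gn0. Qed.

Let G0 x : (0 <= G x)%E. Proof. exact: nneseries_ge0. Qed.

Let intG : (\int[mu]_x G x < +oo)%E.
Proof.
rewrite integral_nneseries//.
apply: (@le_lt_trans _ _ 8%:E); last exact: ltry.
apply: lime_le; first by apply: is_cvg_nneseries => n _ _; exact: integral_ge0.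
apply: nearW => n.
apply: (@le_trans _ _ (\sum_(0 <= k < n) (4 * 2^-1 ^+ k)%:E)%E).
  apply: lee_sum => k _; rewrite /Gn.
  have vL := WL2 (Wv k); have [_ v2] := vL.
  rewrite -EFin_Rintegral; last exact: L1Zl.
  rewrite RintZl// lee_fin.
  apply: (@le_trans _ _ (4 ^+ k * (4 * delta k))).
    by rewrite ler_pM2l ?v_small// exprn_gt0.
  rewrite mulrCA ler_pM2l// /delta -exprMn.
  by rewrite (_ : 4 * 8^-1 = 2^-1 :> R)//; field.
rewrite sumEFin lee_fin -mulr_sumr.
by have := sum_half_le R n; lra.
Qed.

Let Z := G @^-1` [set +oo%E].
Let mZ : measurable Z.
Proof. by rewrite -[Z]setTI; apply: mG => //; exact: emeasurable_set1. Qed.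

Let Z_null : mu Z = 0%E.
Proof.
have iG := ge0_integrable mG G0 intG.
apply: (negligibleP _ mZ).1 => //.
apply: negligibleS (integrable_ae measurableT iG) => x Zx/=.
by move=> /(_ I); rewrite Zx.
Qed.

Let g_ x := fine (G x).
Let gE x : ~ Z x -> G x = (g_ x)%:E.
Proof.
move=> Zx; rewrite /g_ fineK// ge0_fin_numE// ltey; apply/eqP => GE.
exact: Zx.
Qed.

Let v_le n x : ~ Z x -> `|v_ n x| <= Num.sqrt (g_ x) * 2^-1 ^+ n.
Proof.
move=> Zx.
have : (Gn n x <= G x)%E.
  rewrite /G (nneseriesD1 (n := n))//.
  by rewrite leeDl//; exact: nneseries_ge0.
rewrite gE// lee_fin => H.
have g0 : 0 <= g_ x by rewrite (le_trans _ H)// mulr_ge0 ?sqr_ge0// exprn_ge0.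
rewrite -(@ler_pXn2r _ 2)// ?nnegrE ?mulr_ge0 ?sqrtr_ge0 ?exprn_ge0 ?invr_ge0//.
rewrite real_normK ?num_real// exprMn sqr_sqrtr// -exprM mulnC exprM.
rewrite (_ : (2^-1) ^+ 2 = 4^-1 :> R); last by rewrite expr2; field.
by rewrite exprVn ler_pdivlMr ?exprn_gt0// mulrC.
Qed.

Let f_telescope n x : f_ n x = f_ 0%N x + \sum_(0 <= k < n) v_ k x.
Proof.
elim: n => [|n IH]; first by rewrite big_geq// addr0.
by rewrite big_nat_recr//= addrA -IH /v_; ring.
Qed.

Let f_bound n x : ~ Z x -> `|f_ n x| <= `|f_ 0%N x| + 2 * Num.sqrt (g_ x).
Proof.
move=> Zx; rewrite f_telescope (le_trans (ler_normD _ _))// lerD2l.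
rewrite (le_trans (ler_norm_sum _ _ _))//.
apply: (@le_trans _ _ (\sum_(0 <= k < n) Num.sqrt (g_ x) * 2^-1 ^+ k)).
  by apply: ler_sum => k _; exact: v_le.
by rewrite -mulr_sumr mulrC ler_wpM2r ?sqrtr_ge0// sum_half_le.
Qed.

Let f_cvg x : ~ Z x -> cvgn (f_ ^~ x).
Proof.
move=> Zx; have -> : f_ ^~ x = (fun n => f_ 0%N x + series (v_ ^~ x) n).
  by apply/funext => n; rewrite f_telescope.
apply: is_cvgD; first exact: is_cvg_cst.
apply: normed_cvg.
apply: (@series_le_cvg _ _ (fun n => Num.sqrt (g_ x) * 2^-1 ^+ n)) => //=.
- by move=> n; exact: v_le.
- by apply: is_cvg_geometric_series; rewrite ger0_norm ?invr_ge0// invf_lt1//; lra.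
Qed.

(* Set to zero on [Z], the sequence converges everywhere. *)
Let f' n x := \1_(~` Z) x * f_ n x.
Let phi x := limn (f' ^~ x).

Let f'E n x : ~ Z x -> f' n x = f_ n x.
Proof. by move=> Zx; rewrite /f' indicE mem_set// mul1r. Qed.

Let f'0 n x : Z x -> f' n x = 0.
Proof. by move=> Zx; rewrite /f' indicE memNset ?mul0r//=; exact. Qed.

Let f'_phi x : f' ^~ x @ \oo --> phi x.
Proof.
have [Zx|Zx] := pselect (Z x).
  rewrite /phi (_ : f' ^~ x = fun=> 0); last by apply/funext => n; rewrite f'0.
  exact: is_cvg_cst.
rewrite /phi (_ : f' ^~ x = f_ ^~ x); last by apply/funext => n; rewrite f'E.
exact: f_cvg.
Qed.

Let B x := 2 * f_ 0%N x ^+ 2 + 8 * (\1_(~` Z) x * g_ x).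

Let mg : measurable_fun setT (fun x => \1_(~` Z) x * g_ x).
Proof.
apply: measurable_funM; first by apply: measurable_indic; exact: measurableC.
exact: measurableT_comp.
Qed.

Let ig : L1 mu (fun x => \1_(~` Z) x * g_ x).
Proof.
apply: ge0_L1 => //.
  by move=> x; rewrite mulr_ge0// fine_ge0.
apply: le_lt_trans intG; apply: ge0_le_integral => //.
- by move=> x _; rewrite lee_fin mulr_ge0// fine_ge0.
- exact/measurable_EFinP.
- move=> x _; have [Zx|Zx] := pselect (Z x).
    by rewrite indicE memNset ?mul0r//; exact.
  by rewrite indicE mem_set// mul1r gE.
Qed.

Let iB : L1 mu B.
Proof. by apply: L1D; apply: L1Zl => //; have [] := fL2 0. Qed.

Let f'_B n x : f' n x ^+ 2 <= B x.
Proof.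
have g0 : 0 <= g_ x by exact: fine_ge0.
rewrite /B; have [Zx|Zx] := pselect (Z x).
  rewrite f'0// expr0n/=; apply: addr_ge0; first by rewrite mulr_ge0 ?sqr_ge0.
  by rewrite mulr_ge0// mulr_ge0.
rewrite f'E// indicE mem_set// mul1r -(real_normK (num_real (f_ n x))).
rewrite -(real_normK (num_real (f_ 0%N x))) -{1}(sqr_sqrtr g0).
have := f_bound n Zx; move: (sqrtr_ge0 (g_ x)) (normr_ge0 (f_ n x)) (normr_ge0 (f_ 0%N x)).
move: `|f_ n x| `|f_ 0%N x| (Num.sqrt (g_ x)) => a b c c0 a0 b0 abc.
have : a ^+ 2 <= (b + 2 * c) ^+ 2 by rewrite ler_pXn2r// nnegrE; lra.
have := sqr_ge0 (b - 2 * c); nra.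
Qed.

Let mf' n : measurable_fun setT (f' n).
Proof.
apply: measurable_funM; first by apply: measurable_indic; exact: measurableC.
by have [] := fL2 n.
Qed.

Let phiL2 : L2 mu phi.
Proof.
have mphi : measurable_fun setT phi.
  by apply: (measurable_fun_cvg (h := f')) => // x _; exact: f'_phi.
split => //; apply: (L1_le _ iB); first exact: measurable_funX.
move=> x; rewrite ger0_norm ?sqr_ge0//.
have cv : (fun n => f' n x ^+ 2) @ \oo --> phi x ^+ 2.
  exact: (cvgM (@f'_phi x) (@f'_phi x)).
rewrite -(cvg_lim _ cv)//; apply: limr_le; first by apply/cvg_ex; exists (phi x ^+ 2).
by apply: nearW => n; exact: f'_B.
Qed.

Let int_phi h : L2 mu h ->
  (fun n => \int[mu]_x (f_ n x * h x)) @ \oo --> \int[mu]_x (phi x * h x).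
Proof.
move=> hL2; have [mh ih] := hL2.
have [||||_ cv] := @dominated_Rint _ T R mu (fun n x => f' n x * h x)
  (fun x => phi x * h x) (fun x => B x + h x ^+ 2).
- by move=> n; exact: measurable_funM.
- exact: L1D.
- move=> n x; rewrite normrM.
  have := f'_B n x; rewrite -(real_normK (num_real (f' n x))).
  rewrite -(real_normK (num_real (h x))).
  have := sqr_ge0 (`|f' n x| - `|h x|).
  have := normr_ge0 (f' n x); have := normr_ge0 (h x); nra.
- by move=> x; apply: cvgM; [exact: f'_phi|exact: cvg_cst].
suff <- : (fun n => \int[mu]_x (f' n x * h x)) =
    (fun n => \int[mu]_x (f_ n x * h x)) by exact: cv.
apply/funext => n; rewrite /Rintegral; congr fine; apply: ae_eq_integral => //.
- by apply/measurable_EFinP; exact: measurable_funM.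
- by apply/measurable_EFinP; apply: measurable_funM => //; have [] := fL2 n.
- exists Z; split => // x /= H; apply: contrapT => Zx; apply: H => _.
  by rewrite f'E.
Qed.

(** The vector is the component of [g] orthogonal to the closure of [W]: a
    minimizing sequence for the distance from [g] to [W] is Cauchy, and along it
    the pointwise limit exists and is dominated. *)
Lemma exists_orthogonal : exists phi : T -> R, [/\ L2 mu phi,
  forall w, W w -> \int[mu]_x (phi x * w x) = 0 &
  \int[mu]_x (phi x * g x) != 0].
Proof.
have delta0 : delta n @[n --> \oo] --> 0.
  by apply: cvg_expr; rewrite ger0_norm ?invr_ge0// invf_lt1//; lra.
exists phi; split => //.
- move=> w wW; apply/eqP; rewrite -sqrf_eq0; apply/eqP.
  have c1 : (fun n => (\int[mu]_x (f_ n x * w x)) ^+ 2) @ \oo -->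
      (\int[mu]_x (phi x * w x)) ^+ 2.
    by have c := int_phi (WL2 wW); exact: (cvgM c c).
  apply: (cvg_unique _ c1) => //.
  apply: (@squeeze_cvgr _ _ _ _ (fun=> 0) (fun n => delta n * \int[mu]_x (w x ^+ 2))).
  + by apply: nearW => n; rewrite sqr_ge0 near_orth.
  + exact: cvg_cst.
  + by rewrite -[X in _ --> X](mul0r (\int[mu]_x (w x ^+ 2))); apply: cvgMl.
- rewrite gt_eqF//; apply: (lt_le_trans eps_gt0); apply: (le_trans D_ge).
  pose C := 2 * \int[mu]_x (g x ^+ 2) + 2 * (D + 1).
  have [mg_ ig_] := gL2.
  have wC n : \int[mu]_x (w_ n x ^+ 2) <= C.
    have [_ if2] := fL2 n.
    apply: (@le_trans _ _ (\int[mu]_x (2 * g x ^+ 2 + 2 * (f_ n x ^+ 2)))).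
      apply: le_Rint; [by have [] := WL2 (Ww n)|by apply: L1D; exact: L1Zl|].
      move=> x; have := sqr_ge0 (g x + f_ n x); rewrite /f_.
      set a := g x; set b := w_ n x.
      have := sqr_ge0 (2 * a - b); nra.
    rewrite RintD; [|exact: L1Zl..]; rewrite !RintZl// lerD2l ler_pM2l//.
    have := (svalP minimizing n).2; rewrite -/w_ -/(f_ n).
    have : delta n <= 1 by rewrite exprn_ile1// ?invr_ge0// invf_le1//; lra.
    by move=> ? /le_trans; apply; rewrite lerD2l.
  have C0 : 0 <= C.
    by apply: (le_trans _ (wC 0%N)); apply: Rintegral_ge0 => x _; exact: sqr_ge0.
  have low n : D - Num.sqrt (delta n * C) <= \int[mu]_x (f_ n x * g x).
    have [_ if2] := fL2 n.
    have -> : \int[mu]_x (f_ n x * g x) =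
        \int[mu]_x (f_ n x ^+ 2) + \int[mu]_x (f_ n x * w_ n x).
      rewrite -RintD//; last by apply: L2_mul => //; exact: WL2.
      by apply: eq_Rint => x; rewrite /f_; ring.
    apply: lerD; first exact: D_le.
    rewrite lerNl; apply: (le_trans (ler_norm _)); rewrite normrN -sqrtr_sqr.
    apply: ler_wsqrtr; apply: (le_trans (near_orth n (Ww n))).
    by rewrite ler_pM2l.
  have c2 : D - Num.sqrt (delta n * C) @[n --> \oo] --> D.
    rewrite -[X in _ --> X]subr0 -[X in _ - X]sqrtr0.
    apply: cvgB; first exact: cvg_cst.
    apply: continuous_cvg; first exact: sqrt_continuous.
    by rewrite -[X in _ --> X](mul0r C); apply: cvgMl.
  apply: (ler_cvg_to c2 (int_phi gL2)).
  by apply: nearW => n; exact: low.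
Qed.

End orthogonal_vector.

(** * Lebesgue measure in several variables *)

Notation leb := lebesgue_measure.
Notation lam := lebesgue_tuple.

Section tuples.
Context {R : realType}.

Lemma tnth_cons_pair0 n (x : R) (v : n.-tuple R) : tnth (cons_pair (x, v)) ord0 = x.
Proof. exact: tnth0. Qed.

Lemma tnth_cons_pairS n (x : R) (v : n.-tuple R) (i : 'I_n) :
  tnth (cons_pair (x, v)) (lift ord0 i) = tnth v i.
Proof. exact: tnthS. Qed.

Lemma tuple_consP n (u : n.+1.-tuple R) :
  u = cons_pair (tnth u ord0, [tuple tnth u (lift ord0 i) | i < n]).
Proof.
apply: eq_from_tnth => i; case: (unliftP ord0 i) => [j|] ->.
  by rewrite tnth_cons_pairS tnth_mktuple.
by rewrite tnth_cons_pair0.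
Qed.

Lemma dotprod_cons n (x y : R) (u v : n.-tuple R) :
  dotprod (cons_pair (x, u)) (cons_pair (y, v)) = x * y + dotprod u v.
Proof.
rewrite /dotprod big_ord_recl !tnth_cons_pair0; congr (_ + _).
by apply: eq_bigr => i _; rewrite !tnth_cons_pairS.
Qed.

Lemma measurable_mktuple d (T : measurableType d) n (f : 'I_n -> T -> R) :
  (forall i, measurable_fun setT (f i)) ->
  measurable_fun setT (fun x => [tuple f i x | i < n]).
Proof.
move=> mf; apply/measurable_fun_tnthP => i.
by rewrite (_ : _ \o _ = f i)//; apply/funext => x /=; rewrite tnth_mktuple.
Qed.

Lemma measurable_dotprod d (T : measurableType d) n (f g : T -> n.-tuple R) :
  measurable_fun setT f -> measurable_fun setT g ->
  measurable_fun setT (fun x => dotprod (f x) (g x)).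
Proof.
move=> /measurable_fun_tnthP mf /measurable_fun_tnthP mg.
apply: measurable_sum => i; apply: measurable_funM.
  exact: mf.
exact: mg.
Qed.

Lemma measurable_enorm d (T : measurableType d) n (f : T -> n.-tuple R) :
  measurable_fun setT f -> measurable_fun setT (fun x => enorm (f x)).
Proof.
move=> mf; apply: measurableT_comp (measurable_dotprod mf mf).
by apply: continuous_measurable_fun; exact: sqrt_continuous.
Qed.

Definition vaff n (a : R) (b x : n.-tuple R) : n.-tuple R :=
  [tuple a * tnth x i + tnth b i | i < n].

Lemma measurable_vaff n a (b : n.-tuple R) : measurable_fun setT (vaff a b).
Proof.
apply: measurable_mktuple => i; apply: measurable_funD => //.
by apply: measurable_funM => //; exact: measurable_tnth.
Qed.

Lemma vaff_cons n a (b : n.+1.-tuple R) x (v : n.-tuple R) :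
  vaff a b (cons_pair (x, v)) =
  cons_pair (a * x + tnth b ord0, vaff a [tuple tnth b (lift ord0 i) | i < n] v).
Proof.
apply: eq_from_tnth => i; rewrite tnth_mktuple.
case: (unliftP ord0 i) => [j|] ->.
  by rewrite !tnth_cons_pairS !tnth_mktuple.
by rewrite !tnth_cons_pair0.
Qed.

Definition vset n (u : n.-tuple R) (i : 'I_n) (x : R) : n.-tuple R :=
  [tuple if j == i then x else tnth u j | j < n].

Lemma measurable_vset n (u : n.-tuple R) (i : 'I_n) :
  measurable_fun setT (vset u i).
Proof.
apply: measurable_mktuple => j.
by case: (j == i); [exact: measurable_id|exact: measurable_cst].
Qed.

Lemma vset_cons0 n (a x : R) (v : n.-tuple R) :
  vset (cons_pair (a, v)) ord0 x = cons_pair (x, v).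
Proof.
apply: eq_from_tnth => i; rewrite tnth_mktuple.
case: (unliftP ord0 i) => [j|] ->; last by rewrite eqxx tnth_cons_pair0.
by rewrite !tnth_cons_pairS.
Qed.

Lemma vset_consS n (a x : R) (v : n.-tuple R) i :
  vset (cons_pair (a, v)) (lift ord0 i) x = cons_pair (a, vset v i x).
Proof.
apply: eq_from_tnth => j; rewrite tnth_mktuple.
case: (unliftP ord0 j) => [k|] ->; last by rewrite !tnth_cons_pair0.
by rewrite !tnth_cons_pairS tnth_mktuple (inj_eq lift_inj).
Qed.

End tuples.

Section lebesgue_line.
Local Open Scope ereal_scope.
Context {R : realType}.

Lemma lebesgue_affine (a b : R) (A : set R) : (a != 0)%R -> measurable A ->
  leb A = `|a|%:E * leb ((fun x : R => a * x + b)%R @^-1` A).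
Proof.
move=> a0 mA.
have mphi : measurable_fun setT
    ((fun x => a * x + b)%R : measurableTypeR R -> measurableTypeR R).
  by apply: measurable_funD => //; exact: measurable_funM.
rewrite -[RHS]/(pushforward (mscale (NngNum (normr_ge0 a)) (@leb R))
  ((fun x => a * x + b)%R : measurableTypeR R -> measurableTypeR R) A).
apply: lebesgue_measure_unique => //= _ [[p q]] _ <-.
rewrite /pushforward /mscale/=.
have [ap|an] : (0 < a \/ a < 0)%R by apply/orP; rewrite -neq_lt eq_sym.
- rewrite (_ : _ @^-1` _ = `](p - b) / a, (q - b) / a]%classic)%R; last first.
    apply/seteqP; split => x /=; rewrite !in_itv/=.
    + by rewrite ltr_pdivrMr// ler_pdivlMr// ltrBlDr lerBrDr ![(x * a)%R]mulrC.
    + by rewrite ltr_pdivrMr// ler_pdivlMr// ltrBlDr lerBrDr ![(x * a)%R]mulrC.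
  rewrite !lebesgue_measure_itv/= !lte_fin ltr_pM2r ?invr_gt0// ltrD2r.
  case: ifPn => _; last by rewrite mule0.
  rewrite -EFinD -EFinM gtr0_norm//; congr EFin.
  by field.
- rewrite (_ : _ @^-1` _ = `[(q - b) / a, (p - b) / a[%classic)%R; last first.
    apply/seteqP; split => x /=; rewrite !in_itv/=.
    + by rewrite ler_ndivrMr// ltr_ndivlMr// ltrBlDr lerBrDr ![(x * a)%R]mulrC andbC.
    + by rewrite ler_ndivrMr// ltr_ndivlMr// ltrBlDr lerBrDr ![(x * a)%R]mulrC andbC.
  rewrite !lebesgue_measure_itv/= !lte_fin ltr_nM2r ?invr_lt0// ltrD2r.
  case: ifPn => _; last by rewrite mule0.
  rewrite -EFinD -EFinM ltr0_norm//; congr EFin.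
  by field.
Qed.

Lemma ge0_integral_affine (a b : R) (F : R -> \bar R) : (a != 0)%R ->
  measurable_fun setT F -> (forall x, 0 <= F x) ->
  \int[leb]_x F (a * x + b)%R = `|a|^-1%:E * \int[leb]_x F x.
Proof.
move=> a0 mF F0.
have mphi : measurable_fun setT
    ((fun x => a * x + b)%R : measurableTypeR R -> measurableTypeR R).
  by apply: measurable_funD => //; exact: measurable_funM.
have := @ge0_integral_pushforward _ _ _ _ R _ mphi
  (mscale (NngNum (normr_ge0 a)) (@leb R)) setT F measurableT mF
  (fun y _ => F0 y).
rewrite preimage_setT ge0_integral_mscale//=; last exact: measurableT_comp.
move=> H; have -> : \int[leb]_x F x = `|a|%:E * \int[leb]_x F (a * x + b)%R.
  by rewrite -H; apply: eq_measure_integral => A mA _; exact: lebesgue_affine.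
by rewrite muleA -EFinM mulVf ?mul1e// normr_eq0.
Qed.

End lebesgue_line.

Section lebesgue_product.
Local Open Scope ereal_scope.
Context {R : realType}.

Lemma ge0_integral_cons n (F : n.+1.-tuple R -> \bar R) :
  measurable_fun setT F -> (forall x, 0 <= F x) ->
  \int[lam n.+1]_u F u = \int[leb]_x \int[lam n]_v F (cons_pair (x, v)).
Proof.
move=> mF F0.
have := @ge0_integral_pushforward _ _ _ _ R _ (@measurable_cons_pair R n)
  (@leb R \x lam n) setT F measurableT mF (fun y _ => F0 y).
rewrite preimage_setT => H.
transitivity (\int[@leb R \x lam n]_x (F \o (@cons_pair R n)) x).
  rewrite -H; by apply: eq_measure_integral; first exact: measurable_cons_pair.
rewrite fubini_tonelli1//.
  by apply: measurableT_comp => //; exact: measurable_cons_pair.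
by move=> x; exact: F0.
Qed.

Lemma measurable_cons_sect1 n (F : n.+1.-tuple R -> \bar R) x :
  measurable_fun setT F -> measurable_fun setT (fun v => F (cons_pair (x, v))).
Proof.
move=> mF; apply: measurableT_comp => //.
apply: (measurableT_comp (@measurable_cons_pair R n)); exact: pair1_measurable.
Qed.

Lemma measurable_cons_int1 n (F : n.+1.-tuple R -> \bar R) :
  measurable_fun setT F -> (forall x, 0 <= F x) ->
  measurable_fun setT (fun x : R => \int[lam n]_v F (cons_pair (x, v))).
Proof.
move=> mF F0; apply: (measurable_fun_fubini_tonelli_F (F \o @cons_pair R n)).
  by apply: measurableT_comp => //; exact: measurable_cons_pair.
by move=> x; exact: F0.
Qed.

Lemma measurable_cons_int2 n (F : n.+1.-tuple R -> \bar R) :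
  measurable_fun setT F -> (forall x, 0 <= F x) ->
  measurable_fun setT (fun v => \int[leb]_x F (cons_pair (x, v))).
Proof.
move=> mF F0; apply: (measurable_fun_fubini_tonelli_G (m1 := leb) (F \o @cons_pair R n)).
  by apply: measurableT_comp => //; exact: measurable_cons_pair.
by move=> x; exact: F0.
Qed.

Lemma ge0_integral_cons2 n (F : n.+1.-tuple R -> \bar R) :
  measurable_fun setT F -> (forall x, 0 <= F x) ->
  \int[lam n.+1]_u F u = \int[lam n]_v \int[leb]_x F (cons_pair (x, v)).
Proof.
move=> mF F0; rewrite ge0_integral_cons//.
apply: (fubini_tonelli (F \o @cons_pair R n)).
  by apply: measurableT_comp => //; exact: measurable_cons_pair.
by move=> x; exact: F0.
Qed.

Lemma ge0_integral_lam0 (F : 0.-tuple R -> \bar R) : measurable_fun setT F ->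
  \int[lam 0]_u F u = F [tuple].
Proof. by move=> mF /=; rewrite integral_dirac// diracT mul1e. Qed.

Lemma ge0_integral_vaff n (a : R) (b : n.-tuple R) (F : n.-tuple R -> \bar R) :
  (a != 0)%R -> measurable_fun setT F -> (forall x, 0 <= F x) ->
  \int[lam n]_x F (vaff a b x) = (`|a|^-1 ^+ n)%:E * \int[lam n]_x F x.
Proof.
move=> a0; elim: n b F => [|n IH] b F mF F0.
  rewrite expr0 mul1e !ge0_integral_lam0//.
    by rewrite (tuple0 (vaff a b [tuple])).
  by apply: measurableT_comp => //; exact: measurable_vaff.
rewrite ge0_integral_cons//; last first.
  by apply: measurableT_comp => //; exact: measurable_vaff.
under eq_integral => x _.
  under eq_integral => v _ do rewrite vaff_cons.
  rewrite (IH _ (fun v => F (cons_pair (a * x + tnth b ord0, v)%R)))//; last first.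
    exact: measurable_cons_sect1.
  over.
rewrite /=.
have maff : measurable_fun setT (fun x : R => a * x + tnth b ord0)%R.
  by apply: measurable_funD => //; exact: measurable_funM.
rewrite ge0_integralZl//=; last 2 first.
- exact: (measurableT_comp (measurable_cons_int1 mF F0) maff).
- by move=> x _; exact: integral_ge0.
rewrite (ge0_integral_affine (tnth b ord0) a0 (measurable_cons_int1 mF F0)); last first.
  by move=> x; exact: integral_ge0.
by rewrite ge0_integral_cons// muleA -EFinM -exprSr.
Qed.

Lemma measurable_eprod d (T : measurableType d) (I : Type) (r : seq I)
    (f : I -> T -> \bar R) : (forall i, measurable_fun setT (f i)) ->
  measurable_fun setT (fun x => \prod_(i <- r) f i x).
Proof.
move=> mf; elim: r => [|i r IH].
  by under eq_fun do rewrite big_nil; exact: measurable_cst.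
by under eq_fun do rewrite big_cons; exact: emeasurable_funM.
Qed.

Lemma ge0_integral_prod n (f : 'I_n -> R -> \bar R) :
  (forall i, measurable_fun setT (f i)) -> (forall i x, 0 <= f i x) ->
  \int[lam n]_u \prod_(i < n) f i (tnth u i) = \prod_(i < n) \int[leb]_x f i x.
Proof.
elim: n f => [|n IH] f mf f0.
  rewrite ge0_integral_lam0; first by rewrite !big_ord0.
  by under eq_fun do rewrite big_ord0; exact: measurable_cst.
have mP (m : nat) (g : 'I_m -> R -> \bar R) : (forall i, measurable_fun setT (g i)) ->
    measurable_fun setT (fun u : m.-tuple R => \prod_(i < m) g i (tnth u i)).
  move=> mg; apply: measurable_eprod => i.
  by apply: measurableT_comp => //; exact: measurable_tnth.
have P0 (m : nat) (g : 'I_m -> R -> \bar R) : (forall i x, 0 <= g i x) ->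
    forall u : m.-tuple R, 0 <= \prod_(i < m) g i (tnth u i).
  by move=> g0 u; apply: prode_ge0 => i _.
rewrite ge0_integral_cons//; [|exact: mP|exact: P0].
under eq_integral => x _.
  under eq_integral => v _.
    rewrite big_ord_recl tnth_cons_pair0.
    under eq_bigr do rewrite tnth_cons_pairS.
    over.
  rewrite ge0_integralZl//; [|exact: (mP n (fun i => f (lift ord0 i)))|].
    rewrite (IH (fun i => f (lift ord0 i)))//.
    over.
  by move=> v _; exact: (P0 n (fun i => f (lift ord0 i))).
rewrite /= ge0_integralZr//; [by rewrite big_ord_recl|exact: mf|].
by apply: prode_ge0 => i _; exact: integral_ge0.
Qed.

(** By Tonelli's theorem the other coordinates can be fixed one at a time, each
    at a point where the inner integral is again positive and finite. *)
Lemma exists_slice n (F : n.-tuple R -> \bar R) (i : 'I_n) :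
  measurable_fun setT F -> (forall x, 0 <= F x) ->
  0 < \int[lam n]_u F u < +oo ->
  exists u, 0 < \int[leb]_x F (vset u i x) < +oo.
Proof.
elim: n F i => [|n IH] F i mF F0; first by case: i.
case: (unliftP ord0 i) => [j|] -> H.
  move: H; rewrite ge0_integral_cons// => /exists_pos_fin[|x|x].
  - exact: measurable_cons_int1.
  - exact: integral_ge0.
  move=> /(IH (fun v => F (cons_pair (x, v))) j)[||u uP]//.
    exact: measurable_cons_sect1.
  exists (cons_pair (x, u)).
  by under eq_integral do rewrite vset_consS.
move: H; rewrite ge0_integral_cons2// => /exists_pos_fin[|v|v vP].
- exact: measurable_cons_int2.
- exact: integral_ge0.
exists (cons_pair (0%R, v)).
by under eq_integral do rewrite vset_cons0.
Qed.

End lebesgue_product.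

Section boxes.
Context {R : realType}.

Definition box n (a b : 'I_n -> R) : set (n.-tuple R) :=
  [set x | forall i, a i <= tnth x i <= b i].

Lemma measurable_box n (a b : 'I_n -> R) : measurable (box a b).
Proof.
have -> : box a b = \bigcap_(i in [set: 'I_n]) ((@tnth n R ^~ i) @^-1` `[a i, b i]%classic).
  apply/seteqP; split => x /=.
    by move=> H i _ /=; rewrite in_itv/=; exact: H.
  by move=> H i; have := H i I; rewrite /= in_itv/=.
apply: fin_bigcap_measurable => // i _.
by rewrite -[X in measurable X]setTI; apply: measurable_tnth.
Qed.

Lemma indic_box n (a b : 'I_n -> R) x :
  \1_(box a b) x = \prod_(i < n) \1_(`[a i, b i]%classic) (tnth x i) :> R.
Proof.
rewrite indicE; have [xb|xb] := boolP (x \in box a b).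
  rewrite big1// => i _; rewrite indicE mem_set//=.
  by move: xb; rewrite inE => /(_ i); rewrite in_itv.
have [i xi] : exists i, ~ (a i <= tnth x i <= b i).
  by apply/existsNP => H; move: xb; rewrite notin_setE.
by rewrite (bigD1 i)//= indicE memNset ?mul0r//= in_itv.
Qed.

Lemma lam_box n (a b : 'I_n -> R) : (lam n (box a b) < +oo)%E.
Proof.
rewrite -[box a b]setIT -integral_indic//; last exact: measurable_box.
under eq_integral do rewrite indic_box -prodEFin.
rewrite (ge0_integral_prod (f := fun i x => (\1_(`[a i, b i]%classic) x)%:E)).
- have H i : (\int[@leb R]_x (\1_(`[a i, b i]%classic) x)%:E =
      (if a i < b i then b i - a i else 0)%:E)%E.
    rewrite integral_indic// setIT; apply: etrans; first exact: lebesgue_measure_itv.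
    by rewrite /= lte_fin; case: ifP => // _; rewrite EFinD.
  by under eq_bigr do rewrite H; rewrite prodEFin ltry.
- by move=> i; apply/measurable_EFinP; exact: measurable_indic.
- by move=> i x; rewrite lee_fin.
Qed.

(** Boxes are stable under intersection and generate the measurable sets, and
    the cubes of integer half-side exhaust the space. *)
Lemma measure_unique_box n (m1 m2 : {measure set (n.-tuple R) -> \bar R}) :
  (forall a b, m1 (box a b) = m2 (box a b)) ->
  (forall a b, (m1 (box a b) < +oo)%E) ->
  forall A, measurable A -> m1 A = m2 A.
Proof.
move=> m12 m1oo.
pose G : set (set (n.-tuple R)) := [set B | exists a b, B = box a b].
apply: (measure_unique G (fun k => box (fun=> - k%:R) (fun=> k%:R))).
- apply/seteqP; split; last first.
    apply: smallest_sub; first exact: sigma_algebra_measurable.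
    by move=> _ [a [b ->]]; exact: measurable_box.
  move=> A mA.
  have mid : measurable_fun setT (id : g_sigma_algebraType G -> n.-tuple R).
    apply/measurable_fun_tnthP => i.
    apply: (@measurability _ _ _ _ _ _ (@RGenCInfty.G R)).
      exact: RGenCInfty.measurableE.
    move=> _ [_ [a ->] <-]; rewrite setTI.
    have -> : (@tnth n R ^~ i \o (id : g_sigma_algebraType G -> n.-tuple R))
        @^-1` `[a, +oo[%classic =
      \bigcup_k box (fun j => if j == i then a else - k%:R) (fun=> k%:R).
      apply/seteqP; split => x /=.
        rewrite in_itv/= andbT => ax.
        pose S := \sum_(j < n) `|tnth x j|.
        have xS j : `|tnth x j| <= S.
          by rewrite /S (bigD1 j)//= lerDl sumr_ge0.
        exists (Num.bound S) => // j /=.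
        have Sk : S <= (Num.bound S)%:R by apply/ltW/archi_boundP; rewrite sumr_ge0.
        have := le_trans (xS j) Sk; rewrite ler_norml => /andP[p q].
        by rewrite q andbT; case: eqP => [->|].
      move=> [k _ /(_ i)]/=; rewrite eqxx in_itv/= andbT.
      by move=> /andP[].
    apply: bigcupT_measurable => k; apply: sub_sigma_algebra.
    by eexists; eexists; reflexivity.
  by have := mid measurableT _ mA; rewrite setTI.
- move=> _ _ [a [b ->]] [a' [b' ->]].
  exists (fun i => Num.max (a i) (a' i)), (fun i => Num.min (b i) (b' i)).
  apply/seteqP; split => x /=.
    by move=> [H H'] i; rewrite ge_max le_min; have /andP[-> ->] := H i; exact: H'.
  by move=> H; split => i; have := H i; rewrite ge_max le_min;
    move=> /andP[/andP[p q] /andP[p' q']]; apply/andP.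
- by move=> k; eexists; eexists; reflexivity.
- apply/seteqP; split => // x _.
  pose S := \sum_(j < n) `|tnth x j|.
  have xS j : `|tnth x j| <= S.
    by rewrite /S (bigD1 j)//= lerDl sumr_ge0.
  exists (Num.bound S) => // j /=.
  have Sk : S <= (Num.bound S)%:R by apply/ltW/archi_boundP; rewrite sumr_ge0.
  by have := le_trans (xS j) Sk; rewrite ler_norml.
- by move=> _ [a [b ->]]; exact: m12.
- by move=> k; exact: m1oo.
Qed.

End boxes.

Section cone.
Local Open Scope ereal_scope.
Context {R : realType}.

(** Projective coordinates, namely the slope [v] and the first coordinate [r].
    They serve as polar coordinates without a measure on the sphere. *)
Definition cone n (r : R) (v : n.-tuple R) : n.+1.-tuple R :=
  cons_pair (r, [tuple r * tnth v i | i < n])%R.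

Lemma coneE n r (v : n.-tuple R) : cone r v = cons_pair (r, vaff r [tuple 0 | i < n] v)%R.
Proof.
congr cons_pair; congr pair; apply: eq_from_tnth => i.
by rewrite !tnth_mktuple addr0.
Qed.

Lemma measurable_cone n : measurable_fun setT
  (fun x : measurableTypeR R * n.-tuple R => cone x.1 x.2).
Proof.
apply: measurable_cons; first exact: measurable_fst.
apply: measurable_mktuple => i; apply: measurable_funM; first exact: measurable_fst.
apply: (measurableT_comp (measurable_tnth i)); exact: measurable_snd.
Qed.

(** At fixed nonzero [r] the substitution of [r v] for the last [n] coordinates
    has Jacobian [|r| ^+ n]. *)
Lemma ge0_integral_cone n (F : n.+1.-tuple R -> \bar R) :
  measurable_fun setT F -> (forall x, 0 <= F x) ->
  \int[lam n.+1]_u F u =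
  \int[lam n]_v \int[leb]_r (F (cone r v) * (`|r| ^+ n)%:E).
Proof.
move=> mF F0; rewrite ge0_integral_cons//.
have mC : measurable_fun setT
    (fun x : measurableTypeR R * n.-tuple R => F (cone x.1 x.2) * (`|x.1| ^+ n)%:E).
  apply: emeasurable_funM.
    by apply: measurableT_comp => //; exact: measurable_cone.
  apply/measurable_EFinP; apply: measurable_funX.
  by apply: measurableT_comp => //; exact: measurable_fst.
rewrite -(fubini_tonelli (m1 := leb) (fun x : measurableTypeR R * n.-tuple R =>
    F (cone x.1 x.2) * (`|x.1| ^+ n)%:E))//=; last first.
  by move=> x; rewrite mule_ge0// lee_fin exprn_ge0.
apply: ge0_ae_eq_integral => //.
- exact: measurable_cons_int1.
- apply: (measurable_fun_fubini_tonelli_F (m2 := lam n) (fun x : measurableTypeR R * n.-tuple R =>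
    F (cone x.1 x.2) * (`|x.1| ^+ n)%:E)) => //.
  by move=> x; rewrite mule_ge0// lee_fin exprn_ge0.
- by move=> x _; exact: integral_ge0.
- by move=> x _; apply: integral_ge0 => v _; rewrite mule_ge0// lee_fin exprn_ge0.
exists [set 0%R]; split; [exact: measurable_set1|exact: lebesgue_measure_set1|].
move=> r /=; apply: contra_notP => /eqP r0 _.
rewrite ge0_integralZr//; last first.
  apply: measurableT_comp => //.
  exact: (measurableT_comp (@measurable_cone n) (pair1_measurable r)).
under [X in _ = X * _]eq_integral do rewrite coneE.
rewrite (ge0_integral_vaff [tuple 0%R | i < n] r0
  (F := fun v => F (cons_pair (r, v))))//; last exact: measurable_cons_sect1.
rewrite muleC muleA -EFinM -exprMn divff ?normr_eq0// expr1n mul1e//.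
Qed.

End cone.

Section rotation.
Local Open Scope ereal_scope.
Context {R : realType}.

(** An affine substitution in the second variable at a fixed value of the first,
    then one in the first variable at a fixed value of the second. *)
Lemma ge0_integral_rot (c s : R) (F : R -> R -> \bar R) :
  (c ^+ 2 + s ^+ 2 = 1)%R ->
  measurable_fun setT (fun z : R * R => F z.1 z.2) -> (forall x y, 0 <= F x y) ->
  \int[leb]_x \int[leb]_y F (c * x - s * y)%R (s * x + c * y)%R =
  \int[leb]_x \int[leb]_y F x y.
Proof.
move=> cs mF F0.
have msec (f g : R -> R) : measurable_fun setT f -> measurable_fun setT g ->
    measurable_fun setT (fun y => F (f y) (g y)).
  by move=> mf mg; apply: (measurableT_comp mF (measurable_fun_pair mf mg)).
have mlin (a b : R) : measurable_fun setT (fun y : R => a + b * y)%R.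
  by apply: measurable_funD => //; exact: measurable_funM.
have swap (G : R -> R -> \bar R) : measurable_fun setT (fun z : R * R => G z.1 z.2) ->
    (forall x y, 0 <= G x y) ->
    \int[leb]_x \int[leb]_y G x y = \int[leb]_y \int[leb]_x G x y.
  move=> mG G0; exact: (@fubini_tonelli _ _ (measurableTypeR R) (measurableTypeR R)
    R leb leb (fun z => G z.1 z.2) mG (fun z => G0 z.1 z.2)).
have mint2 (G : R -> R -> \bar R) : measurable_fun setT (fun z : R * R => G z.1 z.2) ->
    (forall x y, 0 <= G x y) -> measurable_fun setT (fun y : R => \int[leb]_x G x y).
  move=> mG G0; exact: (@measurable_fun_fubini_tonelli_G _ _ (measurableTypeR R)
    (measurableTypeR R) R leb (fun z => G z.1 z.2) mG (fun z => G0 z.1 z.2)).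
have mint1 (G : R -> R -> \bar R) : measurable_fun setT (fun z : R * R => G z.1 z.2) ->
    (forall x y, 0 <= G x y) -> measurable_fun setT (fun x : R => \int[leb]_y G x y).
  move=> mG G0; exact: (@measurable_fun_fubini_tonelli_F _ _ (measurableTypeR R)
    (measurableTypeR R) R leb (fun z => G z.1 z.2) mG (fun z => G0 z.1 z.2)).
have [c0|c0] := eqVneq c 0%R.
  (* For a quarter turn the first substitution is singular; the variables are swapped. *)
  have s0 : (s != 0)%R.
    by apply/eqP => s0; move: cs; rewrite c0 s0 !expr0n/= addr0 => /eqP; rewrite eq_sym oner_eq0.
  have ns : `|s|%R = 1%R.
    have : (`|s| ^+ 2 = 1)%R by rewrite real_normK ?num_real//; move: cs; rewrite c0 expr0n add0r.
    by move=> /eqP; rewrite sqrf_eq1 => /orP[/eqP//|/eqP H]; have := normr_ge0 s; rewrite H ler0N1.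
  have E1 x : \int[leb]_y F (c * x - s * y)%R (s * x + c * y)%R =
      \int[leb]_y F y (s * x + 0)%R.
    transitivity (\int[leb]_y (fun y => F y (s * x + 0)%R) (- s * y + 0)%R).
      by apply: eq_integral => y _; rewrite c0; congr F; ring.
    have sn0 : (- s != 0)%R by rewrite oppr_eq0.
    rewrite (ge0_integral_affine 0 sn0 (F := fun y => F y (s * x + 0)%R))//.
      by rewrite normrN ns invr1 mul1e.
    exact: msec.
  under eq_integral do rewrite E1.
  rewrite (ge0_integral_affine 0 s0 (F := fun t => \int[leb]_y F y t))//.
  - by rewrite ns invr1 mul1e; rewrite -swap.
  - exact: mint2.
  - by move=> t; exact: integral_ge0.
have E1 x : \int[leb]_y F (c * x - s * y)%R (s * x + c * y)%R =
    `|c|^-1%:E * \int[leb]_y F (c^-1 * x - s / c * y)%R y.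
  rewrite -(ge0_integral_affine (s * x) c0 (F := fun y => F (c^-1 * x - s / c * y)%R y))//.
    apply: eq_integral => y _; congr F; last by rewrite addrC.
    transitivity ((c ^+ 2 + s ^+ 2) / c * x - s * y - s ^+ 2 / c * x)%R.
      by field.
    rewrite cs; by field.
  by apply: msec => //; under eq_fun do rewrite -mulNr; exact: mlin.
under eq_integral do rewrite E1.
have mG2 : measurable_fun setT (fun z : R * R => F (c^-1 * z.1 - s / c * z.2)%R z.2).
  have mp : measurable_fun setT (fun z : R * R => (c^-1 * z.1 - s / c * z.2, z.2)%R).
    by apply: measurable_fun_pair => //=; apply: measurable_funB; apply: measurable_funM.
  exact: (measurableT_comp mF mp).
rewrite ge0_integralZl//; last 2 first.
- exact: (mint1 (fun x y => F (c^-1 * x - s / c * y)%R y)).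
- by move=> x _; exact: integral_ge0.
rewrite (swap (fun x y => F (c^-1 * x - s / c * y)%R y))//.
have E2 y : \int[leb]_x F (c^-1 * x - s / c * y)%R y = `|c|%:E * \int[leb]_x F x y.
  have cV0 : (c^-1 != 0)%R by rewrite invr_eq0.
  rewrite (ge0_integral_affine (- (s / c * y)) cV0 (F := fun x => F x y))//.
    by rewrite normfV invrK.
  exact: msec.
under eq_integral do rewrite E2.
rewrite ge0_integralZl//; last 2 first.
- exact: mint2.
- by move=> x _; exact: integral_ge0.
have mp2 : measurable_fun setT (fun z : R * R => (z.2, z.1)).
  by apply: measurable_fun_pair.
rewrite muleA -EFinM mulVf ?normr_eq0// mul1e -swap//.
exact: (measurableT_comp mF mp2).
Qed.

End rotation.

(** * Signed changes of variables *)

Section real_change.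
Context {R : realType}.

Section affine.
Variables (a b : R) (f : R -> R).
Hypotheses (a0 : a != 0) (fi : L1 leb f).

Let maff : measurable_fun setT (fun x : measurableTypeR R => a * x + b : measurableTypeR R).
Proof. by apply: measurable_funD => //; exact: measurable_funM. Qed.

Let chg F : measurable_fun setT F -> (forall x : R, (0 <= F x)%E) ->
  (\int[leb]_x F (a * x + b)%R = (`|a|^-1)%:E * \int[leb]_x F x)%E.
Proof. by move=> mF F0; exact: ge0_integral_affine. Qed.

Lemma L1_affine : L1 leb (fun x => f (a * x + b)).
Proof.
by apply: (change_L1 maff _ chg fi); rewrite invr_ge0.
Qed.

Lemma Rint_affine : \int[leb]_x f (a * x + b) = `|a|^-1 * \int[leb]_x f x.
Proof.
by apply: (change_Rint maff _ chg fi); rewrite invr_ge0.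
Qed.

End affine.

Section vaff.
Variables (n : nat) (a : R) (b : n.-tuple R) (f : n.-tuple R -> R).
Hypotheses (a0 : a != 0) (fi : L1 (lam n) f).

Let chg F : measurable_fun setT F -> (forall x, (0 <= F x)%E) ->
  (\int[lam n]_x F (vaff a b x) = (`|a|^-1 ^+ n)%:E * \int[lam n]_x F x)%E.
Proof. by move=> mF F0; exact: ge0_integral_vaff. Qed.

Lemma L1_vaff : L1 (lam n) (fun x => f (vaff a b x)).
Proof.
apply: (change_L1 (measurable_vaff a b) _ chg fi).
by rewrite exprn_ge0// invr_ge0.
Qed.

Lemma Rint_vaff : \int[lam n]_x f (vaff a b x) = `|a|^-1 ^+ n * \int[lam n]_x f x.
Proof.
apply: (change_Rint (measurable_vaff a b) _ chg fi).
by rewrite exprn_ge0// invr_ge0.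
Qed.

End vaff.

Section cons.
Variables (n : nat) (f : n.+1.-tuple R -> R) (A : R -> R) (B : n.-tuple R -> R).
Hypotheses (mf : measurable_fun setT f) (iA : L1 leb A) (iB : L1 (lam n) B).
Hypothesis fAB : forall x v, `|f (cons_pair (x, v))| <= A x * B v.

Let mcf : measurable_fun setT
  (fun z : measurableTypeR R * n.-tuple R => f (cons_pair (z.1, z.2))).
Proof.
apply: measurableT_comp => //.
by under eq_fun do rewrite -surjective_pairing; exact: measurable_cons_pair.
Qed.

Lemma L1_cons : L1 (lam n.+1) f.
Proof.
have mabs : measurable_fun setT (fun u => `|f u|%:E).
  by apply/measurable_EFinP; exact: measurableT_comp.
apply/integrableP; split; first exact/measurable_EFinP.
rewrite /= (ge0_integral_cons (F := fun u => `|f u|%:E))//.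
have mE : measurable_fun setT (fun z : measurableTypeR R * n.-tuple R =>
    (f (cons_pair (z.1, z.2)))%:E) by exact/measurable_EFinP.
exact: ((integrable12ltyP leb (lam n) mE).1
  (L1_prod (m1 := @leb R) (m2 := lam n) mcf iA iB fAB)).
Qed.

Lemma Rint_cons : \int[lam n.+1]_u f u = \int[leb]_x \int[lam n]_v f (cons_pair (x, v)).
Proof.
have chg (F : n.+1.-tuple R -> \bar R) : measurable_fun setT F ->
    (forall x, (0 <= F x)%E) -> (\int[leb \x lam n]_z F (cons_pair z) = 1%:E * \int[lam n.+1]_u F u)%E.
  move=> mF F0; rewrite mul1e ge0_integral_cons//.
  apply: (fubini_tonelli1 (F \o @cons_pair R n)) => //.
    by apply: measurableT_comp => //; exact: measurable_cons_pair.
  by move=> z; exact: F0.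
have := change_Rint (@measurable_cons_pair R n) ler01 chg L1_cons.
rewrite mul1r => <-.
have := integral12_prod_meas1 (L1_prod (m1 := @leb R) mcf iA iB fAB).
move=> E; transitivity (fine (\int[leb \x lam n]_z (f (cons_pair (z.1, z.2)))%:E)%E).
  by congr fine; apply: eq_integral => -[x v] _.
rewrite -E; congr fine; apply: eq_integral => x _.
by rewrite EFin_Rintegral//; exact: (L1_section1 mcf iB fAB).
Qed.

End cons.

Lemma Rint_odd (f : R -> R) : L1 leb f -> (forall x, f (- x) = - f x) ->
  \int[leb]_x f x = 0.
Proof.
move=> fi fodd; have n1 : (-1 : R) != 0 by rewrite oppr_eq0 oner_eq0.
have := Rint_affine 0 n1 fi.
rewrite (eq_Rint leb (g := fun x => -1 * f x)); last first.
  by move=> x; rewrite addr0 !mulN1r fodd.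
rewrite RintZl// normrN normr1 invr1 mul1r mulN1r => /eqP.
by rewrite eq_sym -addr_eq0 -mulr2n mulrn_eq0/= => /eqP.
Qed.

End real_change.

Section trig.
Context {R : realType}.

Lemma measurable_cos d (T : measurableType d) (f : T -> R) :
  measurable_fun setT f -> measurable_fun setT (fun x => cos (f x)).
Proof.
move=> mf; apply: measurableT_comp mf.
by apply: continuous_measurable_fun; exact: continuous_cos.
Qed.

Lemma measurable_sin d (T : measurableType d) (f : T -> R) :
  measurable_fun setT f -> measurable_fun setT (fun x => sin (f x)).
Proof.
move=> mf; apply: measurableT_comp mf.
by apply: continuous_measurable_fun; exact: continuous_sin.
Qed.

Lemma measurable_inv_ge0 d (T : measurableType d) (f : T -> R) :
  measurable_fun setT f -> (forall x, 0 <= f x) ->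
  measurable_fun setT (fun x => (f x)^-1).
Proof.
move=> mf f0; under eq_fun do rewrite -powR_inv1 ?f0//.
exact: (measurableT_comp (@measurable_powR R (-1)) mf).
Qed.

Lemma Rint_FTC (F f : R -> R) (a b : R) : a <= b ->
  (forall x : R, is_derive x (1 : R) F (f x)) -> continuous f ->
  \int[leb]_(x in `[a, b]) f x = F b - F a.
Proof.
rewrite le_eqVlt => /predU1P[->|ab] dF cf.
  by rewrite set_itv1 Rintegral_set1 subrr.
have cF : continuous F.
  move=> x; apply: differentiable_continuous; apply/derivable1_diffP.
  exact: @ex_derive _ _ _ _ _ _ _ (dF x).
rewrite /Rintegral (continuous_FTC2 (F := F) ab)//.
- exact: continuous_subspaceT.
- split; first by move=> x _; exact: @ex_derive _ _ _ _ _ _ _ (dF x).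
  + by apply: cvg_at_right_filter; exact: cF.
  + by apply: cvg_at_left_filter; exact: cF.
- by move=> x _; rewrite derive1E; exact: @derive_val _ _ _ _ _ _ _ (dF x).
Qed.

Lemma L1_bounded_supp (f : R -> R) (a b C : R) : measurable_fun setT f ->
  (forall x, `|f x| <= C) -> (forall x, x \notin `[a, b] -> f x = 0) -> L1 leb f.
Proof.
move=> mf fC f0.
have ii : L1 (@leb R) (fun x => \1_(`[a, b]%classic) x).
  by have := integrable_indic_itv a b true false; apply.
have C0 : 0 <= C by rewrite (le_trans _ (fC 0)).
apply: (@L1_le _ _ _ (@leb R) f (fun x => C * \1_(`[a, b]%classic) x) mf) => [|x].
  exact: L1Zl.
rewrite indicE.
have [xab|xab] := boolP (x \in `[a, b]).
  by rewrite mem_set// mulr1.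
by rewrite f0// normr0 mulr_ge0.
Qed.

End trig.

(** * The Fejer kernel *)
Section fejer.
Context {R : realType}.
Implicit Types x v : R.

Definition tent x : R := Num.max 0 (1 - `|x|).
Definition fejer v : R := \int[leb]_x (tent x * cos (v * x)).

Lemma tent_ge0 x : 0 <= tent x. Proof. by rewrite le_max lexx. Qed.

Lemma tent_le1 x : tent x <= 1.
Proof. by rewrite ge_max ler01 gerBl normr_ge0. Qed.

Lemma tentN x : tent (- x) = tent x. Proof. by rewrite /tent normrN. Qed.

Lemma tent_out x : 1 <= `|x| -> tent x = 0.
Proof. by move=> x1; apply/max_idPl; rewrite subr_le0. Qed.

Lemma tent_in x : `|x| <= 1 -> tent x = 1 - `|x|.
Proof. by move=> x1; apply/max_idPr; rewrite subr_ge0. Qed.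

Lemma measurable_tent : measurable_fun setT tent.
Proof.
by apply: measurable_maxr => //; exact: measurable_funB.
Qed.

Lemma L1_tent : L1 leb tent.
Proof.
apply: (@L1_bounded_supp _ _ (-1) 1 1); first exact: measurable_tent.
  by move=> x; rewrite ger0_norm ?tent_ge0// tent_le1.
move=> x; rewrite in_itv/= -ler_norml -ltNge => /ltW; exact: tent_out.
Qed.

Lemma L1_tent_cos v : L1 leb (fun x => tent x * cos (v * x)).
Proof.
apply: (L1_le _ L1_tent).
  apply: measurable_funM; first exact: measurable_tent.
  by apply: measurable_cos; exact: measurable_funM.
move=> x; rewrite normrM ger0_norm ?tent_ge0//.
by rewrite ler_piMr ?tent_ge0// cos_max.
Qed.

Let tent_split v : fejer v =
  \int[leb]_(x in `[-1, 0]) ((1 + x) * cos (v * x)) +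
  \int[leb]_(x in `[0, 1]) ((1 - x) * cos (v * x)).
Proof.
have it := L1_tent_cos v.
have -> : fejer v = \int[leb]_(x in `[-1, 1]) (tent x * cos (v * x)).
  rewrite /fejer [RHS]Rintegral_mkcond; apply: eq_Rint => x; rewrite patchE.
  case: ifPn => // xn; rewrite tent_out ?mul0r//.
  by move: xn; rewrite notin_setE/= in_itv/= -ler_norml => /negP; rewrite -ltNge => /ltW.
have H := @Rintegral_itvB R (fun x => tent x * cos (v * x)) (BLeft (-1)) (BRight 1) 0 _ _ _.
rewrite -[LHS](subrK (\int[leb]_(x in `[-1, 0]) (tent x * cos (v * x)))) H; last 3 first.
- exact: integrableS it.
- by rewrite bnd_simp; lra.
- by rewrite bnd_simp.
rewrite addrC; congr (_ + _).
  apply: eq_Rint_in => x; rewrite /= in_itv/= => /andP[x1 x0].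
  rewrite tent_in ler0_norm//; first by congr (_ * _); ring.
  by lra.
rewrite Rintegral_itv_obnd_cbnd; last exact: integrableS it.
apply: eq_Rint_in => x; rewrite /= in_itv/= => /andP[x1 x0].
by rewrite tent_in ger0_norm.
Qed.

Lemma fejer0 : fejer 0 = 1.
Proof.
rewrite tent_split.
rewrite (eq_Rint_in leb (g := fun x => 1 + x)); last first.
  by move=> x _; rewrite mul0r cos0 mulr1.
rewrite [X in _ + X](eq_Rint_in leb (g := fun x => 1 - x)); last first.
  by move=> x _; rewrite mul0r cos0 mulr1.
have d1 x : is_derive x (1 : R) (fun x : R => x + x ^+ 2 / 2) (1 + x).
  by apply: is_derive_eq; rewrite /GRing.scale/=; field.
have d2 x : is_derive x (1 : R) (fun x : R => x - x ^+ 2 / 2) (1 - x).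
  by apply: is_derive_eq; rewrite /GRing.scale/=; field.
rewrite (Rint_FTC _ d1); last 2 first.
- by lra.
- by move=> x; apply: cvgD; [exact: cvg_cst|exact: cvg_id].
rewrite (Rint_FTC _ d2); last 2 first.
- by lra.
- by move=> x; apply: cvgB; [exact: cvg_cst|exact: cvg_id].
by field.
Qed.

Let continuous_cosM v : continuous (fun x : R => cos (v * x)).
Proof.
move=> x; apply: (@cvg_comp _ _ _ (fun x => v * x) cos); last exact: continuous_cos.
exact: cvgMr.
Qed.

Lemma fejerE v : v != 0 -> fejer v = 2 * (1 - cos v) / v ^+ 2.
Proof.
move=> v0; rewrite tent_split.
have d1 x : is_derive x (1 : R)
    (fun x : R => (1 + x) * sin (v * x) / v + cos (v * x) / v ^+ 2) ((1 + x) * cos (v * x)).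
  by apply: is_derive_eq; rewrite /GRing.scale/=; field.
have d2 x : is_derive x (1 : R)
    (fun x : R => (1 - x) * sin (v * x) / v - cos (v * x) / v ^+ 2) ((1 - x) * cos (v * x)).
  by apply: is_derive_eq; rewrite /GRing.scale/=; field.
rewrite (Rint_FTC _ d1); last 2 first.
- by lra.
- move=> x; apply: cvgM; last exact: continuous_cosM.
  by apply: cvgD; [exact: cvg_cst|exact: cvg_id].
rewrite (Rint_FTC _ d2); last 2 first.
- by lra.
- move=> x; apply: cvgM; last exact: continuous_cosM.
  by apply: cvgB; [exact: cvg_cst|exact: cvg_id].
rewrite !mulr0 !mulr1 mulrN1 cosN cos0 sin0; by field.
Qed.

Lemma fejer_ge0 v : 0 <= fejer v.
Proof.
have [->|v0] := eqVneq v 0; first by rewrite fejer0.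
by rewrite fejerE// divr_ge0 ?sqr_ge0// mulr_ge0// subr_ge0 cos_le1.
Qed.

Lemma fejerN v : fejer (- v) = fejer v.
Proof.
have [->|v0] := eqVneq v 0; first by rewrite oppr0.
by rewrite !fejerE ?oppr_eq0// cosN sqrrN.
Qed.

Lemma fejer_le1 v : fejer v <= 1.
Proof.
rewrite -fejer0; apply: le_Rint; [exact: L1_tent_cos..|move=> x].
by rewrite mul0r cos0 ler_wpM2l ?tent_ge0// cos_le1.
Qed.

Lemma cos_ge v : 1 - v ^+ 2 / 2 <= cos v.
Proof.
have [->|v0] := eqVneq v 0; first by rewrite cos0 expr0n/= mul0r subr0.
have := fejer_le1 v; rewrite fejerE// ler_pdivrMr ?exprn_even_gt0//; lra.
Qed.

Lemma fejer_ge v : 1 - v ^+ 2 / 2 <= fejer v.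
Proof.
have E : 1 - v ^+ 2 / 2 = \int[leb]_x ((1 - v ^+ 2 / 2) * tent x).
  rewrite RintZl; last exact: L1_tent.
  rewrite (_ : \int[leb]_x tent x = 1) ?mulr1// -fejer0.
  by apply: eq_Rint => x; rewrite mul0r cos0 mulr1.
rewrite {1}E; apply: le_Rint; [apply: L1Zl; exact: L1_tent|exact: L1_tent_cos|move=> x].
have [x1|x1] := leP 1 `|x|; first by rewrite tent_out// mulr0 mul0r.
rewrite mulrC ler_wpM2l ?tent_ge0//; apply: le_trans (cos_ge (v * x)).
have : x ^+ 2 <= 1 by rewrite -real_normK ?num_real// exprn_ile1// ltW.
have := sqr_ge0 v; rewrite exprMn; nra.
Qed.

Lemma measurable_fejer : measurable_fun setT fejer.
Proof.
have -> : fejer = fun v => if v == 0 then 1 else 2 * (1 - cos v) / v ^+ 2.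
  by apply/funext => v; case: eqVneq => [->|v0]; [exact: fejer0|exact: fejerE].
apply: measurable_fun_ifT => //=.
- by apply: measurable_fun_eqr.
- apply: measurable_funM; last first.
    by apply: measurable_inv_ge0; [exact: measurable_funX|move=> x; exact: sqr_ge0].
  apply: measurable_funM => //; apply: measurable_funB => //; exact: measurable_cos.
Qed.

Lemma L1_cauchy_density : L1 (@leb R) (fun x => (oneDsqr x)^-1).
Proof.
apply: ge0_L1.
- by apply: continuous_measurable_fun; exact: continuous_oneDsqrV.
- by move=> x; rewrite invr_ge0 (le_trans ler01)// oneDsqr_ge1.
rewrite (@ge0_symfun_integralT _ (fun x => (oneDsqr x)^-1)).
- by rewrite -set_itvcy integral0y_oneDsqr -EFinM ltry.
- by move=> x; rewrite invr_ge0 (le_trans ler01)// oneDsqr_ge1.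
- exact: continuous_oneDsqrV.
- by move=> x /=; rewrite /oneDsqr sqrrN.
Qed.

Lemma fejer_decay v : fejer v <= 5 / oneDsqr v.
Proof.
rewrite ler_pdivlMr; last by rewrite (lt_le_trans ltr01)// oneDsqr_ge1.
rewrite /oneDsqr mulrDr mulr1.
have := fejer_le1 v.
have : fejer v * v ^+ 2 <= 4.
  have [->|v0] := eqVneq v 0; first by rewrite expr0n/= mulr0.
  rewrite fejerE// divfK ?sqrf_eq0//.
  have := cos_geN1 v; lra.
by lra.
Qed.

Lemma L1_fejer : L1 leb fejer.
Proof.
apply: (@L1_le _ _ _ (@leb R) fejer (fun x => 5 * (oneDsqr x)^-1)) => [||v].
- exact: measurable_fejer.
- exact: L1Zl L1_cauchy_density.
by rewrite ger0_norm ?fejer_ge0// fejer_decay.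
Qed.

Lemma L1_fejer_cos x : L1 leb (fun u => fejer u * cos (u * x)).
Proof.
apply: (L1_le _ L1_fejer).
  apply: measurable_funM; first exact: measurable_fejer.
  by apply: measurable_cos; exact: measurable_funM.
move=> u; rewrite normrM ger0_norm ?fejer_ge0//.
by rewrite ler_piMr ?fejer_ge0// cos_max.
Qed.

Definition fejer_mass : R := \int[leb]_u fejer u.

Lemma fejer_mass_gt0 : 0 < fejer_mass.
Proof.
have ii : L1 (@leb R) (fun x => \1_(`[0, 1]%classic) x).
  by have := integrable_indic_itv 0 1 true false; apply.
have : 2^-1 * \int[@leb R]_x \1_(`[0, 1]%classic) x <= fejer_mass.
  rewrite -RintZl//; apply: le_Rint; [exact: L1Zl|exact: L1_fejer|move=> x].
  rewrite indicE; case: (boolP (x \in _)) => [|_]; last by rewrite mulr0 fejer_ge0.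
  rewrite inE/= in_itv/= mulr1 => /andP[x0 x1]; apply: le_trans (fejer_ge x).
  by nra.
apply: lt_le_trans; rewrite /Rintegral integral_indic// setIT.
rewrite mulr_gt0 ?invr_gt0// (_ : fine _ = 1)//.
rewrite -[RHS]/(fine 1%E); congr fine; apply: etrans; first exact: lebesgue_measure_itv.
by rewrite /= lte_fin ltr01 oppr0 addr0.
Qed.

(* [cosint a] is the integral of (1 - cos (a u)) / u ^ 2; scaling shows that it
   is proportional to |a|. *)
Let cosint a := \int[leb]_u (a ^+ 2 / 2 * fejer (a * u)).

Let L1_cosint a : L1 leb (fun u => a ^+ 2 / 2 * fejer (a * u)).
Proof.
have [->|a0] := eqVneq a 0.
  by apply: eq_integrable (L1_0 leb) => // x _; rewrite expr0n/= mul0r mul0r.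
apply: L1Zl; have := L1_affine 0 a0 L1_fejer.
by under eq_fun do rewrite addr0.
Qed.

Let cosintE a : cosint a = `|a| * (fejer_mass / 2).
Proof.
have [->|a0] := eqVneq a 0.
  rewrite /cosint normr0 mul0r (eq_Rint leb (g := fun=> 0)) ?Rint0// => x.
  by rewrite expr0n/= !mul0r.
rewrite /cosint RintZl; last first.
  by have := L1_affine 0 a0 L1_fejer; under eq_fun do rewrite addr0.
rewrite (eq_Rint leb (g := fun u => fejer (a * u + 0))); last first.
  by move=> u; rewrite addr0.
rewrite (Rint_affine 0 a0 L1_fejer) -/fejer_mass -(real_normK (num_real a)).
by field; rewrite normr_eq0.
Qed.

(** Expanding the product of cosines turns the left side into a second
    difference of [cosint], hence of the absolute value. *)
Lemma fejer_inversion x : \int[leb]_u (fejer u * cos (u * x)) = fejer_mass * tent x.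
Proof.
have -> : fejer_mass * tent x = cosint (1 + x) + cosint (1 - x) - 2 * cosint x.
  rewrite !cosintE.
  have [x1|x1] := leP 1 `|x|.
    rewrite tent_out// mulr0; move: x1; rewrite ler_normr => /orP[x1|x1].
      have -> : `|x| = x by rewrite ger0_norm; lra.
      have -> : `|1 + x| = 1 + x by rewrite ger0_norm; lra.
      have -> : `|1 - x| = x - 1 by rewrite ler0_norm; lra.
      by ring.
    have -> : `|x| = - x by rewrite ler0_norm; lra.
    have -> : `|1 + x| = - 1 - x by rewrite ler0_norm; lra.
    have -> : `|1 - x| = 1 - x by rewrite ger0_norm; lra.
    by ring.
  rewrite tent_in ?(ltW x1)//; move: x1; rewrite ltr_norml => /andP[xl xr].
  have -> : `|1 + x| = 1 + x by rewrite ger0_norm; lra.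
  have -> : `|1 - x| = 1 - x by rewrite ger0_norm; lra.
  by field.
rewrite /cosint -RintD// -RintZl// -RintB//; last 2 first.
- exact: L1D.
- exact: L1Zl.
apply: eq_Rint => u; have [->|u0] := eqVneq u 0.
  by rewrite !mulr0 mul0r cos0 fejer0; field.
have E a : a ^+ 2 / 2 * fejer (a * u) = (1 - cos (a * u)) / u ^+ 2.
  have [->|a0] := eqVneq a 0; first by rewrite expr0n/= !mul0r cos0 subrr mul0r.
  by rewrite fejerE ?mulf_neq0//; field; rewrite u0.
rewrite !E fejerE//.
have -> : (1 + x) * u = u + u * x by ring.
have -> : (1 - x) * u = u - u * x by ring.
rewrite (mulrC x u) cosD cosB.
by field.
Qed.

End fejer.

(** * The Hartley transform *)

Section cas.
Context {R : realType}.
Implicit Types a b : R.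

Definition cas a : R := cos a + sin a.

Lemma cas_max a : `|cas a| <= 2.
Proof.
rewrite /cas (le_trans (ler_normD _ _))//.
by have := cos_max a; have := sin_max a; lra.
Qed.

Lemma measurable_cas d (T : measurableType d) (f : T -> R) :
  measurable_fun setT f -> measurable_fun setT (fun x => cas (f x)).
Proof.
by move=> mf; apply: measurable_funD; [exact: measurable_cos|exact: measurable_sin].
Qed.

Lemma sin_cos_shift a : sin a = cos (a - pi / 2).
Proof. by rewrite cosB cos_pihalf sin_pihalf mulr0 add0r mulr1. Qed.

End cas.

Section vprod.
Context {R : realType}.

Definition vprod (p : R -> R) n (x : n.-tuple R) : R := \prod_(i < n) p (tnth x i).

Lemma vprod_cons p n a (x : n.-tuple R) : vprod p (cons_pair (a, x)) = p a * vprod p x.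
Proof.
rewrite /vprod big_ord_recl tnth_cons_pair0; congr (_ * _).
by apply: eq_bigr => i _; rewrite tnth_cons_pairS.
Qed.

Lemma vprod0 p (x : 0.-tuple R) : vprod p x = 1.
Proof. by rewrite /vprod big_ord0. Qed.

Lemma measurable_vprod p n : measurable_fun setT p -> measurable_fun setT (@vprod p n).
Proof.
move=> mp; apply: measurable_prod => i _.
by apply: measurableT_comp => //; exact: measurable_tnth.
Qed.

Lemma vprod_ge0 p n (x : n.-tuple R) : (forall t, 0 <= p t) -> 0 <= vprod p x.
Proof. by move=> p0; apply: prodr_ge0. Qed.

Lemma L1_vprod p n : L1 leb p -> L1 (lam n) (@vprod p n).
Proof.
move=> ip; have mp := L1_measurable ip.
elim: n => [|n IH].
  apply: ge0_L1; first exact: measurable_vprod.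
    by move=> x; rewrite vprod0.
  by under eq_integral do rewrite vprod0; rewrite ge0_integral_lam0 ?ltry//.
apply: (L1_cons (A := fun x => `|p x|) (B := fun v => `|vprod p v|)).
- exact: measurable_vprod.
- exact: L1_norm.
- exact: L1_norm.
- by move=> x v; rewrite vprod_cons normrM.
Qed.

Section even_product.
Variables (p ph : R -> R).
Hypotheses (ip : L1 leb p) (p_even : forall x, p (- x) = p x).
Hypothesis phE : forall v, ph v = \int[leb]_x (p x * cos (v * x)).

Let L1_trig (h : R -> R) : measurable_fun setT h -> (forall x, `|h x| <= 1) ->
  L1 leb (fun x => p x * h x).
Proof.
move=> mh h1; have := L1_bounded_mul ip mh h1.
by under eq_fun do rewrite mulrC.
Qed.

Lemma Rint_even_cos v al :
  \int[leb]_x (p x * cos (v * x + al)) = ph v * cos al.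
Proof.
have mv : measurable_fun setT (fun x : R => v * x) by exact: measurable_funM.
have ic : L1 leb (fun x => p x * cos (v * x)).
  by apply: L1_trig; [exact: measurable_cos|move=> x; exact: cos_max].
have isn : L1 leb (fun x => p x * sin (v * x)).
  by apply: L1_trig; [exact: measurable_sin|move=> x; exact: sin_max].
rewrite (eq_Rint leb (g := fun x => cos al * (p x * cos (v * x)) - sin al * (p x * sin (v * x)))); last first.
  by move=> x; rewrite cosD; ring.
rewrite RintB; [|exact: L1Zl..]; rewrite !RintZl// -phE.
rewrite (Rint_odd isn) ?mulr0 ?subr0 1?mulrC// => x.
by rewrite p_even mulrN sinN mulrN.
Qed.

(** By parity the terms that contain a sine vanish when the cosine of the sum is
    expanded. *)
Lemma Rint_vprod_cos n (u : n.-tuple R) al :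
  \int[lam n]_x (vprod p x * cos (dotprod u x + al)) = vprod ph u * cos al.
Proof.
elim: n u al => [|n IH] u al.
  rewrite (eq_Rint _ (g := fun=> cos al)); last first.
    by move=> x; rewrite vprod0 /dotprod big_ord0 add0r mul1r.
  by rewrite vprod0 /Rintegral/= integral_dirac// diracT !mul1e mul1r.
rewrite [u]tuple_consP; move: (tnth u ord0) [tuple _ | _ < _] => u0 {}u.
rewrite (Rint_cons (A := fun x => `|p x|) (B := fun v => `|vprod p v|)); last 4 first.
- apply: measurable_funM; first exact: (measurable_vprod (L1_measurable ip)).
  apply: measurable_cos; apply: measurable_funD => //.
  exact: measurable_dotprod.
- exact: L1_norm.
- exact/L1_norm/L1_vprod.
- by move=> x v; rewrite normrM vprod_cons normrM ler_piMr ?mulr_ge0// cos_max.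
rewrite (eq_Rint leb (g := fun x => vprod ph u * (p x * cos (u0 * x + al)))); last first.
  move=> x; rewrite mulrCA -IH -RintZl; last first.
    have mc : measurable_fun setT (fun v : n.-tuple R => cos (dotprod u v + (u0 * x + al))).
      by apply: measurable_cos; apply: measurable_funD => //; exact: measurable_dotprod.
    have := L1_bounded_mul (L1_vprod n ip) mc (fun v => cos_max _).
    by under eq_fun do rewrite mulrC.
  apply: eq_Rint => v; rewrite vprod_cons dotprod_cons mulrA; congr (_ * cos _); ring.
rewrite RintZl; last first.
  apply: L1_trig; last by move=> x; exact: cos_max.
  by apply: measurable_cos; apply: measurable_funD => //; exact: measurable_funM.
by rewrite Rint_even_cos vprod_cons; ring.
Qed.

Lemma L1_vprod_cos n (u : n.-tuple R) al :
  L1 (lam n) (fun x => vprod p x * cos (dotprod u x + al)).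
Proof.
have mc : measurable_fun setT (fun v : n.-tuple R => cos (dotprod u v + al)).
  by apply: measurable_cos; apply: measurable_funD => //; exact: measurable_dotprod.
have := L1_bounded_mul (L1_vprod n ip) mc (fun v => cos_max _).
by under eq_fun do rewrite mulrC.
Qed.

Lemma Rint_vprod_sin n (u : n.-tuple R) al :
  \int[lam n]_x (vprod p x * sin (dotprod u x + al)) = vprod ph u * sin al.
Proof.
rewrite [in RHS]sin_cos_shift -Rint_vprod_cos; apply: eq_Rint => x.
by rewrite sin_cos_shift addrA.
Qed.

Lemma L1_vprod_sin n (u : n.-tuple R) al :
  L1 (lam n) (fun x => vprod p x * sin (dotprod u x + al)).
Proof.
have := L1_vprod_cos u (al - pi / 2).
by under eq_fun do rewrite addrA -sin_cos_shift.
Qed.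

Lemma Rint_vprod_cas n (u : n.-tuple R) al :
  \int[lam n]_x (vprod p x * cas (dotprod u x + al)) = vprod ph u * cas al.
Proof.
rewrite /cas mulrDr -Rint_vprod_cos -Rint_vprod_sin -RintD.
- by apply: eq_Rint => x; rewrite mulrDr.
- exact: L1_vprod_cos.
- exact: L1_vprod_sin.
Qed.

End even_product.
End vprod.

Section vectors.
Context {R : realType} {n : nat}.
Implicit Types x y u : n.-tuple R.

Lemma dotprodC x y : dotprod x y = dotprod y x.
Proof. by apply: eq_bigr => i _; rewrite mulrC. Qed.

Definition vadd x y : n.-tuple R := [tuple tnth x i + tnth y i | i < n].

Lemma dotprodDr u x y : dotprod u (vadd x y) = dotprod u x + dotprod u y.
Proof. by rewrite -big_split; apply: eq_bigr => i _; rewrite tnth_mktuple mulrDr. Qed.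

Lemma dotprodBr u x y : dotprod u (vsub x y) = dotprod u x - dotprod u y.
Proof.
rewrite -sumrN -big_split; apply: eq_bigr => i _; rewrite tnth_mktuple/=; ring.
Qed.

Lemma dotprodNr u x : dotprod u (vopp x) = - dotprod u x.
Proof. by rewrite -sumrN; apply: eq_bigr => i _; rewrite tnth_mktuple mulrN. Qed.

Lemma dotprod0r u : dotprod u origin = 0.
Proof. by rewrite /dotprod big1// => i _; rewrite tnth_mktuple mulr0. Qed.

Lemma dotprod0l u : dotprod origin u = 0.
Proof. by rewrite dotprodC dotprod0r. Qed.

Lemma measurable_vsub d (T : measurableType d) (f g : T -> n.-tuple R) :
  measurable_fun setT f -> measurable_fun setT g ->
  measurable_fun setT (fun t : T => vsub (f t) (g t)).
Proof.
move=> /measurable_fun_tnthP mf /measurable_fun_tnthP mg.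
by apply: measurable_mktuple => i; apply: measurable_funB; [exact: mf|exact: mg].
Qed.

Lemma measurable_vopp : measurable_fun setT (@vopp R n).
Proof.
apply: measurable_mktuple => i; apply: measurableT_comp => //.
exact: measurable_tnth.
Qed.

End vectors.

Section bounded_compact_support.
Context {R : realType} {n : nat}.
Implicit Types f g : n.-tuple R -> R.

(** Real test functions: bounded, with compact support. *)
Definition bcs f := [/\ measurable_fun setT f, exists C, forall x, `|f x| <= C &
  exists r, forall x, f x != 0 -> cube r x].

Lemma cube_box (r : R) : cube r = box (fun=> - r) (fun=> r) :> set (n.-tuple R).
Proof. by []. Qed.

Lemma L1_bcs f : bcs f -> L1 (lam n) f.
Proof.
move=> [mf [C fC] [r fr]].
have ii : L1 (lam n) (\1_(@cube R n r)).
  apply: ge0_L1 => //; first by apply: measurable_indic; exact: measurable_box.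
  by rewrite integral_indic ?setIT ?cube_box ?lam_box//; exact: measurable_box.
have C0 : 0 <= C by rewrite (le_trans _ (fC origin)).
apply: (L1_le mf (L1Zl C ii)) => x; rewrite indicE.
have [f0|f0] := eqVneq (f x) 0; first by rewrite f0 normr0 mulr_ge0.
by rewrite mem_set ?mulr1//; exact: fr.
Qed.

Lemma bcs_lin a f g : bcs f -> bcs g -> bcs (fun x => a * f x + g x).
Proof.
move=> [mf [C fC] [r fr]] [mg [D gD] [s gs]]; split.
- by apply: measurable_funD => //; exact: measurable_funM.
- exists (`|a| * C + D) => x; rewrite (le_trans (ler_normD _ _))// lerD//.
  by rewrite normrM ler_wpM2l.
- exists (Num.max r s) => x fg0 i.
  have [f0|f0] := eqVneq (f x) 0.
    have g0 : g x != 0 by move: fg0; rewrite f0 mulr0 add0r.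
    have /andP[p q] := gs x g0 i; rewrite (le_trans _ p)/=.
      by rewrite (le_trans q)// le_max lexx orbT.
    by rewrite lerN2 le_max lexx orbT.
  have /andP[p q] := fr x f0 i; rewrite (le_trans _ p)/=.
    by rewrite (le_trans q)// le_max lexx.
  by rewrite lerN2 le_max lexx.
Qed.

Lemma bcs_mul f (h : n.-tuple R -> R) C : bcs f -> measurable_fun setT h ->
  (forall x, `|h x| <= C) -> bcs (fun x => f x * h x).
Proof.
move=> [mf [D fD] [r fr]] mh hC; split; first exact: measurable_funM.
- by exists (D * C) => x; rewrite normrM ler_pM.
- by exists r => x fh; apply: fr; apply: contra_neq fh => ->; rewrite mul0r.
Qed.

Lemma bcs_vaff f a b : a != 0 -> bcs f -> bcs (fun x => f (vaff a b x)).
Proof.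
move=> a0 [mf [C fC] [r fr]]; split.
- by apply: measurableT_comp => //; exact: measurable_vaff.
- by exists C => x.
- pose S := \sum_(i < n) `|tnth b i|.
  exists ((`|r| + S) / `|a|) => x /fr H i; have := H i; rewrite tnth_mktuple -!ler_norml => {}H.
  have bS : `|tnth b i| <= S by rewrite /S (bigD1 i)//= lerDl sumr_ge0.
  rewrite ler_pdivlMr ?normr_gt0// -normrM.
  have -> : tnth x i * a = (a * tnth x i + tnth b i) - tnth b i by ring.
  rewrite (le_trans (ler_normB _ _))// lerD//.
  by rewrite (le_trans H)// ler_norm.
Qed.

Lemma bcs_sum_eq f g : f =1 g -> bcs f -> bcs g.
Proof. by move=> /funext ->. Qed.

End bounded_compact_support.

Section hartley.
Context {R : realType} {n : nat}.
Implicit Types f g : n.-tuple R -> R.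

(** The real form of the Fourier transform. Against a symmetric measure its
    square integrates like the squared modulus of the Fourier transform, and it
    is its own inverse up to a constant. *)
Definition hartley f (u : n.-tuple R) : R := \int[lam n]_x (f x * cas (dotprod u x)).

Lemma measurable_hartley_kernel d (T : measurableType d) (f : n.-tuple R -> R)
    (h : T -> n.-tuple R) : measurable_fun setT f -> measurable_fun setT h ->
  measurable_fun setT (fun z : T * n.-tuple R => f z.2 * cas (dotprod (h z.1) z.2)).
Proof.
move=> mf mh; apply: measurable_funM.
  exact: (measurableT_comp mf measurable_snd).
apply: measurable_cas; apply: measurable_dotprod; last exact: measurable_snd.
exact: (measurableT_comp mh measurable_fst).
Qed.

Lemma hartley_kernel_le f (u x : n.-tuple R) : `|f x * cas (dotprod u x)| <= 2 * `|f x|.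
Proof. by rewrite normrM mulrC ler_wpM2r// cas_max. Qed.

Lemma L1_hartley_kernel f u : L1 (lam n) f ->
  L1 (lam n) (fun x => f x * cas (dotprod u x)).
Proof.
move=> fi; apply: (L1_le _ (L1Zl 2 (L1_norm fi))); last exact: hartley_kernel_le.
apply: measurable_funM; first exact: L1_measurable fi.
by apply: measurable_cas; exact: measurable_dotprod.
Qed.

Lemma measurable_hartley f : L1 (lam n) f -> measurable_fun setT (hartley f).
Proof.
move=> fi; pose m := @dirac _ (n.-tuple R) (origin : n.-tuple R) R.
have i1 : L1 m (fun=> 2 : R).
  by apply: ge0_L1 => //; rewrite integral_cst//= diracT mule1 ltry.
apply: (@measurable_Rint1 _ _ _ _ R m (lam n) _ (fun=> 2) (fun x => `|f x|)
  (measurable_hartley_kernel (L1_measurable fi) (@measurable_id _ _ setT)) i1 (L1_norm fi)).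
by move=> u x; exact: hartley_kernel_le.
Qed.

Lemma hartley_bound f u : L1 (lam n) f ->
  `|hartley f u| <= 2 * \int[lam n]_x `|f x|.
Proof.
move=> fi; rewrite -RintZl; last exact: L1_norm.
apply: Rint_norm_le; [exact: L1_hartley_kernel|exact/L1Zl/L1_norm|].
exact: hartley_kernel_le.
Qed.

Lemma hartley_lin a f g u : L1 (lam n) f -> L1 (lam n) g ->
  hartley (fun x => a * f x + g x) u = a * hartley f u + hartley g u.
Proof.
move=> fi gi; rewrite /hartley -RintZl ?L1_hartley_kernel// -RintD.
- by apply: eq_Rint => x; ring.
- exact/L1Zl/L1_hartley_kernel.
- exact: L1_hartley_kernel.
Qed.

Lemma hartley_duality (mu : {sigma_finite_measure set (n.-tuple R) -> \bar R}) f g :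
  L1 (lam n) f -> L1 mu g ->
  \int[mu]_u (g u * hartley f u) =
  \int[lam n]_x (f x * \int[mu]_u (g u * cas (dotprod u x))).
Proof.
move=> fi gi; have mg := L1_measurable gi; have mf := L1_measurable fi.
have mk : measurable_fun setT (fun z : n.-tuple R * n.-tuple R =>
    g z.1 * (f z.2 * cas (dotprod z.1 z.2))).
  apply: measurable_funM; first exact: (measurableT_comp mg measurable_fst).
  exact: (measurable_hartley_kernel mf (@measurable_id _ _ setT)).
have bd u x : `|g u * (f x * cas (dotprod u x))| <= `|g u| * (2 * `|f x|).
  by rewrite normrM ler_wpM2l// hartley_kernel_le.
have i2 : L1 (lam n) (fun x => 2 * `|f x|) by exact/L1Zl/L1_norm.
transitivity (\int[mu]_u \int[lam n]_x (g u * (f x * cas (dotprod u x)))).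
  by apply: eq_Rint => u; rewrite RintZl//; exact: L1_hartley_kernel.
rewrite (Rint_swap (m1 := mu) (m2 := lam n) mk (L1_norm gi) i2 bd).
apply: eq_Rint => x; rewrite -RintZl; first by apply: eq_Rint => u; ring.
apply: (L1_le _ (L1Zl 2 (L1_norm gi))).
  apply: measurable_funM => //; apply: measurable_cas.
  exact: measurable_dotprod.
by move=> u; rewrite normrM mulrC ler_wpM2r// cas_max.
Qed.

End hartley.

(** * Band-limited multipliers *)

Section kernel.
Context {R : realType} (delta : R).
Hypothesis delta_gt0 : 0 < delta.

(** The product Fejer kernel at scale [delta] and its Fourier transform, a product
    of tents supported in a cube of half-side [delta]. *)
Definition fejer_kernel n (u : n.-tuple R) : R := vprod (fun v => fejer (delta * v)) u.
Definition tent_kernel n (x : n.-tuple R) : R :=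
  vprod (fun t => fejer_mass / delta * tent (t / delta)) x.

Let d0 : delta != 0. Proof. by rewrite gt_eqF. Qed.

Let L1_fd : L1 leb (fun v => fejer (delta * v)).
Proof. by have := L1_affine 0 d0 L1_fejer; under eq_fun do rewrite addr0. Qed.

Let fd_hat v : fejer_mass / delta * tent (v / delta) =
  \int[leb]_x (fejer (delta * x) * cos (v * x)).
Proof.
have := Rint_affine 0 d0 (L1_fejer_cos (v / delta)).
rewrite fejer_inversion gtr0_norm// => H.
transitivity (delta^-1 * (fejer_mass * tent (v / delta))); first by ring.
rewrite -H; apply: eq_Rint => x; rewrite addr0; congr (_ * cos _).
by field.
Qed.

Lemma L1_fejer_kernel n : L1 (lam n) (@fejer_kernel n).
Proof. exact: (L1_vprod n L1_fd). Qed.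

Lemma fejer_kernel_ge0 n (u : n.-tuple R) : 0 <= fejer_kernel u.
Proof. by apply: vprod_ge0 => t; exact: fejer_ge0. Qed.

Let L1_td : L1 leb (fun x : R => fejer_mass / delta * tent (x / delta)).
Proof.
apply: L1Zl; have := L1_affine 0 (invr_neq0 d0) L1_tent.
by under eq_fun do rewrite addr0 mulrC.
Qed.

Lemma L1_tent_kernel n : L1 (lam n) (@tent_kernel n).
Proof. exact: (L1_vprod n L1_td). Qed.

Let td_hat (v : R) : fejer_mass * fejer (delta * v) =
  \int[leb]_x ((fejer_mass / delta * tent (x / delta)) * cos (v * x)).
Proof.
have := Rint_affine 0 (invr_neq0 d0) (L1_tent_cos (delta * v)).
rewrite gtr0_norm ?invr_gt0// invrK => H.
transitivity (fejer_mass / delta * (delta * fejer (delta * v))).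
  by field.
rewrite -H -RintZl.
  apply: eq_Rint => x; rewrite addr0 -!mulrA; congr (_ * (_ * _)).
  by rewrite [delta^-1 * x]mulrC; congr (_ * cos _); field.
exact: (L1_affine 0 (invr_neq0 d0) (L1_tent_cos (delta * v))).
Qed.

Let td_even (x : R) : fejer_mass / delta * tent (- x / delta) =
  fejer_mass / delta * tent (x / delta).
Proof. by rewrite mulNr tentN. Qed.

Let td_prod n (u : n.-tuple R) :
  vprod (fun v => fejer_mass * fejer (delta * v)) u = fejer_mass ^+ n * fejer_kernel u.
Proof. by rewrite /vprod big_split/= prodr_const card_ord. Qed.

Lemma tent_kernel_cos n (u : n.-tuple R) al :
  \int[lam n]_x (tent_kernel x * cos (dotprod u x + al)) =
  fejer_mass ^+ n * fejer_kernel u * cos al.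
Proof. by rewrite (Rint_vprod_cos L1_td td_even td_hat) td_prod. Qed.

Lemma tent_kernel_sin n (u : n.-tuple R) al :
  \int[lam n]_x (tent_kernel x * sin (dotprod u x + al)) =
  fejer_mass ^+ n * fejer_kernel u * sin al.
Proof. by rewrite (Rint_vprod_sin L1_td td_even td_hat) td_prod. Qed.

Lemma tent_kernel_cas n (u : n.-tuple R) al :
  \int[lam n]_x (tent_kernel x * cas (dotprod u x + al)) =
  fejer_mass ^+ n * fejer_kernel u * cas al.
Proof. by rewrite (Rint_vprod_cas L1_td td_even td_hat) td_prod. Qed.

Lemma fejer_kernel0 n : fejer_kernel (origin : n.-tuple R) = 1.
Proof. by apply: big1 => i _; rewrite tnth_mktuple mulr0 fejer0. Qed.

Lemma Rint_tent_kernel n : \int[lam n]_x tent_kernel x = fejer_mass ^+ n.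
Proof.
have := tent_kernel_cas (origin : n.-tuple R) 0.
rewrite fejer_kernel0 mulr1 /cas cos0 sin0 addr0 mulr1 => <-.
by apply: eq_Rint => x; rewrite dotprod0l addr0 cos0 sin0 addr0 mulr1.
Qed.

Lemma tent_kernel_supp n (x : n.-tuple R) : tent_kernel x != 0 -> cube delta x.
Proof.
move=> + i; rewrite /tent_kernel /vprod prodf_seq_neq0 => /allP/(_ i (mem_index_enum _))/=.
rewrite mulf_eq0 negb_or => /andP[_ h]; rewrite -ler_norml leNgt; apply: contra h => h.
by rewrite tent_out// normrM normfV [`|delta|]gtr0_norm// ler_pdivlMr// mul1r ltW.
Qed.

Lemma bcs_tent_kernel n : bcs (@tent_kernel n).
Proof.
have m0 : 0 <= fejer_mass / delta :> R by rewrite divr_ge0 ?ltW// fejer_mass_gt0.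
split; first exact: L1_measurable (L1_tent_kernel n).
  exists ((fejer_mass / delta) ^+ n) => x.
  rewrite ger0_norm; last by apply: vprod_ge0 => t; rewrite mulr_ge0// tent_ge0.
  rewrite -[n in X in _ <= X]card_ord -prodr_const; apply: ler_prod => i _.
  by rewrite mulr_ge0 ?tent_ge0//= ler_piMr// tent_le1.
by exists delta => x; exact: tent_kernel_supp.
Qed.

Lemma fejer_kernel_le1 n (u : n.-tuple R) : fejer_kernel u <= 1.
Proof. by apply: prodr_ile1 => i _; rewrite fejer_ge0 fejer_le1. Qed.

Lemma fejer_kernel_ge n (u : n.-tuple R) : cube delta^-1 u -> 2^-1 ^+ n <= fejer_kernel u.
Proof.
move=> uc; rewrite -[n in X in X <= _]card_ord -prodr_const.
apply: ler_prod => i _; rewrite invr_ge0 ler0n/=; apply: le_trans (fejer_ge _).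
have : `|delta * tnth u i| <= 1.
  by have := uc i; rewrite -ler_norml normrM gtr0_norm// => h; rewrite -ler_pdivlMl// mulr1.
rewrite -(ler_pXn2r (_ : 0 < 2)%N) ?nnegrE// real_normK ?num_real// expr1n.
by move: (_ ^+ 2) => z hz; lra.
Qed.

Lemma fejer_kernel_cas n (x : n.-tuple R) al :
  \int[lam n]_u (fejer_kernel u * cas (dotprod u x + al)) = tent_kernel x * cas al.
Proof.
have ev (v : R) : fejer (delta * - v) = fejer (delta * v) by rewrite mulrN fejerN.
rewrite -(Rint_vprod_cas L1_fd ev fd_hat).
by apply: eq_Rint => u; rewrite dotprodC.
Qed.

Lemma L1_fejer_kernel_cas n (x : n.-tuple R) al :
  L1 (lam n) (fun u => fejer_kernel u * cas (dotprod u x + al)).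
Proof.
have mc : measurable_fun setT (fun v : n.-tuple R => cas (dotprod v x + al)).
  by apply: measurable_cas; apply: measurable_funD => //; exact: measurable_dotprod.
have := L1_bounded_mul (L1_fejer_kernel n) mc (fun v => cas_max _).
by under eq_fun do rewrite mulrC.
Qed.

Lemma Rint_mul_tent_kernel n (f : n.-tuple R -> R) (W : set (n.-tuple R)) b rho : bcs f ->
  (forall x, W x -> f x = b) -> (forall y, cube delta y -> W (vadd rho y)) ->
  L1 (lam n) (fun x => f x * tent_kernel (vsub x rho)) /\
  \int[lam n]_x (f x * tent_kernel (vsub x rho)) = fejer_mass ^+ n * b.
Proof.
move=> [mf [C fC] _] fb Wrho.
have E x : f x * tent_kernel (vsub x rho) = b * tent_kernel (vaff 1 (vopp rho) x).
  have -> : vaff 1 (vopp rho) x = vsub x rho.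
    by apply: eq_from_tnth => i; rewrite !tnth_mktuple mul1r.
  have [->|h] := eqVneq (tent_kernel (vsub x rho)) 0; first by rewrite !mulr0.
  congr (_ * _); apply: fb; have := Wrho _ (tent_kernel_supp h).
  congr W; apply: eq_from_tnth => i; rewrite !tnth_mktuple; ring.
split.
  rewrite (_ : (fun x => _) = (fun x => (b * tent_kernel (vaff 1 (vopp rho) x))%:E)).
    by apply: L1Zl; apply: (L1_vaff _ (oner_neq0 _)); exact: L1_tent_kernel.
  by apply/funext => x; rewrite E.
rewrite (eq_Rint _ E) RintZl; last first.
  by apply: (L1_vaff _ (oner_neq0 _)); exact: L1_tent_kernel.
rewrite (Rint_vaff _ (oner_neq0 _)); last exact: L1_tent_kernel.
by rewrite normr1 invr1 expr1n mul1r Rint_tent_kernel mulrC.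
Qed.

End kernel.

Section band_limited.
Context {R : realType} (delta : R) {n : nat} (W : set (n.-tuple R)).
Hypothesis delta_gt0 : 0 < delta.
Local Notation K := (@fejer_kernel R delta n).

(** [band_limited delta W G]: the distributional Fourier transform of [G],
    symmetrised and smeared over a cube of half-side [delta], lives in [W]; it is
    expressed by testing against the functions that are constant on [W]. *)
Definition band_limited (G : n.-tuple R -> R) :=
  [/\ measurable_fun setT G, exists C, forall u, `|G u| <= C &
  forall f b, bcs f -> (forall x, W x -> f x = b) ->
    \int[lam n]_u (G u * K u * hartley f u) = fejer_mass ^+ n * b * G origin].

Lemma L1_mul_fejer_kernel (G : n.-tuple R -> R) (C : R) : measurable_fun setT G -> (forall u, `|G u| <= C) ->
  L1 (lam n) (fun u => G u * K u).
Proof. by move=> mG GC; exact: (L1_bounded_mul (L1_fejer_kernel delta_gt0 n) mG GC). Qed.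

Lemma L1_mul_fejer_kernel_hartley (G f : n.-tuple R -> R) (C : R) :
  measurable_fun setT G -> (forall u, `|G u| <= C) -> bcs f ->
  L1 (lam n) (fun u => G u * K u * hartley f u).
Proof.
move=> mG GC bf; have fi := L1_bcs bf.
have := L1_bounded_mul (L1_mul_fejer_kernel mG GC) (measurable_hartley fi)
  (fun u => hartley_bound u fi).
by under eq_fun do rewrite mulrC.
Qed.

(** The transform of this wave consists of point masses at [rho] and at its opposite. *)
Lemma band_limited_cos (rho : n.-tuple R) al :
  (forall y, cube delta y -> W (vadd rho y)) ->
  (forall y, cube delta y -> W (vadd (vopp rho) y)) ->
  band_limited (fun u => cos (dotprod u rho + al)).
Proof.
move=> W1 W2; have mG : measurable_fun setT (fun u : n.-tuple R => cos (dotprod u rho + al)).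
  by apply: measurable_cos; apply: measurable_funD => //; exact: measurable_dotprod.
have G1 (u : n.-tuple R) : `|cos (dotprod u rho + al)| <= 1 by exact: cos_max.
split=> //; first by exists 1.
move=> f b bf fb.
rewrite (hartley_duality (L1_bcs bf) (L1_mul_fejer_kernel mG G1)).
have [i1 e1] := Rint_mul_tent_kernel delta_gt0 bf fb W1.
have [i2 e2] := Rint_mul_tent_kernel delta_gt0 bf fb W2.
rewrite (eq_Rint _ (g := fun x =>
  2^-1 * cas (- al) * (f x * tent_kernel delta (vsub x rho)) +
  2^-1 * cas al * (f x * tent_kernel delta (vsub x (vopp rho))))); last first.
  move=> x; transitivity (f x * (2^-1 * (tent_kernel delta (vsub x rho) * cas (- al) +
    tent_kernel delta (vsub x (vopp rho)) * cas al))); last by ring.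
  congr (_ * _); rewrite -!fejer_kernel_cas// -RintD ?L1_fejer_kernel_cas//.
  rewrite -RintZl; last by apply: L1D; exact: L1_fejer_kernel_cas.
  apply: eq_Rint => u; rewrite !dotprodBr dotprodNr opprK /cas.
  set a := dotprod u x; set c := dotprod u rho; set k := fejer_kernel _ _.
  have -> : a - c - al = a - (c + al) by ring.
  rewrite -[a + c + al]addrA; move: (c + al) => b'.
  by rewrite !cosB !sinB !cosD !sinD; field.
rewrite RintD; [|exact: L1Zl..]; rewrite !RintZl// e1 e2 dotprod0l add0r.
by rewrite /cas cosN sinN; field.
Qed.

Lemma band_limited_lin a G H : band_limited G -> band_limited H ->
  band_limited (fun u => a * G u + H u).
Proof.
move=> [mG [C GC] eG] [mH [D HD] eH]; split.
- by apply: measurable_funD => //; exact: measurable_funM.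
- exists (`|a| * C + D) => u; rewrite (le_trans (ler_normD _ _))// lerD//.
  by rewrite normrM ler_wpM2l.
- move=> f b bf fb.
  rewrite (eq_Rint _ (g := fun u => a * (G u * K u * hartley f u) + H u * K u * hartley f u)).
    rewrite RintD; [|apply: L1Zl|].
    + rewrite RintZl; last exact: L1_mul_fejer_kernel_hartley GC bf.
      rewrite (eG _ _ bf fb) (eH _ _ bf fb); ring.
    + exact: L1_mul_fejer_kernel_hartley GC bf.
    + exact: L1_mul_fejer_kernel_hartley HD bf.
  by move=> u; ring.
Qed.

Lemma band_limited_superpose d (Z : measurableType d)
    (mu : {sigma_finite_measure set Z -> \bar R}) (w : Z -> R)
    (G : Z -> n.-tuple R -> R) C : L1 mu w ->
  measurable_fun setT (fun z : Z * n.-tuple R => G z.1 z.2) ->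
  (forall z u, `|G z u| <= C) ->
  (forall z, w z != 0 -> band_limited (G z)) ->
  band_limited (fun u => \int[mu]_z (w z * G z u)).
Proof.
move=> iw mG GC bG; have mw := L1_measurable iw.
have sw : measurable_fun setT (fun z : n.-tuple R * Z => (z.2, z.1)).
  by apply: measurable_fun_pair; [exact: measurable_snd|exact: measurable_fst].
have mG' : measurable_fun setT (fun z : n.-tuple R * Z => w z.2 * G z.2 z.1).
  apply: measurable_funM; first exact: (measurableT_comp mw measurable_snd).
  exact: (measurableT_comp mG sw).
have iC : L1 mu (fun z => C * `|w z|) by exact/L1Zl/L1_norm.
have bd z u : `|w z * G z u| <= C * `|w z|.
  by rewrite normrM mulrC ler_wpM2r.
have m1 u : measurable_fun setT (fun z => w z * G z u).
  apply: measurable_funM => //.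
  have mp : measurable_fun setT (fun z : Z => (z, u)) by apply: measurable_fun_pair.
  exact: (measurableT_comp mG mp).
have i1 u : L1 mu (fun z => w z * G z u) by exact: (L1_le (m1 u) iC).
split.
- pose m := @dirac _ (n.-tuple R) (origin : n.-tuple R) R.
  have i2 : L1 m (fun=> 1 : R).
    by apply: ge0_L1 => //; rewrite integral_cst//= diracT mule1 ltry.
  apply: (@measurable_Rint1 _ _ _ _ R m mu (fun u z => w z * G z u) (fun=> 1) _ mG' i2 iC).
  by move=> u z; rewrite mul1r.
- by exists (\int[mu]_z (C * `|w z|)) => u; apply: Rint_norm_le.
- move=> f b bf fb; have fi := L1_bcs bf; have mh := measurable_hartley fi.
  pose B := 2 * \int[lam n]_x `|f x|.
  have hB u : `|hartley f u| <= B by exact: hartley_bound.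
  pose F u z := w z * G z u * (K u * hartley f u).
  have mF : measurable_fun setT (fun z : n.-tuple R * Z => F z.1 z.2).
    apply: measurable_funM => //; apply: measurable_funM.
      exact: (measurableT_comp (L1_measurable (L1_fejer_kernel delta_gt0 n)) measurable_fst).
    exact: (measurableT_comp mh measurable_fst).
  have iK : L1 (lam n) (fun u => B * K u) by apply: L1Zl; exact: L1_fejer_kernel.
  have Fb u z : `|F u z| <= B * K u * (C * `|w z|).
    rewrite /F normrM mulrC ler_pM// normrM mulrC ler_pM//.
    by rewrite ger0_norm// fejer_kernel_ge0.
  transitivity (\int[lam n]_u \int[mu]_z F u z).
    apply: eq_Rint => u; rewrite -mulrA mulrC -RintZl//.
    by apply: eq_Rint => z; rewrite /F mulrC.
  rewrite (Rint_swap (m1 := lam n) (m2 := mu) mF iK iC Fb).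
  rewrite -RintZl//; apply: eq_Rint => z.
  have [wz|wz] := eqVneq (w z) 0.
    rewrite wz mul0r mulr0 (eq_Rint _ (g := fun=> 0)) ?Rint0// => u.
    by rewrite /F wz !mul0r.
  have [mGz [D GD] eG] := bG z wz.
  transitivity (w z * \int[lam n]_u (G z u * K u * hartley f u)).
    rewrite -RintZl; last exact: L1_mul_fejer_kernel_hartley GD bf.
    by apply: eq_Rint => u; rewrite /F !mulrA.
  by rewrite (eG _ _ bf fb); ring.
Qed.

End band_limited.

(** * Finite differences *)
Section differences.
Context {R : realType} (delta : R) {n : nat}.
Hypothesis delta_gt0 : 0 < delta.
Implicit Types (f : n.-tuple R -> R) (i : 'I_n).

Definition vaxis i (c : R) : n.-tuple R := [tuple if j == i then c else 0 | j < n].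

(** The reflections make multiplication by a sine, on the side of the Hartley
    transform, a combination of values of [f] without any convolution by an odd
    kernel. *)
Definition refl_diff i f x : R :=
  2^-1 * f (vaff (-1) (vaxis i delta) x) - 2^-1 * f (vaff (-1) (vaxis i (- delta)) x).

Definition refl_diffs (l : seq 'I_n) f := foldr refl_diff f l.

Let N1 : (-1 : R) != 0. Proof. by rewrite oppr_eq0 oner_neq0. Qed.

Lemma bcs_refl_diff i f : bcs f -> bcs (refl_diff i f).
Proof.
move=> bf; have bg c : bcs (fun x => f (vaff (-1) (vaxis i c) x)) by exact: bcs_vaff.
apply: (bcs_sum_eq _ (bcs_lin 2^-1 (bg delta) (bcs_lin (- 3 / 2) (bg (- delta)) (bg (- delta))))).
by move=> x; rewrite /refl_diff; field.
Qed.

Lemma bcs_refl_diffs l f : bcs f -> bcs (refl_diffs l f).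
Proof. by move=> bf; elim: l => //= i l; exact: bcs_refl_diff. Qed.

Lemma hartley_refl f (a : n.-tuple R) u : L1 (lam n) f ->
  hartley (fun x => f (vaff (-1) a x)) u =
  \int[lam n]_x (f x * cas (dotprod u a - dotprod u x)).
Proof.
move=> fi.
have mc : measurable_fun setT (fun x : n.-tuple R => cas (dotprod u a - dotprod u x)).
  by apply: measurable_cas; apply: measurable_funB => //; exact: measurable_dotprod.
have ic : L1 (lam n) (fun x => f x * cas (dotprod u a - dotprod u x)).
  have := L1_bounded_mul fi mc (fun x => cas_max _).
  by under eq_fun do rewrite mulrC.
have := Rint_vaff a N1 ic.
rewrite normrN1 invr1 expr1n mul1r => <-; apply: eq_Rint => x; congr (_ * cas _).
rewrite /dotprod -sumrB; apply: eq_bigr => i _; rewrite tnth_mktuple; ring.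
Qed.

Lemma dotprod_vaxis u i c : dotprod u (vaxis i c) = tnth u i * c.
Proof.
rewrite /dotprod (bigD1 i)//= tnth_mktuple eqxx big1 ?addr0// => j ji.
by rewrite tnth_mktuple (negPf ji) mulr0.
Qed.

Lemma hartley_refl_diff i f u : bcs f ->
  hartley (refl_diff i f) u = sin (delta * tnth u i) * hartley f u.
Proof.
move=> bf; have fi := L1_bcs bf.
pose g c x := f (vaff (-1) (vaxis i c) x).
have gi c : L1 (lam n) (g c) by apply: L1_bcs; exact: bcs_vaff.
rewrite (_ : hartley _ _ = 2^-1 * hartley (g delta) u - 2^-1 * hartley (g (- delta)) u); last first.
  rewrite /hartley -!RintZl ?L1_hartley_kernel// -RintB; [|exact/L1Zl/L1_hartley_kernel..].
  by apply: eq_Rint => x; rewrite /refl_diff -/(g _ _) -/(g _ _); ring.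
rewrite !hartley_refl// !dotprod_vaxis.
have ic c : L1 (lam n) (fun x => f x * cas (tnth u i * c - dotprod u x)).
  have mc : measurable_fun setT (fun x : n.-tuple R => cas (tnth u i * c - dotprod u x)).
    by apply: measurable_cas; apply: measurable_funB => //; exact: measurable_dotprod.
  have := L1_bounded_mul fi mc (fun x => cas_max _).
  by under eq_fun do rewrite mulrC.
rewrite -!RintZl ?L1_hartley_kernel// -RintB; [|exact: L1Zl..].
apply: eq_Rint => x; rewrite /cas mulrN -opprD cosN sinN [delta * _]mulrC.
by rewrite cosB sinB cosD sinD; field.
Qed.

Lemma hartley_refl_diffs l f u : bcs f ->
  hartley (refl_diffs l f) u = \prod_(i <- l) sin (delta * tnth u i) * hartley f u.
Proof.
move=> bf; elim: l => [|i l IH] /=; first by rewrite big_nil mul1r.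
by rewrite (hartley_refl_diff _ _ (bcs_refl_diffs l bf)) IH big_cons mulrA.
Qed.

Lemma refl_diffs_local (W : R -> set (n.-tuple R)) l f g rho :
  (forall r c i x, `|c| <= delta -> W r x -> W (r + delta) (vaff (-1) (vaxis i c) x)) ->
  (forall x, W (rho + delta *+ size l) x -> f x = g x) ->
  forall x, W rho x -> refl_diffs l f x = refl_diffs l g x.
Proof.
move=> Wd; elim: l rho => [|i l IH] rho /= fg x Wx; first by apply: fg; rewrite mulr0n addr0.
have E c : `|c| <= delta -> refl_diffs l f (vaff (-1) (vaxis i c) x) =
    refl_diffs l g (vaff (-1) (vaxis i c) x).
  move=> c1; apply: (IH (rho + delta)); last exact: Wd.
  by move=> y; rewrite -addrA -mulrS; exact: fg.
by rewrite /refl_diff !E// ?normrN gtr0_norm.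
Qed.

Definition shift_poly (c : R) : {poly R} := c%:P - 'X.
Definition poly_diff (p : {poly R}) : {poly R} :=
  2^-1 *: ((p \Po shift_poly delta) - (p \Po shift_poly (- delta))).

Lemma horner_poly_diff p y : (poly_diff p).[y] = 2^-1 * p.[delta - y] - 2^-1 * p.[- delta - y].
Proof.
by rewrite /poly_diff /shift_poly hornerZ hornerD hornerN !horner_comp !(hornerE, mulrBr).
Qed.

Let shift_polyE c : shift_poly c = - ('X - c%:P). Proof. by rewrite opprB. Qed.

Let shift_expE c m : shift_poly c ^+ m = (-1) ^+ m *: ('X - c%:P) ^+ m.
Proof. by rewrite shift_polyE -scaleN1r exprZn. Qed.

Lemma poly_diffX m : poly_diff 'X^(m.+1) = (-1) ^+ m *: (delta *:
  \sum_(i < m.+1) ('X - delta%:P) ^+ (m - i) * ('X - (- delta)%:P) ^+ i).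
Proof.
rewrite /poly_diff !comp_Xn_poly subrXX.
have -> : shift_poly delta - shift_poly (- delta) = (2 * delta)%:P.
  by rewrite /shift_poly polyCN polyCM; ring.
rewrite mul_polyC !scalerA mulrA mulVf// mul1r mulrC -scalerA; congr (_ *: _).
rewrite scaler_sumr; apply: eq_bigr => i _; rewrite /= !shift_expE.
rewrite -scalerAl -scalerAr scalerA -exprD subnK//.
by rewrite -ltnS.
Qed.

Lemma size_poly_diffX m : size (poly_diff 'X^(m.+1)) = m.+1.
Proof.
rewrite poly_diffX !size_scale ?signr_eq0 ?gt_eqF//.
have mon (i : 'I_m.+1) : ('X - delta%:P) ^+ (m - i) * ('X - (- delta)%:P) ^+ i \is monic.
  by rewrite monicMl monic_exp// monicXsubC.
have sz (i : 'I_m.+1) : size (('X - delta%:P) ^+ (m - i) * ('X - (- delta)%:P) ^+ i) = m.+1.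
  rewrite size_Mmonic ?monic_exp ?monicXsubC ?monic_neq0 ?monic_exp ?monicXsubC//.
  by rewrite !size_exp_XsubC addnS/= addSn subnK// -ltnS.
apply/eqP; rewrite eqn_leq; apply/andP; split.
  by rewrite (leq_trans (size_sum _ _ _))//; apply/bigmax_leqP => i _; rewrite sz.
rewrite ltnNge; apply/negP => /leq_sizeP/(_ m (leqnn _)).
rewrite coef_sum (eq_bigr (fun=> 1)) => [|i _].
  by rewrite sumr_const card_ord => /eqP; rewrite pnatr_eq0.
by have /monicP := mon i; rewrite /lead_coef sz.
Qed.

Lemma size_poly_diff (p : {poly R}) m : size p = m.+2 -> size (poly_diff p) = m.+1.
Proof.
have lin a (q q' : {poly R}) : poly_diff (a *: q + q') = a *: poly_diff q + poly_diff q'.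
  by rewrite /poly_diff !comp_polyD !comp_polyZ -!mul_polyC; ring.
have small (q : {poly R}) j : (size q <= j)%N -> (size (poly_diff q) <= j.-1)%N.
  elim: j q => [|j IH] q sq.
    by move: sq; rewrite leqn0 size_poly_eq0 => /eqP ->; rewrite /poly_diff !comp_poly0 subrr scaler0 size_poly0.
  have -> : q = q`_j *: 'X^j + (q - q`_j *: 'X^j) by rewrite addrCA subrr addr0.
  have s2 : (size (q - q`_j *: 'X^j)%R <= j)%N.
    apply/leq_sizeP => k jk; rewrite coefB coefZ coefXn.
    have [->|kj] := eqVneq k j; first by rewrite mulr1 subrr.
    rewrite mulr0 subr0; apply: (leq_sizeP _ _ sq); by rewrite ltn_neqAle eq_sym kj.
  rewrite lin (leq_trans (size_polyD _ _))// geq_max; apply/andP; split.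
    rewrite (leq_trans (size_scale_leq _ _))//; case: j {IH sq s2} => [|j].
      by rewrite expr0 /poly_diff -polyC1 !comp_polyC subrr scaler0 size_poly0.
    by rewrite size_poly_diffX.
  by rewrite (leq_trans (IH _ s2))// leq_pred.
move=> sp; pose q := p - p`_m.+1 *: 'X^(m.+1).
have sq : (size q <= m.+1)%N.
  apply/leq_sizeP => k jk; rewrite coefB coefZ coefXn.
  have [->|kj] := eqVneq k m.+1; first by rewrite mulr1 subrr.
  rewrite mulr0 subr0 nth_default// sp ltn_neqAle eq_sym kj//.
have -> : p = p`_m.+1 *: 'X^(m.+1) + q by rewrite addrCA subrr addr0.
have lp : p`_m.+1 != 0.
  have : lead_coef p != 0 by rewrite lead_coef_eq0 -size_poly_gt0 sp.
  by rewrite /lead_coef sp.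
by rewrite lin size_polyDl (size_scale _ lp) size_poly_diffX// ltnS; exact: (small _ _ sq).
Qed.

(** The differences lower the degrees one by one, down to a nonzero constant. *)
Lemma refl_diffs_poly (l : seq 'I_n) (p : 'I_n -> {poly R}) :
  (forall i, size (p i) = (count_mem i l).+1) ->
  exists2 b, b != 0 &
    refl_diffs l (fun x => \prod_(i < n) (p i).[tnth x i]) = fun=> b.
Proof.
elim/last_ind: l p => [|l i IH] p sp.
  have c i : p i = ((p i)`_0)%:P by apply: size1_polyC; rewrite sp.
  exists (\prod_(i < n) (p i)`_0).
    apply/prodf_neq0 => i _; have := sp i; rewrite c size_polyC coefC eqxx.
    by case: eqP.
  by apply/funext => x; apply: eq_bigr => i _; rewrite c hornerC coefC eqxx.
pose q j := if j == i then poly_diff (p j) else p j \Po (- 'X).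
have E : refl_diff i (fun x => \prod_(j < n) (p j).[tnth x j]) =
    fun x => \prod_(j < n) (q j).[tnth x j].
  apply/funext => x; rewrite /refl_diff [RHS](bigD1 i)//= {1}/q eqxx horner_poly_diff.
  have F c : \prod_(j < n) (p j).[tnth (vaff (-1) (vaxis i c) x) j] =
      (p i).[c - tnth x i] * \prod_(j < n | j != i) (q j).[tnth x j].
    rewrite (bigD1 i)//= !tnth_mktuple eqxx mulN1r addrC; congr (_ * _).
    apply: eq_bigr => j ji; rewrite !tnth_mktuple /q (negPf ji) addr0.
    by rewrite horner_comp !hornerE mulN1r.
  by rewrite !F; ring.
rewrite /refl_diffs foldr_rcons E; apply: IH => j; rewrite /q; have := sp j.
rewrite -cats1 count_cat/= addn0 eq_sym.
have [->|ji] := eqVneq j i; first by rewrite addn1 => /size_poly_diff.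
by rewrite addn0 => <-; rewrite size_comp_poly2// size_polyN size_polyX.
Qed.

End differences.

Local Notation normc := ComplexField.Normc.normc.
Local Open Scope complex_scope.

(** * Variances as integrals of Hartley transforms *)

Lemma ge0_double_inj (R : realType) (x y : \bar R) :
  (x + x = y + y -> 0 <= x -> 0 <= y -> x = y)%E.
Proof.
case: x y => [x| |] [y| |]//= /eqP; rewrite -!EFinD eqe => /eqP h _ _.
by congr (_%:E); lra.
Qed.

Section variance.
Context {R : realType} disp (T : measurableType disp) (P : probability T R).

Lemma normc_sqr (z : R[i]) : normc z ^+ 2 = complex.Re z ^+ 2 + complex.Im z ^+ 2.
Proof. by case: z => a b /=; rewrite sqr_sqrtr// addr_ge0// sqr_ge0. Qed.

Lemma Re_sub (x y : R[i]) : complex.Re (x - y) = complex.Re x - complex.Re y.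
Proof. by case: x y => [a b] [c e]. Qed.

Lemma Im_sub (x y : R[i]) : complex.Im (x - y) = complex.Im x - complex.Im y.
Proof. by case: x y => [a b] [c e]. Qed.

Lemma CvarianceE (X : T -> R[i]) : Cvariance P X =
  (\int[P]_w (((complex.Re (X w) - fine (\int[P]_w (complex.Re (X w))%:E)) ^+ 2 +
              (complex.Im (X w) - fine (\int[P]_w (complex.Im (X w))%:E)) ^+ 2)%R)%:E)%E.
Proof.
rewrite /Cvariance /Cexpectation unlock.
by apply: eq_integral => w _; rewrite normc_sqr Re_sub Im_sub.
Qed.

Lemma Cvariance_ge0 (X : T -> R[i]) : (0 <= Cvariance P X)%E.
Proof. by rewrite CvarianceE; apply: integral_ge0 => w _; rewrite lee_fin addr_ge0// sqr_ge0. Qed.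

Lemma Cvariance_ae_eq (X Y : T -> R[i]) :
  measurable_fun setT (fun w => complex.Re (X w)) ->
  measurable_fun setT (fun w => complex.Im (X w)) ->
  measurable_fun setT (fun w => complex.Re (Y w)) ->
  measurable_fun setT (fun w => complex.Im (Y w)) ->
  {ae P, forall w, X w = Y w} -> Cvariance P X = Cvariance P Y.
Proof.
move=> mXr mXi mYr mYi XY; rewrite !CvarianceE.
have e1 : (\int[P]_w (complex.Re (X w))%:E = \int[P]_w (complex.Re (Y w))%:E)%E.
  apply: ae_eq_integral => //; [exact/measurable_EFinP..|].
  by move: XY; apply: filterS => w /= ->.
have e2 : (\int[P]_w (complex.Im (X w))%:E = \int[P]_w (complex.Im (Y w))%:E)%E.
  apply: ae_eq_integral => //; [exact/measurable_EFinP..|].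
  by move: XY; apply: filterS => w /= ->.
rewrite e1 e2; apply: ae_eq_integral => //.
- by apply/measurable_EFinP; apply: measurable_funD; apply: measurable_funX; apply: measurable_funB.
- by apply/measurable_EFinP; apply: measurable_funD; apply: measurable_funX; apply: measurable_funB.
- by move: XY; apply: filterS => w /= ->.
Qed.

Lemma Cvariance_lty (a b : T -> R) : L2 P a -> L2 P b ->
  (Cvariance P (fun w => a w +i* b w) < +oo)%E.
Proof.
move=> a2 b2; rewrite CvarianceE/=.
have L2c (c : R) : L2 P (fun=> c).
  split=> //; apply: ge0_L1 => //; first by move=> w; exact: sqr_ge0.
  by rewrite integral_cst//= probability_setT mule1 ltry.
apply: (L1_lty (L1D (L2B a2 (L2c _)).2 (L2B b2 (L2c _)).2)) => w.
by rewrite addr_ge0// sqr_ge0.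
Qed.

End variance.

Section Ccb_bcs.
Context {R : realType} {d : nat}.
Implicit Types (f : d.-tuple R -> R[i]) (g : d.-tuple R -> R).

Lemma norm_tnth_le_enorm (x : d.-tuple R) i : `|tnth x i| <= enorm x.
Proof.
rewrite -sqrtr_sqr ler_sqrt ?sumr_ge0// => [|j _]; last by rewrite -expr2 sqr_ge0.
by rewrite /dotprod (bigD1 i)//= -expr2 lerDl sumr_ge0// => j _; rewrite -expr2 sqr_ge0.
Qed.

Lemma enorm_cube_le (x : d.-tuple R) r : cube r x -> enorm x <= Num.sqrt (d%:R * r ^+ 2).
Proof.
move=> xr; rewrite ler_wsqrtr// /dotprod.
rewrite (_ : d%:R * r ^+ 2 = \sum_(i < d) r ^+ 2); last by rewrite sumr_const card_ord mulr_natl.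
apply: ler_sum => i _; have := xr i; rewrite -ler_norml => xi.
by rewrite -expr2 -real_normK ?num_real// ler_pXn2r ?nnegrE// (le_trans _ xi).
Qed.

Lemma bcs_Re f : Ccb f -> bcs (fun x => complex.Re (f x)).
Proof.
move=> [m1 m2 [C fC] [r fr]]; split=> //.
- exists C => x; rewrite (le_trans _ (fC x))// -sqrtr_sqr.
  by case: (f x) => a b /=; rewrite ler_wsqrtr// lerDl sqr_ge0.
- exists r => x fx i; rewrite -ler_norml (le_trans (norm_tnth_le_enorm x i))//.
  by rewrite leNgt; apply/negP => /fr fx0; rewrite fx0 eqxx in fx.
Qed.

Lemma bcs_Im f : Ccb f -> bcs (fun x => complex.Im (f x)).
Proof.
move=> [m1 m2 [C fC] [r fr]]; split=> //.
- exists C => x; rewrite (le_trans _ (fC x))// -sqrtr_sqr.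
  by case: (f x) => a b /=; rewrite ler_wsqrtr// lerDr sqr_ge0.
- exists r => x fx i; rewrite -ler_norml (le_trans (norm_tnth_le_enorm x i))//.
  by rewrite leNgt; apply/negP => /fr fx0; rewrite fx0 eqxx in fx.
Qed.

Lemma Ccb_bcs (a b : d.-tuple R -> R) : bcs a -> bcs b -> Ccb (fun x => a x +i* b x).
Proof.
move=> [ma [C aC] [r ar]] [mb [D bD] [q bq]]; split=> //=.
- exists (Num.sqrt (C ^+ 2 + D ^+ 2)) => x; rewrite ler_wsqrtr//.
  by rewrite lerD// -real_normK ?num_real// ler_pXn2r ?nnegrE// (le_trans _ (aC x), le_trans _ (bD x)).
- exists (Num.max (Num.sqrt (d%:R * r ^+ 2)) (Num.sqrt (d%:R * q ^+ 2))) => x.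
  rewrite gt_max => /andP[h1 h2]; congr (_ +i* _).
    by apply/eqP; apply: contraLR h1 => /ar/enorm_cube_le; rewrite -leNgt.
  by apply/eqP; apply: contraLR h2 => /bq/enorm_cube_le; rewrite -leNgt.
Qed.

Lemma bcs0 : bcs (fun _ : d.-tuple R => 0).
Proof. by split=> //; exists 0 => x; rewrite ?normr0// eqxx. Qed.

Lemma hartley0 (u : d.-tuple R) : hartley (fun=> 0) u = 0.
Proof. by rewrite /hartley (eq_Rint _ (g := fun=> 0)) ?Rint0// => x; rewrite mul0r. Qed.

Lemma Ccb_real g : bcs g -> Ccb (fun x => (g x)%:C).
Proof. by move=> bg; apply: Ccb_bcs => //; exact: bcs0. Qed.

End Ccb_bcs.

Section spectral.
Context {R : realType} {d : nat} {disp} {T : measurableType disp}.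
Context {P : probability T R} (M : wss_measure d P).
Local Notation S := (spectral_measure M).
Implicit Types (f : d.-tuple R -> R[i]) (g : d.-tuple R -> R).

Lemma ge0_integral_sym (F : d.-tuple R -> \bar R) : measurable_fun setT F ->
  (forall x, 0 <= F x)%E -> (\int[S]_x F (vopp x) = \int[S]_x F x)%E.
Proof.
move=> mF F0; have mo := @measurable_vopp R d.
rewrite [RHS](@eq_measure_integral _ _ _ _ (pushforward S (@vopp R d))); last first.
  move=> A mA _.
  exact/esym/spectral_measure_sym.
by rewrite (ge0_integral_pushforward mo).
Qed.

(** Averaging over [u] and [- u], by symmetry of the spectral measure, removes the
    terms that mix the real and imaginary parts. *)
Lemma fourier_hartley f : Ccb f ->
  (\int[S]_u ((normc (fourier f u)) ^+ 2)%:E =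
   \int[S]_u ((hartley (fun x => complex.Re (f x)) u ^+ 2 +
               hartley (fun x => complex.Im (f x)) u ^+ 2)%R)%:E)%E.
Proof.
move=> Cf; pose a x := complex.Re (f x); pose b x := complex.Im (f x).
have ai : L1 (lam d) a by exact/L1_bcs/bcs_Re.
have bi : L1 (lam d) b by exact/L1_bcs/bcs_Im.
pose co g u := \int[lam d]_x (g x * cos (dotprod u x)).
pose si g u := \int[lam d]_x (g x * sin (dotprod u x)).
have ic g u : L1 (lam d) g -> L1 (lam d) (fun x => g x * cos (dotprod u x)).
  move=> gi; have mc : measurable_fun setT (fun x : d.-tuple R => cos (dotprod u x)).
    by apply: measurable_cos; exact: measurable_dotprod.
  have := L1_bounded_mul gi mc (fun x => cos_max _).
  by under eq_fun do rewrite mulrC.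
have is_ g u : L1 (lam d) g -> L1 (lam d) (fun x => g x * sin (dotprod u x)).
  move=> gi; have mc : measurable_fun setT (fun x : d.-tuple R => sin (dotprod u x)).
    by apply: measurable_sin; exact: measurable_dotprod.
  have := L1_bounded_mul gi mc (fun x => sin_max _).
  by under eq_fun do rewrite mulrC.
have hE g u : L1 (lam d) g -> hartley g u = co g u + si g u.
  move=> gi; rewrite /hartley -RintD; [|exact: ic|exact: is_].
  by apply: eq_Rint => x; rewrite /cas mulrDr.
have hNE g u : L1 (lam d) g -> hartley g (vopp u) = co g u - si g u.
  move=> gi; rewrite /hartley -RintB; [|exact: ic|exact: is_].
  by apply: eq_Rint => x; rewrite /cas dotprodC dotprodNr dotprodC cosN sinN; ring.
have fE u : normc (fourier f u) ^+ 2 = (co a u + si b u) ^+ 2 + (co b u - si a u) ^+ 2.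
  rewrite normc_sqr /fourier /Cintegral/=; congr (_ ^+ 2 + _ ^+ 2).
    rewrite -RintD; [|exact: ic|exact: is_]; apply: eq_Rint => x.
    rewrite /a /b; case: (f x) => p q /=; rewrite cosN sinN; ring.
  rewrite -RintB; [|exact: ic|exact: is_]; apply: eq_Rint => x.
  rewrite /a /b; case: (f x) => p q /=; rewrite cosN sinN; ring.
pose ha := hartley a; pose hb := hartley b.
have mha : measurable_fun setT ha by exact: measurable_hartley.
have mhb : measurable_fun setT hb by exact: measurable_hartley.
have mo := @measurable_vopp R d.
have mhaN : measurable_fun setT (fun u => ha (vopp u)) by exact: (measurableT_comp mha mo).
have mhbN : measurable_fun setT (fun u => hb (vopp u)) by exact: (measurableT_comp mhb mo).
pose F (u : d.-tuple R) : R := normc (fourier f u) ^+ 2.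
pose G (u : d.-tuple R) : R := ha u ^+ 2 + hb u ^+ 2.
have voppK u : vopp (vopp u) = u :> d.-tuple R.
  by apply: eq_from_tnth => i; rewrite !tnth_mktuple opprK.
have coE g u : L1 (lam d) g -> co g u = 2^-1 * (hartley g u + hartley g (vopp u)).
  by move=> gi; rewrite hE// hNE//; field.
have siE g u : L1 (lam d) g -> si g u = 2^-1 * (hartley g u - hartley g (vopp u)).
  by move=> gi; rewrite hE// hNE//; field.
have FE u : F u = (co a u + si b u) ^+ 2 + (co b u - si a u) ^+ 2 by exact: fE.
have mco g : measurable_fun setT (hartley g) -> L1 (lam d) g ->
    measurable_fun setT (co g) /\ measurable_fun setT (si g).
  move=> mg gi; have mgN : measurable_fun setT (fun u => hartley g (vopp u)).
    exact: (measurableT_comp mg mo).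
  rewrite (funext (coE g ^~ gi)) (funext (siE g ^~ gi)); split; apply: measurable_funM => //.
    exact: measurable_funD.
  exact: measurable_funB.
have [mca msa] := mco _ mha ai; have [mcb msb] := mco _ mhb bi.
have mF : measurable_fun setT F.
  rewrite (funext FE); apply: measurable_funD; apply: measurable_funX.
    exact: measurable_funD.
  exact: measurable_funB.
have mG : measurable_fun setT G by apply: measurable_funD; apply: measurable_funX.
have F0 u : 0 <= F u by exact: sqr_ge0.
have G0 u : 0 <= G u by rewrite addr_ge0// sqr_ge0.
have FG u : F u + F (vopp u) = G u + G (vopp u).
  by rewrite !FE !coE// !siE// /G -/ha -/hb !voppK; field.
have mEF : measurable_fun setT (fun u => (F u)%:E) by exact/measurable_EFinP.
have mEG : measurable_fun setT (fun u => (G u)%:E) by exact/measurable_EFinP.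
have mEFN : measurable_fun setT (fun u => (F (vopp u))%:E) by exact: (measurableT_comp mEF mo).
have mEGN : measurable_fun setT (fun u => (G (vopp u))%:E) by exact: (measurableT_comp mEG mo).
have dbl (H : d.-tuple R -> R) : (forall u, 0 <= H u) ->
    measurable_fun setT (fun u => (H u)%:E) ->
    (\int[S]_u (H u + H (vopp u))%:E = \int[S]_u (H u)%:E + \int[S]_u (H u)%:E)%E.
  move=> H0 mH; rewrite -[X in _ = (X + _)%E](ge0_integral_sym mH) => [|x]; last by rewrite lee_fin.
  rewrite addeC -ge0_integralD//.
  - by move=> u _; rewrite lee_fin.
  - by move=> u _; rewrite lee_fin.
  - exact: (measurableT_comp mH mo).
have : (\int[S]_u (F u)%:E + \int[S]_u (F u)%:E = \int[S]_u (G u)%:E + \int[S]_u (G u)%:E)%E.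
  by rewrite -!dbl//; apply: eq_integral => u _; rewrite FG.
by move=> /ge0_double_inj; apply; apply: integral_ge0 => u _; rewrite lee_fin.
Qed.

Lemma variance_hartley f : Ccb f -> Cvariance P (IM M f) =
  (((2 * pi) ^- d)%:E *
   \int[S]_u ((hartley (fun x => complex.Re (f x)) u ^+ 2 +
               hartley (fun x => complex.Im (f x)) u ^+ 2)%R)%:E)%E.
Proof. by move=> Cf; rewrite /IM wss_var_spectral// fourier_hartley. Qed.

Let c0 : 0 < (2 * pi : R) ^- d.
Proof. by rewrite invr_gt0 exprn_gt0// mulr_gt0// pi_gt0. Qed.

Let mI (g : d.-tuple R -> R) : measurable_fun setT (wss_int M g).
Proof. exact: measurable_funPT. Qed.

Lemma hartley_L2 g : bcs g -> L2 S (hartley g).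
Proof.
move=> bg; have gi := L1_bcs bg; have mg := measurable_hartley gi; split=> //.
apply: ge0_L1; [exact: measurable_funX|by move=> u; exact: sqr_ge0|].
have Cg := Ccb_real bg.
have : (Cvariance P (IM M (fun x => (g x)%:C)) < +oo)%E.
  apply: Cvariance_lty; split; first exact: mI.
  - exact/Lfun2_integrable_sqr/wss_int_L2.
  - exact: mI.
  - exact/Lfun2_integrable_sqr/wss_int_L2/Ccb_real/bcs0.
rewrite variance_hartley//=.
rewrite (eq_integral (fun u => (hartley g u ^+ 2)%:E)); last first.
  by move=> u _; rewrite hartley0 expr0n addr0.
rewrite !ltNge !leye_eq; apply: contra => /eqP ->.
by rewrite gt0_muley ?lte_fin.
Qed.

Lemma variance_sub f k : Ccb f -> Ccb k ->
  Cvariance P (fun w => IM M f w - IM M k w) = Cvariance P (IM M (fun x => f x - k x)).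
Proof.
move=> Cf Ck; apply: Cvariance_ae_eq.
- by under eq_fun do rewrite Re_sub; apply: measurable_funB; exact: mI.
- by under eq_fun do rewrite Im_sub; apply: measurable_funB; exact: mI.
- exact: mI.
- exact: mI.
have H1 := wss_int_linear M (-1) (Ccb_real (bcs_Re Ck)) (Ccb_real (bcs_Re Cf)).
have H2 := wss_int_linear M (-1) (Ccb_real (bcs_Im Ck)) (Ccb_real (bcs_Im Cf)).
apply: filterS2 H1 H2 => w h1 h2; rewrite /IM /Cextend.
have -> : (fun x => complex.Re (f x - k x)) = (fun x => -1 * complex.Re (k x) + complex.Re (f x)).
  by apply/funext => x; rewrite Re_sub; ring.
have -> : (fun x => complex.Im (f x - k x)) = (fun x => -1 * complex.Im (k x) + complex.Im (f x)).
  by apply/funext => x; rewrite Im_sub; ring.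
by rewrite h1 h2; apply/eqP; rewrite eq_complex/= !mulN1r ![- _ + _]addrC !eqxx.
Qed.

Lemma variance_sub_hartley f k : Ccb f -> Ccb k ->
  Cvariance P (fun w => IM M f w - IM M k w) =
  (((2 * pi) ^- d)%:E *
   ((\int[S]_u (hartley (fun x => complex.Re (f x) - complex.Re (k x)) u ^+ 2) +
     \int[S]_u (hartley (fun x => complex.Im (f x) - complex.Im (k x)) u ^+ 2))%R)%:E)%E.
Proof.
move=> Cf Ck; rewrite variance_sub// variance_hartley; last first.
  have b1 := bcs_lin (-1) (bcs_Re Ck) (bcs_Re Cf).
  have b2 := bcs_lin (-1) (bcs_Im Ck) (bcs_Im Cf).
  have := Ccb_bcs b1 b2; congr Ccb; apply/funext => x.
  by case: (f x) (k x) => [p q] [p' q'] /=; apply/eqP; rewrite eq_complex/= !mulN1r ![- _ + _]addrC !eqxx.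
have bR : bcs (fun x => complex.Re (f x) - complex.Re (k x)).
  by apply: (bcs_sum_eq _ (bcs_lin (-1) (bcs_Re Ck) (bcs_Re Cf))) => x; ring.
have bI : bcs (fun x => complex.Im (f x) - complex.Im (k x)).
  by apply: (bcs_sum_eq _ (bcs_lin (-1) (bcs_Im Ck) (bcs_Im Cf))) => x; ring.
have [_ i1] := hartley_L2 bR; have [_ i2] := hartley_L2 bI.
have -> : (fun x => complex.Re (f x - k x)) = (fun x => complex.Re (f x) - complex.Re (k x)).
  by apply/funext => x; rewrite Re_sub.
have -> : (fun x => complex.Im (f x - k x)) = (fun x => complex.Im (f x) - complex.Im (k x)).
  by apply/funext => x; rewrite Im_sub.
by rewrite -RintD// EFin_Rintegral//; exact: L1D.
Qed.

(** If [M] is not maximally rigid on [A], some real test function on [A] stays away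
    from the test functions off [A]; the component [phi] of its transform orthogonal
    to theirs is the object to be analysed. *)
Lemma not_rigid_orthogonal A : ~ linearly_maximally_rigid M A ->
  exists g phi, [/\ bcs g, L2 S phi,
    forall h, bcs h -> (forall x, A x -> h x = 0) -> \int[S]_u (phi u * hartley h u) = 0 &
    \int[S]_u (phi u * hartley g u) != 0].
Proof.
move=> /existsNP[gam /not_implyP[[Cg gA] nrig]].
pose V (h : d.-tuple R -> R[i]) := Cvariance P (fun w => IM M gam w - IM M h w).
have [eps eps0 epsV] : exists2 eps : R, 0 < eps &
    forall h, Ccb_on (~` A) h -> (eps%:E <= V h)%E.
  have ge0 : (0 <= ereal_inf [set V h | h in Ccb_on (~` A)])%E.
    by apply: le_ereal_inf_tmp => _ [h _ <-]; exact: Cvariance_ge0.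
  have lb h : Ccb_on (~` A) h -> (ereal_inf [set V h | h in Ccb_on (~` A)] <= V h)%E.
    by move=> Ah; apply: ereal_inf_lbound; exists h.
  have ne0 : ereal_inf [set V h | h in Ccb_on (~` A)] != 0%E by apply/eqP.
  move: ge0 lb ne0; case: (ereal_inf _) => [e| |] // e0 lb ne0.
    by exists e => //; rewrite lt_neqAle -lee_fin e0 andbT eq_sym -eqe.
  by exists 1 => // h /lb; rewrite leye_eq => /eqP ->; rewrite leey.
have bR := bcs_Re Cg; have bI := bcs_Im Cg.
pose off h := bcs h /\ forall x, A x -> h x = 0.
pose far (g : d.-tuple R -> R) e := forall h, off h -> e <= \int[S]_u (hartley (fun x => g x - h x) u ^+ 2).
pose c : R := (2 * pi) ^- d; pose e := eps / (c *+ 2).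
have e0 : 0 < e by rewrite divr_gt0// pmulrn_lgt0.
have [g [bg fg]] : exists g, bcs g /\ far g e.
  apply: contrapT => /forallNP H.
  have {}H g : bcs g -> exists2 h, off h & \int[S]_u (hartley (fun x => g x - h x) u ^+ 2) < e.
    move=> bg; have := H g => /not_andP[//|] /existsNP[h /not_implyP[oh /negP]].
    by rewrite -ltNge; exists h.
  have [h1 [b1 o1] l1] := H _ bR; have [h2 [b2 o2] l2] := H _ bI.
  have Ch := Ccb_bcs b1 b2.
  have := epsV (fun x => h1 x +i* h2 x); rewrite /V variance_sub_hartley//= => /(_ _)/wrap[].
    by split=> // x /contrapT Ax; rewrite o1// o2.
  rewrite -EFinM lee_fin leNgt -/c => /negP; apply.
  have -> : eps = c * (e + e) by rewrite /e; field; rewrite gt_eqF.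
  move: l1 l2; move: (\int[S]_u _) (\int[S]_u _) => X Y l1 l2.
  by rewrite (ltr_pM2l c0); exact: ltrD l1 l2.
pose W (w : d.-tuple R -> R) := exists2 h, off h & w = hartley h.
have W0 : W (fun=> 0).
  by exists (fun=> 0); [split=> //; exact: bcs0|apply/funext => u; rewrite hartley0].
have Wlin a (w1 w2 : d.-tuple R -> R) : W w1 -> W w2 -> W (fun x => a * w1 x + w2 x).
  move=> [h1 [b1 o1] ->] [h2 [b2 o2] ->].
  exists (fun x => a * h1 x + h2 x).
    by split; [exact: bcs_lin|move=> x Ax; rewrite o1// o2// mulr0 addr0].
  by apply/funext => u; rewrite hartley_lin//; exact: L1_bcs.
have WL2 w : W w -> L2 S w by move=> [h [bh _] ->]; exact: hartley_L2.
have Wfar w : W w -> e <= \int[S]_u ((hartley g u - w u) ^+ 2).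
  move=> [h oh ->]; apply: (le_trans (fg _ oh)); rewrite le_eqVlt; apply/orP; left; apply/eqP.
  apply: eq_Rint => u; congr (_ ^+ 2).
  transitivity (hartley (fun x => -1 * h x + g x) u).
    by congr (hartley _ u); apply/funext => x; ring.
  by rewrite hartley_lin ?L1_bcs//; [ring|case: oh].
have [phi [p1 p2 p3]] := exists_orthogonal W0 Wlin WL2 (hartley_L2 bg) e0 Wfar.
exists g, phi; split=> // h bh oh; apply: p2; by exists h.
Qed.

End spectral.

(** * Inversion on boxes *)

Section preliminaries.
Context {R : realType}.

Lemma Rint_prod n (p : 'I_n -> R -> R) : (forall i, L1 leb (p i)) ->
  (forall i t, 0 <= p i t) ->
  \int[lam n]_x (\prod_(i < n) p i (tnth x i)) = \prod_(i < n) \int[leb]_t p i t.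
Proof.
move=> ip p0; rewrite /Rintegral.
have EP (I : Type) (r : seq I) (f : I -> R) :
    ((\prod_(i <- r) f i)%:E = \prod_(i <- r) (f i)%:E)%E.
  by elim/big_rec2: _ => // i x y _ <-.
rewrite (eq_integral (fun x => \prod_(i < n) (p i (tnth x i))%:E)%E); last first.
  by move=> x _; rewrite EP.
rewrite (@ge0_integral_prod R n (fun i t => (p i t)%:E)).
- rewrite (eq_bigr (fun i => (\int[leb]_t p i t)%:E)) -?EP// => i _.
  by rewrite EFin_Rintegral.
- by move=> i; apply/measurable_EFinP; exact: L1_measurable (ip i).
- by move=> i t; rewrite lee_fin.
Qed.

Lemma integral_in_indic d (T : measurableType d) (mu : {measure set T -> \bar R})
    (A : set T) (f : T -> R) :
  (\int[mu]_(x in A) (f x)%:E = \int[mu]_x (\1_A x * f x)%:E)%E.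
Proof.
rewrite integral_mkcond; apply: eq_integral => x _; rewrite patchE indicE.
by case: ifP => _; rewrite ?mul1r ?mul0r.
Qed.

Lemma exists_density d (T : measurableType d) (mu : {measure set T -> \bar R})
    (f : T -> \bar R) : measurable_fun setT f -> (forall x, 0 <= f x)%E ->
  exists m : {measure set T -> \bar R},
    forall A, m A = (\int[mu]_(x in A) f x)%E.
Proof.
move=> mf f0; pose m A := (\int[mu]_(x in A) f x)%E.
have m0 : m set0 = 0%E by rewrite /m integral_set0.
have mge0 A : (0 <= m A)%E by apply: integral_ge0.
have madd : semi_sigma_additive m.
  move=> F mF tF mUF; rewrite /m ge0_integral_bigcup//; last first.
    by apply: measurable_funTS.
  by apply: is_cvg_nneseries => n _ _; exact: mge0.
pose mm := isMeasure.Build _ _ _ m m0 mge0 madd.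
pose M : {measure set T -> \bar R} := HB.pack m mm.
by exists M.
Qed.

(* The closed interval is approached through larger ones, so that the limit is
   right at the end points too. *)
Definition slab (a b : R) N (u : R) := \int[leb]_t
  (\1_(`[a - N.+1%:R^-1, b + N.+1%:R^-1]%classic) (N.+1%:R ^- 2 * t + u) * fejer t).

Let in_itvE (a b t : R) : (\1_(`[a, b]%classic) t : R) = ((a <= t) && (t <= b))%:R.
Proof. by rewrite indicE mem_setE in_itv. Qed.

Let measurable_slab (a b : R) N (u : R) : measurable_fun setT (fun t : R =>
  \1_(`[a - N.+1%:R^-1, b + N.+1%:R^-1]%classic) (N.+1%:R ^- 2 * t + u) * fejer t : R).
Proof.
apply: measurable_funM; last exact: measurable_fejer.
have m1 : measurable_fun setT (\1_(`[a - N.+1%:R^-1, b + N.+1%:R^-1]%classic) : R -> R).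
  exact: measurable_indic.
have m2 : measurable_fun setT (fun t : R => N.+1%:R ^- 2 * t + u).
  by apply: measurable_funD => //; exact: measurable_funM.
exact: (measurableT_comp m1 m2).
Qed.

Lemma cvg_slab (a b u : R) :
  slab a b N u @[N --> \oo] --> (\1_(`[a, b]%classic) u * fejer_mass : R).
Proof.
pose f N t : R := \1_(`[a - N.+1%:R^-1, b + N.+1%:R^-1]%classic) (N.+1%:R ^- 2 * t + u) * fejer t.
pose g t : R := \1_(`[a, b]%classic) u * fejer t.
have mf N : measurable_fun setT (f N) by exact: measurable_slab.
have fb N t : `|f N t| <= fejer t.
  rewrite normrM [`|fejer t|]ger0_norm ?fejer_ge0// ler_piMl ?fejer_ge0//.
  by rewrite in_itvE; case: andP => _; rewrite ?normr1 ?normr0.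
have fg t : f ^~ t @ \oo --> g t.
  rewrite /f /g; apply: cvgMl.
  apply: cvg_near_cst.
  pose e N : R := N.+1%:R^-1.
  have e0 N : 0 < e N by rewrite invr_gt0.
  have ecvg : e N @[N --> \oo] --> (0 : R) by exact: cvg_harmonic.
  have near_lt (z : R) : 0 < z -> \forall N \near \oo, e N < z.
    by move=> z0; apply: (cvgr_lt _ ecvg).
  have E N : N.+1%:R ^- 2 * t = e N * (e N * t).
    by rewrite -exprVn expr2 mulrA.
  have small (z : R) : 0 < z -> \forall N \near \oo, `|e N * t| <= z.
    move=> z0; have z' : 0 < z / (`|t| + 1) by rewrite divr_gt0// ltr_wpDl.
    near=> N; have : e N < z / (`|t| + 1) by near: N; exact: near_lt.
    rewrite ltr_pdivlMr ?ltr_wpDl// => h; rewrite normrM gtr0_norm//.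
    by rewrite (le_trans _ (ltW h))// ler_wpM2l ?ltW// ltrDl.
  have [au|ua] := leP a u; last first.
    near=> N; rewrite !in_itvE [a <= u]leNgt ua/=.
    have h1 : e N < (a - u) / 2 by near: N; apply: near_lt; rewrite divr_gt0// subr_gt0.
    have h2 : `|e N * t| <= 1 by near: N; exact: small.
    suff -> : (a - N.+1%:R^-1 <= N.+1%:R ^- 2 * t + u) = false by [].
    apply/negbTE; rewrite -ltNge E -/(e N).
    have : e N * (e N * t) <= e N 
      by apply: ler_piMr; [exact: ltW|exact: le_trans (ler_norm _) h2].
    by move: h1; lra.
  have [ub|bu] := leP u b; last first.
    near=> N; rewrite !in_itvE [u <= b]leNgt bu/= andbF.
    have h1 : e N < (u - b) / 2 by near: N; apply: near_lt; rewrite divr_gt0// subr_gt0.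
    have h2 : `|e N * t| <= 1 by near: N; exact: small.
    suff -> : (N.+1%:R ^- 2 * t + u <= b + N.+1%:R^-1) = false by rewrite andbF.
    apply/negbTE; rewrite -ltNge E -/(e N).
    have : - (e N * (e N * t)) <= e N.
      rewrite -mulrN; apply: ler_piMr; [exact: ltW|].
      by apply: le_trans h2; rewrite -normrN ler_norm.
    by move: h1; lra.
  near=> N; have h2 : `|e N * t| <= 1 by near: N; exact: small.
  have : `|e N * (e N * t)| <= e N by rewrite normrM gtr0_norm// ler_piMr// ltW.
  rewrite ler_norml !in_itvE E -/(e N) au ub/= => /andP[h3 h4].
  suff -> : (a - e N <= e N * (e N * t) + u) && (e N * (e N * t) + u <= b + e N) by [].
  by move: (e N * (e N * t)) h3 h4 => z h3 h4; apply/andP; split; lra.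
have [_] := @dominated_Rint _ _ _ (@leb R) f g (@fejer R) mf L1_fejer fb fg.
by rewrite /g RintZl ?L1_fejer.
Unshelve. all: by end_near. Qed.

Lemma cvg_closed_itv (a b u : R) :
  (\1_(`[a - N.+1%:R^-1, b + N.+1%:R^-1]%classic) u : R) @[N --> \oo] --> (\1_(`[a, b]%classic) u : R).
Proof.
have near_lt (z : R) : 0 < z -> \forall N \near \oo, (N.+1%:R^-1 : R) < z.
  by move=> z0; apply: (cvgr_lt _ (@cvg_harmonic R)).
apply: cvg_near_cst; have [au|ua] := leP a u; last first.
  near=> N; rewrite !in_itvE [a <= u]leNgt ua/=.
  have h1 : (N.+1%:R^-1 : R) < a - u by near: N; apply: near_lt; rewrite subr_gt0.
  suff -> : (a - N.+1%:R^-1 <= u) = false by [].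
  by apply/negbTE; rewrite -ltNge; move: (N.+1%:R^-1 : R) h1 => z h1; lra.
have [ub|bu] := leP u b; last first.
  near=> N; rewrite !in_itvE [u <= b]leNgt bu/= andbF.
  have h1 : (N.+1%:R^-1 : R) < u - b by near: N; apply: near_lt; rewrite subr_gt0.
  suff -> : (u <= b + N.+1%:R^-1) = false by rewrite andbF.
  by apply/negbTE; rewrite -ltNge; move: (N.+1%:R^-1 : R) h1 => z h1; lra.
near=> N; rewrite !in_itvE au ub/=.
have h : 0 <= (N.+1%:R^-1 : R) by rewrite invr_ge0.
suff -> : (a - N.+1%:R^-1 <= u) && (u <= b + N.+1%:R^-1) by [].
by move: (N.+1%:R^-1 : R) h => z h; apply/andP; split; lra.
Unshelve. all: by end_near. Qed.

Lemma cvg_prod_ord n (f : 'I_n -> nat -> R) (l : 'I_n -> R) :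
  (forall i, f i @ \oo --> l i) -> \prod_(i < n) f i N @[N --> \oo] --> \prod_(i < n) l i.
Proof.
elim: n f l => [|n IH] f l fl.
  by rewrite big_ord0; under eq_fun do rewrite big_ord0; exact: cvg_cst.
rewrite big_ord_recl; under eq_fun do rewrite big_ord_recl.
by apply: cvgM; [exact: fl|apply: IH => i; exact: fl].
Qed.

Lemma slab_ge0 a b N u : 0 <= slab a b N u.
Proof.
by apply: Rintegral_ge0 => t _; rewrite mulr_ge0 ?fejer_ge0// in_itvE.
Qed.

Lemma slab_le a b N u : slab a b N u <= fejer_mass.
Proof.
apply: le_Rint; [|exact: L1_fejer|].
  apply: (@L1_le _ _ _ (@leb R) _ (@fejer R) (measurable_slab a b N u) L1_fejer).
  move=> t; rewrite normrM [`|fejer t|]ger0_norm ?fejer_ge0// ler_piMl ?fejer_ge0//.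
  by rewrite in_itvE; case: andP => _; rewrite ?normr1 ?normr0.
move=> t; rewrite ler_piMl ?fejer_ge0// in_itvE; by case: andP.
Qed.

End preliminaries.

Section box_inversion.
Context {R : realType} {n : nat}.
Variables (a b : 'I_n -> R).

Let c (N : nat) : R := N.+1%:R^-1.
Let Q N : set (n.-tuple R) := box (fun i => a i - c N) (fun i => b i + c N).
Let T N : R := N.+1%:R ^+ 2.

Let T0 N : 0 < T N. Proof. by rewrite exprn_gt0. Qed.

Lemma L1_indic_box (p q : 'I_n -> R) : L1 (lam n) (\1_(box p q)).
Proof.
apply: ge0_L1 => //; first by apply: measurable_indic; exact: measurable_box.
by rewrite integral_indic ?setIT ?lam_box//; exact: measurable_box.
Qed.

(** A cut-off of the transform of a box, whose own transform tends to the indicator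
    of the box. *)
Definition box_probe N (y : n.-tuple R) : R :=
  (T N / fejer_mass) ^+ n * (tent_kernel (T N) y * hartley (\1_(Q N)) y).

Lemma bcs_box_probe N : bcs (box_probe N).
Proof.
have iQ := @L1_indic_box (fun i => a i - c N) (fun i => b i + c N).
have b1 := bcs_mul (bcs_tent_kernel (T0 N) n) (measurable_hartley iQ) (fun u => hartley_bound u iQ).
by apply: (bcs_sum_eq _ (bcs_lin ((T N / fejer_mass) ^+ n - 1) b1 b1)) => y; rewrite /box_probe; ring.
Qed.

Let tent_mass N (y : n.-tuple R) :
  (T N / fejer_mass) ^+ n * tent_kernel (T N) y = \prod_(i < n) tent (tnth y i / T N).
Proof.
rewrite /tent_kernel /vprod -[n in X in X * _]card_ord -prodr_const -big_split/=.
apply: eq_bigr => i _; field; rewrite !gt_eqF ?fejer_mass_gt0 ?T0//.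
Qed.

Let indic_Q_le N x : `|\1_(Q N) x : R| <= `|\1_(Q 0) x|.
Proof.
rewrite !ger0_norm// !indicE ler_nat.
have [/set_mem h|//] := boolP (x \in Q N); rewrite mem_set// => i; have := h i.
have : c N <= c 0 by rewrite lef_pV2 ?posrE// ler_nat.
by move=> h1' /andP[h2 h3]; apply/andP; split; lra.
Qed.

Lemma box_probe_bound N y :
  `|box_probe N y| <= 2 * \int[lam n]_x `|\1_(Q 0) x|.
Proof.
rewrite /box_probe mulrA tent_mass normrM ger0_norm; last first.
  by apply: prodr_ge0 => i _; exact: tent_ge0.
have h1 : \prod_(i < n) tent (tnth y i / T N) <= 1.
  by apply: prodr_ile1 => i _; rewrite tent_ge0 tent_le1.
apply: (le_trans (ler_piMl (normr_ge0 _) h1)).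
apply: (le_trans (hartley_bound _ (L1_indic_box _ _))); rewrite ler_pM2l//.
apply: le_Rint; [exact/L1_norm/L1_indic_box|exact/L1_norm/L1_indic_box|].
exact: indic_Q_le.
Qed.

Lemma cvg_box_probe y : box_probe N y @[N --> \oo] --> hartley (\1_(box a b)) y.
Proof.
rewrite /box_probe.
have c0 : c N @[N --> \oo] --> (0 : R) by exact: cvg_harmonic.
have c_ge0 N : 0 <= c N by rewrite invr_ge0.
have Tc N : (T N)^-1 = c N * c N by rewrite /T /c -exprVn expr2.
have Ti0 : (T N)^-1 @[N --> \oo] --> (0 : R).
  by rewrite (funext Tc) -(mulr0 0); exact: cvgM.
have t1 (z : R) : tent (z / T N) @[N --> \oo] --> (1 : R).
  apply: (@squeeze_cvgr _ _ _ _ (fun N => 1 - `|z| * (T N)^-1) (fun=> 1)); last 2 first.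
  - rewrite -[X in _ --> X](_ : 1 - `|z| * 0 = 1); last by rewrite mulr0 subr0.
    by apply: cvgB; [exact: cvg_cst|exact: cvgMr].
  - exact: cvg_cst.
  near=> N; rewrite tent_le1 andbT /tent le_max normrM normfV [`|T N|]gtr0_norm ?T0//.
  by rewrite lexx orbT.
have p1 : \prod_(i < n) tent (tnth y i / T N) @[N --> \oo] --> (1 : R).
  have := @cvg_prod_ord R n (fun i N => tent (tnth y i / T N)) (fun=> 1) (fun i => t1 _).
  by rewrite big1.
have h1 : hartley (\1_(Q N)) y @[N --> \oo] --> hartley (\1_(box a b)) y.
  have mQ N : measurable_fun setT (fun x : n.-tuple R => (\1_(Q N) x : R) * cas (dotprod y x)).
    apply: measurable_funM; first by apply: measurable_indic; exact: measurable_box.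
    by apply: measurable_cas; exact: measurable_dotprod.
  have bQ N x : `|(\1_(Q N) x : R) * cas (dotprod y x)| <= 2 * `|\1_(Q 0) x|.
    by rewrite (le_trans (hartley_kernel_le _ _ _))// ler_pM2l// indic_Q_le.
  apply: (proj2 (@dominated_Rint _ _ _ (lam n) _ (fun x => (\1_(box a b) x : R) * cas (dotprod y x)) _
    mQ (L1Zl 2 (L1_norm (L1_indic_box _ _))) bQ _)).
  move=> x; apply: cvgMl; rewrite indic_box.
  under eq_fun do rewrite indic_box.
  by apply: cvg_prod_ord => i; exact: cvg_closed_itv.
under eq_fun do rewrite mulrA tent_mass.
by have H := cvgM p1 h1; rewrite mul1r in H; exact: H.
Unshelve. all: by end_near. Qed.

Let kernel_cas_cas N (u xi : n.-tuple R) :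
  \int[lam n]_y ((T N / fejer_mass) ^+ n * (tent_kernel (T N) y * cas (dotprod u y)) * cas (dotprod y xi)) =
  T N ^+ n * fejer_kernel (T N) (vsub u xi).
Proof.
have ti := L1_tent_kernel (T0 N) n.
have ic w : L1 (lam n) (fun y => tent_kernel (T N) y * cos (dotprod w y + 0)).
  have mc : measurable_fun setT (fun y : n.-tuple R => cos (dotprod w y + 0)).
    by apply: measurable_cos; apply: measurable_funD => //; exact: measurable_dotprod.
  have := L1_bounded_mul ti mc (fun y => cos_max _).
  by under eq_fun do rewrite mulrC.
have is_ w : L1 (lam n) (fun y => tent_kernel (T N) y * sin (dotprod w y + 0)).
  have mc : measurable_fun setT (fun y : n.-tuple R => sin (dotprod w y + 0)).
    by apply: measurable_sin; apply: measurable_funD => //; exact: measurable_dotprod.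
  have := L1_bounded_mul ti mc (fun y => sin_max _).
  by under eq_fun do rewrite mulrC.
transitivity ((T N / fejer_mass) ^+ n * (\int[lam n]_y (tent_kernel (T N) y * cos (dotprod (vsub u xi) y + 0))
   + \int[lam n]_y (tent_kernel (T N) y * sin (dotprod (vadd u xi) y + 0)))); last first.
  rewrite tent_kernel_cos ?T0// tent_kernel_sin ?T0// cos0 sin0 mulr0 addr0 mulr1 mulrA -exprMn.
  by rewrite divfK// gt_eqF// fejer_mass_gt0.
rewrite -RintD// -RintZl; last exact: L1D.
apply: eq_Rint => y; rewrite -!mulrA; congr (_ * _); rewrite -mulrDr; congr (_ * _).
rewrite !addr0 ![dotprod (_ _ xi) y]dotprodC dotprodBr dotprodDr [dotprod y u]dotprodC.
by rewrite /cas cosB sinD; ring.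
Qed.

Lemma hartley_box_probe N u :
  hartley (box_probe N) u = \prod_(i < n) slab (a i) (b i) N (tnth u i).
Proof.
have ti := L1_tent_kernel (T0 N) n.
have mc : measurable_fun setT (fun y : n.-tuple R => cas (dotprod u y)).
  by apply: measurable_cas; exact: measurable_dotprod.
have gi : L1 (lam n) (fun y => (T N / fejer_mass) ^+ n * (tent_kernel (T N) y * cas (dotprod u y))).
  apply: L1Zl; have := L1_bounded_mul ti mc (fun y => cas_max _).
  by under eq_fun do rewrite mulrC.
transitivity (\int[lam n]_y ((T N / fejer_mass) ^+ n * (tent_kernel (T N) y * cas (dotprod u y)) * hartley (\1_(Q N)) y)).
  by apply: eq_Rint => y; rewrite /box_probe; ring.
rewrite (hartley_duality (mu := lam n) (L1_indic_box _ _) gi).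
pose p i t : R := \1_(`[a i - c N, b i + c N]%classic) t * (T N * fejer (T N * (tnth u i - t))).
transitivity (\int[lam n]_xi \prod_(i < n) p i (tnth xi i)).
  apply: eq_Rint => xi; rewrite kernel_cas_cas indic_box big_split/=; congr (_ * _).
  rewrite big_split/= prodr_const card_ord; congr (_ * _).
  by apply: eq_bigr => i _; rewrite tnth_mktuple.
have i1 i : L1 leb (fun t => T N * fejer (T N * (tnth u i - t))).
  apply: L1Zl; have TN : - T N != 0 by rewrite oppr_eq0 gt_eqF ?T0.
  have := L1_affine (T N * tnth u i) TN L1_fejer.
  by apply: eq_ind; congr integrable; apply/funext => t; congr ((fejer _)%:E); ring.
have ip i : L1 leb (p i).
  have m1 : measurable_fun setT (\1_(`[a i - c N, b i + c N]%classic) : R -> R).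
    exact: measurable_indic.
  by apply: (L1_bounded_mul (C := 1) (i1 i) m1) => t; rewrite indicE ger0_norm// lern1 leq_b1.
rewrite Rint_prod//; last first.
  by move=> i t; rewrite mulr_ge0// mulr_ge0 ?fejer_ge0// ltW ?T0.
apply: eq_bigr => i _.
have TN : (T N)^-1 != 0 by rewrite invr_eq0 gt_eqF ?T0.
have := Rint_affine (tnth u i) TN (ip i).
rewrite gtr0_norm ?invr_gt0 ?T0// invrK => H.
transitivity ((T N)^-1 * (T N * \int[leb]_t p i t)); first by rewrite mulKf// gt_eqF ?T0.
have iq := L1_affine (tnth u i) TN (ip i).
rewrite -H -RintZl//; apply: eq_Rint => t; rewrite /p mulrCA; congr (_ * _).
rewrite mulKf ?gt_eqF ?T0// opprD addrCA subrr addr0 mulrN mulrA.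
by rewrite divff ?gt_eqF ?T0// mul1r fejerN.
Qed.

(** Duality of the transform is tested against [box_probe]; both sides converge
    by dominated convergence as [N] grows. *)
Lemma box_inversion (S : {sigma_finite_measure set (n.-tuple R) -> \bar R}) v :
  L1 S v -> bcs (fun y => \int[S]_u (v u * cas (dotprod u y))) ->
  fejer_mass ^+ n * \int[S]_u (\1_(box a b) u * v u) =
  \int[lam n]_x (\1_(box a b) x * hartley (fun y => \int[S]_u (v u * cas (dotprod u y))) x).
Proof.
pose m y := \int[S]_u (v u * cas (dotprod u y)).
move=> iv; rewrite -/m => bm; have mi := L1_bcs bm; have mm := L1_measurable mi.
have mb : measurable_fun setT (\1_(box a b) : n.-tuple R -> R).
  by apply: measurable_indic; exact: measurable_box.
have mH N := measurable_hartley (L1_bcs (bcs_box_probe N)).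
have lhs : \int[S]_u (v u * hartley (box_probe N) u) @[N --> \oo] -->
    fejer_mass ^+ n * \int[S]_u (\1_(box a b) u * v u).
  have i1 : L1 S (fun u => \1_(box a b) u * v u).
    by apply: (L1_bounded_mul (C := 1) iv mb) => u; rewrite indicE ger0_norm// lern1 leq_b1.
  rewrite -RintZl//.
  have := @dominated_Rint _ _ _ S (fun N u => v u * hartley (box_probe N) u)
    (fun u => fejer_mass ^+ n * (\1_(box a b) u * v u)) (fun u => fejer_mass ^+ n * `|v u|).
  case=> //.
  - by move=> N; apply: measurable_funM => //; exact: L1_measurable iv.
  - exact/L1Zl/L1_norm.
  - move=> N u; rewrite normrM mulrC ler_wpM2r// hartley_box_probe.
    rewrite ger0_norm; last by apply: prodr_ge0 => i _; exact: slab_ge0.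
    rewrite -[n in X in _ <= X]card_ord -prodr_const; apply: ler_prod => i _.
    by rewrite slab_ge0 slab_le.
  - move=> u; rewrite mulrA mulrC; apply: cvgMr.
    under eq_fun do rewrite hartley_box_probe.
    rewrite indic_box -[n in _ ^+ n]card_ord -prodr_const -big_split/=.
    apply: cvg_prod_ord => i; rewrite mulrC; exact: cvg_slab.
have rhs : \int[lam n]_y (box_probe N y * m y) @[N --> \oo] -->
    \int[lam n]_y (hartley (\1_(box a b)) y * m y).
  have := @dominated_Rint _ _ _ (lam n) (fun N y => box_probe N y * m y)
    (fun y => hartley (\1_(box a b)) y * m y)
    (fun y => (2 * \int[lam n]_x `|\1_(Q 0) x|) * `|m y|).
  case=> //.
  - by move=> N; apply: measurable_funM => //; exact: L1_measurable (L1_bcs (bcs_box_probe N)).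
  - exact/L1Zl/L1_norm.
  - by move=> N y; rewrite normrM ler_wpM2r// box_probe_bound.
  - by move=> y; apply: cvgMl; exact: cvg_box_probe.
have e N : \int[S]_u (v u * hartley (box_probe N) u) = \int[lam n]_y (box_probe N y * m y).
  exact: hartley_duality (L1_bcs (bcs_box_probe N)) iv.
rewrite (funext e) in lhs.
rewrite (cvg_unique _ lhs rhs)//.
rewrite (eq_Rint _ (g := fun y => m y * hartley (\1_(box a b)) y)); last by move=> y; rewrite mulrC.
rewrite (hartley_duality (mu := lam n) (L1_indic_box _ _) mi).
apply: eq_Rint => x; congr (_ * _); apply: eq_Rint => y.
by rewrite dotprodC.
Qed.

End box_inversion.

(** * Identification of the density *)

Section positive_part.
Context {R : realType}.

Definition pospart (x : R) : R := Num.max x 0.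

Lemma pospart_ge0 x : 0 <= pospart x. Proof. by rewrite le_max lexx orbT. Qed.

Lemma pospart_sub x : pospart x - pospart (- x) = x.
Proof.
rewrite /pospart; have [x0|x0] := leP x 0.
  by rewrite max_l ?oppr_ge0// sub0r opprK.
by rewrite max_r ?oppr_le0 ?ltW// subr0.
Qed.

Lemma pospart_le x : pospart x <= `|x|.
Proof. by rewrite ge_max ler_norm normr_ge0. Qed.

Lemma norm_pospart x : `|x| = pospart x + pospart (- x).
Proof.
rewrite /pospart; have [x0|x0] := leP x 0.
  by rewrite max_l ?oppr_ge0// add0r ler0_norm.
by rewrite max_r ?oppr_le0 ?ltW// addr0 gtr0_norm.
Qed.

Lemma measurable_pospart d (T : measurableType d) (f : T -> R) :
  measurable_fun setT f -> measurable_fun setT (fun x => pospart (f x)).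
Proof. by move=> mf; apply: measurable_maxr. Qed.

Lemma L1_pospart d (T : measurableType d) (mu : {measure set T -> \bar R}) (f : T -> R) :
  L1 mu f -> L1 mu (fun x => pospart (f x)).
Proof.
move=> fi; apply: (L1_le (measurable_pospart (L1_measurable fi)) (L1_norm fi)) => x.
by rewrite ger0_norm ?pospart_ge0// pospart_le.
Qed.

End positive_part.

Section identification.
Context {R : realType} {n : nat}.
Variables (S : {measure set (n.-tuple R) -> \bar R}) (v psi : n.-tuple R -> R) (c : R).
Hypotheses (iv : L1 S v) (mpsi : measurable_fun setT psi).
Hypothesis psi_bounded : exists C, forall x, `|psi x| <= C.
Hypothesis c_ge0 : 0 <= c.
Hypothesis box_eq : forall a b,
  c * \int[S]_u (\1_(box a b) u * v u) = \int[lam n]_u (\1_(box a b) u * psi u).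

Let vp u := c * pospart (v u).
Let vn u := c * pospart (- v u).
Let pp u := pospart (psi u).
Let pn u := pospart (- psi u).

Let ivN : L1 S (fun u => - v u).
Proof. by have := L1Zl (-1) iv; under eq_fun do rewrite mulN1r. Qed.
Let ivp : L1 S vp. Proof. exact/L1Zl/L1_pospart. Qed.
Let ivn : L1 S vn. Proof. exact/L1Zl/L1_pospart. Qed.
Let mpp : measurable_fun setT pp. Proof. exact: measurable_pospart. Qed.
Let mpn : measurable_fun setT pn.
Proof. by apply: measurable_pospart; exact: measurableT_comp. Qed.
Let vp0 u : 0 <= vp u. Proof. by rewrite mulr_ge0// pospart_ge0. Qed.
Let vn0 u : 0 <= vn u. Proof. by rewrite mulr_ge0// pospart_ge0. Qed.
Let pp0 u : 0 <= pp u. Proof. exact: pospart_ge0. Qed.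
Let pn0 u : 0 <= pn u. Proof. exact: pospart_ge0. Qed.

Let L1_indic_mul (mu : {measure set (n.-tuple R) -> \bar R}) A f : measurable A ->
  L1 mu f -> L1 mu (fun u => \1_A u * f u).
Proof.
move=> mA fi; apply: (L1_bounded_mul (C := 1) fi (measurable_indic mA)) => u.
by rewrite indicE ger0_norm// lern1 leq_b1.
Qed.

Let L1_bounded_indic (f : n.-tuple R -> R) A r : measurable_fun setT f ->
  (exists C, forall x, `|f x| <= C) -> measurable A -> A `<=` cube r ->
  L1 (lam n) (fun u => \1_A u * f u).
Proof.
move=> mf [C fC] mA Ar; have C0 : 0 <= C by rewrite (le_trans _ (fC origin)).
apply: (L1_le (measurable_indicM mA mf) (L1Zl C (L1_indic_box (fun=> - r) (fun=> r)))) => u.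
rewrite -cube_box !indicE; have [/set_mem Au|_] := boolP (u \in A).
  by rewrite mem_set ?mul1r ?mulr1//; exact: Ar.
by rewrite mul0r normr0 mulr_ge0.
Qed.

Let pp_bounded : exists C, forall x, `|pp x| <= C.
Proof.
have [C pC] := psi_bounded; exists C => x; rewrite ger0_norm//.
exact: le_trans (pospart_le _) (pC x).
Qed.
Let pn_bounded : exists C, forall x, `|pn x| <= C.
Proof.
have [C pC] := psi_bounded; exists C => x; rewrite ger0_norm//.
by apply: le_trans (pospart_le _) _; rewrite normrN.
Qed.

Let box_cube a b : exists r, box a b `<=` @cube R n r.
Proof.
pose r := \sum_(i < n) (`|a i| + `|b i|); exists r => x xb i; have /andP[h1 h2] := xb i.
have : `|a i| + `|b i| <= r by rewrite /r (bigD1 i)//= lerDl sumr_ge0.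
have := ler_norm (- a i); have := ler_norm (b i); rewrite normrN.
have := normr_ge0 (a i); have := normr_ge0 (b i) => ? ? ? ? ?.
by apply/andP; split; lra.
Qed.

(** Moving the negative parts across the equality on boxes leaves two measures,
    which are finite on boxes and agree there. *)
Lemma box_measure_eq A : measurable A ->
  (\int[S]_(u in A) (vp u)%:E + \int[lam n]_(u in A) (pn u)%:E =
   \int[S]_(u in A) (vn u)%:E + \int[lam n]_(u in A) (pp u)%:E)%E.
Proof.
have ex (mu : {measure set (n.-tuple R) -> \bar R}) (f : n.-tuple R -> R) : measurable_fun setT f ->
    (forall x, 0 <= f x) -> exists m : {measure set (n.-tuple R) -> \bar R},
      forall A, m A = (\int[mu]_(x in A) (f x)%:E)%E.
  move=> mf f0; apply: exists_density; first exact/measurable_EFinP.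
  by move=> x; rewrite lee_fin.
have [m1 E1] := ex S _ (L1_measurable ivp) vp0.
have [m2 E2] := ex (lam n) _ mpn pn0.
have [m3 E3] := ex S _ (L1_measurable ivn) vn0.
have [m4 E4] := ex (lam n) _ mpp pp0.
have boxE a b : [/\ m1 (box a b) = (\int[S]_u (\1_(box a b) u * vp u))%:E,
   m2 (box a b) = (\int[lam n]_u (\1_(box a b) u * pn u))%:E,
   m3 (box a b) = (\int[S]_u (\1_(box a b) u * vn u))%:E &
   m4 (box a b) = (\int[lam n]_u (\1_(box a b) u * pp u))%:E].
  have [r br] := box_cube a b; have mb := measurable_box a b.
  rewrite E1 E2 E3 E4 !(integral_in_indic _ (box a b)) !EFin_Rintegral//; try exact: L1_indic_mul.
  - exact: L1_bounded_indic br.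
  - exact: L1_bounded_indic br.
have add (p q : {measure set (n.-tuple R) -> \bar R}) :
    exists m : {measure set (n.-tuple R) -> \bar R}, forall A, m A = (p A + q A)%E.
  by exists (measure_add p q) => B; exact: measure_addE.
have [m12 E12] := add m1 m2; have [m34 E34] := add m3 m4.
move=> mA; rewrite -E1 -E2 -E3 -E4 -E12 -E34.
apply: measure_unique_box => // a b; rewrite ?E12 ?E34; have [-> -> e3 e4] := boxE a b.
  rewrite e3 e4.
  have [r br] := box_cube a b; have mb := measurable_box a b.
  rewrite -!EFinD; congr (_%:E); have := box_eq a b.
  have i1 := L1_indic_mul mb ivp; have i2 := L1_indic_mul mb ivn.
  have i3 := L1_bounded_indic mpp pp_bounded mb br.
  have i4 := L1_bounded_indic mpn pn_bounded mb br.
  rewrite -RintZl; last exact: L1_indic_mul.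
  rewrite (eq_Rint S (g := fun u => \1_(box a b) u * vp u - \1_(box a b) u * vn u)); last first.
    by move=> u; rewrite -[in LHS](pospart_sub (v u)) /vp /vn; ring.
  rewrite (eq_Rint (lam n) (g := fun u => \1_(box a b) u * pp u - \1_(box a b) u * pn u)); last first.
    by move=> u; rewrite -[in LHS](pospart_sub (psi u)) /pp /pn; ring.
  by rewrite !RintB// => h; lra.
by rewrite -EFinD ltry.
Qed.

Section density.
Variables (s : n.-tuple R -> R) (nu : {measure set (n.-tuple R) -> \bar R}) (N : set (n.-tuple R)).
Hypotheses (ms : measurable_fun setT s) (s0 : forall u, 0 <= s u).
Hypotheses (mN : measurable N) (lamN : lam n N = 0%E) (nuN : nu (~` N) = 0%E).
Hypothesis SE : forall E, measurable E ->
  S E = (\int[lam n]_(u in E) (s u)%:E + nu E)%E.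

Lemma L1_density f : L1 S f -> L1 (lam n) (fun u => f u * s u).
Proof.
move=> fi; have mf := L1_measurable fi.
have : L1 (lam n) (fun u => `|f u| * s u).
  apply: ge0_L1; [by apply: measurable_funM => //; exact: measurableT_comp|by move=> u; rewrite mulr_ge0|].
  have := L1_lty (L1_norm fi) (fun u => normr_ge0 _).
  rewrite (ge0_integral_density ms s0 SE); [|exact/measurable_EFinP/measurableT_comp|by move=> u; rewrite lee_fin].
  apply: le_lt_trans; rewrite -[X in (X <= _)%E]adde0 leeD//.
  by apply: integral_ge0 => u _; rewrite lee_fin.
move=> fsi; apply: (L1_le (measurable_funM mf ms) fsi) => u.
by rewrite normrM (ger0_norm (s0 u)).
Qed.

Let int_off_N (f : n.-tuple R -> R) A : measurable A -> A `<=` ~` N -> L1 S f ->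
  (forall u, 0 <= f u) ->
  (\int[S]_(u in A) (f u)%:E = (\int[lam n]_u (\1_A u * (f u * s u)))%:E)%E.
Proof.
move=> mA AN fi f0; rewrite integral_in_indic (ge0_integral_density ms s0 SE); last 2 first.
- by apply/measurable_EFinP; apply: measurable_indicM => //; exact: L1_measurable fi.
- by move=> u; rewrite lee_fin mulr_ge0// indicE.
rewrite [X in (_ + X)%E](_ : _ = 0%E).
  rewrite adde0 EFin_Rintegral; last exact/L1_indic_mul/L1_density.
  by apply: eq_integral => u _; rewrite -EFinM mulrA.
rewrite (ae_eq_integral (cst 0%E))//.
- by rewrite integral0.
- by apply/measurable_EFinP; apply: measurable_indicM => //; exact: L1_measurable fi.
exists (~` N); split=> //; first exact: measurableC.
move=> u /= h Nu; apply: h => _; rewrite indicE memNset ?mul0r// => /AN; exact.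
Qed.

(** Off the null set [N], which carries the singular part, both sides have the
    same integral over every bounded measurable set. *)
Lemma density_identity : {ae lam n, forall u, psi u = c * v u * s u}.
Proof.
pose D (k : nat) : set (n.-tuple R) := cube k%:R `&` ~` N.
have mcube (k : nat) : measurable (@cube R n k%:R) by rewrite cube_box; exact: measurable_box.
have mD k : measurable (D k) by apply: measurableI => //; exact: measurableC.
have ivs := L1_density iv.
have i_cvs : L1 (lam n) (fun u => c * v u * s u).
  by have := L1Zl c ivs; under eq_fun do rewrite mulrA.
have key k : ae_eq (lam n) (D k) (fun u => (c * v u * s u)%:E) (fun u => (psi u)%:E).
  apply: integral_ae_eq => //.
  - exact: (integrableS _ _ (subsetT _) i_cvs).
  - by apply: measurable_funTS; exact/measurable_EFinP.
  move=> E ED mE; have EN : E `<=` ~` N by move=> u /ED[].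
  have Ec : E `<=` cube k%:R by move=> u /ED[].
  have i1 := L1_indic_mul mE (L1_density ivp); have i2 := L1_indic_mul mE (L1_density ivn).
  have i3 := L1_bounded_indic mpp pp_bounded mE Ec.
  have i4 := L1_bounded_indic mpn pn_bounded mE Ec.
  rewrite !(integral_in_indic _ E) -!EFin_Rintegral; last 2 first.
  - exact: L1_bounded_indic Ec.
  - exact: L1_indic_mul.
  congr (_%:E); have := box_measure_eq mE.
  rewrite (int_off_N mE EN ivp vp0) (int_off_N mE EN ivn vn0) !(integral_in_indic _ E).
  rewrite -!EFin_Rintegral// -!EFinD => -[h].
  rewrite (eq_Rint (lam n) (g := fun u => \1_E u * (vp u * s u) - \1_E u * (vn u * s u))); last first.
    by move=> u; rewrite -[in LHS](pospart_sub (v u)) /vp /vn; ring.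
  rewrite [RHS](eq_Rint (lam n) (g := fun u => \1_E u * pp u - \1_E u * pn u)); last first.
    by move=> u; rewrite -[in LHS](pospart_sub (psi u)) /pp /pn; ring.
  by rewrite !RintB//; lra.
have aeN : {ae lam n, forall u, ~ N u}.
  by exists N; split=> // u /=; exact: contrapT.
have := ae_foralln key; apply: filterS2 aeN => u Nu ku.
have [k uk] : exists k : nat, cube k%:R u.
  pose r := \sum_(i < n) `|tnth u i|.
  have r0 : 0 <= r by exact: sumr_ge0.
  exists (Num.bound r) => i; rewrite -ler_norml.
  apply: (le_trans _ (ltW (archi_boundP r0))).
  by rewrite /r (bigD1 i)//= lerDl sumr_ge0.
by have /= := ku k (conj uk Nu) => -[].
Qed.

End density.
End identification.

(** * The function attached to a measure that is not maximally rigid *)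

(** Fubini's theorem takes sigma-finiteness as part of the structure of the
    measure, whereas for the spectral measure it is a theorem. *)
Section sigma_finite_copy.
Context d (T : measurableType d) (R : realType) (mu : {measure set T -> \bar R}).
Hypothesis mu_sigma_finite : sigma_finite setT mu.

Definition sigma_finite_copy of sigma_finite setT mu : set T -> \bar R := mu.

Local Notation copy := (sigma_finite_copy mu_sigma_finite).

HB.instance Definition _ := Measure.copy copy mu.
HB.instance Definition _ := Measure_isSigmaFinite.Build _ _ _ copy mu_sigma_finite.

End sigma_finite_copy.

Section inverse_density.
Context {R : realType} d (T : measurableType d) (s : T -> R).
Hypotheses (ms : measurable_fun setT s) (s0 : forall u, 0 <= s u).

Lemma inverse_density_ge0 u : (0 <= (s u)%:E^-1)%E.
Proof. by rewrite inve_ge0 lee_fin. Qed.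

Lemma measurable_inverse_density : measurable_fun setT (fun u => (s u)%:E^-1%E).
Proof.
under eq_fun do rewrite inver.
apply: measurable_fun_ifT => //.
  exact: measurable_fun_eqr.
by apply/measurable_EFinP; exact: measurable_inv_ge0.
Qed.

End inverse_density.

Section spectral_function.
Context {R : realType} {d : nat} {disp} {T : measurableType disp}.
Context {P : probability T R} (M : wss_measure d P).
Local Notation S := (spectral_measure M).

Let mass0 : fejer_mass != 0 :> R. Proof. by rewrite gt_eqF ?fejer_mass_gt0. Qed.

Lemma hartley_tent_kernel delta (u : d.-tuple R) : 0 < delta ->
  hartley (@tent_kernel R delta d) u = fejer_mass ^+ d * fejer_kernel delta u.
Proof.
move=> d0; have := tent_kernel_cas d0 u 0; rewrite /cas cos0 sin0 addr0 mulr1 => <-.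
by apply: eq_Rint => x; rewrite addr0.
Qed.

Lemma fejer_kernel_L2 delta : 0 < delta -> L2 S (@fejer_kernel R delta d).
Proof.
move=> d0; have := L2Z (fejer_mass ^- d) (hartley_L2 M (bcs_tent_kernel d0 d)).
by under eq_fun do rewrite hartley_tent_kernel// mulKf ?expf_neq0//.
Qed.

(** The square of a Fejer kernel is integrable, as a multiple of the transform
    of a test function, and the kernel is bounded below on the cube. *)
Lemma spectral_measure_cube r : 0 < r -> (S (cube r) < +oo)%E.
Proof.
move=> r0; have r'0 : 0 < r^-1 by rewrite invr_gt0.
have [_ i2] := fejer_kernel_L2 r'0.
have mc : measurable (@cube R d r) by rewrite cube_box; exact: measurable_box.
have := L1_lty (L1Zl (4 ^+ d) i2) (fun u => mulr_ge0 (exprn_ge0 _ (ler0n _ _)) (sqr_ge0 _)).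
apply: le_lt_trans; rewrite -[S _]mul1e -integral_cst//.
rewrite integral_mkcond; apply: ge0_le_integral => //.
- by move=> u _; rewrite patchE; case: ifP => // _; rewrite lee_fin.
- by rewrite -measurable_restrictT.
- by apply/measurable_EFinP; apply: measurable_funM => //; exact: L1_measurable i2.
move=> u _; rewrite patchE; case: ifPn => [/set_mem uc|_]; last first.
  by rewrite lee_fin mulr_ge0 ?sqr_ge0// exprn_ge0.
rewrite lee_fin; have : 2^-1 ^+ d <= fejer_kernel r^-1 u.
  by apply: fejer_kernel_ge; rewrite // invrK.
have h0 : 0 <= 2^-1 ^+ d :> R by rewrite exprn_ge0.
move=> h; rewrite (_ : 4 = 2 ^+ 2); last by ring.
rewrite -exprM mulnC exprM -exprMn expr_ge1 ?mulr_ge0 ?exprn_ge0 ?fejer_kernel_ge0//.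
apply: (@le_trans _ _ (2 ^+ d * 2^-1 ^+ d)); last by rewrite ler_wpM2l ?exprn_ge0.
by rewrite -exprMn mulfV// expr1n.
Qed.

Lemma cube_exhaust (u : d.-tuple R) : exists k : nat, cube k.+1%:R u.
Proof.
pose r := \sum_(i < d) `|tnth u i|.
have r0 : 0 <= r by exact: sumr_ge0.
exists (Num.bound r) => i; rewrite -ler_norml.
apply: (@le_trans _ _ (Num.bound r)%:R); last by rewrite ler_nat.
apply: (le_trans _ (ltW (archi_boundP r0))).
by rewrite /r (bigD1 i)//= lerDl sumr_ge0.
Qed.

Lemma spectral_sigma_finite : sigma_finite setT S.
Proof.
exists (fun k => cube k.+1%:R).
  by rewrite eqEsubset; split=> // u _; have [k uk] := cube_exhaust u; exists k.
move=> k; split; last exact: spectral_measure_cube.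
by rewrite cube_box; exact: measurable_box.
Qed.

Variables (s : d.-tuple R -> R) (A : set (d.-tuple R)) (r0 : R).
Hypotheses (Ms : spectral_density M s) (Ar : A `<=` cube r0).
Hypothesis not_max : ~ linearly_maximally_rigid M A.

Lemma cvg_fejer_kernel (e : R) (u : d.-tuple R) :
  fejer_kernel (e / k.+1%:R) u @[k --> \oo] --> (1 : R).
Proof.
have := @cvg_prod_ord R d (fun i k => fejer (e / k.+1%:R * tnth u i)) (fun=> 1) _.
rewrite big1//; apply=> i.
have c0 : (k.+1%:R^-1 : R) @[k --> \oo] --> (0 : R) by exact: cvg_harmonic.
apply: (@squeeze_cvgr _ _ _ _ (fun k => 1 - (e / k.+1%:R * tnth u i) ^+ 2 / 2) (fun=> 1)); last 2 first.
- have cz : (e / k.+1%:R * tnth u i) @[k --> \oo] --> (0 : R).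
    have h1 : (e / k.+1%:R) @[k --> \oo] --> (e * 0 : R) by exact: cvgMr.
    by have := cvgM h1 (cvg_cst (tnth u i)); rewrite mulr0 mul0r; exact.
  have c2 : ((e / k.+1%:R * tnth u i) ^+ 2 / 2) @[k --> \oo] --> (0 * 0 / 2 : R).
    by apply: cvgMl; under eq_fun do rewrite expr2; exact: cvgM.
  by have := cvgB (cvg_cst (1 : R)) c2; rewrite mul0r mul0r subr0; exact.
- exact: cvg_cst.
by apply: nearW => k; rewrite fejer_ge fejer_le1.
Qed.

(** Let [phi] be the vector of [not_rigid_orthogonal], multiplied by a Fejer
    kernel of scale [delta] small enough to keep the pairing with [g] nonzero,
    and let [m] be the transform of this product against the spectral measure.
    Translates of the tent are test functions off [A] unless their centre is
    near [A], so that orthogonality makes [m] vanish away from [A]. By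
    [density_identity] the transform of [m] is the product times [s], up to a
    constant; hence its square is integrable against the inverse of [s]. *)
Lemma spectral_function delta0 : 0 < delta0 ->
  exists (delta : R) (m : d.-tuple R -> R), [/\ 0 < delta <= delta0, bcs m,
    forall y, m y != 0 -> exists2 x, A x & cube delta (vsub x y) &
    (0 < \int[lam d]_u ((hartley m u ^+ 2)%:E * (s u)%:E^-1) < +oo)%E].
Proof.
move=> delta0_gt0.
have [g [phi [bg phi2 phi_orth phi_g]]] := not_rigid_orthogonal not_max.
have gi := L1_bcs bg; have hg2 := hartley_L2 M bg.
have ipg : L1 S (fun u => phi u * hartley g u) := L2_mul phi2 hg2.
pose de k : R := delta0 / k.+1%:R.
have de0 k : 0 < de k by rewrite divr_gt0.
have [k0 k0P] : exists k, \int[S]_u (fejer_kernel (de k) u * (phi u * hartley g u)) != 0.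
  apply: contrapT => /forallNP H; move/eqP: phi_g; apply.
  have := @dominated_Rint _ _ _ S (fun k u => fejer_kernel (de k) u * (phi u * hartley g u))
    (fun u => phi u * hartley g u) (fun u => `|phi u * hartley g u|).
  case.
  - move=> k; apply: measurable_funM; last exact: L1_measurable ipg.
    exact: (fejer_kernel_L2 (de0 k)).1.
  - exact: L1_norm.
  - move=> k u; rewrite normrM ler_piMl// ger0_norm ?fejer_kernel_ge0//.
    exact: fejer_kernel_le1.
  - move=> u; have := cvgM (cvg_fejer_kernel delta0 u) (cvg_cst (phi u * hartley g u)).
    by rewrite mul1r; exact.
  move=> _ h; apply: (cvg_unique _ h) => //.
  rewrite (_ : (fun k => _) = fun=> 0); first exact: cvg_cst.
  by apply/funext => k; have /negP := H k; rewrite negbK => /eqP.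
pose delta := de k0; have delta_gt0 : 0 < delta := de0 k0.
pose v u := phi u * fejer_kernel delta u.
have K2 := fejer_kernel_L2 delta_gt0.
have iv : L1 S v := L2_mul phi2 K2.
pose S' : {sigma_finite_measure set (d.-tuple R) -> \bar R} :=
  sigma_finite_copy spectral_sigma_finite.
have iv' : L1 S' v := iv.
pose m y := \int[S]_u (v u * cas (dotprod u y)).
have msupp y : m y != 0 -> exists2 x, A x & cube delta (vsub x y).
  move=> my; apply: contrapT => no; move/eqP: my; apply.
  pose h x := tent_kernel delta (vaff 1 (vopp y) x).
  have bt := bcs_tent_kernel delta_gt0 d.
  have bh : bcs h by apply: bcs_vaff => //; rewrite oner_eq0.
  have vE x : vaff 1 (vopp y) x = vsub x y.
    by apply: eq_from_tnth => i; rewrite !tnth_mktuple mul1r.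
  have h0 x : A x -> h x = 0.
    move=> Ax; apply/eqP; apply: contrapT => /negP hx; apply: no; exists x => //.
    by rewrite -vE; exact: tent_kernel_supp hx.
  have hE u : hartley h u = fejer_mass ^+ d * fejer_kernel delta u * cas (dotprod u y).
    rewrite -tent_kernel_cas//.
    have it : L1 (lam d) (fun x => tent_kernel delta x * cas (dotprod u x + dotprod u y)).
      have mc : measurable_fun setT (fun x : d.-tuple R => cas (dotprod u x + dotprod u y)).
        by apply: measurable_cas; apply: measurable_funD => //; exact: measurable_dotprod.
      have := L1_bounded_mul (L1_bcs bt) mc (fun x => cas_max _).
      by under eq_fun do rewrite mulrC.
    have := Rint_vaff (vopp y) (oner_neq0 _) it; rewrite normr1 invr1 expr1n mul1r => <-.
    by apply: eq_Rint => x; rewrite /h vE dotprodBr subrK.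
  have := phi_orth h bh h0 => e; rewrite /m.
  rewrite (eq_Rint S (g := fun u => fejer_mass ^- d * (phi u * hartley h u))).
    by rewrite RintZl ?e ?mulr0//; exact: L2_mul phi2 (hartley_L2 M bh).
  by move=> u; rewrite hE /v; field; rewrite expf_neq0.
have mm : measurable_fun setT m.
  pose mu := @dirac _ (d.-tuple R) (origin : d.-tuple R) R.
  have i1 : L1 mu (fun=> 2 : R).
    by apply: ge0_L1 => //; rewrite integral_cst//= diracT mule1 ltry.
  have mk : measurable_fun setT (fun z : d.-tuple R * d.-tuple R => v z.1 * cas (dotprod z.1 z.2)).
    apply: measurable_funM; first exact: (measurableT_comp (L1_measurable iv) measurable_fst).
    by apply: measurable_cas; apply: measurable_dotprod; [exact: measurable_fst|exact: measurable_snd].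
  apply: (@measurable_Rint2 _ _ _ _ R S' mu (fun u y => v u * cas (dotprod u y)) (fun u => `|v u|) (fun=> 2) mk (L1_norm iv') i1).
  by move=> u y; rewrite normrM ler_wpM2l// cas_max.
have bm : bcs m.
  split=> //.
    exists (\int[S]_u (2 * `|v u|)) => y; apply: Rint_norm_le; last 2 first.
    - exact/L1Zl/L1_norm.
    - by move=> u; rewrite normrM mulrC ler_wpM2r// cas_max.
    have mc : measurable_fun setT (fun u : d.-tuple R => cas (dotprod u y)).
      by apply: measurable_cas; exact: measurable_dotprod.
    have := L1_bounded_mul iv mc (fun u => cas_max _).
    by under eq_fun do rewrite mulrC.
  exists (r0 + delta) => y /msupp[x /Ar Ax xy] i; have := Ax i; have := xy i.
  rewrite tnth_mktuple => /andP[h1 h2] /andP[h3 h4]; apply/andP; split; lra.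
pose psi := hartley m.
have mpsi : measurable_fun setT psi := measurable_hartley (L1_bcs bm).
have bpsi : exists C, forall x, `|psi x| <= C.
  by exists (2 * \int[lam d]_x `|m x|) => x; exact: hartley_bound (L1_bcs bm).
pose c : R := fejer_mass ^+ d; have c0 : 0 < c by rewrite exprn_gt0// fejer_mass_gt0.
have boxE a b : c * \int[S]_u (\1_(box a b) u * v u) = \int[lam d]_u (\1_(box a b) u * psi u).
  exact: (box_inversion (S := S') a b iv' bm).
have [ms s_ge0 [nu [N [mN lN nuN SE]]]] := Ms.
have psiE := density_identity iv mpsi bpsi (ltW c0) boxE ms s_ge0 mN lN nuN SE.
have iv2 : L1 S (fun u => v u ^+ 2).
  apply: (L1_le _ phi2.2); first by apply: measurable_funX; exact: L1_measurable iv.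
  move=> u; rewrite ger0_norm ?sqr_ge0// /v exprMn ler_piMr ?sqr_ge0//.
  by rewrite expr_le1 ?fejer_kernel_le1// fejer_kernel_ge0.
have iw : L1 (lam d) (fun u => (c * v u) ^+ 2 * s u).
  have := L1Zl (c ^+ 2) (L1_density ms s_ge0 SE iv2).
  by under eq_fun do rewrite mulrA -exprMn.
have JE : (\int[lam d]_u ((psi u ^+ 2)%:E * (s u)%:E^-1) =
    \int[lam d]_u ((c * v u) ^+ 2 * s u)%:E)%E.
  apply: ae_eq_integral => //.
  - apply: emeasurable_funM; last exact: measurable_inverse_density.
    by apply/measurable_EFinP; exact: measurable_funX.
  - exact: measurable_int iw.
  move: psiE; apply: filterS => u e _; rewrite inver e.
  have [s0|s0] := eqVneq (s u) 0; first by rewrite s0 !mulr0 expr0n mul0e.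
  by rewrite -EFinM; congr (_%:E); field.
exists delta, m; split=> //.
  by rewrite delta_gt0/= ler_pdivrMr// ler_peMr ?ler1n// ltW.
rewrite -/psi JE; apply/andP; split; last first.
  by apply: (L1_lty iw) => u; rewrite mulr_ge0// sqr_ge0.
rewrite lt_neqAle integral_ge0 ?andbT => [|u _]; last by rewrite lee_fin mulr_ge0// sqr_ge0.
apply/eqP => J0.
have psi0 : {ae lam d, forall u, psi u = 0}.
  have : ae_eq (lam d) setT (fun u => ((c * v u) ^+ 2 * s u)%:E) (cst 0%E).
    apply/ae_eq_integral_abs => //; first exact: measurable_int iw.
    rewrite J0; apply: eq_integral => u _; rewrite gee0_abs// lee_fin mulr_ge0// sqr_ge0//.
  apply: filterS2 psiE => u -> /(_ Logic.I)/= [/eqP]; rewrite mulf_eq0 expf_eq0/=.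
  by move=> /orP[/eqP ->|/eqP ->]; rewrite ?mul0r ?mulr0.
have int0 (f : d.-tuple R -> R) E : measurable E -> measurable_fun setT f ->
    {ae lam d, forall u, f u = 0} -> (\int[lam d]_(u in E) (f u)%:E = 0)%E.
  move=> mE mf f0; rewrite (ae_eq_integral (cst 0%E))//; first by rewrite integral0.
    by apply: measurable_funTS; exact/measurable_EFinP.
  by move: f0; apply: filterS => u /= -> _.
have parts E : measurable E -> (\int[S]_(u in E) (c * pospart (v u))%:E =
    \int[S]_(u in E) (c * pospart (- v u))%:E)%E.
  move=> mE; have := box_measure_eq iv mpsi bpsi (ltW c0) boxE mE.
  rewrite !int0 ?adde0//.
  - exact: measurable_pospart.
  - by move: psi0; apply: filterS => u ->; rewrite /pospart maxxx.
  - by apply: measurable_pospart; exact: measurableT_comp.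
  - by move: psi0; apply: filterS => u ->; rewrite /pospart oppr0 maxxx.
have mv := L1_measurable iv.
have pos0 : (\int[S]_u (c * pospart (v u))%:E = 0)%E.
  pose E := v @^-1` `]0, +oo[%classic.
  have mE : measurable E by rewrite -[E]setTI; apply: mv.
  have Eu u : (u \in E) = (0 < v u).
    apply/idP/idP => [/set_mem|h]; first by rewrite /E/= in_itv/= andbT.
    by apply: mem_set; rewrite /E/= in_itv/= h.
  have := parts E mE; rewrite !(integral_in_indic _ E).
  rewrite (eq_integral (fun u => (c * pospart (v u))%:E)); last first.
    move=> u _; rewrite indicE Eu.
    by have [_|v0] := ltP 0 (v u); rewrite ?mul1r// /pospart max_r// mul0r mulr0.
  move=> ->; apply: integral0_eq => u _; rewrite indicE Eu.
  have [v0|_] := ltP 0 (v u); last by rewrite mul0r.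
  by rewrite /pospart max_r ?oppr_le0 ?ltW// !mulr0.
have neg0 : (\int[S]_u (c * pospart (- v u))%:E = 0)%E.
  by rewrite -(parts setT).
have iN : L1 S (fun u => - v u).
  by have := L1Zl (-1) iv; under eq_fun do rewrite mulN1r.
have abs0 : \int[S]_u (c * `|v u|) = 0.
  rewrite (eq_Rint S (g := fun u => c * pospart (v u) + c * pospart (- v u))); last first.
    by move=> u; rewrite -mulrDr norm_pospart.
  rewrite RintD; [|exact/L1Zl/L1_pospart..].
  by rewrite /Rintegral pos0 neg0 addr0.
move/eqP: k0P; apply; apply/eqP; rewrite -normr_le0.
pose B := 2 * \int[lam d]_x `|g x|.
have -> : 0 = B / c * \int[S]_u (c * `|v u|) by rewrite abs0 mulr0.
rewrite -RintZl; last exact/L1Zl/L1_norm.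
apply: Rint_norm_le.
- apply: (L1_le _ (L1_norm ipg)).
    by apply: measurable_funM; [exact: K2.1|exact: L1_measurable ipg].
  move=> u; rewrite normrM ler_piMl// ger0_norm ?fejer_kernel_ge0//.
  exact: fejer_kernel_le1.
- exact/L1Zl/L1Zl/L1_norm.
move=> u; have -> : B / c * (c * `|v u|) = `|v u| * B by field; rewrite gt_eqF.
rewrite (_ : _ * _ = v u * hartley g u); last by rewrite /v -/delta; ring.
by rewrite normrM ler_wpM2l//; exact: hartley_bound.
Qed.

End spectral_function.

Local Open Scope complex_scope.

(** * A criterion against rigidity *)

Section criterion.
Context {R : realType} {d : nat} {disp} {T : measurableType disp}.
Context {P : probability T R} (M : wss_measure d P).
Local Notation S := (spectral_measure M).

(** The differences are indexed by a list, in which [i] must occur [k i] times. *)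
Lemma exists_multiset (k : 'I_d -> nat) : exists l : seq 'I_d,
  [/\ forall i, count_mem i l = k i, size l = (\sum_(i < d) k i)%N &
    forall f : 'I_d -> R, \prod_(i <- l) f i = \prod_(i < d) f i ^+ k i].
Proof.
exists (flatten [seq nseq (k i) i | i <- index_enum 'I_d]); split.
- move=> i; rewrite count_flatten -map_comp sumnE big_map (bigD1 i)//= count_nseq/= eqxx mul1n.
  by rewrite big1 ?addn0// => j ji; rewrite count_nseq/= (negPf ji) mul0n.
- rewrite size_flatten /shape -map_comp sumnE big_map.
  by apply: eq_bigr => i _; rewrite /= size_nseq.
- move=> f; rewrite big_flatten big_map; apply: eq_bigr => i _.
  by rewrite big_nseq iter_mulr_1.
Qed.

Lemma bcs_monomial_indic (k : 'I_d -> nat) (A : set (d.-tuple R)) r : measurable A ->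
  A `<=` cube r -> bcs (fun x => monomial k x * \1_A x).
Proof.
move=> mA Ar; split.
- apply: measurable_funM; last exact: measurable_indic.
  apply: measurable_prod => i _; apply: measurable_funX.
  exact: measurable_tnth.
- exists (\prod_(i < d) `|r| ^+ k i) => x; rewrite indicE.
  have [/set_mem/Ar xr|_] := boolP (x \in A); last first.
    by rewrite mulr0 normr0 prodr_ge0.
  rewrite mulr1 normr_prod; apply: ler_prod => i _; rewrite normrX exprn_ge0//=.
  rewrite lerXn2r ?nnegrE//; have := xr i; rewrite -ler_norml => h.
  exact: le_trans (ler_norm _).
- exists r => x; rewrite indicE; have [/set_mem/Ar//|_] := boolP (x \in A).
  by rewrite mulr0 eqxx.
Qed.

Lemma Rint_ae_eq d' (U : measurableType d') (mu : {measure set U -> \bar R}) (f g : U -> R) :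
  measurable_fun setT f -> measurable_fun setT g -> {ae mu, forall x, f x = g x} ->
  \int[mu]_x f x = \int[mu]_x g x.
Proof.
move=> mf mg fg; rewrite /Rintegral; congr fine; apply: ae_eq_integral => //.
- exact/measurable_EFinP.
- exact/measurable_EFinP.
- by move: fg; apply: filterS => x ->.
Qed.

(** Since the integral with the inverse weight is finite, [f] vanishes almost
    everywhere where [s] does; elsewhere the product is that of [f / sqrt s] and
    [g * sqrt s]. *)
Lemma weighted_Cauchy_Schwarz d' (U : measurableType d') (mu : {measure set U -> \bar R})
    (s f g : U -> R) : measurable_fun setT s -> (forall x, 0 <= s x) ->
  measurable_fun setT f -> measurable_fun setT g ->
  (\int[mu]_x ((f x ^+ 2)%:E * (s x)%:E^-1) < +oo)%E ->
  L1 mu (fun x => g x ^+ 2 * s x) ->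
  (\int[mu]_x (f x * g x)) ^+ 2 <=
  fine (\int[mu]_x ((f x ^+ 2)%:E * (s x)%:E^-1))%E * \int[mu]_x (g x ^+ 2 * s x).
Proof.
move=> ms s0 mf mg J ig; pose q x := Num.sqrt (s x).
have mq : measurable_fun setT q.
  apply: measurableT_comp ms.
  by apply: continuous_measurable_fun; exact: sqrt_continuous.
have q0 x : 0 <= q x by exact: sqrtr_ge0.
have qq x : q x ^+ 2 = s x by rewrite sqr_sqrtr.
pose f1 x := f x * (q x)^-1; pose g1 x := g x * q x.
have mf1 : measurable_fun setT f1.
  by apply: measurable_funM => //; exact: measurable_inv_ge0.
have mg1 : measurable_fun setT g1 by exact: measurable_funM.
pose F x := ((f x ^+ 2)%:E * (s x)%:E^-1)%E.
have mF : measurable_fun setT F.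
  apply: emeasurable_funM; last exact: measurable_inverse_density.
  by apply/measurable_EFinP; exact: measurable_funX.
have F0 x : (0 <= F x)%E by rewrite mule_ge0 ?inverse_density_ge0// lee_fin sqr_ge0.
have f1F x : ((f1 x ^+ 2)%:E <= F x)%E.
  rewrite /f1 /F inver; have [sx|sx] := eqVneq (s x) 0.
    by rewrite /q sx sqrtr0 invr0 mulr0 expr0n mule_ge0 ?leey ?lee_fin ?sqr_ge0.
  by rewrite -EFinM lee_fin exprMn exprVn qq.
have mf2 : measurable_fun setT (fun x => f1 x ^+ 2) by exact: measurable_funX.
have if1 : L1 mu (fun x => f1 x ^+ 2).
  apply: ge0_L1 => //; first by move=> x; exact: sqr_ge0.
  apply: le_lt_trans J; apply: ge0_le_integral => //.
  - by move=> x _; rewrite lee_fin sqr_ge0.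
  - exact/measurable_EFinP.
have g1E x : g1 x ^+ 2 = g x ^+ 2 * s x by rewrite /g1 exprMn qq.
have ig1 : L1 mu (fun x => g1 x ^+ 2) by under eq_fun do rewrite g1E.
have -> : \int[mu]_x (f x * g x) = \int[mu]_x (f1 x * g1 x).
  apply: Rint_ae_eq; [exact: measurable_funM|exact: measurable_funM|].
  have := integrable_ae measurableT (ge0_integrable mF F0 J).
  apply: filterS => x /(_ Logic.I); rewrite /F inver /f1 /g1.
  have [sx|sx] := eqVneq (s x) 0.
    have [->|fx] := eqVneq (f x) 0; first by rewrite !mul0r.
    by rewrite gt0_muley// lte_fin exprn_even_gt0.
  move=> _; have qx : q x != 0 by apply: contra_neq sx => qx; rewrite -qq qx expr0n.
  by field.
apply: (le_trans (Cauchy_Schwarz (conj mf1 if1) (conj mg1 ig1))).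
rewrite (eq_Rint _ g1E) ler_wpM2r//.
  by apply: Rintegral_ge0 => x _; rewrite mulr_ge0// sqr_ge0.
have Ffin : (\int[mu]_x F x \is a fin_num)%E.
  by rewrite ge0_fin_numE//; exact: integral_ge0.
rewrite -lee_fin EFin_Rintegral// fineK//; apply: ge0_le_integral => //.
- by move=> x _; rewrite lee_fin sqr_ge0.
- exact/measurable_EFinP.
Qed.

Variables (s : d.-tuple R -> R) (Ms : spectral_density M s).
Variables (k : 'I_d -> nat) (A : set (d.-tuple R)) (r delta rho : R).
Variables (W : R -> set (d.-tuple R)) (G : d.-tuple R -> R).
Hypotheses (mA : measurable A) (Ar : A `<=` cube r) (delta_gt0 : 0 < delta).
Hypothesis W_refl : forall a c i x, `|c| <= delta -> W a x ->
  W (a + delta) (vaff (-1) (vaxis i c) x).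
Hypothesis WA : W (rho + delta *+ (\sum_(i < d) k i)%N) `<=` A.
Hypotheses (blG : band_limited delta (W rho) G) (G0 : G origin != 0).

Let Psi u := G u * fejer_kernel delta u * \prod_(i < d) sin (delta * tnth u i) ^+ k i.

(** The test functional is integration against [Psi]: its spectrum lies in [A], so
    that it kills the transforms of functions vanishing on [A], while finite
    differences of order [k] do not kill the monomial. *)
Lemma not_linearly_k_rigid :
  (\int[lam d]_u ((Psi u ^+ 2)%:E * (s u)%:E^-1) < +oo)%E -> ~ linearly_k_rigid M k A.
Proof.
move=> J rig.
have [ms s0 [nu [N [_ _ _ SE]]]] := Ms.
have [l [lc lsz lprod]] := exists_multiset k.
have [b b0 bE] := refl_diffs_poly delta_gt0 (l := l) (p := fun i => 'X^(k i))
  (fun i => etrans (size_polyXn _ (k i)) (congr1 succn (esym (lc i)))).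
have [mG [C GC] eG] := blG.
pose gam x := monomial k x * \1_A x.
have bgam : bcs gam := bcs_monomial_indic k mA Ar.
have pairing f : bcs f -> (forall x, A x -> f x = monomial k x) ->
    \int[lam d]_u (Psi u * hartley f u) = fejer_mass ^+ d * b * G origin.
  move=> bf fA; rewrite -(eG _ _ (bcs_refl_diffs delta l bf)).
    by apply: eq_Rint => u; rewrite hartley_refl_diffs// lprod /Psi; ring.
  move=> x Wx.
  rewrite (@refl_diffs_local _ _ _ delta_gt0 W l f (fun x => \prod_(i < d) ('X^(k i)).[tnth x i]) rho)//.
    by rewrite bE.
  by rewrite lsz => y /WA /fA ->; apply: eq_bigr => i _; rewrite hornerXn.
pose e := fejer_mass ^+ d * b * G origin.
have e0 : e != 0 by rewrite !mulf_neq0// expf_neq0// gt_eqF ?fejer_mass_gt0.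
pose J' := fine (\int[lam d]_u ((Psi u ^+ 2)%:E * (s u)%:E^-1))%E.
have J'0 : 0 <= J'.
  by apply/fine_ge0/integral_ge0 => u _; rewrite mule_ge0 ?inverse_density_ge0// lee_fin sqr_ge0.
pose c : R := (2 * pi) ^- d.
have c0 : 0 < c by rewrite invr_gt0 exprn_gt0// mulr_gt0// pi_gt0.
pose eps := c * (e ^+ 2 / (J' + 1)).
have eps0 : 0 < eps.
  by rewrite mulr_gt0// divr_gt0 ?ltr_wpDl// exprn_even_gt0.
have mPsi : measurable_fun setT Psi.
  apply: measurable_funM; first by apply: measurable_funM => //; exact: L1_measurable (L1_fejer_kernel delta_gt0 d).
  apply: measurable_prod => i _; apply: measurable_funX; apply: measurable_sin.
  by apply: measurable_funM => //; exact: measurable_tnth.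
pose V (h : d.-tuple R -> R[i]) :=
  Cvariance P (fun w => IM M (fun x => (gam x)%:C) w - IM M h w).
have far (h : d.-tuple R -> R[i]) : Ccb_on (~` A) h ->
    (eps%:E <= V h)%E.
  move=> [Ch hA]; rewrite /V (variance_sub_hartley M (Ccb_real bgam) Ch) -EFinM lee_fin.
  rewrite /eps -/c ler_pM2l//.
  pose f x := gam x - complex.Re (h x).
  have bf : bcs f.
    by apply: (bcs_sum_eq _ (bcs_lin (-1) (bcs_Re Ch) bgam)) => x; rewrite /f; ring.
  have fA x : A x -> f x = monomial k x.
    move=> Ax; rewrite /f hA ?subr0; last by move=> nA; exact: nA.
    by rewrite /gam indicE mem_set ?mulr1.
  have [mHf iHf] := hartley_L2 M bf.
  have iHs := L1_density ms s0 SE iHf.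
  have h1 : \int[lam d]_u (hartley f u ^+ 2 * s u) <= \int[S]_u (hartley f u ^+ 2).
    rewrite -lee_fin !EFin_Rintegral// (ge0_integral_density ms s0 SE).
    - by rewrite leeDl//; apply: integral_ge0 => u _; rewrite lee_fin sqr_ge0.
    - exact: measurable_int iHf.
    - by move=> u; rewrite lee_fin sqr_ge0.
  have h2 := weighted_Cauchy_Schwarz ms s0 mPsi mHf J iHs.
  rewrite (pairing f bf fA) -/e -/J' in h2.
  have h3 : 0 <= \int[lam d]_u (hartley f u ^+ 2 * s u).
    by apply: Rintegral_ge0 => u _; rewrite mulr_ge0// sqr_ge0.
  apply: (@le_trans _ _ (\int[S]_u (hartley f u ^+ 2))); last first.
    by rewrite lerDl; apply: Rintegral_ge0 => u _; exact: sqr_ge0.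
  apply: le_trans h1; rewrite ler_pdivrMr ?ltr_wpDl//.
  by apply: (le_trans h2); rewrite mulrDr mulr1 mulrC lerDl.
have : (eps%:E <= 0)%E.
  move: rig; rewrite /linearly_k_rigid /linearly_rigid => <-.
  apply: le_ereal_inf_tmp => _ [h Ah <-]; exact: far.
by rewrite lee_fin leNgt eps0.
Qed.

End criterion.

(** * Norms and enlarged sets *)

Section euclidean_norm.
Context {R : realType} {d : nat}.
Implicit Types x y : d.-tuple R.

Lemma dotprod_ge0 x : 0 <= dotprod x x.
Proof. by apply: sumr_ge0 => i _; rewrite -expr2 sqr_ge0. Qed.

Lemma enorm_sqr x : enorm x ^+ 2 = dotprod x x.
Proof. by rewrite sqr_sqrtr ?dotprod_ge0. Qed.

Lemma enorm_ge0 x : 0 <= enorm x. Proof. exact: sqrtr_ge0. Qed.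

Lemma dotprod_le x y : `|dotprod x y| <= enorm x * enorm y.
Proof.
rewrite -(ler_pXn2r (_ : 0 < 2)%N) ?nnegrE ?mulr_ge0 ?enorm_ge0//.
rewrite real_normK ?num_real// exprMn !enorm_sqr.
apply: quad_discr => [|t]; first exact: dotprod_ge0.
have -> : dotprod x x - 2 * dotprod x y * t + dotprod y y * t ^+ 2 =
    \sum_(i < d) (tnth x i - t * tnth y i) ^+ 2.
  rewrite /dotprod mulr_sumr !mulr_suml -sumrB -big_split/=.
  by apply: eq_bigr => i _; ring.
by apply: sumr_ge0 => i _; exact: sqr_ge0.
Qed.

Lemma enorm_vadd x y : enorm (vadd x y) <= enorm x + enorm y.
Proof.
rewrite -(ler_pXn2r (_ : 0 < 2)%N) ?nnegrE ?addr_ge0 ?enorm_ge0//.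
have -> : enorm (vadd x y) ^+ 2 = dotprod x x + 2 * dotprod x y + dotprod y y.
  by rewrite enorm_sqr dotprodDr ![dotprod (vadd _ _) _]dotprodC !dotprodDr (dotprodC y x); ring.
rewrite sqrrD !enorm_sqr lerD2r lerD2l mulr_natl lerMn2r/=.
exact: le_trans (ler_norm _) (dotprod_le x y).
Qed.

Lemma enorm_vopp x : enorm (vopp x) = enorm x.
Proof. by rewrite /enorm dotprodNr dotprodC dotprodNr opprK. Qed.

Lemma enorm_vaxis i c : enorm (vaxis i c : d.-tuple R) = `|c|.
Proof. by rewrite /enorm dotprod_vaxis tnth_mktuple eqxx -expr2 sqrtr_sqr. Qed.

Lemma enorm_le_sum x : enorm x <= \sum_(i < d) `|tnth x i|.
Proof.
have s0 : 0 <= \sum_(i < d) `|tnth x i| by exact: sumr_ge0.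
rewrite -(ler_pXn2r (_ : 0 < 2)%N) ?nnegrE ?enorm_ge0// enorm_sqr expr2 mulr_suml.
apply: ler_sum => i _; rewrite -expr2 -real_normK ?num_real// expr2 ler_wpM2l//.
by rewrite (bigD1 i)//= lerDl sumr_ge0.
Qed.

Lemma enorm_mono x y : (forall i, `|tnth x i| <= `|tnth y i|) -> enorm x <= enorm y.
Proof.
move=> xy; rewrite ler_wsqrtr//; apply: ler_sum => i _.
by rewrite -!expr2 -[X in X <= _]real_normK ?num_real// -[X in _ <= X]real_normK ?num_real// lerXn2r ?nnegrE.
Qed.

Lemma enormZ c x : enorm [tuple c * tnth x i | i < d] = `|c| * enorm x.
Proof.
rewrite /enorm -sqrtr_sqr -sqrtrM ?sqr_ge0//; congr (Num.sqrt _).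
by rewrite /dotprod mulr_sumr; apply: eq_bigr => i _; rewrite !tnth_mktuple; ring.
Qed.

Lemma vsub0 x : vsub x origin = x.
Proof. by apply: eq_from_tnth => i; rewrite !tnth_mktuple subr0. Qed.

Lemma enorm_vsubC x y : enorm (vsub x y) = enorm (vsub y x).
Proof.
rewrite -enorm_vopp; congr enorm.
by apply: eq_from_tnth => i; rewrite !tnth_mktuple opprB.
Qed.

Lemma eball0E r : eball origin r = [set x : d.-tuple R | enorm x < r].
Proof. by apply/seteqP; split=> x; rewrite /eball/= vsub0. Qed.

Definition cball (r : R) : set (d.-tuple R) := [set x | enorm x <= r].

(** What the supports of test functions require of the balls [cball] and [cube],
    which grow linearly with the radius. *)
Definition gauge (W : R -> set (d.-tuple R)) := [/\
  forall a b x y, W a x -> W b y -> W (a + b) (vadd x y),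
  forall a x, W a x -> W a (vopp x),
  forall i b c, `|c| <= b -> W b (vaxis i c) &
  forall a x, cube a x -> W (d%:R * a) x].

Lemma gauge_cball : gauge cball.
Proof.
split=> [a b x y xa yb|a x|i b c cb|a x xa]; rewrite /cball/=.
- by rewrite (le_trans (enorm_vadd _ _))// lerD.
- by rewrite enorm_vopp.
- by rewrite enorm_vaxis.
- rewrite (le_trans (enorm_le_sum _))//.
  rewrite (_ : d%:R * a = \sum_(i < d) a); last by rewrite sumr_const card_ord mulr_natl.
  by apply: ler_sum => i _; have := xa i; rewrite -ler_norml.
Qed.

Lemma gauge_cube : gauge (@cube R d).
Proof.
split=> [a b x y xa yb i|a x xa i|i b c cb j|a x xa i]; rewrite ?tnth_mktuple -ler_norml.
- by rewrite (le_trans (ler_normD _ _))// lerD// ler_norml ?xa ?yb.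
- by rewrite normrN ler_norml xa.
- by case: eqP => _; rewrite ?normr0// (le_trans _ cb).
- have h : `|tnth x i| <= a by rewrite ler_norml xa.
  rewrite (le_trans h)// ler_peMl ?(le_trans _ h)// ler1n.
  exact: leq_ltn_trans (ltn_ord i).
Qed.

End euclidean_norm.

Section enlarged_sets.
Context {R : realType} {d : nat} (r eta : R).
Hypotheses (r_gt0 : 0 < r) (eta_gt0 : 0 < eta).

Lemma enlarge_ball : enlarge (eball origin r) eta = [set x : d.-tuple R | enorm x < r + eta].
Proof.
apply/seteqP; split=> [x [t]|x /= xr].
  rewrite eball0E /eball/= => tr tx.
  have -> : x = vadd t (vsub x t).
    by apply: eq_from_tnth => i; rewrite !tnth_mktuple; ring.
  by rewrite (le_lt_trans (enorm_vadd _ _))// ltrD.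
pose q := (Num.max (enorm x - eta) 0 + r) / 2.
have m0 : 0 <= Num.max (enorm x - eta) 0 by rewrite le_max lexx orbT.
have mr : Num.max (enorm x - eta) 0 < r by rewrite gt_max r_gt0 andbT ltrBlDr.
have mx : enorm x - eta <= Num.max (enorm x - eta) 0 by rewrite le_max lexx.
have [q0 qr qx] : [/\ 0 < q, q < r & enorm x - q < eta] by rewrite /q; split; lra.
have [xq|qx'] := leP (enorm x) q.
  exists x; first by rewrite eball0E/= (le_lt_trans xq).
  rewrite /eball/= (_ : vsub x x = origin); last first.
    by apply: eq_from_tnth => i; rewrite !tnth_mktuple subrr.
  by rewrite /enorm dotprod0l sqrtr0.
have x0 : 0 < enorm x by exact: lt_trans qx'.
exists [tuple q / enorm x * tnth x i | i < d].
  have e : `|q / enorm x| * enorm x = q.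
    by rewrite (gtr0_norm (divr_gt0 q0 x0)) divfK// gt_eqF.
  by rewrite eball0E/= enormZ e.
rewrite /eball/= enorm_vsubC.
have -> : vsub [tuple q / enorm x * tnth x i | i < d] x =
    [tuple (q / enorm x - 1) * tnth x i | i < d].
  by apply: eq_from_tnth => i; rewrite !tnth_mktuple; ring.
rewrite enormZ ltr0_norm; last by rewrite subr_lt0 ltr_pdivrMr// mul1r.
by rewrite opprB mulrBl mul1r divfK// gt_eqF.
Qed.

Lemma measurable_enlarge_ball : measurable (enlarge (eball origin r : set (d.-tuple R)) eta).
Proof.
have -> : enlarge (eball origin r) eta = (@enorm R d) @^-1` `]-oo, r + eta[%classic.
  by rewrite enlarge_ball; apply/seteqP; split=> x; rewrite /= in_itv/=.
rewrite -[X in measurable X]setTI; apply: (measurable_enorm (@measurable_id _ _ setT)) => //.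
Qed.

Lemma enlarge_ball_cube : enlarge (eball origin r) eta `<=` @cube R d (r + eta).
Proof.
rewrite enlarge_ball => x /= xr i; rewrite -ler_norml.
by rewrite (le_trans (norm_tnth_le_enorm x i))// ltW.
Qed.

(** The nearest point of the cube. *)
Definition clamp (x : d.-tuple R) : d.-tuple R :=
  [tuple Num.max (- r) (Num.min r (tnth x i)) | i < d].

Let clamp_cube x : cube r (clamp x).
Proof.
move=> i; rewrite tnth_mktuple le_max lexx/= ge_max ge_min lexx/= andbT.
by rewrite (@le_trans _ _ 0)// ?oppr_le0 ltW.
Qed.

Let clamp_dist (x t : d.-tuple R) : cube r t -> enorm (vsub x (clamp x)) <= enorm (vsub x t).
Proof.
move=> tr; apply: enorm_mono => i; rewrite !tnth_mktuple; have /andP[t1 t2] := tr i.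
have [h1|h1] := leP r (tnth x i).
  rewrite max_r; last by lra.
  by rewrite !ger0_norm; lra.
have [h2|h2] := leP (tnth x i) (- r).
  by rewrite !ler0_norm; lra.
by rewrite subrr normr0.
Qed.

Lemma enlarge_cube : enlarge (cube r) eta = [set x : d.-tuple R | enorm (vsub x (clamp x)) < eta].
Proof.
apply/seteqP; split=> [x [t tr tx]|x /= xr]; first exact: le_lt_trans (clamp_dist x tr) tx.
by exists (clamp x).
Qed.

Lemma measurable_enlarge_cube : measurable (enlarge (cube r : set (d.-tuple R)) eta).
Proof.
have mc : measurable_fun setT (fun x : d.-tuple R => enorm (vsub x (clamp x))).
  apply: measurable_enorm; apply: measurable_vsub => //.
  apply: measurable_mktuple => i; apply: measurable_maxr => //.
  by apply: measurable_minr => //; exact: measurable_tnth.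
have -> : enlarge (cube r) eta = (fun x : d.-tuple R => enorm (vsub x (clamp x))) @^-1` `]-oo, eta[%classic.
  by rewrite enlarge_cube; apply/seteqP; split=> x; rewrite /= in_itv/=.
by rewrite -[X in measurable X]setTI; apply: mc.
Qed.

Lemma enlarge_cube_cube : enlarge (cube r) eta `<=` @cube R d (r + eta).
Proof.
move=> x [t tr tx] i; have /andP[t1 t2] := tr i; rewrite -ler_norml.
have : `|tnth x i - tnth t i| < eta.
  have h := norm_tnth_le_enorm (vsub x t) i; rewrite tnth_mktuple in h.
  exact: le_lt_trans h tx.
by rewrite ltr_norml ler_norml => /andP[h1 h2]; apply/andP; split; lra.
Qed.

Lemma cube_enlarge a : (0 < d)%N -> a < eta / d%:R -> @cube R d (r + a) `<=` enlarge (cube r) eta.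
Proof.
move=> d0 ad x xa; rewrite enlarge_cube/=.
have e0 : 0 < eta / d%:R by rewrite divr_gt0// ltr0n.
rewrite (le_lt_trans (enorm_le_sum _))//.
have : forall i, `|tnth (vsub x (clamp x)) i| < eta / d%:R.
  move=> i; rewrite !tnth_mktuple; have /andP[x1 x2] := xa i.
  have [h1|h1] := leP r (tnth x i).
    by rewrite max_r ?ger0_norm; move: ad r_gt0; lra.
  have [h2|h2] := leP (tnth x i) (- r); first by rewrite ler0_norm; move: ad; lra.
  by rewrite subrr normr0.
move=> h; apply: (@lt_le_trans _ _ (\sum_(i < d) eta / d%:R)).
  apply: ltr_sum => //; apply/hasP; exists (Ordinal d0) => //.
by rewrite sumr_const card_ord -[leLHS]mulr_natr divfK// pnatr_eq0 -lt0n.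
Qed.

End enlarged_sets.

Section reduction.
Context {R : realType} {d : nat} {disp} {T : measurableType disp}.
Context {P : probability T R} (M : wss_measure d P).
Variables (s : d.-tuple R -> R) (Ms : spectral_density M s) (k : 'I_d -> nat).
Variables (A A' : set (d.-tuple R)) (r eta : R) (W : R -> set (d.-tuple R)).
Hypotheses (d_gt0 : (0 < d)%N) (eta_gt0 : 0 < eta).
Hypotheses (gW : gauge W) (AW : A `<=` W r) (A_cube : A `<=` cube r).
Hypotheses (mA' : measurable A') (A'_cube : A' `<=` cube (r + eta)).
Hypothesis WA' : forall a, a < eta / d%:R -> W (r + a) `<=` A'.
Hypothesis not_max : ~ linearly_maximally_rigid M A.

(** What remains is to produce a band-limited multiplier, nonzero at the origin,
    that makes the test function of [not_linearly_k_rigid] square integrable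
    against the inverse of the density. Its spectrum may exceed that of [m] by a
    fixed multiple of [delta], since [eta] leaves room for it. *)
Lemma rigidity_reduction :
  (forall delta m, 0 < delta -> bcs m -> (forall y, m y != 0 -> W (r + d%:R * delta) y) ->
     (0 < \int[lam d]_u ((hartley m u ^+ 2)%:E * (s u)%:E^-1) < +oo)%E ->
     exists G, [/\ band_limited delta (W (r + d%:R * delta + d%:R * delta + delta)) G, G origin != 0 &
       (\int[lam d]_u (((G u * fejer_kernel delta u *
          \prod_(i < d) sin (delta * tnth u i) ^+ k i) ^+ 2)%:E * (s u)%:E^-1) < +oo)%E]) ->
  ~ linearly_k_rigid M k A'.
Proof.
move=> H; have [W1 W2 W3 W4] := gW.
pose n := (\sum_(i < d) k i)%N; pose c : R := d%:R + d%:R + n%:R + 2.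
have dR : 0 < d%:R :> R by rewrite ltr0n.
have c0 : 0 < c by rewrite ltr_wpDl// !addr_ge0 ?ler0n.
have e0 : 0 < eta / d%:R / c by rewrite !divr_gt0.
have [delta [m [/andP[delta0 delta_le] bm msupp J]]] := spectral_function Ms A_cube not_max e0.
have mW y : m y != 0 -> W (r + d%:R * delta) y.
  move=> /msupp[x Ax xy]; have := W1 _ _ _ _ (AW Ax) (W2 _ _ (W4 _ _ xy)).
  by congr (W _); apply: eq_from_tnth => i; rewrite !tnth_mktuple; ring.
have [G [blG G0 JG]] := H delta m delta0 bm mW J.
apply: (not_linearly_k_rigid Ms mA' A'_cube delta0 _ _ blG G0 JG).
  move=> a c' i x c'd Wx; have := W1 _ _ _ _ (W2 _ _ Wx) (W3 i _ _ c'd).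
  by congr (W _); apply: eq_from_tnth => j; rewrite !tnth_mktuple; ring.
rewrite -!addrA; apply: WA'; rewrite -/n -[delta *+ n]mulr_natl.
have : delta * c <= eta / d%:R by rewrite -ler_pdivlMr.
by apply: lt_le_trans; rewrite /c; lra.
Qed.

End reduction.

(** * Division by powers *)

Section order_at_zero.
Context {R : realType}.
Variables (q : nat -> R -> R) (C B : R).
Hypothesis q_rec : forall n x, q n x = q n 0 + x * q n.+1 x.
Hypothesis q_bound : forall n x, `|q n x| <= C * (B ^+ n / n`!%:R).

(** If all the successive quotients vanished at 0, then [q 0] would be divisible by
    every power of the variable with rapidly decreasing quotients. *)
Lemma order_at_zero : (forall x, q 0 x = 0) \/
  exists n, (forall x, q 0 x = x ^+ n * q n x) /\ q n 0 != 0.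
Proof.
have [H|H] := pselect (exists n, q n 0 != 0).
  right; have [n qn nmin] := ex_minnP H; exists n; split=> // x.
  have : forall k, (k <= n)%N -> q 0 x = x ^+ k * q k x.
    elim=> [_|k IH kn]; first by rewrite expr0 mul1r.
    rewrite IH ?(ltnW kn)// q_rec.
    have -> : q k 0 = 0 by apply/eqP; apply: contraTT kn => /nmin; rewrite -leqNgt.
    by rewrite add0r mulrA exprSr.
  exact.
left=> x; have q0 n : q n 0 = 0.
  by apply/eqP; apply: contrapT => /negP qn; apply: H; exists n.
have qE n : q 0 x = x ^+ n * q n x.
  elim: n => [|n ->]; first by rewrite expr0 mul1r.
  by rewrite q_rec q0 add0r mulrA exprSr.
pose b n := C * exp_coeff (`|x| * B) n.
have qb n : `|q 0 x| <= b n.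
  rewrite (qE n) normrM normrX /b exp_coeffE exprMn.
  rewrite (_ : C * _ = `|x| ^+ n * (C * (B ^+ n / n`!%:R))); last by ring.
  by rewrite ler_wpM2l ?exprn_ge0.
have b0 : b n @[n --> \oo] --> (0 : R).
  rewrite -(mulr0 C); apply: cvgMr; exact: cvg_exp_coeff.
apply/eqP; rewrite -normr_le0.
apply: (@ler_cvg_to _ _ _ _ (fun=> `|q 0 x|) b _ _ (cvg_cst _) b0).
by apply: nearW => n; exact: qb.
Qed.

End order_at_zero.

Section taylor.
Context {R : realType}.

Definition unit_indic (t : R) : R := \1_(`[0, 1]%classic) t.

Definition taylor_weight n (t : R) : R := (1 - t) ^+ n / n`!%:R.

Variables (H : nat -> R -> R) (c : R).
Hypothesis H_derive : forall n (t : R), is_derive t (1 : R) (H n) (c * H n.+1 t).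

(** When [H n] stands for [c ^- n] times the [n]-th derivative of a function, this is
    [c ^- n] times the integral form of its Taylor remainder of order [n] at 1. *)
Definition taylor_remainder n :=
  if n is n'.+1 then \int[leb]_t (unit_indic t * taylor_weight n' t * H n'.+1 t) else H 0 1.

Let cH n : continuous (H n).
Proof. by move=> t; apply/differentiable_continuous/derivable1_diffP; have [] := H_derive n t. Qed.
Let cw n : continuous (taylor_weight n).
Proof.
move=> t; apply: cvgM; last exact: cvg_cst.
apply: (@continuous_comp _ _ _ (fun t : R => 1 - t) (fun x : R => x ^+ n)); last exact: exprn_continuous.
by apply: cvgB; [exact: cvg_cst|exact: cvg_id].
Qed.

Let cwH m k : continuous (fun t => taylor_weight m t * H k t).
Proof. by move=> t; apply: cvgM; [exact: cw|exact: cH]. Qed.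

Let in_indic (f : R -> R) :
  \int[leb]_(t in `[0, 1]) f t = \int[leb]_t (unit_indic t * f t).
Proof.
rewrite Rintegral_mkcond; apply: eq_Rint => t; rewrite patchE /unit_indic indicE.
by case: ifP => _; rewrite ?mul1r ?mul0r.
Qed.

Let L1_indic_continuous (f : R -> R) : continuous f ->
  L1 leb (fun t => unit_indic t * f t).
Proof.
move=> cf; have : leb.-integrable `[0 : R, 1] (fun t => (f t)%:E).
  by apply: continuous_compact_integrable; [exact: segment_compact|exact/continuous_subspaceT].
move=> h; have := (@integrable_mkcond _ _ R (@leb R) _ (fun t => (f t)%:E) (measurable_itv `[0 : R, 1])).1 h.
apply: eq_ind; congr integrable; apply/funext => t; rewrite patchE /unit_indic indicE.
by case: ifP => _; rewrite ?mul1r ?mul0r.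
Qed.

Lemma L1_taylor_weight n : L1 leb (fun t => unit_indic t * taylor_weight n t).
Proof. exact: L1_indic_continuous (@cw n). Qed.

Lemma taylor_remainderE n :
  taylor_remainder n = H n 0 / n`!%:R + c * taylor_remainder n.+1.
Proof.
have remE m : taylor_remainder m.+1 = \int[leb]_(t in `[0, 1]) (taylor_weight m t * H m.+1 t).
  by rewrite in_indic /taylor_remainder; apply: (eq_Rint leb) => t; rewrite mulrA.
case: n => [|n].
  have cH' : continuous (fun t => c * H 1 t).
    by move=> t; apply: cvgM; [exact: cvg_cst|exact: cH].
  have := Rint_FTC ler01 (H_derive 0) cH'.
  rewrite remE fact0 divr1 !in_indic => h; rewrite -RintZl; last exact/L1_indic_continuous.
  rewrite (eq_Rint leb (g := fun t => unit_indic t * (c * H 1 t))).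
    by rewrite h /=; ring.
  by move=> t; rewrite /taylor_weight expr0 fact0 divr1; ring.
pose F t := - (n.+1)`!%:R^-1 * ((1 - t) ^+ n.+1 * H n.+1 t).
pose f t := taylor_weight n t * H n.+1 t - c * (taylor_weight n.+1 t * H n.+2 t).
have dF (t : R) : is_derive t (1 : R) F (f t).
  have d1 : is_derive t (1 : R) (fun t : R => 1 - t) (-1).
    by apply: is_derive_eq; ring.
  have d2 : is_derive t (1 : R) (fun t : R => (1 - t) ^+ n.+1) (n.+1%:R * (1 - t) ^+ n * -1).
    by have := is_deriveX n.+1 d1; rewrite /GRing.scale/= exprfctE.
  apply: (is_derive_eq (is_deriveZ _ (is_deriveM d2 (H_derive n.+1 t)))).
  rewrite /f /taylor_weight /GRing.scale/= factS natrM exprS.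
  have a0 : n.+1%:R != 0 :> R by rewrite pnatr_eq0.
  have b0 : n`!%:R != 0 :> R by rewrite pnatr_eq0 -lt0n fact_gt0.
  move: (n.+1%:R : R) (n`!%:R : R) a0 b0 => a b a0 b0.
  by field; rewrite a0 b0.
have cf : continuous f.
  move=> t; apply: cvgB; first exact: cwH.
  by apply: cvgM; [exact: cvg_cst|exact: cwH].
have F1 : F 1 = 0 by rewrite /F subrr expr0n/= mul0r mulr0.
have F0 : F 0 = - (H n.+1 0 / (n.+1)`!%:R) by rewrite /F subr0 expr1n; ring.
have := Rint_FTC ler01 dF cf; rewrite in_indic F1 F0 sub0r opprK.
rewrite (eq_Rint leb (g := fun t => unit_indic t * (taylor_weight n t * H n.+1 t) -
   c * (unit_indic t * (taylor_weight n.+1 t * H n.+2 t)))); last first.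
  by move=> t; rewrite /f; ring.
rewrite RintB; [|exact: L1_indic_continuous|exact/L1Zl/L1_indic_continuous].
rewrite RintZl; last exact: L1_indic_continuous.
by rewrite !remE !in_indic => <-; ring.
Qed.

End taylor.

Section taylor_bound.
Context {R : realType}.

Lemma unit_weight_ge0 n (t : R) : 0 <= unit_indic t * taylor_weight n t.
Proof.
rewrite /unit_indic indicE; have [/set_mem|_] := boolP (_ \in _); last by rewrite mul0r.
rewrite /= in_itv/= => /andP[_ t1]; rewrite mul1r mulr_ge0 ?invr_ge0//.
by rewrite exprn_ge0// subr_ge0.
Qed.

(** Taylor's formula for constants. *)
Lemma Rint_unit_weight n :
  \int[leb]_t (unit_indic t * taylor_weight n t) = (n.+1`!%:R)^-1 :> R.
Proof.
have H_derive (m : nat) (t : R) : is_derive t (1 : R) (fun=> 1 : R) (0 * 1).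
  by rewrite mul0r; exact: is_derive_cst.
have := @taylor_remainderE R (fun _ _ => 1) 0 H_derive n.+1.
rewrite mul0r addr0 mul1r /= => <-.
by apply: (eq_Rint leb) => t; rewrite mulr1.
Qed.

End taylor_bound.

Section superposition.
Context {R : realType}.

Lemma measurable_Rint_param d1 d2 (T1 : measurableType d1) (T2 : measurableType d2)
    (mu : {sigma_finite_measure set T2 -> \bar R}) (f : T1 -> T2 -> R) (b : T2 -> R) :
  measurable_fun setT (fun z : T1 * T2 => f z.1 z.2) -> L1 mu b ->
  (forall x y, `|f x y| <= b y) -> measurable_fun setT (fun x => \int[mu]_y f x y).
Proof.
move=> mf ib fb; pose m := @dirac _ T1 point R.
have i1 : L1 m (fun=> 1 : R).
  by apply: ge0_L1 => //; rewrite integral_cst//= diracT mule1 ltry.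
apply: (@measurable_Rint1 _ _ _ _ R m mu f (fun=> 1) b mf i1 ib).
by move=> x y; rewrite mul1r.
Qed.

(** The functions of one variable built from the waves of frequency at most [B] by
    iterated superposition.  Quantifying over all properties closed under
    superposition spares the product spaces. *)
Definition superposed (B : R) (q : R -> R) := forall Q : (R -> R) -> Prop,
  (forall rho al, `|rho| <= B -> Q (fun x => cos (x * rho + al))) ->
  (forall d (Z : measurableType d) (mu : {sigma_finite_measure set Z -> \bar R})
     (w : Z -> R) (G : Z -> R -> R) C,
     L1 mu w -> measurable_fun setT (fun z : Z * R => G z.1 z.2) ->
     (forall z x, `|G z x| <= C) -> (forall z, w z != 0 -> Q (G z)) ->
     Q (fun x => \int[mu]_z (w z * G z x))) ->
  Q q.

Lemma superposed_measurable_bounded B q : superposed B q ->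
  measurable_fun setT q /\ exists C : R, forall x, `|q x| <= C.
Proof.
move=> /(_ (fun q => measurable_fun setT q /\ exists C : R, forall x, `|q x| <= C)).
apply; first move=> rho al _.
  split; last by exists 1 => x; exact: cos_max.
  by apply: measurable_cos; apply: measurable_funD => //; exact: measurable_funM.
move=> d Z mu w G C iw mG GC _.
have mw := L1_measurable iw.
have bd z x : `|w z * G z x| <= C * `|w z| by rewrite normrM mulrC ler_wpM2r.
have iC : L1 mu (fun z => C * `|w z|) by exact/L1Zl/L1_norm.
have mk : measurable_fun setT (fun z : R * Z => w z.2 * G z.2 z.1).
  apply: measurable_funM; first exact: (measurableT_comp mw measurable_snd).
  have sw : measurable_fun setT (fun z : R * Z => (z.2, z.1)).
    by apply: measurable_fun_pair; [exact: measurable_snd|exact: measurable_fst].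
  exact: (measurableT_comp mG sw).
split; first by apply: (measurable_Rint_param mk iC) => x z; exact: bd.
exists (\int[mu]_z (C * `|w z|)) => x; apply: Rint_norm_le => //.
apply: (L1_le _ iC) => //; apply: measurable_funM => //.
have mp : measurable_fun setT (fun z : Z => (z, x)) by apply: measurable_fun_pair.
exact: (measurableT_comp mG mp).
Qed.

End superposition.

Section wave_division.
Context {R : realType} d (Z : measurableType d).
Variables (mu : {sigma_finite_measure set Z -> \bar R}) (w tau al : Z -> R) (B : R).
Hypotheses (iw : L1 mu w) (mtau : measurable_fun setT tau) (mal : measurable_fun setT al).
Hypotheses (B_ge0 : 0 <= B) (tauB : forall z, w z != 0 -> `|tau z| <= B).

Let W n (t : R) : R := unit_indic t * taylor_weight n t.

(* Each derivative of a wave is a wave with a phase shift. *)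
Let H (x : R) z n t := cos (t * (x * tau z) + (al z + n%:R * (pi / 2))).
Let kap n (x : R) z := taylor_remainder (H x z) n.

Let H_derive x z n (t : R) : is_derive t (1 : R) (H x z n) (x * tau z * H x z n.+1 t).
Proof.
rewrite /H; apply: is_derive_eq; rewrite /GRing.scale/=.
have -> : t * (x * tau z) + (al z + n.+1%:R * (pi / 2)) =
  t * (x * tau z) + (al z + n%:R * (pi / 2)) + pi / 2 by rewrite -natr1; ring.
by rewrite cosDpihalf; ring.
Qed.
Let L1_W n : L1 leb (W n).
Proof. exact: L1_taylor_weight. Qed.
Let W_ge0 n t : 0 <= W n t.
Proof. exact: unit_weight_ge0. Qed.
Let W_int n : \int[leb]_t W n t = (n.+1`!%:R)^-1.
Proof. exact: Rint_unit_weight. Qed.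
Let W_supp n t : W n t != 0 -> `|t| <= 1.
Proof.
rewrite /W /unit_indic indicE; have [/set_mem|_] := boolP (_ \in _); last by rewrite mul0r eqxx.
by rewrite /= in_itv/= => /andP[h1 h2] _; rewrite ger0_norm.
Qed.

Let kapS n x z : kap n.+1 x z = \int[leb]_t (W n t * cos (x * (t * tau z) + (al z + n.+1%:R * (pi / 2)))).
Proof. by apply: (eq_Rint leb) => t; rewrite /H; congr (_ * cos (_ + _)); ring. Qed.

Let mphase n : measurable_fun setT (fun y : (Z * R) * R =>
  cos (y.1.2 * (y.2 * tau y.1.1) + (al y.1.1 + n%:R * (pi / 2)))).
Proof.
have m1 : measurable_fun setT (fun y : (Z * R) * R => y.1.1).
  exact: (measurableT_comp measurable_fst measurable_fst).
have m2 : measurable_fun setT (fun y : (Z * R) * R => y.1.2).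
  exact: (measurableT_comp measurable_snd measurable_fst).
apply: measurable_cos; apply: measurable_funD; last first.
  by apply: measurable_funD => //; exact: (measurableT_comp mal m1).
apply: measurable_funM => //; apply: measurable_funM; first exact: measurable_snd.
exact: (measurableT_comp mtau m1).
Qed.

Let mkap n : measurable_fun setT (fun y : Z * R => kap n y.2 y.1).
Proof.
case: n => [|n].
  have mp : measurable_fun setT (fun y : Z * R => (y, 1 : R)) by apply: measurable_fun_pair.
  have := measurableT_comp (mphase 0) mp; apply: eq_measurable_fun => y _ /=.
  by rewrite /kap/= /H; congr (cos (_ + _)); ring.
under eq_fun do rewrite kapS.
apply: (measurable_Rint_param _ (L1_W n)) => [|y t].
  apply: measurable_funM; last exact: mphase.
  exact: (measurableT_comp (L1_measurable (L1_W n)) measurable_snd).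
by rewrite normrM (ger0_norm (W_ge0 _ _)) ler_piMr// cos_max.
Qed.

Let kap_bound n x z : `|kap n x z| <= (n`!%:R)^-1.
Proof.
case: n => [|n]; first by rewrite fact0 invr1 cos_max.
rewrite kapS -W_int; apply: Rint_norm_le => //.
  apply: (L1_le _ (L1_W n)).
    apply: measurable_funM; first exact: L1_measurable (L1_W n).
    have mp : measurable_fun setT (fun t : R => ((z, x), t)) by apply: measurable_fun_pair.
    exact: (measurableT_comp (mphase n.+1) mp).
  by move=> t; rewrite normrM (ger0_norm (W_ge0 _ _)) ler_piMr// cos_max.
by move=> t; rewrite normrM (ger0_norm (W_ge0 _ _)) ler_piMr// cos_max.
Qed.

Let q n x := \int[mu]_z (w z * tau z ^+ n * kap n x z).

Let iwt n : L1 mu (fun z => w z * tau z ^+ n).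
Proof.
apply: (L1_le _ (L1Zl (B ^+ n) (L1_norm iw))).
  by apply: measurable_funM; [exact: L1_measurable iw|exact: measurable_funX].
move=> z; rewrite normrM normrX mulrC.
have [->|wz] := eqVneq (w z) 0; first by rewrite normr0 !mulr0.
by rewrite ler_wpM2r// lerXn2r ?nnegrE// tauB.
Qed.

Let iq n x : L1 mu (fun z => w z * tau z ^+ n * kap n x z).
Proof.
have mk : measurable_fun setT (fun z => kap n x z).
  have mp : measurable_fun setT (fun z : Z => (z, x)) by apply: measurable_fun_pair.
  exact: (measurableT_comp (mkap n) mp).
have := L1_bounded_mul (iwt n) mk (kap_bound n x).
by under eq_fun do rewrite mulrC.
Qed.

Let q_superposed n : superposed B (q n).
Proof.
move=> Q Qcos Qsup; apply: (Qsup _ _ _ _ (fun z x => kap n x z) _ (iwt n) (mkap n)).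
  by move=> z x; exact: kap_bound.
move=> z; rewrite mulf_eq0 negb_or => /andP[wz _].
case: n => [|n].
  have := Qcos (tau z) (al z) (tauB wz); congr Q; apply/funext => x.
  by rewrite /kap/= /H; congr cos; ring.
rewrite (funext (fun x => kapS n x z)).
apply: (Qsup _ _ leb (W n) (fun t x => cos (x * (t * tau z) + (al z + n.+1%:R * (pi / 2)))) 1 (L1_W n)).
- have mp : measurable_fun setT (fun y : R * R => ((z, y.2), y.1)).
    apply: measurable_fun_pair; last exact: measurable_fst.
    by apply: measurable_fun_pair => //; exact: measurable_snd.
  exact: (measurableT_comp (mphase n.+1) mp).
- by move=> t x; exact: cos_max.
- move=> t /W_supp t1; apply: Qcos; rewrite normrM.
  by rewrite (le_trans (ler_piMl _ t1))// tauB.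
Qed.

Let q_rec n x : q n x = q n 0 + x * q n.+1 x.
Proof.
have E y z : kap n y z = H y z n 0 / n`!%:R + y * tau z * kap n.+1 y z.
  exact: (taylor_remainderE (H_derive y z)).
rewrite /q -RintZl// -RintD//; last exact: L1Zl.
apply: eq_Rint => z; rewrite (E x) (E 0) /H !mul0r addr0 exprS; ring.
Qed.

Let q_bound n x : `|q n x| <= (\int[mu]_z `|w z|) * (B ^+ n / n`!%:R).
Proof.
rewrite mulrC -RintZl; last exact: L1_norm.
apply: Rint_norm_le => //; first exact/L1Zl/L1_norm.
move=> z; rewrite !normrM normrX.
have [->|wz] := eqVneq (w z) 0; first by rewrite normr0 !mul0r mulr0.
rewrite (_ : B ^+ n / _ * _ = `|w z| * B ^+ n * (n`!%:R)^-1); last by ring.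
by rewrite ler_pM ?mulr_ge0 ?exprn_ge0 ?kap_bound// ler_wpM2l// lerXn2r ?nnegrE// tauB.
Qed.

(** Taylor's formula divides each wave by a power of the variable; the quotients
    are superpositions of waves of no larger frequency, and [order_at_zero]
    excludes an infinite order. *)
Lemma wave_division (f : R -> R) :
  (forall x, f x = \int[mu]_z (w z * cos (x * tau z + al z))) ->
  (forall x, f x = 0) \/
  exists n g, [/\ superposed B g, forall x, f x = x ^+ n * g x & g 0 != 0].
Proof.
move=> fE; have f0 x : f x = q 0 x.
  rewrite fE /q; apply: eq_Rint => z; rewrite expr0 mulr1 /kap/= /H.
  by congr (_ * cos _); ring.
case: (@order_at_zero R q _ B q_rec q_bound) => [h|[n [h hn]]].
  by left=> x; rewrite f0.
by right; exists n, (q n); split=> // x; rewrite f0.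
Qed.

End wave_division.

(** * The separable case *)

Section product_multiplier.
Context {R : realType} {d : nat} (delta B : R).
Hypothesis delta_gt0 : 0 < delta.
Local Notation bl := (band_limited delta (@cube R d (B + delta))).

Lemma band_limited_sub (V W : set (d.-tuple R)) G : V `<=` W ->
  band_limited delta V G -> band_limited delta W G.
Proof.
move=> VW [mG bG eG]; split=> // f b bf fb; apply: eG => // x Vx.
exact/fb/VW.
Qed.

Let bl_wave (sigma : d.-tuple R) be : (forall j, `|tnth sigma j| <= B) ->
  bl (fun u => cos (dotprod u sigma + be)).
Proof.
move=> sB; have cb x y : (forall j, `|tnth x j| <= B) -> cube delta y ->
    @cube R d (B + delta) (vadd x y).
  move=> xB yd j; rewrite tnth_mktuple -ler_norml (le_trans (ler_normD _ _))// lerD//.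
  by rewrite ler_norml yd.
apply: band_limited_cos => // y yd; apply: cb => // j.
by rewrite tnth_mktuple normrN.
Qed.

Let bl_waves (rho al : 'I_d -> R) (l : seq 'I_d) sigma be : uniq l ->
  (forall i, `|rho i| <= B) -> (forall j, `|tnth sigma j| <= B) ->
  (forall i, i \in l -> tnth sigma i = 0) ->
  bl (fun u => cos (dotprod u sigma + be) * \prod_(i <- l) cos (tnth u i * rho i + al i)).
Proof.
move=> ul rB; elim: l ul sigma be => [_ sigma be sB _|i l IH /= /andP[il ul] sigma be sB s0].
  by under eq_fun do rewrite big_nil mulr1; exact: bl_wave.
have i0 : tnth sigma i = 0 by apply: s0; rewrite mem_head.
pose sg c := vadd sigma (vaxis i c).
have sgB c : `|c| <= B -> forall j, `|tnth (sg c) j| <= B.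
  move=> cB j; rewrite !tnth_mktuple; have [->|ji] := eqVneq j i; first by rewrite i0 add0r.
  by rewrite addr0.
have sg0 c j : j \in l -> tnth (sg c) j = 0.
  move=> jl; rewrite !tnth_mktuple s0 ?in_cons ?jl ?orbT// add0r.
  by case: eqP => // ji; move: il; rewrite -ji jl.
have b1 := IH ul (sg (rho i)) (be + al i) (sgB _ (rB i)) (sg0 _).
have rBN : `|- rho i| <= B by rewrite normrN.
have b2 := IH ul (sg (- rho i)) (be - al i) (sgB _ rBN) (sg0 _).
have := band_limited_lin delta_gt0 2^-1 b1 (band_limited_lin delta_gt0 (- 2^-1) b2 b2).
congr band_limited; apply/funext => u; rewrite big_cons !dotprodDr !dotprod_vaxis.
set p := \prod_(_ <- _) _; set a := dotprod u sigma; set b := tnth u i * rho i.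
have -> : a + b + (be + al i) = (a + be) + (b + al i) by ring.
have -> : a + tnth u i * - rho i + (be - al i) = (a + be) - (b + al i).
  by rewrite /b; ring.
by rewrite cosB cosD; field.
Qed.

(** The variables are treated one at a time: in each of them the multiplier is an
    iterated superposition of waves. *)
Lemma band_limited_prod (h : 'I_d -> R -> R) : 0 <= B ->
  (forall i, superposed B (h i)) -> bl (fun u => \prod_(i < d) h i (tnth u i)).
Proof.
move=> B0; have key m : forall h : 'I_d -> R -> R,
    (forall i, superposed B (h i)) ->
    (forall i : 'I_d, (m <= i)%N -> exists rho al, `|rho| <= B /\ h i = fun x => cos (x * rho + al)) ->
    bl (fun u => \prod_(i < d) h i (tnth u i)).
  elim: m => [|m IH] {}h hS hW.
    have /choice[f fP] : forall i, exists p : R * R, `|p.1| <= B /\ h i = fun x => cos (x * p.1 + p.2).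
      by move=> i; have [rho [al H]] := hW i (leq0n _); exists (rho, al).
    have := @bl_waves (fun i => (f i).1) (fun i => (f i).2) (index_enum 'I_d) origin 0
      (index_enum_uniq _) (fun i => (fP i).1) _ _.
    case=> [j|i _|]; rewrite ?tnth_mktuple ?normr0//.
    move=> m1 b1 e1; have -> : (fun u : d.-tuple R => \prod_(i < d) h i (tnth u i)) =
       (fun u => cos (dotprod u origin + 0) * \prod_(i < d) cos (tnth u i * (f i).1 + (f i).2)).
      apply/funext => u; rewrite dotprod0r addr0 cos0 mul1r.
      by apply: eq_bigr => i _; rewrite (fP i).2.
    by split.
  have [md|dm] := ltnP m d; last first.
    by apply: IH => // i mi; have := ltn_ord i; rewrite ltnNge (leq_trans dm mi).
  pose i0 := Ordinal md.
  pose h' q j := if j == i0 then q else h j.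
  pose rest (u : d.-tuple R) := \prod_(j < d | j != i0) h j (tnth u j).
  have E q u : \prod_(j < d) h' q j (tnth u j) = q (tnth u i0) * rest u.
    rewrite (bigD1 i0)//= {1}/h' eqxx; congr (_ * _).
    by apply: eq_bigr => j ji; rewrite /h' (negPf ji).
  have bnd j := superposed_measurable_bounded (hS j).
  have mrest : measurable_fun setT rest.
    rewrite /rest; under eq_fun do rewrite -big_filter.
    apply: measurable_prod => j _; apply: (measurableT_comp (bnd j).1).
    exact: measurable_tnth.
  have [D Drest] : exists D, forall u, `|rest u| <= D.
    have /choice[f fP] : forall j, exists C, forall x, `|h j x| <= C by move=> j; exact: (bnd j).2.
    exists (\prod_(j < d | j != i0) f j) => u; rewrite normr_prod.
    by apply: ler_prod => j _; rewrite normr_ge0 fP.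
  have D0 : 0 <= D := le_trans (normr_ge0 _) (Drest origin).
  suff : bl (fun u => h i0 (tnth u i0) * rest u).
    congr band_limited; apply/funext => u; rewrite -E; apply: eq_bigr => j _.
    by rewrite /h'; case: eqP => // ->.
  apply: (hS i0 (fun q => bl (fun u => q (tnth u i0) * rest u))).
    move=> rho al rB; have : bl (fun u => \prod_(i < d) h' (fun x => cos (x * rho + al)) i (tnth u i)).
      apply: IH => j; rewrite /h'; case: eqP => [ji|ji] //.
      - by move=> Q Qcos _; exact: Qcos.
      - by move=> _; exists rho, al.
      move=> mj; apply: hW; rewrite ltn_neqAle mj andbT; apply/eqP => mj'.
      by apply: ji; apply: val_inj.
    by congr band_limited; apply/funext => u; rewrite E.
  move=> dZ Z mu w G C iw mG GC GQ.
  have := @band_limited_superpose R delta d (cube (B + delta)) delta_gt0 dZ Z mu w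
    (fun z u => G z (tnth u i0) * rest u) (C * D) iw.
  have E' : (fun u : d.-tuple R => \int[mu]_z (w z * (G z (tnth u i0) * rest u))) =
     (fun u => (\int[mu]_z (w z * G z (tnth u i0))) * rest u).
    apply/funext => u; rewrite mulrC -RintZl.
      by apply: eq_Rint => z; ring.
    have mGx : measurable_fun setT (fun z => G z (tnth u i0)).
      have mp : measurable_fun setT (fun z : Z => (z, tnth u i0)) by apply: measurable_fun_pair.
      exact: (measurableT_comp mG mp).
    have := L1_bounded_mul iw mGx (fun z => GC z _).
    by under eq_fun do rewrite mulrC.
  rewrite E'; apply => //.
  - apply: measurable_funM; last exact: (measurableT_comp mrest measurable_snd).
    have mp : measurable_fun setT (fun z : Z * d.-tuple R => (z.1, tnth z.2 i0)).
      apply: measurable_fun_pair; first exact: measurable_fst.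
      exact: (measurableT_comp (@measurable_tnth _ R d i0) measurable_snd).
    exact: (measurableT_comp mG mp).
  - by move=> z u; rewrite normrM ler_pM.
move=> hS; apply: (key d) => // i; by rewrite leqNgt ltn_ord.
Qed.

End product_multiplier.

Section inverse_products.
Context {R : realType}.
Local Open Scope ereal_scope.

Lemma inve_mul (a b : R) : (0 <= a)%R -> (0 <= b)%R -> (a * b)%:E^-1 = a%:E^-1 * b%:E^-1.
Proof.
move=> a0 b0; rewrite !inver mulf_eq0.
have [->|an] := eqVneq a 0%R; have [->|bn] := eqVneq b 0%R; rewrite ?orbT/=.
- by rewrite mulyy.
- by rewrite gt0_mulye// lte_fin invr_gt0 lt_neqAle eq_sym bn.
- by rewrite gt0_muley// lte_fin invr_gt0 lt_neqAle eq_sym an.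
- by rewrite -EFinM invfM.
Qed.

Lemma inve_prod n (a : 'I_n -> R) : (forall i, 0 <= a i)%R ->
  (\prod_(i < n) a i)%R%:E^-1 = \prod_(i < n) (a i)%:E^-1.
Proof.
move=> a0; elim: n a a0 => [|n IH] a a0; first by rewrite !big_ord0 inve1.
by rewrite !big_ord_recl inve_mul ?IH ?prodr_ge0// => i _; exact: a0.
Qed.

Lemma EFin_prod n (a : 'I_n -> R) : (\prod_(i < n) a i)%R%:E = \prod_(i < n) (a i)%:E.
Proof. by elim/big_rec2: _ => // i x y _ <-. Qed.

Lemma prode_gt0_lty n (a : 'I_n -> \bar R) : (forall i, 0 < a i) ->
  \prod_(i < n) a i < +oo -> forall i, a i < +oo.
Proof.
move=> a0 h i; have p0 : 0 < \prod_(j < n | j != i) a j.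
  by elim/big_ind : _ => // x y x0 y0; exact: mule_gt0.
rewrite ltNge leye_eq; apply/negP => /eqP ai; move: h.
by rewrite (bigD1 i)//= ai gt0_mulye.
Qed.

Lemma prode_lty n (a : 'I_n -> \bar R) : (forall i, 0 <= a i) -> (forall i, a i < +oo) ->
  \prod_(i < n) a i < +oo.
Proof.
move=> a0 h; suff : 0 <= \prod_(i < n) a i < +oo by case/andP.
elim/big_ind : _ => [|x y /andP[x0 xy] /andP[y0 yy]|i _]; last by rewrite a0 h.
  by rewrite lee_fin ler01 ltry.
by rewrite mule_ge0//= lte_mul_pinfty// ge0_fin_numE.
Qed.

End inverse_products.

Lemma cas_cos {R : realType} (a : R) : cas a = (cos (pi / 4))^-1 * cos (a - pi / 4).
Proof.
have e : sin (pi / 4) = cos (pi / 4) :> R.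
  by rewrite sin_cos_shift -cosN; congr cos; field.
have c0 : cos (pi / 4) != 0 :> R.
  apply/eqP => c0; have := cos2Dsin2 (pi / 4 : R); rewrite e c0 expr0n addr0 => /eqP.
  by rewrite eq_sym oner_eq0.
by rewrite cosB e /cas; field.
Qed.

Lemma integral_gt0 d (T : measurableType d) (R : realType) (mu : {measure set T -> \bar R})
    (F : T -> \bar R) (A : set T) : measurable_fun setT F -> (forall x, 0 <= F x)%E ->
  measurable A -> (0 < mu A)%E -> (forall x, A x -> (0 < F x)%E) ->
  (0 < \int[mu]_x F x)%E.
Proof.
move=> mF F0 mA A0 AF; rewrite lt_neqAle integral_ge0// andbT; apply/eqP => n0.
have : ae_eq mu setT F (cst 0%E).
  apply/ae_eq_integral_abs => //; rewrite [RHS]n0.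
  by apply: eq_integral => x _; rewrite gee0_abs.
move=> [N [mN N0 hN]]; move: A0; rewrite ltNge -N0 => /negP; apply.
apply: le_measure; rewrite ?inE// => x /AF Fx.
by apply: hN => /(_ Logic.I)/= Fx0; rewrite Fx0 ltxx in Fx.
Qed.

Lemma sin_sqr_le {R : realType} (a : R) : sin a ^+ 2 <= a ^+ 2.
Proof.
have := cos2Dsin2 a; have := cos_ge a; have := cos_le1 a; have := cos_geN1 a.
by move: (cos a) (sin a) => c s; nra.
Qed.

Section separable_case.
Context {R : realType} {d : nat}.
Variables (s : d.-tuple R -> R) (s_ : 'I_d -> R -> R) (k : 'I_d -> nat).
Hypotheses (ms : measurable_fun setT s) (s_ge0 : forall i a, 0 <= s_ i a).
Hypothesis sE : forall u, s u = \prod_(i < d) s_ i (tnth u i).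
Variables (eps delta B : R) (m : d.-tuple R -> R).
Hypotheses (eps_gt0 : 0 < eps) (delta_gt0 : 0 < delta) (B_ge0 : 0 <= B).
Hypothesis near0 : (\int[lam d]_(u in eball origin eps)
  ((monomial (fun i => 2 * k i)%N u)%:E * (s u)%:E^-1) < +oo)%E.
Hypotheses (bm : bcs m) (mB : forall y, m y != 0 -> cube B y).
Hypothesis J : (0 < \int[lam d]_u ((hartley m u ^+ 2)%:E * (s u)%:E^-1) < +oo)%E.

Let s0 u : 0 <= s u. Proof. by rewrite sE prodr_ge0. Qed.

Let F u := ((hartley m u ^+ 2)%:E * (s u)%:E^-1)%E.
Let mF : measurable_fun setT F.
Proof.
apply: emeasurable_funM; last exact: measurable_inverse_density.
apply/measurable_EFinP/measurable_funX; exact: measurable_hartley (L1_bcs bm).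
Qed.
Let F0 u : (0 <= F u)%E.
Proof. by rewrite mule_ge0 ?inverse_density_ge0// lee_fin sqr_ge0. Qed.

Let s_vset u i x : s (vset u i x) = (\prod_(j < d | j != i) s_ j (tnth u j)) * s_ i x.
Proof.
rewrite sE (bigD1 i)//= tnth_mktuple eqxx mulrC; congr (_ * _).
by apply: eq_bigr => j ji; rewrite tnth_mktuple (negPf ji).
Qed.

(** The line comes from [exists_slice]; on it the density is a constant multiple
    of [s_ i]. *)
Let slice i : exists u c, [/\ c > 0, measurable_fun setT (s_ i) &
  (0 < \int[leb]_x ((hartley m (vset u i x) ^+ 2)%:E * (c * s_ i x)%:E^-1) < +oo)%E].
Proof.
have [u Fu] := exists_slice i mF F0 J; exists u.
pose c := \prod_(j < d | j != i) s_ j (tnth u j); exists c.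
have c_ge0 : 0 <= c by exact: prodr_ge0.
have mv := measurable_vset u i.
have c0 : c != 0.
  have mFv : measurable_fun setT (fun x => F (vset u i x)) by exact: (measurableT_comp mF mv).
  have [x /andP[]] := @exists_pos_fin _ _ _ (@leb R) (fun x => F (vset u i x)) mFv (fun x => F0 _) Fu.
  move=> Fp Ff; apply/eqP => c0; move: Fp Ff; rewrite /F s_vset -/c c0 mul0r inve0.
  have [->|h] := eqVneq (hartley m (vset u i x)) 0; first by rewrite expr0n mul0e ltxx.
  by rewrite gt0_muley ?ltxx// lte_fin exprn_even_gt0.
have cp : 0 < c by rewrite lt_neqAle eq_sym c0.
split=> //.
  have -> : s_ i = fun x => c^-1 * s (vset u i x).
    by apply/funext => x; rewrite s_vset -/c mulKf.
  by apply: measurable_funM => //; exact: (measurableT_comp ms mv).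
by move: Fu; rewrite /F; under eq_integral do rewrite s_vset.
Qed.

Let ms_ i : measurable_fun setT (s_ i).
Proof. by have [u [c []]] := slice i. Qed.

Let eps' := eps / (d%:R + 1).
Let eps'_gt0 : 0 < eps'. Proof. by rewrite divr_gt0// ltr_wpDl. Qed.

Let N (i : 'I_d) (x : R) : \bar R := ((\1_(`[- eps', eps']%classic) x * x ^+ (2 * k i))%:E * (s_ i x)%:E^-1)%E.
Let mN i : measurable_fun setT (N i).
Proof.
apply: emeasurable_funM; last exact: measurable_inverse_density.
apply/measurable_EFinP; apply: measurable_funM; first exact: measurable_indic.
exact: measurable_funX.
Qed.
Let N0 i x : (0 <= N i x)%E.
Proof.
rewrite mule_ge0 ?inverse_density_ge0// lee_fin mulr_ge0// ?indicE//.
by rewrite exprM exprn_ge0// sqr_ge0.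
Qed.

Let N_pos i : (0 < \int[leb]_x N i x)%E.
Proof.
have mI : measurable (`]0, eps']%classic : set R) by [].
apply: (@integral_gt0 _ _ R (@leb R) _ _ (mN i) (N0 i) mI).
  rewrite [X in (_ < X)%E](_ : _ = eps'%:E) ?lte_fin//.
  by apply: etrans; [exact: lebesgue_measure_itv|rewrite /= lte_fin eps'_gt0 sube0].
move=> x /=; rewrite in_itv/= => /andP[x0 xe]; rewrite /N.
rewrite indicE mem_set ?mul1r/=; last by rewrite in_itv/= xe andbT (le_trans _ (ltW x0))// oppr_le0 ltW.
apply: mule_gt0; first by rewrite lte_fin exprn_gt0.
rewrite inver; case: eqVneq => // s0'; rewrite lte_fin invr_gt0 lt_neqAle eq_sym s0'.
exact: s_ge0.
Qed.

Let N_prod u : (\prod_(i < d) N i (tnth u i) =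
  (\1_(cube eps') u * monomial (fun i => 2 * k i)%N u)%:E * (s u)%:E^-1)%E.
Proof.
rewrite big_split/= -EFin_prod -inve_prod// -sE; congr (_%:E * _)%E.
by rewrite big_split/= cube_box indic_box.
Qed.

(** The integral of the monomial weight splits over the coordinates; as every
    factor is positive, a finite product leaves no room for an infinite factor. *)
Let N_fin i : (\int[leb]_x N i x < +oo)%E.
Proof.
move: i; apply: (prode_gt0_lty (a := fun i => (\int[leb]_x N i x)%E)) => //.
have E := @ge0_integral_prod R d N mN N0.
rewrite -E; apply: le_lt_trans near0.
have mball : measurable (eball (origin : d.-tuple R) eps).
  have -> : eball origin eps = (@enorm R d) @^-1` `]-oo, eps[%classic.
    by rewrite eball0E; apply/seteqP; split=> x; rewrite /= in_itv/=.
  by rewrite -[X in measurable X]setTI; apply: (measurable_enorm (@measurable_id _ _ setT)).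
have mono_ge0 u : 0 <= monomial (fun i => 2 * k i)%N u :> R.
  by apply: prodr_ge0 => i _; rewrite exprM exprn_ge0// sqr_ge0.
rewrite [leRHS]integral_mkcond; apply: ge0_le_integral => //.
- by move=> u _; rewrite N_prod mule_ge0 ?inverse_density_ge0// lee_fin mulr_ge0// indicE.
- by apply: measurable_eprod => i; apply: (measurableT_comp (mN i)); exact: measurable_tnth.
- apply/(measurable_restrictT _ _).1; first exact: mball.
  apply: measurable_funTS; apply: emeasurable_funM; last exact: measurable_inverse_density.
  apply/measurable_EFinP; apply: measurable_prod => i _; apply: measurable_funX.
  exact: measurable_tnth.
move=> u _; rewrite N_prod patchE indicE.
have [/set_mem uc|_] := boolP (u \in cube eps'); last first.
  rewrite mul0r mul0e; case: ifP => // _.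
  by rewrite mule_ge0 ?inverse_density_ge0// lee_fin.
rewrite mul1r mem_set// eball0E/= (le_lt_trans (enorm_le_sum u))//.
apply: (@le_lt_trans _ _ (\sum_(i < d) eps')).
  by apply: ler_sum => i _; have := uc i; rewrite -ler_norml.
rewrite sumr_const card_ord -[ltLHS]mulr_natr /eps' mulrAC ltr_pdivrMr ?ltr_wpDl//.
by rewrite ltr_pM2l// ltrDl.
Qed.

Let g0 : cos (pi / 4) != 0 :> R.
Proof.
apply/eqP => c0; have := cas_cos (pi / 4 : R); rewrite c0 invr0 mul0r /cas c0 add0r => s0'.
by have := cos2Dsin2 (pi / 4 : R); rewrite c0 s0' expr0n addr0 => /eqP; rewrite eq_sym oner_eq0.
Qed.

(** Away from 0 the quotient is dominated by the restriction it comes from, near 0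
    the sines restore the monomial. *)
Let factor i : exists q, [/\ superposed B q, q 0 != 0 &
  (\int[leb]_x (((q x * fejer (delta * x) * sin (delta * x) ^+ k i) ^+ 2)%:E *
     (s_ i x)%:E^-1) < +oo)%E].
Proof.
have [u [c [c0 _ Fu]]] := slice i; pose g x := hartley m (vset u i x).
pose tau (y : d.-tuple R) := tnth y i.
pose al (y : d.-tuple R) := dotprod (vset u i 0) y - pi / 4.
pose w y := (cos (pi / 4))^-1 * m y.
have mtau : measurable_fun setT tau by exact: measurable_tnth.
have mal : measurable_fun setT al by apply: measurable_funB => //; exact: measurable_dotprod.
have iw : L1 (lam d) w by exact/L1Zl/L1_bcs.
have tauB y : w y != 0 -> `|tau y| <= B.
  rewrite mulf_eq0 negb_or => /andP[_ /mB yB]; have := yB i.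
  by rewrite -ler_norml.
have dotE x y : dotprod (vset u i x) y = x * tau y + dotprod (vset u i 0) y.
  rewrite /dotprod (bigD1 i)//= [in RHS](bigD1 i)//= !tnth_mktuple eqxx mul0r add0r.
  congr (_ + _); apply: eq_bigr => j ji; by rewrite !tnth_mktuple (negPf ji).
have gE x : g x = \int[lam d]_y (w y * cos (x * tau y + al y)).
  apply: eq_Rint => y; rewrite cas_cos dotE /w /al addrA; ring.
have mg : measurable_fun setT g.
  apply: measurableT_comp (measurable_hartley (L1_bcs bm)) _.
  exact: measurable_vset.
have [g0'|[n [q [qB gq q0]]]] := wave_division iw mtau mal B_ge0 tauB gE.
  move: Fu => /andP[]; rewrite (eq_integral (cst 0%E)) ?integral0 ?ltxx// => x _.
  by rewrite -/(g x) g0' expr0n mul0e.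
exists q; split=> //.
have [mq [C qC]] := superposed_measurable_bounded qB.
have C0 : 0 <= C := le_trans (normr_ge0 _) (qC 0).
pose Fi x := ((g x ^+ 2)%:E * (c * s_ i x)%:E^-1)%E.
have ms_i := ms_ i.
have mFi : measurable_fun setT Fi.
  apply: emeasurable_funM; first exact/measurable_EFinP/measurable_funX.
  apply: measurable_inverse_density; first exact: measurable_funM.
  by move=> x; rewrite mulr_ge0// ltW.
have Fi0 x : (0 <= Fi x)%E.
  by rewrite mule_ge0 ?lee_fin ?sqr_ge0// inve_ge0 lee_fin mulr_ge0// ltW.
pose a1 := C ^+ 2 * (delta ^+ 2) ^+ k i; pose a2 := (eps' ^+ 2) ^- n * c.
have a10 : 0 <= a1 by rewrite mulr_ge0 ?sqr_ge0// exprn_ge0// sqr_ge0.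
have a20 : 0 <= a2 by rewrite mulr_ge0 ?(ltW c0)// invr_ge0 exprn_ge0// sqr_ge0.
have bound x : (((q x * fejer (delta * x) * sin (delta * x) ^+ k i) ^+ 2)%:E *
     (s_ i x)%:E^-1 <= a1%:E * N i x + a2%:E * Fi x)%E.
  have sx0 : (0 <= (s_ i x)%:E^-1)%E by exact: inverse_density_ge0.
  have f1 : fejer (delta * x) ^+ 2 <= 1 by rewrite expr_le1 ?fejer_le1 ?fejer_ge0.
  have s1 : (sin (delta * x) ^+ 2) ^+ k i <= 1.
    by rewrite exprn_ile1 ?sqr_ge0// -real_normK ?num_real// expr_le1// sin_max.
  have e2 : ((q x * fejer (delta * x) * sin (delta * x) ^+ k i) ^+ 2) =
     q x ^+ 2 * (fejer (delta * x) ^+ 2 * (sin (delta * x) ^+ 2) ^+ k i).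
    by rewrite !exprMn mulrA; congr (_ * _); exact: exprAC.
  have [xe|xe] := boolP (- eps' <= x <= eps').
    apply: (@le_trans _ _ (a1%:E * N i x)%E); last by rewrite leeDl// mule_ge0 ?lee_fin.
    rewrite /N muleA -EFinM; apply: lee_wpmul2r => //; rewrite lee_fin.
    rewrite indicE mem_set ?mul1r/=; last by rewrite in_itv.
    rewrite e2 /a1 -[leRHS]mulrA; apply: ler_pM; rewrite ?sqr_ge0//.
    - by rewrite mulr_ge0 ?sqr_ge0// exprn_ge0// sqr_ge0.
    - by rewrite -real_normK ?num_real// lerXn2r ?nnegrE.
    rewrite exprM -exprMn -exprMn; apply: (le_trans (ler_piMl _ f1)).
      by rewrite exprn_ge0// sqr_ge0.
    by rewrite lerXn2r ?nnegrE ?sqr_ge0// sin_sqr_le.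
  apply: (@le_trans _ _ (a2%:E * Fi x)%E); last by rewrite leeDr// mule_ge0 ?lee_fin.
  rewrite /Fi (inve_mul (ltW c0) (s_ge0 i x)) (_ : (c%:E^-1)%E = c^-1%:E); last by rewrite inver gt_eqF.
  rewrite [X in (_ <= X)%E](_ : _ = (a2 * g x ^+ 2 * c^-1)%:E * (s_ i x)%:E^-1)%E; last first.
    by rewrite !EFinM !muleA.
  apply: lee_wpmul2r => //; rewrite lee_fin.
  have ex : eps' ^+ 2 <= x ^+ 2.
    rewrite -[leRHS]real_normK ?num_real// lerXn2r ?nnegrE ?normr_ge0 ?(ltW eps'_gt0)//.
    by move: xe; rewrite -ler_norml -ltNge => /ltW.
  have x0 : 0 < x ^+ 2 by apply: lt_le_trans ex; rewrite exprn_gt0.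
  have -> : a2 * g x ^+ 2 * c^-1 = (eps' ^+ 2) ^- n * (x ^+ 2) ^+ n * q x ^+ 2.
    have e3 : g x ^+ 2 = (x ^+ 2) ^+ n * q x ^+ 2.
      by rewrite gq exprMn; congr (_ * _); exact: exprAC.
    by rewrite /a2 e3; field; rewrite (gt_eqF c0)/= expf_neq0// expf_neq0// gt_eqF.
  rewrite e2; apply: (@le_trans _ _ (q x ^+ 2)).
    by rewrite ler_piMr ?sqr_ge0// mulr_ile1 ?sqr_ge0// exprn_ge0// sqr_ge0.
  rewrite ler_peMl ?sqr_ge0// mulrC ler_pdivlMr ?exprn_gt0// ?mul1r.
  by rewrite lerXn2r ?nnegrE ?sqr_ge0.
have mL : measurable_fun setT (fun x : R => (((q x * fejer (delta * x) * sin (delta * x) ^+ k i) ^+ 2)%:E *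
     (s_ i x)%:E^-1)%E).
  apply: emeasurable_funM; last exact: measurable_inverse_density.
  have md : measurable_fun setT (fun x : R => delta * x) by exact: measurable_funM.
  apply/measurable_EFinP/measurable_funX/measurable_funM.
    by apply: measurable_funM => //; exact: (measurableT_comp (@measurable_fejer R) md).
  by apply: measurable_funX; exact: measurable_sin.
have m1 : measurable_fun setT (fun x : R => (a1%:E * N i x)%E).
  by apply: measurable_funeM; exact: mN.
have m2 : measurable_fun setT (fun x : R => (a2%:E * Fi x)%E).
  by apply: measurable_funeM; exact: mFi.
apply: (@le_lt_trans _ _ (\int[leb]_x (a1%:E * N i x + a2%:E * Fi x))%E).
  apply: ge0_le_integral => //.
  - by move=> x _; rewrite mule_ge0 ?inverse_density_ge0// lee_fin sqr_ge0.
  - exact: emeasurable_funD m1 m2.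
have p1 (x : R) : setT x -> (0 <= a1%:E * N i x)%E by move=> _; rewrite mule_ge0 ?lee_fin.
have p2 (x : R) : setT x -> (0 <= a2%:E * Fi x)%E by move=> _; rewrite mule_ge0 ?lee_fin.
rewrite (@ge0_integralD _ _ _ (@leb R) _ measurableT _ _ p1 m1 p2 m2).
have /andP[_ Fu'] := Fu.
rewrite !ge0_integralZl//; try exact: mN; try exact: mFi.
by apply: lte_add_pinfty; apply: lte_mul_pinfty.
Qed.

Lemma separable_multiplier : exists G, [/\ band_limited delta (cube (B + delta)) G,
  G origin != 0 & (\int[lam d]_u (((G u * fejer_kernel delta u *
     \prod_(i < d) sin (delta * tnth u i) ^+ k i) ^+ 2)%:E * (s u)%:E^-1) < +oo)%E].
Proof.
have /choice[q qP] := factor; exists (fun u => \prod_(i < d) q i (tnth u i)).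
have qB i : superposed B (q i) by have [] := qP i.
split; first exact: band_limited_prod.
  by apply/prodf_neq0 => i _; rewrite tnth_mktuple; have [] := qP i.
pose E (i : 'I_d) (x : R) : \bar R := (((q i x * fejer (delta * x) * sin (delta * x) ^+ k i) ^+ 2)%:E *
     (s_ i x)%:E^-1)%E.
rewrite (eq_integral (fun u => \prod_(i < d) E i (tnth u i))%E); last first.
  move=> u _; rewrite big_split/= -EFin_prod -inve_prod// -sE; congr (_%:E * _)%E.
  by rewrite prodrXl !big_split.
rewrite (@ge0_integral_prod R d E).
- apply: prode_lty => i; last by have [] := qP i.
  by apply: integral_ge0 => x _; rewrite mule_ge0 ?inverse_density_ge0// lee_fin sqr_ge0.
- move=> i; apply: emeasurable_funM; last exact: measurable_inverse_density.
  have md : measurable_fun setT (fun x : R => delta * x) by exact: measurable_funM.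
  apply/measurable_EFinP/measurable_funX/measurable_funM.
    apply: measurable_funM; first exact: (superposed_measurable_bounded (qB i)).1.
    exact: (measurableT_comp (@measurable_fejer R) md).
  by apply: measurable_funX; exact: measurable_sin.
- by move=> i x; rewrite mule_ge0 ?inverse_density_ge0// lee_fin sqr_ge0.
Qed.

End separable_case.

(** * Cosines as averages *)

Section euler_wave.
Context {R : realType}.
Local Notation leb := (@lebesgue_measure R).

(** The span of the functions [x ^+ i * cos^(i) x], stable under [x * d/dx]. *)
Definition euler_wave N (c : {poly R}) (x : R) : R :=
  \sum_(i < N) c`_i * (x ^+ i * cos (x + i%:R * (pi / 2))).

Lemma euler_waveD N a b (p q : {poly R}) x :
  euler_wave N (a *: p + b *: q) x = a * euler_wave N p x + b * euler_wave N q x.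
Proof.
rewrite /euler_wave !mulr_sumr -big_split/=; apply: eq_bigr => i _.
by rewrite coefD !coefZ; ring.
Qed.

Lemma euler_wave_widen N (c : {poly R}) x : (size c <= N)%N ->
  euler_wave N c x = euler_wave N.+1 c x.
Proof.
by move=> cN; rewrite /euler_wave [RHS]big_ord_recr/= nth_default// mul0r addr0.
Qed.

Let deuler N (c : {poly R}) (x : R) : R :=
  \sum_(i < N) c`_i * (i%:R * x ^+ i.-1 * cos (x + i%:R * (pi / 2))
     + x ^+ i * cos (x + i.+1%:R * (pi / 2))).

Let is_derive_euler N (c : {poly R}) (x : R) :
  is_derive x (1 : R) (euler_wave N c) (deuler N c x).
Proof.
have -> : euler_wave N c = \sum_(i < N)
    (fun x : R => c`_i * (x ^+ i * cos (x + i%:R * (pi / 2)))).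
  by apply/funext => y; rewrite fct_sumE.
apply: is_derive_sum => i.
have dX : is_derive x (1 : R) (fun y : R => y ^+ i) (i%:R * x ^+ i.-1).
  have := is_deriveX i (is_derive_id x (1 : R)).
  by rewrite /GRing.scale/= mulr1 exprfctE.
have dc : is_derive x (1 : R) (fun y : R => cos (y + i%:R * (pi / 2)))
    (cos (x + i.+1%:R * (pi / 2))).
  have -> : x + i.+1%:R * (pi / 2) = x + i%:R * (pi / 2) + pi / 2 by rewrite -natr1; ring.
  rewrite cosDpihalf; apply: is_derive_eq; rewrite /GRing.scale/=; ring.
apply: (is_derive_eq (is_deriveZ _ (is_deriveM dX dc))).
by rewrite /GRing.scale/=; ring.
Qed.

Let xdeuler N (c : {poly R}) (x : R) : (size c <= N)%N ->
  x * deuler N c x = euler_wave N.+1 ('X * (c^`() + c)) x.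
Proof.
move=> cN; rewrite /euler_wave.
transitivity (\sum_(i < N.+1) (c`_i * (i%:R * x ^+ i * cos (x + i%:R * (pi / 2))) )
   + \sum_(i < N) c`_i * (x ^+ i.+1 * cos (x + i.+1%:R * (pi / 2)))).
  rewrite big_ord_recr/= [c`_N]nth_default// mul0r addr0 /deuler mulr_sumr -big_split/=.
  apply: eq_bigr => i _; case: (i : nat) => [|j] /=; first by rewrite expr0 expr1; ring.
  by rewrite !exprS; ring.
rewrite big_ord_recl/= [in RHS]big_ord_recl/= mul0r mul0r mulr0 add0r.
rewrite coefXM/= mul0r add0r -big_split/=; apply: eq_bigr => i _.
by rewrite coefXM/= coefD coef_deriv /bump/= !add1n -mulr_natl; ring.
Qed.

Lemma continuous_euler_wave N c : continuous (euler_wave N c).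
Proof.
move=> x; have := is_derive_euler N c x.
by move=> H; apply: differentiable_continuous; apply/derivable1_diffP; exact: ex_derive.
Qed.

Lemma euler_wave_bound N c (x K : R) : `|x| <= K ->
  `|euler_wave N c x| <= \sum_(i < N) `|c`_i| * K ^+ i.
Proof.
move=> xK; apply: (le_trans (ler_norm_sum _ _ _)); apply: ler_sum => i _.
rewrite normrM ler_wpM2l// normrM normrX.
rewrite (le_trans (ler_wpM2l _ (cos_max _)))// ?mulr1 ?exprn_ge0//.
by rewrite lerXn2r ?nnegrE// (le_trans (normr_ge0 x)).
Qed.

Let cont_int (f : R -> R) : continuous f ->
  leb.-integrable `[-1, 1]%classic (EFin \o f).
Proof.
move=> cf; apply: continuous_compact_integrable; first exact: segment_compact.
exact: continuous_subspaceT.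
Qed.

Let cwave N c w E : continuous (fun t : R => (1 - t ^+ 2) ^+ E * euler_wave N c (w * t)).
Proof.
move=> t; apply: cvgM.
  apply: (@continuous_comp _ _ _ (fun t : R => 1 - t ^+ 2) (fun x : R => x ^+ E)).
    by apply: cvgB; [exact: cvg_cst|exact: exprn_continuous].
  exact: exprn_continuous.
apply: (@continuous_comp _ _ _ (fun t : R => w * t)); last exact: continuous_euler_wave.
exact: mulrl_continuous.
Qed.

(** Integrating by parts trades a factor [1 - t^2] against one application of
    [x * d/dx]; starting from [(t cos (w t))'] this inverts every one of the averages of
    a cosine against the weights [(1 - t^2)^E]. *)
Lemma cos_euler_wave E : exists2 c : {poly R}, (size c <= E.+2)%N &
  forall w, \int[leb]_(t in `[-1, 1]) ((1 - t ^+ 2) ^+ E * euler_wave E.+2 c (w * t)) = cos w.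
Proof.
elim: E => [|E [c cE H]].
  exists (2^-1 *: (1 + 'X)) => [|w].
    rewrite (leq_trans (size_scale_leq _ _))// (leq_trans (size_polyD _ _))//.
    by rewrite size_polyX size_poly1.
  rewrite (eq_Rint_in leb (g := fun t => 2^-1 * (cos (w * t) - w * t * sin (w * t)))); last first.
    move=> t _; rewrite expr0 mul1r /euler_wave !big_ord_recl big_ord0 addr0/=.
    rewrite /bump/= !coefZ !coefD !coefX !coef1/= addn0 expr0 expr1 mul0r !addr0 !mul1r cosDpihalf; ring.
  have dF (t : R) : is_derive t (1 : R) (fun t : R => 2^-1 * (t * cos (w * t)))
      (2^-1 * (cos (w * t) - w * t * sin (w * t))).
    apply: is_derive_eq; rewrite /GRing.scale/=; ring.
  rewrite (Rint_FTC _ dF); [|lra|].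
    by rewrite mulr1 mulrN1 cosN; field.
  move=> t; apply: cvgM; first exact: cvg_cst.
  have cw : continuous (fun t : R => w * t) by exact: mulrl_continuous.
  apply: cvgB; first by apply: (continuous_comp (cw t)); exact: continuous_cos.
  by apply: cvgM; [exact: cw|apply: (continuous_comp (cw t)); exact: continuous_sin].
pose a : R := (2 * E.+1%:R)^-1.
have a0 : 2 * E.+1%:R != 0 :> R by rewrite mulf_neq0 ?pnatr_eq0.
pose c1 := 'X * (c^`() + c).
have c1E : (size c1 <= E.+3)%N.
  rewrite (leq_trans (size_polyMleq _ _))// size_polyX addSn add1n ltnS.
  rewrite (leq_trans (size_polyD _ _))// geq_max cE andbT.
  by rewrite /deriv (leq_trans (size_poly _ _))// (leq_trans (leq_pred _)).
exists ((1 + a) *: c + a *: c1) => [|w].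
  rewrite (leq_trans (size_polyD _ _))// geq_max !(leq_trans (size_scale_leq _ _))//.
  exact: leqW.
pose f t := (1 - t ^+ 2) ^+ E * euler_wave E.+2 c (w * t).
pose F t := a * ((1 - t ^+ 2) ^+ E.+1 * t * euler_wave E.+2 c (w * t)).
pose g t := (1 - t ^+ 2) ^+ E.+1 * euler_wave E.+3 ((1 + a) *: c + a *: c1) (w * t).
have cf : continuous f by exact: cwave.
have cg : continuous g by exact: cwave.
have dF (t : R) : is_derive t (1 : R) F (g t - f t).
  have dw : is_derive t (1 : R) (fun t : R => euler_wave E.+2 c (w * t))
      (w * deuler E.+2 c (w * t)).
    have d1 : is_derive t (1 : R) (fun t : R => w * t) w.
      by apply: is_derive_eq; rewrite /GRing.scale/= mulr1.
    by rewrite mulrC; exact: (is_derive1_comp (is_derive_euler E.+2 c (w * t)) d1).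
  have dp : is_derive t (1 : R) (fun t : R => 1 - t ^+ 2) (- (2 * t)).
    by apply: is_derive_eq; rewrite /GRing.scale/=; ring.
  have dpE : is_derive t (1 : R) (fun t : R => (1 - t ^+ 2) ^+ E.+1)
      (E.+1%:R * (1 - t ^+ 2) ^+ E * - (2 * t)).
    by have := is_deriveX E.+1 dp; rewrite /GRing.scale/= exprfctE.
  apply: (is_derive_eq (is_deriveZ a (is_deriveM (is_deriveM dpE (is_derive_id t (1 : R))) dw))).
  rewrite /GRing.scale/= /g /f euler_waveD -xdeuler// -(euler_wave_widen _ cE) /a.
  rewrite mulrfctE (exprS _ E) -[E.+1%:R]natr1.
  have : E%:R + 1 != 0 :> R by rewrite natr1 pnatr_eq0.
  by move=> h; field.
have := Rint_FTC (a := -1) (b := 1) _ dF.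
rewrite /F expr1n sqrrN expr1n subrr !expr0n/= !mul0r !mulr0 subrr => h.
have {}h : \int[leb]_(t in `[-1, 1]) (g t - f t) = 0.
  by apply: h; [lra|move=> t; apply: cvgB; [exact: cg|exact: cf]].
move: h; rewrite RintegralB//; [|exact: cont_int|exact: cont_int].
by move/eqP; rewrite subr_eq0 => /eqP ->; exact: H.
Qed.

End euler_wave.

(** * Rotation invariance *)

Section radial.
Context {R : realType}.
Local Notation leb := (@lebesgue_measure R).
Local Notation lam n := (@lebesgue_tuple R n).
Local Open Scope ereal_scope.

Let mcomp2 d (T : measurableType d) (Phi : R -> R -> \bar R) (f g : T -> R) :
  measurable_fun setT (fun p : R * R => Phi p.1 p.2) ->
  measurable_fun setT f -> measurable_fun setT g ->
  measurable_fun setT (fun x => Phi (f x) (g x)).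
Proof.
move=> mPhi mf mg.
apply: (@measurableT_comp _ _ _ _ _ _ _ _ (fun x => (f x, g x)) mPhi).
exact: measurable_fun_pair.
Qed.

Lemma measurable_radial n (Phi : R -> R -> \bar R) (z : n.-tuple R) :
  measurable_fun setT (fun p : R * R => Phi p.1 p.2) ->
  measurable_fun setT (fun x : n.-tuple R => Phi (dotprod x x) (dotprod z x)).
Proof.
move=> mPhi.
by apply: mcomp2 mPhi _ _; apply: measurable_dotprod.
Qed.

Lemma dotprod_axis0 n (a : R) (x : n.+1.-tuple R) :
  dotprod (vaxis ord0 a) x = (a * tnth x ord0)%R.
Proof.
rewrite /dotprod big_ord_recl tnth_mktuple eqxx big1 ?addr0// => i _.
by rewrite tnth_mktuple mul0r.
Qed.

(** The rotation carries [(a, b)] onto the first axis; [H] stands for an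
    integral over the remaining coordinates. *)
Lemma plane_rotation (H : R -> R -> \bar R) (a b c : R) :
  measurable_fun setT (fun p : R * R => H p.1 p.2) -> (forall x y, 0 <= H x y) ->
  (c ^+ 2 = a ^+ 2 + b ^+ 2)%R ->
  \int[leb]_x \int[leb]_y H (x ^+ 2 + y ^+ 2)%R (a * x + b * y)%R =
  \int[leb]_x \int[leb]_y H (x ^+ 2 + y ^+ 2)%R (c * x)%R.
Proof.
move=> mH H0 c2; have [c0|c0] := eqVneq c 0%R.
  have /andP[a0 b0] : (a ^+ 2 == 0)%R && (b ^+ 2 == 0)%R.
    by rewrite -paddr_eq0 ?sqr_ge0// -c2 c0 expr0n.
  rewrite sqrf_eq0 in a0; rewrite sqrf_eq0 in b0.
  apply: eq_integral => x _; apply: eq_integral => y _.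
  by rewrite (eqP a0) (eqP b0) c0 !mul0r addr0.
have cs : ((a / c) ^+ 2 + (- (b / c)) ^+ 2 = 1)%R.
  by rewrite sqrrN !expr_div_n -mulrDl -c2 divff// sqrf_eq0.
have mF : measurable_fun setT (fun q : R * R => H (q.1 ^+ 2 + q.2 ^+ 2)%R (c * q.1)%R).
  apply: mcomp2 mH _ _; last by apply: measurable_funM.
  by apply: measurable_funD; apply: measurable_funX.
have := @ge0_integral_rot _ _ _ (fun x y => H (x ^+ 2 + y ^+ 2)%R (c * x)%R) cs mF (fun _ _ => H0 _ _).
move=> <-; apply: eq_integral => x _; apply: eq_integral => y _; congr H.
  have := cs; rewrite sqrrN; set p := (a / c)%R; set e := (b / c)%R => ce.
  transitivity ((p ^+ 2 + e ^+ 2) * (x ^+ 2 + y ^+ 2))%R; last by ring.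
  by rewrite ce mul1r.
by field.
Qed.

(** The rotation that carries [z] onto the first axis is a product of plane
    rotations, one for each coordinate: the induction hypothesis rotates the
    last coordinates, and [plane_rotation] the first two. *)
Lemma ge0_integral_radial n (Phi : R -> R -> \bar R) (z : n.+1.-tuple R) :
  measurable_fun setT (fun p : R * R => Phi p.1 p.2) -> (forall a b, 0 <= Phi a b) ->
  \int[lam n.+1]_x Phi (dotprod x x) (dotprod z x) =
  \int[lam n.+1]_x Phi (dotprod x x) (enorm z * tnth x ord0)%R.
Proof.
under [in RHS]eq_integral do rewrite -dotprod_axis0.
elim: n Phi z => [|n IH] Phi z mPhi Phi0.
  have mF (y : 1.-tuple R) := measurable_radial y mPhi.
  have F0 (y x : 1.-tuple R) : 0 <= Phi (dotprod x x) (dotprod y x) by exact: Phi0.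
  rewrite (ge0_integral_cons (mF z) (F0 z)) (ge0_integral_cons (mF _) (F0 _)).
  rewrite (tuple_consP z); set a := tnth z ord0; set e := [tuple _ | _ < 0].
  have -> : e = [tuple] by exact: tuple0.
  have nz : enorm (cons_pair (a, [tuple]) : 1.-tuple R) = `|a|%R.
    by rewrite /enorm dotprod_cons /dotprod big_ord0 addr0 -expr2 sqrtr_sqr.
  have slice (y : R) b : \int[lam 0]_v Phi (dotprod (cons_pair (y, v)) (cons_pair (y, v)))
      (dotprod (cons_pair (b, [tuple])) (cons_pair (y, v))) = Phi (y ^+ 2)%R (b * y)%R.
    rewrite ge0_integral_lam0; last by apply: (measurable_cons_sect1 y (mF _)).
    by rewrite !dotprod_cons /dotprod !big_ord0 !addr0 expr2.
  have -> : vaxis ord0 (enorm (cons_pair (a, [tuple]) : 1.-tuple R)) =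
      cons_pair (`|a|%R, [tuple]) :> 1.-tuple R.
    by apply: eq_from_tnth => i; rewrite (ord1 i) tnth_mktuple eqxx nz tnth_cons_pair0.
  under eq_integral do rewrite slice; under [RHS]eq_integral do rewrite slice.
  have [a0|a0] := leP 0%R a; first by rewrite ger0_norm.
  have mP : measurable_fun setT (fun y : R => Phi (y ^+ 2)%R (a * y)%R).
    by apply: mcomp2 mPhi _ _; [exact: measurable_funX|exact: measurable_funM].
  have n1 : (-1 : R)%R != 0%R by rewrite oppr_eq0 oner_eq0.
  have := ge0_integral_affine 0 n1 mP (fun y => Phi0 _ _).
  rewrite normrN1 invr1 mul1e => <-; apply: eq_integral => y _.
  by rewrite ltr0_norm//; congr (Phi _ _); ring.
pose rho := enorm z; pose z0 := tnth z ord0; pose z' := [tuple tnth z (lift ord0 i) | i < n.+1].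
have zE : z = cons_pair (z0, z') by exact: tuple_consP.
have rho2 : (rho ^+ 2 = z0 ^+ 2 + enorm z' ^+ 2)%R.
  by rewrite !enorm_sqr zE dotprod_cons expr2.
have mH : measurable_fun setT (fun p : R * R => \int[lam n]_t Phi (p.1 + dotprod t t)%R p.2).
  apply: (measurable_fun_fubini_tonelli_F (m2 := lam n)
    (fun p : (R * R) * n.-tuple R => Phi (p.1.1 + dotprod p.2 p.2)%R p.1.2)) => //.
  have m1 : measurable_fun setT (fun p : (R * R) * n.-tuple R => p.1.1).
    exact: (measurableT_comp measurable_fst measurable_fst).
  have m2 : measurable_fun setT (fun p : (R * R) * n.-tuple R => p.1.2).
    exact: (measurableT_comp measurable_snd measurable_fst).
  apply: mcomp2 mPhi _ m2; apply: measurable_funD => //.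
  by apply: measurable_dotprod; exact: measurable_snd.
pose H a b := \int[lam n]_t Phi (a + dotprod t t)%R b.
have H0 a b : 0 <= H a b by exact: integral_ge0.
(* Only the first two coordinates matter after the induction hypothesis. *)
have two (a b : R) : \int[leb]_x \int[lam n.+1]_v
    Phi (x * x + dotprod v v)%R (a * x + b * tnth v ord0)%R =
    \int[leb]_x \int[leb]_y H (x ^+ 2 + y ^+ 2)%R (a * x + b * y)%R.
  apply: eq_integral => x _.
  have mv : measurable_fun setT (fun v : n.+1.-tuple R =>
      Phi (x * x + dotprod v v)%R (a * x + b * tnth v ord0)%R); last first.
    rewrite (ge0_integral_cons mv (fun _ => Phi0 _ _)).
    apply: eq_integral => y _; apply: eq_integral => t _.
    by rewrite dotprod_cons tnth_cons_pair0 addrA !expr2.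
  under eq_fun do rewrite -dotprod_axis0.
  apply: (@measurable_radial _ (fun c e => Phi (x * x + c)%R (a * x + e)%R)).
  by apply: mcomp2 mPhi _ _; apply: measurable_funD.
have L : \int[lam n.+2]_x Phi (dotprod x x) (dotprod z x) =
    \int[leb]_x \int[leb]_y H (x ^+ 2 + y ^+ 2)%R (z0 * x + enorm z' * y)%R.
  rewrite (ge0_integral_cons (measurable_radial z mPhi) (fun _ => Phi0 _ _)) -two.
  apply: eq_integral => x _.
  have dz v : dotprod z (cons_pair (x, v)) = (z0 * x + dotprod z' v)%R.
    by rewrite {1}zE dotprod_cons.
  under eq_integral do rewrite dz dotprod_cons.
  rewrite (IH (fun c e => Phi (x * x + c)%R (z0 * x + e)%R))//.
    by under eq_integral do rewrite dotprod_axis0.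
  by apply: mcomp2 mPhi _ _; apply: measurable_funD.
have R' : \int[lam n.+2]_x Phi (dotprod x x) (dotprod (vaxis ord0 rho) x) =
    \int[leb]_x \int[leb]_y H (x ^+ 2 + y ^+ 2)%R (rho * x)%R.
  rewrite (ge0_integral_cons (measurable_radial (vaxis ord0 rho) mPhi) (fun _ => Phi0 _ _)).
  transitivity (\int[leb]_x \int[leb]_y H (x ^+ 2 + y ^+ 2)%R (rho * x + 0 * y)%R).
    rewrite -two; apply: eq_integral => x _; apply: eq_integral => v _.
    by rewrite dotprod_axis0 tnth_cons_pair0 dotprod_cons mul0r addr0.
  by apply: eq_integral => x _; apply: eq_integral => y _; rewrite mul0r addr0.
by rewrite L R'; exact: plane_rotation.
Qed.

Lemma Rint_radial n (Phi : R -> R -> R) (z : n.+1.-tuple R) :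
  measurable_fun setT (fun p : R * R => Phi p.1 p.2) ->
  (\int[lam n.+1]_x Phi (dotprod x x) (dotprod z x) =
   \int[lam n.+1]_x Phi (dotprod x x) (enorm z * tnth x ord0))%R.
Proof.
move=> mPhi; have mE : measurable_fun setT (fun p : R * R => (Phi p.1 p.2)%:E).
  exact/measurable_EFinP.
rewrite /Rintegral; congr fine; rewrite integralE [in RHS]integralE; congr (_ - _).
  have m1 : measurable_fun setT (fun p : R * R => (fun q : R * R => (Phi q.1 q.2)%:E)^\+ (p.1, p.2)).
    rewrite (_ : (fun p : R * R => _) = (fun q : R * R => (Phi q.1 q.2)%:E)^\+).
    exact: measurable_funepos.
  by apply/funext => -[].
  have := @ge0_integral_radial n (fun a b => (fun q : R * R => (Phi q.1 q.2)%:E)^\+ (a, b)) z m1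
    (fun a b => funepos_ge0 _ (a, b)).
  move=> E; transitivity (\int[lam n.+1]_x (fun q : R * R => (Phi q.1 q.2)%:E)^\+ (dotprod x x, dotprod z x)).
    by apply: eq_integral => x _; rewrite unlock.
  by rewrite E; apply: eq_integral => x _; rewrite unlock.
have m1 : measurable_fun setT (fun p : R * R => (fun q : R * R => (Phi q.1 q.2)%:E)^\- (p.1, p.2)).
  rewrite (_ : (fun p : R * R => _) = (fun q : R * R => (Phi q.1 q.2)%:E)^\-).
    exact: measurable_funeneg.
  by apply/funext => -[].
have := @ge0_integral_radial n (fun a b => (fun q : R * R => (Phi q.1 q.2)%:E)^\- (a, b)) z m1
    (fun a b => funeneg_ge0 _ (a, b)).
  move=> E; transitivity (\int[lam n.+1]_x (fun q : R * R => (Phi q.1 q.2)%:E)^\- (dotprod x x, dotprod z x)).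
    by apply: eq_integral => x _; rewrite unlock.
  by rewrite E; apply: eq_integral => x _; rewrite unlock.
Qed.

End radial.

(** * Averages of waves over the ball *)

Section ball_waves.
Context {R : realType}.
Local Notation leb := (@lebesgue_measure R).
Local Notation lam n := (@lebesgue_tuple R n).

(** The function [(1 - a) ^ (p / 2)], extended by zero to [a > 1]: with the square root, the
    weight [(1 - |x|^2) ^ (p / 2)] of the unit ball has an integer power of [1 - t^2] as
    marginal in every dimension. *)
Definition ball_weight p (a : R) : R := Num.sqrt (1 - a) ^+ p.

Lemma ball_weight_ge0 p a : 0 <= ball_weight p a.
Proof. exact/exprn_ge0/sqrtr_ge0. Qed.

Lemma ball_weight_out p a : 1 <= a -> ball_weight p.+1 a = 0.
Proof. by move=> a1; rewrite /ball_weight ler0_sqrtr ?subr_le0// expr0n. Qed.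

Lemma ball_weight_le1 p a : 0 <= a -> ball_weight p a <= 1.
Proof.
by move=> a0; rewrite exprn_ile1 ?sqrtr_ge0// -[leRHS]sqrtr1 ler_wsqrtr//; lra.
Qed.

Lemma measurable_ball_weight p : measurable_fun setT (ball_weight p).
Proof.
apply: measurable_funX; apply: (@measurableT_comp _ _ _ _ _ _ (@Num.sqrt R)).
  by apply: continuous_measurable_fun; exact: sqrt_continuous.
by apply: measurable_funB => //; exact: measurable_cst.
Qed.

Lemma norm_tnth_lt1 n (x : n.-tuple R) i : dotprod x x < 1 -> `|tnth x i| <= 1.
Proof.
move=> x1; apply: (le_trans (norm_tnth_le_enorm _ _)).
by rewrite -[leRHS]sqrtr1 ler_wsqrtr// ltW.
Qed.

Lemma ball_weight_supp n p (x : n.-tuple R) :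
  ball_weight p.+1 (dotprod x x) != 0 -> cube 1 x.
Proof.
move=> h i; rewrite -ler_norml; apply: norm_tnth_lt1; rewrite ltNge; apply/negP => /ball_weight_out h'.
by rewrite h' eqxx in h.
Qed.

Lemma bcs_ball_weight n p : bcs (fun x : n.-tuple R => ball_weight p.+1 (dotprod x x)).
Proof.
split; last by exists 1 => x; exact: ball_weight_supp.
  by apply: (measurableT_comp (measurable_ball_weight _)); exact: measurable_dotprod.
exists 1 => x; rewrite ger0_norm ?ball_weight_ge0// ball_weight_le1//.
by rewrite -enorm_sqr sqr_ge0.
Qed.

Definition ball_mass n : R := \int[lam n]_x ball_weight n.+2 (dotprod x x).

Lemma ball_mass_gt0 n : 0 < ball_mass n.
Proof.
pose h : R := (2 * n.+1%:R)^-1.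
have n1 : 0 < n.+1%:R :> R by rewrite ltr0n.
have h0 : 0 < h by rewrite invr_gt0 mulr_gt0.
pose b : 'I_n -> R := fun=> h; pose a : 'I_n -> R := fun=> - h.
have mb := measurable_box a b.
have L i : L1 leb (\1_(`[a i, b i]%classic) : R -> R).
  by have := integrable_indic_itv (a i) (b i) true false; apply.
have I1 i : \int[leb]_t \1_(`[a i, b i]%classic) t = 2 * h.
  apply: EFin_inj; rewrite EFin_Rintegral// integral_indic// setIT.
  apply: etrans; first exact: lebesgue_measure_itv.
  by rewrite /= lte_fin /a /b gtrN// -EFinD; congr EFin; ring.
have B0 : 0 < \int[lam n]_x (2^-1 ^+ n.+2 * \1_(box a b) x).
  rewrite RintZl; last exact: L1_indic_box.
  rewrite mulr_gt0 ?exprn_gt0 ?invr_gt0//.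
  rewrite (eq_Rint (lam n) (g := fun x => \prod_(i < n) \1_(`[a i, b i]%classic) (tnth x i))).
    rewrite (Rint_prod (p := fun i => \1_(`[a i, b i]%classic)))//.
    by apply: prodr_gt0 => i _; rewrite I1 mulr_gt0.
  by move=> x; rewrite indic_box.
apply: (lt_le_trans B0); apply: le_Rint.
- by apply: L1Zl; exact: L1_indic_box.
- exact/L1_bcs/bcs_ball_weight.
move=> x; rewrite indicE; have [/set_mem xb|_] := boolP (_ \in _); last first.
  by rewrite mulr0 ball_weight_ge0.
rewrite mulr1 /ball_weight lerXn2r ?nnegrE ?sqrtr_ge0 ?invr_ge0//.
have x2 : enorm x <= 2^-1.
  apply: (le_trans (enorm_le_sum x)); apply: (@le_trans _ _ (\sum_(i < n) h)).
    by apply: ler_sum => i _; rewrite ler_norml; exact: xb.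
  rewrite sumr_const card_ord -[leLHS]mulr_natr /h invfM.
  have : n.+1%:R^-1 * n%:R <= 1 :> R by rewrite mulrC ler_pdivrMr// mul1r ler_nat.
  by rewrite -mulrA; move: (_ * n%:R) => q; lra.
have h2 : 0 <= 2^-1 :> R by rewrite invr_ge0.
rewrite -[leLHS](ger0_norm h2) -sqrtr_sqr ler_wsqrtr// -enorm_sqr.
by have := enorm_ge0 x; nra.
Qed.

Let L1_ball_slice n (t : R) :
  L1 (lam n) (fun v : n.-tuple R => ball_weight n.+2 (t * t + dotprod v v)).
Proof.
apply/L1_bcs; split.
- apply: (measurableT_comp (measurable_ball_weight _)); apply: measurable_funD => //.
  exact: measurable_dotprod.
- exists 1 => v; rewrite ger0_norm ?ball_weight_ge0// ball_weight_le1//.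
  by rewrite -expr2 -enorm_sqr addr_ge0 ?sqr_ge0.
exists 1 => v h; apply: (@ball_weight_supp _ n.+1); apply: contraNN h => /eqP h0.
move: h0; rewrite /ball_weight => /eqP; rewrite !expf_eq0/= !sqrtr_eq0 -expr2.
by have := sqr_ge0 t; lra.
Qed.

(* The slice of the ball at height [t] is a ball of radius [sqrt (1 - t^2)]. *)
Let ball_slice n (t : R) :
  \int[lam n]_v ball_weight n.+2 (t * t + dotprod v v) =
  ball_weight (2 * n.+1) (t ^+ 2) * ball_mass n.
Proof.
have [t1|t1] := leP 1 (t ^+ 2).
  rewrite mulnS addSn ball_weight_out// mul0r (eq_Rint _ (g := fun=> 0)) ?Rint0// => v.
  rewrite ball_weight_out// -expr2 -enorm_sqr; by have := sqr_ge0 (enorm v); lra.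
set a := Num.sqrt (1 - t ^+ 2).
have a0 : 0 < a by rewrite sqrtr_gt0 subr_gt0.
have a2 : a ^+ 2 = 1 - t ^+ 2 by rewrite sqr_sqrtr// subr_ge0 ltW.
have fE (v : n.-tuple R) : ball_weight n.+2 (t * t + dotprod (vaff a origin v) (vaff a origin v)) =
    a ^+ n.+2 * ball_weight n.+2 (dotprod v v).
  have -> : dotprod (vaff a origin v) (vaff a origin v) = a ^+ 2 * dotprod v v.
    by rewrite /dotprod mulr_sumr; apply: eq_bigr => i _; rewrite !tnth_mktuple; ring.
  rewrite /ball_weight -exprMn; congr (_ ^+ _).
  by rewrite -[a in RHS](ger0_norm (ltW a0)) -sqrtr_sqr -sqrtrM ?sqr_ge0// a2; congr Num.sqrt; ring.
have mf := @L1_ball_slice n t.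
have := Rint_vaff origin (lt0r_neq0 a0) mf.
rewrite (eq_Rint _ fE) RintZl; last exact/L1_bcs/bcs_ball_weight.
rewrite -/(ball_mass n) gtr0_norm// => /(congr1 ( *%R (a ^+ n))).
rewrite [RHS]mulrA -exprMn divff ?lt0r_neq0// expr1n mul1r => <-.
by rewrite mulrA -exprD /ball_weight -/a; congr (_ ^+ _ * _); rewrite mulnC muln2 -addnn addnS addSn.
Qed.

(** Rotation invariance makes the average of [euler_wave c <z, x>] over the ball depend
    only on [|z|]; integrating over slices reduces it to [cos_euler_wave]. *)
Lemma ball_euler_wave n : exists c : {poly R}, forall z : n.+1.-tuple R,
  \int[lam n.+1]_x (ball_weight n.+2 (dotprod x x) * euler_wave n.+3 c (dotprod z x)) =
  ball_mass n * cos (enorm z).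
Proof.
have [c _ cE] := @cos_euler_wave R n.+1; exists c => z.
have me : measurable_fun setT (euler_wave n.+3 c).
  by apply: continuous_measurable_fun; exact: continuous_euler_wave.
rewrite (@Rint_radial _ n (fun a b => ball_weight n.+2 a * euler_wave n.+3 c b)); last first.
  apply: measurable_funM; first exact: (measurableT_comp (measurable_ball_weight _) measurable_fst).
  exact: (measurableT_comp me measurable_snd).
set w := enorm z; pose K := \sum_(i < n.+3) `|c`_i| * `|w| ^+ i.
have K0 : 0 <= K by apply: sumr_ge0 => i _; rewrite mulr_ge0// exprn_ge0.
pose A (t : R) : R := \1_(`[-1, 1]%classic) t * K.
rewrite (Rint_cons (A := A) (B := \1_(box (fun=> -1) (fun=> 1)))); last 4 first.
- apply: measurable_funM.
    by apply: (measurableT_comp (measurable_ball_weight _)); exact: measurable_dotprod.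
  by apply: (measurableT_comp me); apply: measurable_funM => //; exact: measurable_tnth.
- have i1 : L1 leb (fun t : R => \1_(`[-1, 1]%classic) t).
    by have := integrable_indic_itv (-1 : R) 1 true false; apply.
  have -> : A = (fun t => K * \1_(`[-1, 1]%classic) t) by apply/funext => t; rewrite /A mulrC.
  exact: (L1Zl K i1).
- exact: L1_indic_box.
- move=> t v; rewrite tnth_cons_pair0 normrM.
  have [->|h] := eqVneq (ball_weight n.+2 (dotprod (cons_pair (t, v)) (cons_pair (t, v)))) 0.
    by rewrite normr0 mul0r mulr_ge0 ?mulr_ge0.
  have tv := ball_weight_supp h.
  have t1 : -1 <= t <= 1 by have := tv ord0; rewrite tnth_cons_pair0.
  have v1 : box (fun=> -1) (fun=> 1) v.
    by move=> i; have := tv (lift ord0 i); rewrite tnth_cons_pairS.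
  have -> : A t * \1_(box (fun=> -1) (fun=> 1)) v = K.
    by rewrite /A !indicE !mem_set ?mul1r ?mulr1//= in_itv.
  rewrite -[leRHS]mul1r ler_pM//.
    by rewrite ger0_norm ?ball_weight_ge0// ball_weight_le1// -enorm_sqr sqr_ge0.
  by apply: euler_wave_bound; rewrite normrM ler_piMr// ler_norml.
rewrite (eq_Rint leb (g := fun t => ball_mass n *
  (\1_(`[-1, 1]%classic) t * ((1 - t ^+ 2) ^+ n.+1 * euler_wave n.+3 c (w * t))))); last first.
  move=> t; under [LHS]eq_Rint do rewrite tnth_cons_pair0 dotprod_cons mulrC.
  rewrite (RintZl _ (L1_ball_slice n t)).
  rewrite ball_slice indicE; have [/set_mem|] := boolP (t \in _).
    rewrite /= in_itv/= => t1; rewrite /ball_weight exprM sqr_sqrtr; first by ring.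
    by nra.
  move=> /negP t1; rewrite mul0r mulr0 mulnS addSn ball_weight_out ?mul0r ?mulr0//.
  rewrite leNgt; apply/negP => t2; apply: t1; apply: mem_set; rewrite /= in_itv/=; nra.
rewrite RintZl; last first.
  apply: (@L1_bounded_supp _ _ (-1) 1 K).
  - apply: measurable_indicM => //; apply: measurable_funM; last first.
      by apply: (measurableT_comp me); apply: measurable_funM.
    by apply: measurable_funX; apply: measurable_funB => //; exact: measurable_funX.
  - move=> t; rewrite indicE; have [/set_mem|_] := boolP (t \in _); last by rewrite mul0r normr0.
    rewrite /= in_itv/= => t1; rewrite mul1r normrM -[leRHS]mul1r ler_pM//.
      by rewrite normrX exprn_ile1// ger0_norm; nra.
    by apply: euler_wave_bound; rewrite normrM ler_piMr// ler_norml.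
  by move=> t t1; rewrite indicE memNset ?mul0r//= => h; rewrite h in t1.
congr (_ * _); rewrite -cE.
by rewrite /Rintegral (integral_in_indic leb `[-1, 1]%classic
  (fun t => (1 - t ^+ 2) ^+ n.+1 * euler_wave n.+3 c (w * t))).
Qed.

End ball_waves.

(** * Tapered waves *)

Section sinc.
Context {R : realType}.
Local Notation leb := (@lebesgue_measure R).

(** The cardinal sine [sin v / v], as a superposition of waves. *)
Definition sinc (v : R) : R := \int[leb]_t (unit_indic t * cos (t * v)).

Lemma L1_unit_indic : L1 leb (@unit_indic R).
Proof. by have := integrable_indic_itv (0 : R) 1 true false; apply. Qed.

Lemma L1_unit_cos v : L1 leb (fun t => unit_indic t * cos (t * v)).
Proof.
have mi := L1_measurable L1_unit_indic.
apply: (L1_le _ L1_unit_indic).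
  by apply: measurable_funM => //; apply: measurable_cos; exact: measurable_funM.
move=> t; have i0 : 0 <= unit_indic t by [].
by rewrite normrM ger0_norm// ler_piMr// cos_max.
Qed.

Lemma Rint_unit_indic : \int[leb]_t unit_indic t = 1.
Proof.
apply: EFin_inj; rewrite (EFin_Rintegral L1_unit_indic) integral_indic// setIT.
by apply: etrans; [exact: lebesgue_measure_itv|rewrite /= lte_fin ltr01 sube0].
Qed.

Lemma sinc0 : sinc 0 = 1.
Proof.
rewrite -Rint_unit_indic; apply: eq_Rint => t; by rewrite mulr0 cos0 mulr1.
Qed.

Lemma sinc_le1 v : `|sinc v| <= 1.
Proof.
rewrite -Rint_unit_indic; apply: (Rint_norm_le (L1_unit_cos v) L1_unit_indic).
move=> t; have i0 : 0 <= unit_indic t by [].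
by rewrite normrM ger0_norm// ler_piMr// cos_max.
Qed.

Lemma measurable_sinc : measurable_fun setT sinc.
Proof.
apply: (measurable_Rint_param _ L1_unit_indic) => [|v t].
  apply: measurable_funM; first exact: (measurableT_comp (L1_measurable L1_unit_indic) measurable_snd).
  by apply: measurable_cos; apply: measurable_funM; [exact: measurable_snd|exact: measurable_fst].
have i0 : 0 <= unit_indic t by [].
by rewrite normrM ger0_norm// ler_piMr// cos_max.
Qed.

Lemma sincE v : v * sinc v = sin v.
Proof.
rewrite /sinc -RintZl; last exact: L1_unit_cos.
have dF (t : R) : is_derive t (1 : R) (fun t : R => sin (t * v)) (v * cos (t * v)).
  by apply: is_derive_eq; rewrite /GRing.scale/=; ring.
have := Rint_FTC ler01 dF; rewrite mul0r sin0 subr0 mul1r => <-; last first.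
  move=> t; apply: cvgM; first exact: cvg_cst.
  by apply: (@continuous_comp _ _ _ (fun t : R => t * v)); [exact: mulrr_continuous|exact: continuous_cos].
rewrite /Rintegral (integral_in_indic leb `[0, 1]%classic (fun t => v * cos (t * v))).
  by congr fine; apply: eq_integral => t _; rewrite /unit_indic mulrCA.
Qed.

End sinc.

Section tapered_waves.
Context {R : realType} {d : nat} (delta h B : R).
Hypotheses (delta_gt0 : 0 < delta) (h_gt0 : 0 < h).
Local Notation leb := (@lebesgue_measure R).
Local Notation bl := (band_limited delta (@cball R d B)).

(** Products of cardinal sines: a factor [sinc (h * u_i)] widens the spectrum by only [h]
    and absorbs one factor [u_i] of a polynomial. *)
Definition taper (l : seq 'I_d) (u : d.-tuple R) : R := \prod_(i <- l) sinc (h * tnth u i).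

Lemma measurable_taper l : measurable_fun setT (taper l).
Proof.
apply: measurable_prod => i _; apply: (measurableT_comp measurable_sinc).
by apply: measurable_funM => //; exact: measurable_tnth.
Qed.

Lemma taper_le1 l u : `|taper l u| <= 1.
Proof.
rewrite /taper; elim: l => [|i l IH]; first by rewrite big_nil normr1.
by rewrite big_cons normrM mulr_ile1// sinc_le1.
Qed.

Lemma taper_origin l : taper l origin = 1.
Proof. by rewrite /taper big1// => i _; rewrite tnth_mktuple mulr0 sinc0. Qed.

Lemma taper_rem j l u : j \in l -> tnth u j * taper l u =
  h^-1 * sin (h * tnth u j) * taper (rem j l) u.
Proof.
move=> jl; rewrite /taper (perm_big _ (perm_to_rem jl)) big_cons/= mulrA; congr (_ * _).
by rewrite -sincE; field; rewrite gt_eqF.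
Qed.

Let count_mem_rem i (j k : 'I_d) l :
  (i < count_mem k l)%N -> (i <= count_mem k (rem j l))%N.
Proof.
move=> il; rewrite count_rem; case: (_ && _); last by rewrite subn0 ltnW.
by rewrite subn1 -ltnS prednK// (leq_ltn_trans _ il).
Qed.

Lemma taper_poly_le i l u : (forall j, (i <= count_mem j l)%N) ->
  (\sum_(j < d) `|tnth u j|) ^+ i * `|taper l u| <= (d%:R / h) ^+ i.
Proof.
elim: i l => [|i IH] l il; first by rewrite !expr0 mul1r taper_le1.
set s := \sum_j _ in IH *; have s0 : 0 <= s ^+ i by rewrite exprn_ge0// sumr_ge0.
rewrite !exprS -mulrA {1}/s mulr_suml.
have -> : d%:R / h * (d%:R / h) ^+ i = \sum_(j < d) (h^-1 * (d%:R / h) ^+ i).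
  by rewrite sumr_const card_ord -mulr_natr; ring.
apply: ler_sum => j _.
have jl : j \in l by rewrite -has_pred1 has_count (leq_ltn_trans _ (il j)).
have -> : `|tnth u j| * (s ^+ i * `|taper l u|) = s ^+ i * `|tnth u j * taper l u|.
  by rewrite normrM; ring.
rewrite taper_rem// !normrM mulrCA -!mulrA ler_pM ?mulr_ge0//.
  by rewrite gtr0_norm ?invr_gt0.
rewrite (le_trans _ (IH (rem j l) _))//.
  by rewrite ler_piMl ?mulr_ge0// sin_max.
by move=> k; apply: count_mem_rem.
Qed.

Lemma band_limited0 : bl (fun=> 0).
Proof.
split; [exact: measurable_cst|by exists 0 => u; rewrite normr0|] => f b _ _.
by rewrite mulr0 (eq_Rint _ (g := fun=> 0)) ?Rint0// => u; rewrite !mul0r.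
Qed.

Lemma band_limited_sum (I : Type) (r : seq I) (a : I -> R) (G : I -> d.-tuple R -> R) :
  (forall i, bl (G i)) -> bl (fun u => \sum_(i <- r) a i * G i u).
Proof.
move=> bG; elim: r => [|i r IH]; first by under eq_fun do rewrite big_nil; exact: band_limited0.
by under eq_fun do rewrite big_cons; exact: band_limited_lin.
Qed.

Let bl_taper l (y : d.-tuple R) al : enorm y + h * (size l)%:R + d%:R * delta <= B ->
  bl (fun u => cos (dotprod u y + al) * taper l u).
Proof.
elim: l y al => [|j l IH] y al yB.
  under eq_fun do rewrite /taper big_nil mulr1.
  have cb (x z : d.-tuple R) : enorm x = enorm y -> cube delta z -> cball B (vadd x z).
    move=> xy zd; rewrite /cball/= (le_trans (enorm_vadd _ _))// (le_trans _ yB)//.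
    rewrite /= mulr0 addr0 xy lerD2l.
    by have [_ _ _] := @gauge_cball R d; apply.
  apply: band_limited_cos => // z zd; apply: cb => //; exact: enorm_vopp.
pose G (t : R) u := cos (t * (h * tnth u j)) * (cos (dotprod u y + al) * taper l u).
have -> : (fun u => cos (dotprod u y + al) * taper (j :: l) u) =
    (fun u => \int[leb]_t (unit_indic t * G t u)).
  apply/funext => u; rewrite /taper big_cons /sinc mulrCA mulrC -RintZl.
    by apply: (eq_Rint leb) => t; rewrite /G /taper; ring.
  exact: L1_unit_cos.
apply: (band_limited_superpose delta_gt0 (C := 1) L1_unit_indic) => [|t u|t t0].
- rewrite /G; apply: measurable_funM.
    apply: measurable_cos; apply: measurable_funM; first exact: measurable_fst.
    apply: measurable_funM => //; exact: (measurableT_comp (measurable_tnth j) measurable_snd).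
  apply: measurable_funM; last exact: (measurableT_comp (measurable_taper l) measurable_snd).
  apply: measurable_cos; apply: measurable_funD => //.
  by apply: measurable_dotprod => //; exact: measurable_snd.
- by rewrite !normrM !mulr_ile1 ?mulr_ge0 ?cos_max ?taper_le1.
have t1 : `|t| <= 1.
  move: t0; rewrite /unit_indic indicE; have [/set_mem|_] := boolP (_ \in _); last by rewrite eqxx.
  by rewrite /= in_itv/= => /andP[h1 h2] _; rewrite ger0_norm.
have yt c : `|c| <= h -> enorm (vadd y (vaxis j c)) + h * (size l)%:R + d%:R * delta <= B.
  move=> ch; apply: le_trans yB; rewrite lerD2r /= -natr1.
  have := enorm_vadd y (vaxis j c); rewrite enorm_vaxis => e1.
  by rewrite mulrDr mulr1; move: (h * _) => q; lra.
have th : `|t * h| <= h by rewrite normrM (gtr0_norm h_gt0) ler_piMl// ltW.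
have b1 := IH (vadd y (vaxis j (t * h))) al (yt _ th).
have b2 := IH (vadd y (vaxis j (- (t * h)))) al (yt _ _).
rewrite normrN in b2; have {}b2 := b2 th.
have := band_limited_lin delta_gt0 2^-1 b1 (band_limited_lin delta_gt0 (- 2^-1) b2 b2).
congr band_limited; apply/funext => u; rewrite !dotprodDr !dotprod_vaxis /G.
set a := dotprod u y; set T := taper l u.
have -> : a + tnth u j * (t * h) + al = (a + al) + t * (h * tnth u j) by ring.
have -> : a + tnth u j * - (t * h) + al = (a + al) - t * (h * tnth u j) by ring.
by rewrite cosD cosB; field.
Qed.

(** Each factor [u_j] of the scalar product turns one [sinc (h * u_j)] into a
    sine, which shifts the frequency of the wave by at most [h]. *)
Lemma band_limited_poly_wave i l (x y : d.-tuple R) al :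
  (forall j, (i <= count_mem j l)%N) ->
  enorm y + h * (size l)%:R + d%:R * delta <= B ->
  bl (fun u => dotprod u x ^+ i * cos (dotprod u y + al) * taper l u).
Proof.
elim: i l y al => [|i IH] l y al il yB.
  by under eq_fun do rewrite expr0 mul1r; exact: bl_taper.
pose l' j := rem j l.
have jl j : j \in l by rewrite -has_pred1 has_count (leq_ltn_trans _ (il j)).
have il' j k : (i <= count_mem k (l' j))%N.
  exact: count_mem_rem.
have yB' j c : `|c| <= h -> enorm (vadd y (vaxis j c)) + h * (size (l' j))%:R + d%:R * delta <= B.
  move=> ch; apply: le_trans yB; rewrite lerD2r size_rem//.
  have -> : (size l)%:R = (size l).-1%:R + 1 :> R.
    by rewrite natr1 prednK//; have := jl j; case: (l).
  have := enorm_vadd y (vaxis j c); rewrite enorm_vaxis; lra.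
have hh : `|h| <= h by rewrite gtr0_norm.
have hN : `|- h| <= h by rewrite normrN gtr0_norm.
pose G j c u := dotprod u x ^+ i * cos (dotprod u (vadd y (vaxis j c)) + (al - pi / 2)) * taper (l' j) u.
have bG j : bl (fun u => 1 * G j h u + -1 * G j (- h) u).
  have b1 := IH _ _ (al - pi / 2) (il' j) (yB' j _ hh).
  have b2 := IH _ _ (al - pi / 2) (il' j) (yB' j _ hN).
  have := band_limited_lin delta_gt0 1 b1 (band_limited_lin delta_gt0 (-1) b2 band_limited0).
  by congr band_limited; apply/funext => u; rewrite addr0.
have := band_limited_sum (index_enum 'I_d) (fun j => tnth x j * (2 * h)^-1) bG.
congr band_limited; apply/funext => u.
rewrite exprS -!mulrA {2}/dotprod mulr_suml; apply: eq_bigr => j _.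
rewrite /G !dotprodDr !dotprod_vaxis.
set a := dotprod u y; set p := dotprod u x ^+ i.
have -> : a + tnth u j * h + (al - pi / 2) = a + al + h * tnth u j - pi / 2 by ring.
have -> : a + tnth u j * - h + (al - pi / 2) = a + al - h * tnth u j - pi / 2 by ring.
rewrite !cosBpihalf sinD sinB.
transitivity (tnth x j * p * cos (a + al) * (h^-1 * sin (h * tnth u j) * taper (l' j) u)).
  by field; rewrite gt_eqF.
by rewrite -taper_rem//; ring.
Qed.

Lemma band_limited_euler_wave N c l (z : d.-tuple R) :
  (forall j, (N <= count_mem j l)%N) ->
  enorm z + h * (size l)%:R + d%:R * delta <= B ->
  bl (fun u => euler_wave N c (dotprod u z) * taper l u).
Proof.
move=> Nl zB; have bG (i : 'I_N) := @band_limited_poly_wave i l z z (i%:R * (pi / 2))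
  (fun j => leq_trans (ltnW (ltn_ord i)) (Nl j)) zB.
have := band_limited_sum (index_enum 'I_N) (fun i : 'I_N => c`_i) bG.
congr band_limited; apply/funext => u; rewrite /euler_wave mulr_suml.
by apply: eq_bigr => i _; ring.
Qed.

End tapered_waves.

(** * Radial multipliers *)

Section radial_waves.
Context {R : realType} {n : nat} (delta h rho B : R) (l : seq 'I_n.+1).
Hypotheses (delta_gt0 : 0 < delta) (h_gt0 : 0 < h).
Hypotheses (l_count : forall j, (n.+3 <= count_mem j l)%N).
Hypothesis rhoB : rho + h * (size l)%:R + n.+1%:R * delta <= B.
Local Notation lam := (@lebesgue_tuple R n.+1).
Local Notation bl := (band_limited delta (@cball R n.+1 B)).
Local Notation T := (taper h l).

(** Finite speed of propagation: [cos (tau * |u|)] is the transform of a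
    distribution carried by the ball of radius [tau]. By [ball_euler_wave] it is
    an average of plane waves with polynomial factors, and the taper absorbs
    these. *)
Let bl_radial_cos tau : `|tau| <= rho -> bl (fun u => cos (tau * enorm u) * T u).
Proof.
move=> taur; have [c cE] := @ball_euler_wave R n.
pose w (x : n.+1.-tuple R) := ball_weight n.+2 (dotprod x x).
pose A : set (n.+1.-tuple R) := box (fun=> -1) (fun=> 1).
pose z (x : n.+1.-tuple R) : n.+1.-tuple R := [tuple tau * tnth x i | i < n.+1].
have dz u x : dotprod u (z x) = dotprod (z u) x.
  by rewrite /dotprod; apply: eq_bigr => i _; rewrite !tnth_mktuple; ring.
have zle u x : A x -> `|dotprod u (z x)| <= `|tau| * \sum_(j < n.+1) `|tnth u j|.
  move=> xA; rewrite (le_trans (ler_norm_sum _ _ _))// mulr_sumr; apply: ler_sum => j _.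
  rewrite tnth_mktuple !normrM mulrCA ler_wpM2l// ler_piMr// ler_norml.
  exact: xA.
have wA x : w x != 0 -> A x by exact: ball_weight_supp.
have iw : L1 lam w by exact/L1_bcs/bcs_ball_weight.
have mz : measurable_fun setT z.
  by apply: measurable_mktuple => i; apply: measurable_funM => //; exact: measurable_tnth.
have me : measurable_fun setT (euler_wave n.+3 c).
  by apply: continuous_measurable_fun; exact: continuous_euler_wave.
pose G x u := \1_A x * (euler_wave n.+3 c (dotprod u (z x)) * T u).
have bG x : w x != 0 -> bl (G x).
  move=> wx; have xA : x \in A by apply/mem_set/wA.
  have xz : enorm (z x) + h * (size l)%:R + n.+1%:R * delta <= B.
    apply: le_trans rhoB; rewrite !lerD2r enormZ (le_trans _ taur)// ler_piMr//.
    rewrite -sqrtr1 ler_wsqrtr// leNgt; apply/negP => /ltW /(ball_weight_out n.+1) w0.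
    by rewrite /w w0 eqxx in wx.
  have := band_limited_euler_wave delta_gt0 h_gt0 c l_count xz.
  by congr band_limited; apply/funext => u; rewrite /G indicE xA mul1r.
have mG : measurable_fun setT (fun p : n.+1.-tuple R * n.+1.-tuple R => G p.1 p.2).
  apply: measurable_funM.
    by apply: (measurableT_comp _ measurable_fst); apply: measurable_indic; exact: measurable_box.
  apply: measurable_funM; last exact: (measurableT_comp (measurable_taper h l) measurable_snd).
  apply: (measurableT_comp me); apply: measurable_dotprod; first exact: measurable_snd.
  exact: (measurableT_comp mz measurable_fst).
pose C := \sum_(i < n.+3) `|c`_i| * (`|tau| ^+ i * (n.+1%:R / h) ^+ i).
have GC x u : `|G x u| <= C.
  have C0 : 0 <= C.
    by apply: sumr_ge0 => i _; rewrite !mulr_ge0 ?exprn_ge0 ?divr_ge0// ltW.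
  rewrite /G indicE; have [/set_mem xA|_] := boolP (x \in A); last by rewrite mul0r normr0.
  rewrite mul1r normrM; apply: (le_trans (ler_wpM2r _ (euler_wave_bound _ _ (zle u x xA))))=> //.
  rewrite mulr_suml; apply: ler_sum => i _; rewrite -mulrA ler_wpM2l// exprMn -mulrA ler_wpM2l ?exprn_ge0//.
  by apply: taper_poly_le => // j; rewrite (leq_trans _ (l_count j))// ltnW.
have := band_limited_lin delta_gt0 (ball_mass n)^-1
  (band_limited_superpose delta_gt0 iw mG GC bG) (@band_limited0 R n.+1 delta B).
have k0 := @ball_mass_gt0 R n.
congr band_limited; apply/funext => u; rewrite addr0.
rewrite (eq_Rint lam (g := fun x => T u * (w x * euler_wave n.+3 c (dotprod (z u) x)))); last first.
  move=> x; rewrite -dz /G; have [->|wx] := eqVneq (w x) 0; first by ring.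
  by rewrite indicE mem_set ?mul1r; [ring|exact: wA].
have iwe : L1 lam (fun x => w x * euler_wave n.+3 c (dotprod (z u) x)).
  pose K := \sum_(i < n.+3) `|c`_i| * (`|tau| * \sum_(j < n.+1) `|tnth u j|) ^+ i.
  apply: (L1_le _ (L1Zl K iw)).
    apply: measurable_funM; first exact: L1_measurable iw.
    by apply: (measurableT_comp me); exact: measurable_dotprod.
  move=> x; have [->|wx] := eqVneq (w x) 0; first by rewrite mul0r mulr0 normr0.
  rewrite mulrC normrM (ger0_norm (ball_weight_ge0 _ _)) ler_wpM2r ?ball_weight_ge0//.
  by rewrite -dz; apply: euler_wave_bound; exact/zle/wA.
rewrite RintZl// cE enormZ mulrCA [_ * (_ * cos _)]mulrA mulVf ?gt_eqF// mul1r mulrC.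
by case: (ler0P tau) => // _; rewrite mulNr cosN.
Qed.

Lemma band_limited_radial q : superposed rho q ->
  bl (fun u => 2^-1 * (q (enorm u) + q (- enorm u)) * T u).
Proof.
move=> hq; apply: (hq (fun q => bl (fun u => 2^-1 * (q (enorm u) + q (- enorm u)) * T u))).
  move=> tau al taur.
  have := band_limited_lin delta_gt0 (cos al) (bl_radial_cos taur) (@band_limited0 R n.+1 delta B).
  congr band_limited; apply/funext => u; rewrite addr0 mulNr [tau * _]mulrC.
  by rewrite !cosD cosN sinN; field.
move=> dZ Z mu w G C iw mG GC bG.
have mE (sg : R) : measurable_fun setT (fun p : Z * n.+1.-tuple R => G p.1 (sg * enorm p.2)).
  have mp : measurable_fun setT (fun p : Z * n.+1.-tuple R => (p.1, sg * enorm p.2)).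
    apply: measurable_fun_pair => //; apply: measurable_funM => //.
    by apply: measurable_enorm; exact: measurable_snd.
  exact: (measurableT_comp mG mp).
have := @band_limited_superpose R delta n.+1 (cball B) delta_gt0 dZ Z mu w
  (fun z u => 2^-1 * (G z (enorm u) + G z (- enorm u)) * T u) C iw.
have -> : (fun u => \int[mu]_z (w z * (2^-1 * (G z (enorm u) + G z (- enorm u)) * T u))) =
    (fun u => 2^-1 * (\int[mu]_z (w z * G z (enorm u)) + \int[mu]_z (w z * G z (- enorm u))) * T u).
  apply/funext => u.
  have iG x : L1 mu (fun z => w z * G z x).
    apply: (L1_le _ (L1Zl C (L1_norm iw))).
      apply: measurable_funM; first exact: L1_measurable iw.
      have mp : measurable_fun setT (fun z : Z => (z, x)) by apply: measurable_fun_pair.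
      exact: (measurableT_comp mG mp).
    by move=> z; rewrite normrM mulrC ler_wpM2r.
  rewrite -RintD// mulrAC -RintZl; last exact: L1D.
  by apply: eq_Rint => z; ring.
apply => //.
- apply: measurable_funM; last exact: (measurableT_comp (measurable_taper h l) measurable_snd).
  apply: measurable_funM => //; apply: measurable_funD.
    by have := mE 1; under eq_fun do rewrite mul1r.
  by have := mE (-1); under eq_fun do rewrite mulN1r.
- move=> z u; rewrite -[leRHS]mulr1 normrM ler_pM ?taper_le1//.
  have := ler_normD (G z (enorm u)) (G z (- enorm u)); have := GC z (enorm u); have := GC z (- enorm u).
  by rewrite normrM (ger0_norm (_ : 0 <= 2^-1)) ?invr_ge0//; lra.
Qed.

End radial_waves.

Section radial_integrals.
Context {R : realType} (n : nat).
Local Notation leb := (@lebesgue_measure R).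
Local Notation lam n := (@lebesgue_tuple R n).
Local Open Scope ereal_scope.

Lemma enorm_cone r (v : n.-tuple R) : enorm (cone r v) = (`|r| * enorm (cone 1 v))%R.
Proof.
rewrite -enormZ; congr enorm; apply: eq_from_tnth => i; rewrite tnth_mktuple /cone.
by case: (unliftP ord0 i) => [j|] ->; rewrite ?tnth_cons_pairS ?tnth_cons_pair0 ?tnth_mktuple ?mul1r ?mulr1.
Qed.

Lemma enorm_cone1_gt0 (v : n.-tuple R) : (0 < enorm (cone 1 v))%R.
Proof.
rewrite sqrtr_gt0 /cone dotprod_cons mulr1 ltr_pwDl//.
by rewrite dotprod_ge0.
Qed.

Let mN : measurable_fun setT (fun v : n.-tuple R => enorm (cone 1 v)).
Proof.
apply: measurable_enorm; have := @measurable_cone R n => mC.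
have mp : measurable_fun setT (fun v : n.-tuple R => (1%R : measurableTypeR R, v)).
  by apply: measurable_fun_pair.
exact: (measurableT_comp mC mp).
Qed.

Definition radial_mass : \bar R := \int[lam n]_v ((enorm (cone 1 v))^-1 ^+ n.+1)%:E.

(** In projective coordinates the norm is [|r|] times a function of the slope,
    and a scaling of [r] at each slope separates the variables. The constant
    [radial_mass] is half the area of the unit sphere. *)
Lemma ge0_integral_enorm (Phi : R -> \bar R) :
  measurable_fun setT Phi -> (forall r, 0 <= Phi r) ->
  \int[lam n.+1]_u Phi (enorm u) = radial_mass * \int[leb]_r (Phi `|r|%R * (`|r| ^+ n)%:E).
Proof.
move=> mPhi Phi0.
have mPn : measurable_fun setT (fun r : R => Phi `|r|%R * (`|r| ^+ n)%:E).
  apply: emeasurable_funM; first exact: measurableT_comp.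
  by apply/measurable_EFinP; exact: measurable_funX.
have Pn0 (r : R) : 0 <= Phi `|r|%R * (`|r| ^+ n)%:E by rewrite mule_ge0// lee_fin exprn_ge0.
have mPe : measurable_fun setT (fun u : n.+1.-tuple R => Phi (enorm u)).
  by apply: (measurableT_comp mPhi); exact: measurable_enorm.
rewrite (ge0_integral_cone mPe (fun _ => Phi0 _)).
rewrite /radial_mass -ge0_integralZr//; last 3 first.
- by apply/measurable_EFinP; apply: measurable_funX; apply: measurable_inv_ge0 => // v; exact: enorm_ge0.
- by move=> v _; rewrite lee_fin exprn_ge0// invr_ge0 enorm_ge0.
- exact: integral_ge0.
apply: eq_integral => v _; set N := enorm (cone 1 v).
have N0 : (0 < N)%R by exact: enorm_cone1_gt0.
transitivity (\int[leb]_r ((N^-1 ^+ n)%:E * (Phi `|N * r + 0|%R * (`|N * r + 0| ^+ n)%:E))).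
  apply: eq_integral => r _; rewrite enorm_cone -/N addr0 normrM (gtr0_norm N0) mulrC.
  by rewrite muleCA -EFinM exprMn mulrA -exprMn mulVf ?gt_eqF// expr1n mul1r.
rewrite ge0_integralZl//; last 2 first.
- have ma : measurable_fun setT (fun r : R => (N * r + 0)%R).
    by apply: measurable_funD => //; exact: measurable_funM.
  exact: (measurableT_comp mPn ma).
- by rewrite lee_fin exprn_ge0// invr_ge0 ltW.
rewrite (ge0_integral_affine 0 (lt0r_neq0 N0) mPn Pn0) gtr0_norm// muleA -EFinM.
by rewrite exprSr.
Qed.

(** The formula for the indicator of the unit ball, whose volume is finite. *)
Lemma radial_mass_lty : radial_mass < +oo.
Proof.
pose Phi (r : R) : \bar R := (\1_(`[0, 1]%classic) r)%:E.
have mPhi : measurable_fun setT Phi by apply/measurable_EFinP; exact: measurable_indic.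
have Phi0 r : 0 <= Phi r by rewrite lee_fin.
have := ge0_integral_enorm mPhi Phi0; set I := (X in _ = _ * X) => E.
have I0 : 0 < I.
  apply: (@integral_gt0 _ _ _ leb _ `]0%R, 1%R]%classic) => //.
  - apply: emeasurable_funM; first exact: measurableT_comp.
    by apply/measurable_EFinP; exact: measurable_funX.
  - by move=> r; rewrite mule_ge0// lee_fin exprn_ge0.
  - rewrite [X in _ < X](_ : _ = 1) ?lte01//.
    by apply: etrans; [exact: lebesgue_measure_itv|rewrite /= lte_fin ltr01 sube0].
  move=> r; rewrite /= in_itv/= => /andP[r0 r1]; rewrite /Phi indicE mem_set; last first.
    by rewrite /= in_itv/= normr_ge0 gtr0_norm.
  by rewrite mul1e lte_fin exprn_gt0// normr_gt0 gt_eqF.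
have fin : \int[lam n.+1]_u Phi (enorm u) < +oo.
  pose A : set (n.+1.-tuple R) := (box (fun=> -1) (fun=> 1))%R.
  apply: (@le_lt_trans _ _ (\int[lam n.+1]_u (\1_A u)%:E)).
    apply: ge0_le_integral => //.
    - by apply: (measurableT_comp mPhi); exact: measurable_enorm.
    - by apply/measurable_EFinP; apply: measurable_indic; exact: measurable_box.
    move=> u _; rewrite /Phi !indicE lee_fin ler_nat.
    have [/set_mem|_] := boolP (enorm u \in _); last by [].
    rewrite /= in_itv/= => /andP[_ u1]; rewrite mem_set// => i.
    by rewrite -ler_norml (le_trans (norm_tnth_le_enorm _ _)).
  rewrite integral_indic//; last exact: measurable_box.
  by rewrite setIT lam_box.
have C0 : 0 <= radial_mass.
  by apply: integral_ge0 => v _; rewrite lee_fin exprn_ge0// invr_ge0 enorm_ge0.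
rewrite ltey; apply/eqP => Coo; move: fin; rewrite E Coo gt0_mulye//.
Qed.

End radial_integrals.

(** * The isotropic case *)

Section isotropic_case.
Context {R : realType} {n : nat}.
Local Notation d := n.+1.
Local Notation leb := (@lebesgue_measure R).
Local Notation lam n := (@lebesgue_tuple R n).
Variables (s : d.-tuple R -> R) (k : 'I_d -> nat).
Hypotheses (ms : measurable_fun setT s) (s_ge0 : forall u, 0 <= s u) (s_iso : isotropic s).
Variables (eps delta B : R) (m : d.-tuple R -> R).
Hypotheses (eps_gt0 : 0 < eps) (delta_gt0 : 0 < delta) (B_ge0 : 0 <= B).
Hypothesis near0 : (\int[lam d]_(u in eball origin eps)
  ((monomial (fun i => 2 * k i)%N u)%:E * (s u)%:E^-1) < +oo)%E.
Hypotheses (bm : bcs m) (mB : forall y, m y != 0 -> cball B y).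
Hypothesis J : (0 < \int[lam d]_u ((hartley m u ^+ 2)%:E * (s u)%:E^-1) < +oo)%E.

Let S1 (r : R) := s (cons_pair (r, origin)).
Let enorm_axis r : enorm (cons_pair (r, origin : n.-tuple R)) = `|r|.
Proof.
by rewrite /enorm dotprod_cons dotprod0l addr0 -expr2 sqrtr_sqr.
Qed.
Let sE u : s u = S1 (enorm u).
Proof. by apply: s_iso; rewrite enorm_axis ger0_norm ?enorm_ge0. Qed.
Let S1N r : S1 `|r| = S1 r.
Proof. by apply: s_iso; rewrite !enorm_axis normr_id. Qed.
Let mS1 : measurable_fun setT S1.
Proof.
have mp : measurable_fun setT (fun r : R => (r : measurableTypeR R, origin : n.-tuple R)).
  by apply: measurable_fun_pair; [exact: measurable_id|exact: measurable_cst].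
exact: (measurableT_comp ms (measurableT_comp (@measurable_cons_pair R n) mp)).
Qed.
Let I r : \bar R := ((S1 r)%:E^-1)%E.
Let mI : measurable_fun setT I.
Proof. by apply: measurable_inverse_density => // r; exact: s_ge0. Qed.
Let I0 r : (0 <= I r)%E.
Proof. by apply: inverse_density_ge0 => x; exact: s_ge0. Qed.

Let F u := ((hartley m u ^+ 2)%:E * (s u)%:E^-1)%E.
Let mF : measurable_fun setT F.
Proof.
apply: emeasurable_funM; last exact: measurable_inverse_density.
apply/measurable_EFinP/measurable_funX; exact: measurable_hartley (L1_bcs bm).
Qed.
Let F0 u : (0 <= F u)%E.
Proof. by rewrite mule_ge0 ?inverse_density_ge0// lee_fin sqr_ge0. Qed.

Let mconev (v : n.-tuple R) : measurable_fun setT (fun r : R => cone r v).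
Proof.
have mp : measurable_fun setT (fun r : R => (r : measurableTypeR R, v)).
  by apply: measurable_fun_pair; [exact: measurable_id|exact: measurable_cst].
exact: (measurableT_comp (@measurable_cone R n) mp).
Qed.

(** Projective coordinates reduce the integral to lines through the origin; on
    almost every one of them it is finite, and on some it does not vanish. *)
Let good_line : exists v : n.-tuple R,
  (0 < \int[leb]_r (F (cone r v) * (`|r| ^+ n)%:E) < +oo)%E.
Proof.
have mc : measurable_fun setT (fun x : measurableTypeR R * n.-tuple R =>
    (F (cone x.1 x.2) * (`|x.1| ^+ n)%:E)%E).
  apply: emeasurable_funM; first exact: (measurableT_comp mF (@measurable_cone R n)).
  apply/measurable_EFinP; apply: measurable_funX; apply: measurableT_comp => //.
have p0 (x : measurableTypeR R * n.-tuple R) : (0 <= F (cone x.1 x.2) * (`|x.1| ^+ n)%:E)%E.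
  by rewrite mule_ge0// lee_fin exprn_ge0.
have := J; rewrite -/F (ge0_integral_cone mF F0).
apply: exists_pos_fin.
  exact: (measurable_fun_fubini_tonelli_G (m1 := leb) _ mc p0).
by move=> v; apply: integral_ge0 => r _; exact: (p0 (r, v)).
Qed.

(** The restriction of the transform to that line, in arc length. *)
Let profile : exists f : R -> R, [/\ measurable_fun setT f,
  (exists p q, [/\ superposed B q, forall r, f r = r ^+ p * q r & q 0 != 0]) &
  (\int[leb]_r ((f r ^+ 2)%:E * I r * (`|r| ^+ n)%:E) < +oo)%E].
Proof.
have [v /andP[v_gt0 v_lty]] := good_line.
pose N := enorm (cone 1 v); have N0 : 0 < N by exact: enorm_cone1_gt0.
have Nn : N != 0 by rewrite gt_eqF.
pose f r := hartley m (cone (r / N) v).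
have mf : measurable_fun setT f.
  have md : measurable_fun setT (fun r : R => r / N) by exact: measurable_funM.
  exact: (measurableT_comp (measurable_hartley (L1_bcs bm)) (measurableT_comp (mconev v) md)).
have conv r y : dotprod (cone r v) y = r * dotprod (cone 1 v) y.
  rewrite /dotprod mulr_sumr; apply: eq_bigr => i _; rewrite mulrA; congr (_ * _).
  by rewrite /cone; case: (unliftP ord0 i) => [j|] ->;
    rewrite ?tnth_cons_pairS ?tnth_cons_pair0 ?tnth_mktuple ?mul1r ?mulr1.
have fE r : f r = \int[lam d]_y ((cos (pi / 4))^-1 * m y *
    cos (r * (dotprod (cone 1 v) y / N) + - (pi / 4))).
  by apply: eq_Rint => y; rewrite cas_cos conv [r * (_ / N)]mulrA [r / N * _]mulrAC; ring.
exists f; split; first exact: mf.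
- have iw : L1 (lam d) (fun y => (cos (pi / 4))^-1 * m y) by exact/L1Zl/L1_bcs.
  have mt : measurable_fun setT (fun y : d.-tuple R => dotprod (cone 1 v) y / N).
    by apply: measurable_funM => //; exact: measurable_dotprod.
  have ma : measurable_fun setT (fun _ : d.-tuple R => - (pi / 4) : R) by exact: measurable_cst.
  have tB y : (cos (pi / 4))^-1 * m y != 0 -> `|dotprod (cone 1 v) y / N| <= B.
    rewrite mulf_eq0 negb_or => /andP[_ /mB yB].
    rewrite normrM normfV (gtr0_norm N0) ler_pdivrMr// (le_trans (dotprod_le _ _))//.
    by rewrite mulrC ler_wpM2r// ltW.
  case: (wave_division iw mt ma B_ge0 tB fE) => [f0|]; last by [].
  move: v_gt0; rewrite (eq_integral (fun=> 0%E)) ?integral0 ?ltxx// => r _.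
  have := f0 (r * N); rewrite /f mulfK// /F => ->.
  by rewrite expr0n/= mul0e mul0e.
have mH : measurable_fun setT (fun r => ((f r ^+ 2)%:E * I r * (`|r| ^+ n)%:E)%E).
  apply: emeasurable_funM; last by apply/measurable_EFinP; exact: measurable_funX.
  by apply: emeasurable_funM => //; apply/measurable_EFinP; exact: measurable_funX.
have H0 r : (0 <= (f r ^+ 2)%:E * I r * (`|r| ^+ n)%:E)%E.
  by rewrite !mule_ge0// lee_fin ?sqr_ge0// exprn_ge0.
have E : (\int[leb]_r ((f (N * r + 0)%R ^+ 2)%:E * I (N * r + 0)%R * (`|N * r + 0| ^+ n)%:E) =
    (N ^+ n)%:E * \int[leb]_r (F (cone r v) * (`|r| ^+ n)%:E))%E.
  rewrite -ge0_integralZl//; last 3 first.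
  - apply: emeasurable_funM; first exact: (measurableT_comp mF (mconev v)).
    by apply/measurable_EFinP; exact: measurable_funX.
  - by move=> r _; rewrite mule_ge0// lee_fin exprn_ge0.
  - by rewrite lee_fin exprn_ge0// ltW.
  apply: eq_integral => r _; rewrite addr0 /f mulrAC divff// mul1r /F.
  have -> : I (N * r) = ((s (cone r v))%:E^-1)%E.
    by rewrite /I sE enorm_cone -/N -[in LHS]S1N normrM (gtr0_norm N0) mulrC.
  by rewrite normrM (gtr0_norm N0) exprMn EFinM muleCA.
have := ge0_integral_affine 0 Nn mH H0; rewrite E => E'.
rewrite ltey; apply/eqP => Hoo; move: E'; rewrite Hoo gt0_muley ?lte_fin ?invr_gt0 ?normr_gt0// => E'.
suff : ((N ^+ n)%:E * \int[leb]_r (F (cone r v) * (`|r| ^+ n)%:E) < +oo)%E by rewrite E' ltxx.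
by rewrite lte_mul_pinfty ?lee_fin ?exprn_ge0// ltW.
Qed.

Let taper_indices : exists l : seq 'I_d,
  (forall j, n.+3 = count_mem j l) /\ (0 < size l)%N.
Proof.
have H N : exists l : seq 'I_d, (forall j, N = count_mem j l) /\ size l = (N * d)%N.
  elim: N => [|N [l [lc ls]]]; first by exists [::].
  exists (enum 'I_d ++ l); split; last by rewrite size_cat size_enum_ord ls mulSn.
  by move=> j; rewrite count_cat -lc count_uniq_mem ?enum_uniq// mem_enum.
by have [l [lc ls]] := H n.+3; exists l; split => //; rewrite ls.
Qed.

(** The profile divided by the largest possible power of the variable is nonzero
    at 0. Its even part, taken at the norm of [u], is a radial function which
    [band_limited_radial] shows to be band-limited after tapering. *)
Lemma isotropic_multiplier : exists G,
  [/\ band_limited delta (cball (B + d%:R * delta + delta)) G, G origin != 0 &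
   (\int[lam d]_u (((G u * fejer_kernel delta u *
     \prod_(i < d) sin (delta * tnth u i) ^+ k i) ^+ 2)%:E * (s u)%:E^-1) < +oo)%E].
Proof.
have [f [mf [p [q [qB fE q0]]] f_lty]] := profile.
have [l [lc ls]] := taper_indices.
pose h := delta / (size l)%:R.
have sl : 0 < (size l)%:R :> R by rewrite ltr0n.
have h0 : 0 < h by rewrite divr_gt0.
have hB : B + h * (size l)%:R + d%:R * delta <= B + d%:R * delta + delta.
  by rewrite /h divfK ?gt_eqF//; lra.
pose Q r := 2^-1 * (q r + q (- r)).
pose G u := Q (enorm u) * taper h l u.
have lc' j : (n.+3 <= count_mem j l)%N by rewrite -lc.
have blG := band_limited_radial delta_gt0 h0 lc' hB qB.
have [mq [C qC]] := superposed_measurable_bounded qB.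
have C0 : 0 <= C by rewrite (le_trans _ (qC 0)).
have QC r : `|Q r| <= C.
  have := ler_normD (q r) (q (- r)); have := qC r; have := qC (- r).
  by rewrite /Q normrM (ger0_norm (_ : 0 <= 2^-1)) ?invr_ge0//; lra.
exists G; split => //.
  rewrite /G taper_origin mulr1 /Q /enorm dotprod0l sqrtr0 oppr0.
  by have -> : 2^-1 * (q 0 + q 0) = q 0 by field.
pose Psi u := G u * fejer_kernel delta u * \prod_(i < d) sin (delta * tnth u i) ^+ k i.
have mQ : measurable_fun setT Q.
  apply: measurable_funM => //; apply: measurable_funD => //.
  by apply: (measurableT_comp mq); exact: measurable_funN.
have mG : measurable_fun setT G.
  apply: measurable_funM; last exact: measurable_taper.
  by apply: (measurableT_comp mQ); exact: measurable_enorm.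
have mPsi : measurable_fun setT Psi.
  apply: measurable_funM; first by apply: measurable_funM => //; exact: L1_measurable (L1_fejer_kernel delta_gt0 d).
  apply: measurable_prod => i _; apply: measurable_funX; apply: measurable_sin.
  by apply: measurable_funM => //; exact: measurable_tnth.
have P0 u : 0 <= \prod_(i < d) (sin (delta * tnth u i) ^+ k i) ^+ 2.
  by apply: prodr_ge0 => i _; exact: sqr_ge0.
have PsiE u : Psi u ^+ 2 <= Q (enorm u) ^+ 2 * \prod_(i < d) (sin (delta * tnth u i) ^+ k i) ^+ 2.
  have -> : Psi u ^+ 2 = Q (enorm u) ^+ 2 * (taper h l u ^+ 2 * fejer_kernel delta u ^+ 2) *
      (\prod_(i < d) sin (delta * tnth u i) ^+ k i) ^+ 2 by rewrite /Psi /G; ring.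
  rewrite prodrXl ler_wpM2r ?sqr_ge0// ler_piMr ?sqr_ge0//.
  have := taper_le1 h l u; rewrite ler_norml => /andP[t1 t2].
  have := fejer_kernel_le1 delta u; have := fejer_kernel_ge0 delta u => K0 K1.
  have T2 : taper h l u ^+ 2 <= 1 by nra.
  have K2 : fejer_kernel delta u ^+ 2 <= 1 by nra.
  by have := sqr_ge0 (taper h l u); have := sqr_ge0 (fejer_kernel delta u); nra.
pose D := C ^+ 2 * \prod_(i < d) (delta ^+ (2 * k i)).
pose Phi r := (((f r ^+ 2 + f (- r) ^+ 2)%:E) * I r)%E.
have D0 : 0 <= D.
  by rewrite mulr_ge0 ?sqr_ge0// prodr_ge0// => i _; rewrite exprn_ge0// ltW.
have mPhi : measurable_fun setT Phi.
  apply: emeasurable_funM => //; apply/measurable_EFinP; apply: measurable_funD.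
    exact: measurable_funX.
  by apply: measurable_funX; apply: (measurableT_comp mf); exact: measurable_funN.
have Phi0 r : (0 <= Phi r)%E by rewrite mule_ge0// lee_fin addr_ge0 ?sqr_ge0.
have far : (\int[lam d]_u Phi (enorm u) < +oo)%E.
  rewrite ge0_integral_enorm// lte_mul_pinfty ?radial_mass_lty//.
  - by apply: integral_ge0 => v _; rewrite lee_fin exprn_ge0// invr_ge0 enorm_ge0.
  - by rewrite ge0_fin_numE ?radial_mass_lty//; apply: integral_ge0 => v _; rewrite lee_fin exprn_ge0// invr_ge0 enorm_ge0.
  pose H r := ((f r ^+ 2)%:E * I r * (`|r| ^+ n)%:E)%E.
  have mH : measurable_fun setT H.
    apply: emeasurable_funM; last by apply/measurable_EFinP; exact: measurable_funX.
    by apply: emeasurable_funM => //; apply/measurable_EFinP; exact: measurable_funX.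
  have H0 r : (0 <= H r)%E by rewrite !mule_ge0// lee_fin ?sqr_ge0// exprn_ge0.
  have INr r : I (- r) = I r by rewrite /I -S1N normrN S1N.
  have HE r : (Phi `|r|%R * (`|r| ^+ n)%:E = H r + H (-1 * r + 0)%R)%E.
    rewrite mulN1r addr0 /H normrN INr -!ge0_muleDl ?mule_ge0 ?lee_fin ?sqr_ge0//.
    rewrite /Phi -EFinD; have [r0|r0] := leP 0 r; first by rewrite ger0_norm.
    by rewrite ltr0_norm// opprK INr addrC.
  have mN : measurable_fun setT (fun r : R => H (-1 * r + 0)).
    have ma : measurable_fun setT (fun r : R => -1 * r + 0 : R).
      by apply: measurable_funD => //; exact: measurable_funM.
    exact: (measurableT_comp mH ma).
  have n1 : (-1 : R) != 0 by rewrite oppr_eq0 oner_eq0.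
  under eq_integral do rewrite HE.
  rewrite (@ge0_integralD _ _ _ leb setT measurableT H (fun r => H (-1 * r + 0)) (fun r _ => H0 r) mH (fun r _ => H0 _) mN).
  rewrite (ge0_integral_affine 0 n1 mH H0) normrN1 invr1 mul1e.
  by rewrite lte_add_pinfty.
pose mono u := ((\1_(eball origin eps) u * monomial (fun i => 2 * k i)%N u)%:E * (s u)%:E^-1)%E.
have near0' : (\int[lam d]_u mono u < +oo)%E.
  move: near0; rewrite integral_mkcond; congr (_ < _)%E; apply: eq_integral => u _.
  rewrite patchE /mono indicE; case: ifP => _; last by rewrite mul0r mul0e.
  by rewrite mul1r.
have mono0 u : (0 <= mono u)%E.
  rewrite mule_ge0 ?inverse_density_ge0// lee_fin mulr_ge0// prodr_ge0// => i _.
  by rewrite exprM exprn_ge0// sqr_ge0.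
have mball : measurable (eball origin eps : set (d.-tuple R)).
  rewrite eball0E; have me : measurable_fun setT (fun u : d.-tuple R => enorm u).
    exact: measurable_enorm.
  have := me measurableT _ (measurable_itv `]-oo, eps[); rewrite setTI.
  suff -> : (fun u : d.-tuple R => enorm u) @^-1` `]-oo, eps[%classic = [set x | enorm x < eps] by [].
  by apply/seteqP; split=> x /=; rewrite in_itv.
have mmono : measurable_fun setT mono.
  apply: emeasurable_funM; last exact: measurable_inverse_density.
  apply/measurable_EFinP; apply: measurable_indicM => //.
  by apply: measurable_prod => i _; apply: measurable_funX; exact: measurable_tnth.
have mPhie : measurable_fun setT (fun u : d.-tuple R => Phi (enorm u)).
  by apply: (measurableT_comp mPhi); exact: measurable_enorm.
have e0 : (0 <= (eps ^- (2 * p))%:E)%E by rewrite lee_fin invr_ge0 exprn_ge0// ltW.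
(* Far from the origin the multiplier is controlled by the profile, and near the
   origin by the sines. *)
apply: (@le_lt_trans _ _ (\int[lam d]_u (D%:E * mono u + ((eps ^- (2 * p))%:E * Phi (enorm u))))%E).
  apply: ge0_le_integral => //.
  - by move=> u _; rewrite mule_ge0 ?inverse_density_ge0// lee_fin sqr_ge0.
  - apply: emeasurable_funM; last exact: measurable_inverse_density.
    by apply/measurable_EFinP; exact: measurable_funX.
  - by apply: emeasurable_funD; apply: emeasurable_funM => //; exact: measurable_cst.
  move=> u _; have [ue|ue] := ltP (enorm u) eps.
    apply: (@le_trans _ _ (D%:E * mono u)%E); last by rewrite leeDl// mule_ge0.
    rewrite /mono indicE mem_set; last by rewrite eball0E.
    rewrite mul1r muleA -EFinM lee_wpmul2r ?inverse_density_ge0// lee_fin.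
    apply: (le_trans (PsiE u)); rewrite /D -[leRHS]mulrA; apply: ler_pM; rewrite ?sqr_ge0//.
      by rewrite -real_normK ?num_real// lerXn2r ?nnegrE.
    rewrite /monomial -big_split/=; apply: ler_prod => i _; rewrite sqr_ge0/=.
    rewrite -exprM mulnC exprM -exprMn [leRHS]exprM.
    by apply: lerXn2r; rewrite ?nnegrE ?sqr_ge0 ?sin_sqr_le.
  apply: (@le_trans _ _ ((eps ^- (2 * p))%:E * Phi (enorm u))%E); last by rewrite leeDr// mule_ge0.
  rewrite /Phi muleA -EFinM /I -sE.
  rewrite lee_wpmul2r ?inverse_density_ge0// lee_fin.
  apply: (le_trans (PsiE u)); rewrite -[leRHS]mulr1; apply: ler_pM; rewrite ?sqr_ge0//; last first.
    by apply: prodr_ile1 => i _; rewrite sqr_ge0/= -exprM mulnC exprM exprn_ile1 ?sqr_ge0//;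
      have := sin_max (delta * tnth u i); rewrite ler_norml => /andP[h1 h2]; nra.
  set r := enorm u in ue *.
  have -> : f r ^+ 2 + f (- r) ^+ 2 = r ^+ (2 * p) * (q r ^+ 2 + q (- r) ^+ 2).
    by rewrite !fE !exprMn -!exprM ![(p * 2)%N]mulnC !exprM sqrrN; ring.
  have re : 1 <= eps ^- (2 * p) * r ^+ (2 * p).
    by rewrite -exprVn -exprMn exprn_ege1// mulrC ler_pdivlMr// mul1r.
  have : Q r ^+ 2 <= q r ^+ 2 + q (- r) ^+ 2.
    by rewrite /Q; have := sqr_ge0 (q r - q (- r)); have := sqr_ge0 (q r + q (- r)); nra.
  rewrite mulrA; have := sqr_ge0 (q r); have := sqr_ge0 (q (- r)); nra.
rewrite ge0_integralD//; last 4 first.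
- by move=> u _; rewrite mule_ge0.
- by apply: emeasurable_funM => //; exact: measurable_cst.
- by move=> u _; rewrite mule_ge0.
- by apply: emeasurable_funM => //; exact: measurable_cst.
rewrite !ge0_integralZl ?lee_fin//; try exact: mmono; try exact: mPhie; try by move=> u _; exact: Phi0.
by rewrite lte_add_pinfty// lte_mul_pinfty// ?lee_fin.
Qed.

End isotropic_case.

(** * Rigidity of given order *)

Theorem theorem2 (R : realType) (d : nat) (d_ge1 : (1 <= d)%N)
    (k : 'I_d -> nat) (r : R) (r_gt0 : 0 < r)
    (disp : measure_display) (T : measurableType disp) (P : probability T R)
    (M : wss_measure d P) (s : d.-tuple R -> R) (Ms : spectral_density M s)
    (A : set (d.-tuple R))
    (sA : (isotropic s /\ A = eball origin r) \/ (separable s /\ A = cube r))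
    (not_max : ~ linearly_maximally_rigid M A)
    (not_infty : ~ forall eps : R, 0 < eps ->
      (\int[lebesgue_tuple d]_(u in eball origin eps)
        ((monomial (fun i => 2 * k i)%N u)%:E * (s u)%:E^-1) = +oo)%E)
    (eta : R) (eta_gt0 : 0 < eta) :
  ~ linearly_k_rigid M k (enlarge A eta).
Proof.
case: d d_ge1 k M s Ms A sA not_max not_infty => // n d_ge1 k M s Ms A sA not_max not_infty.
have [ms s0 _] := Ms.
have [eps eps0 near0] : exists2 eps : R, 0 < eps &
    (\int[lebesgue_tuple n.+1]_(u in eball origin eps)
      ((monomial (fun i => 2 * k i)%N u)%:E * (s u)%:E^-1) < +oo)%E.
  apply: contrapT => H; apply: not_infty => eps eps0; apply/eqP; rewrite -leye_eq leNgt.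
  by apply/negP => h; apply: H; exists eps.
have budget (delta : R) : 0 < delta -> 0 <= r + n.+1%:R * delta.
  by move=> delta0; rewrite addr_ge0 ?mulr_ge0// ltW.
have le_dim (delta : R) : 0 < delta -> delta <= n.+1%:R * delta.
  by move=> delta0; rewrite ler_peMl ?ler1n// ltW.
case: sA => -[hs AE]; subst A.
  apply: (rigidity_reduction Ms (A := eball origin r) (W := cball) (r := r) d_ge1 eta_gt0 (@gauge_cball R n.+1)) => //.
  - by move=> x; rewrite eball0E => /ltW.
  - move=> x; rewrite eball0E => /ltW xr i; rewrite -ler_norml.
    exact: (le_trans (norm_tnth_le_enorm _ _)).
  - exact: measurable_enlarge_ball.
  - exact: enlarge_ball_cube.
  - move=> a ad x; rewrite enlarge_ball// /cball/= => xr; apply: (le_lt_trans xr); rewrite ltrD2l.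
    by apply: (lt_le_trans ad); rewrite ler_pdivrMr ?ltr0n// ler_peMr ?ler1n// ltW.
  move=> delta m delta0 bm mW J.
  exact: (isotropic_multiplier ms s0 hs eps0 delta0 (budget _ delta0) near0 bm mW J).
apply: (rigidity_reduction Ms (A := cube r) (W := @cube R n.+1) (r := r) d_ge1 eta_gt0 (@gauge_cube R n.+1)) => //.
- exact: measurable_enlarge_cube.
- exact: enlarge_cube_cube.
- by move=> a ad; exact: cube_enlarge.
move=> delta m delta0 bm mW J; have [s_ [s_ge0 _ sE]] := hs.
have [G [blG G0 JG]] := separable_multiplier ms s_ge0 sE eps0 delta0 (budget _ delta0) near0 bm mW J.
exists G; split => //; apply: band_limited_sub blG => x xB i.
have := xB i; have := le_dim _ delta0; rewrite -!ler_norml => h1 h2.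
by apply: (le_trans h2); rewrite lerD2r lerDl (le_trans _ h1)// ltW.
Qed.
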